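(* There are constants $E_1>0$ and $\epsilon_0>0$ such that, for all $0<\epsilon\le\epsilon_0$, every minimizer $(\theta^\epsilon,a^\epsilon,\delta^\epsilon)$ of $\mathcal{F}^\epsilon[\theta;a,\delta]$ over all $a\in[0,1]$, $\delta\in\mathbb{R}$ and all $\theta$ admissible for $(\epsilon,a,\delta)$ satisfies $$\mathcal{F}^\epsilon[\theta^\epsilon;a^\epsilon,\delta^\epsilon]\ge E_1 .$$ Further, there are constants $0<\alpha_1<\alpha_2$ such that, for all sufficiently small $\epsilon>0$, every such minimizer satisfies $$1-\alpha_2\epsilon<a^\epsilon<1-\alpha_1\epsilon .$$
   Context: For $\epsilon\in(0,1]$ put $l=\pi/\epsilon$ and let $\mathcal{S}^\epsilon=\{(x,y): 0\le x<l,\ y\ge 0\}$, regarded as a half-cylinder, $l$-periodic in $x$. For $a\in[0,1]$ and $\delta\in\mathbb{R}$, a real-valued function $\theta$ is called admissible for $(\epsilon,a,\delta)$ if it satisfies the boundary conditions (understood in the sense of traces) (i) $\theta(x,0)=0$ for $0\le x<al$; (ii) $\theta_y(x,0)=0$ for $al\le x<l$; (iii) $\theta(x,y)-\epsilon x$ is periodic in $x$ with period $l$ for each $y\ge 0$; (iv) $\theta(x,y)-\left[\epsilon x+\sqrt{1-\epsilon^2}\,y+\delta\right]\in H^2(\mathcal{S}^\epsilon)$, where $H^2$ is taken on the half-cylinder (i.e. the $l$-periodic extension in $x$ is locally $H^2$ on the closed upper half-plane, and it is $H^2$ over one period). For admissible $\theta$ the energy is $$\mathcal{F}^\epsilon[\theta;a,\delta]=\iint_{\mathcal{S}^\epsilon}\left\{[\Delta\theta]^2+(1-|\nabla\theta|^2)^2\right\}dx\,dy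 .$$ A triple $(\theta^\epsilon,a^\epsilon,\delta^\epsilon)$ denotes a minimizer of $\mathcal{F}^\epsilon$ jointly over all $a\in[0,1]$, $\delta\in\mathbb{R}$ and admissible $\theta$; such a minimizer exists for each $\epsilon$ by the direct method. *)

(* Defs.v *)
From HB Require Import structures.
From mathcomp Require Import all_boot all_order all_algebra.
From mathcomp Require Import all_classical all_reals all_analysis.
Set Implicit Arguments.
Unset Strict Implicit.
Unset Printing Implicit Defensive.
Import Order.TTheory GRing.Theory Num.Theory.
Import numFieldNormedType.Exports.
Local Open Scope classical_set_scope.
Local Open Scope ring_scope.

Section HalfCylinder.
Variable R : realType.
Implicit Types (u v g phi theta : R * R -> R) (e z : R * R).

Local Notation leb2 :=
  (@lebesgue_measure R \x @lebesgue_measure R)%E.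

Definition dirx : R * R := (1, 0).
Definition diry : R * R := (0, 1).

Definition half_plane : set (R * R) := [set z | 0 < z.2].

Definition strip (l : R) : set (R * R) := [set z | 0 <= z.1 < l /\ 0 <= z.2].

Fixpoint Ck (k : nat) phi : Prop :=
  continuous phi /\
  match k with
  | 0 => True
  | k'.+1 => forall e, e = dirx \/ e = diry ->
      (forall z, derivable phi z e) /\ Ck k' ('D_e phi)
  end.

Definition smooth phi : Prop := forall k, Ck k phi.

Definition test_function phi : Prop :=
  smooth phi /\
  exists K : set (R * R), [/\ compact K, K `<=` half_plane &
    forall z, ~ K z -> phi z = 0].

Definition loc_integrable u : Prop :=
  measurable_fun half_plane u /\
  forall K : set (R * R), compact K -> K `<=` half_plane ->
    (\int[leb2]_(z in K) `|u z|%:E < +oo)%E.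

(* The conditions on [u] and [g] see only the open half-plane; asking [g] to
   be Borel on the whole plane makes integrals over sets that touch the line
   y = 0 independent of the representative. *)
Definition is_weak_derivative e u g : Prop :=
  [/\ loc_integrable u, loc_integrable g, measurable_fun setT g &
    forall phi, test_function phi ->
      \int[leb2]_(z in half_plane) (u z * 'D_e phi z) =
      - \int[leb2]_(z in half_plane) (g z * phi z)].

Definition weakly_derivable e u : Prop := exists g, is_weak_derivative e u g.

(* A representative of the weak derivative, which is unique almost everywhere
   on the half-plane; the default value is 0 when there is none. *)
Definition wD e u : R * R -> R :=
  xget (fun=> 0) [set g | is_weak_derivative e u g].

Definition L2_strip (l : R) u : Prop :=
  measurable_fun (strip l) u /\
  (\int[leb2]_(z in strip l) ((u z) ^+ 2)%:E < +oo)%E.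

(* The weak derivatives are taken on the whole half-plane, i.e. across the
   seam of the half-cylinder. *)
Definition H1_strip (l : R) u : Prop :=
  L2_strip l u /\
  forall e, e = dirx \/ e = diry -> weakly_derivable e u /\ L2_strip l (wD e u).

Definition x_periodic (l : R) u : Prop :=
  forall x y, 0 <= y -> u (x + l, y) = u (x, y).

(* For periodic [u], membership in H^2 over one period implies that [u] is
   H^2 on every bounded rectangle [-r, r] x [0, r]. *)
Definition H2_half_cylinder (l : R) u : Prop :=
  [/\ x_periodic l u, H1_strip l u & forall e, e = dirx \/ e = diry ->
    H1_strip l (wD e u)].

Definition segment (r : R) : set R := `[- r, r]%classic.

Definition half_box (r : R) : set (R * R) :=
  segment r `*` `[0, r]%classic.

(* [g] is the trace on the line y = 0 of the function [v], locally H^1 up to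
   this line: smooth functions converge to [v] in H^1 and their restrictions
   to the line converge to [g] in L^2, on bounded sets. *)
Definition has_trace v (g : R -> R) : Prop :=
  measurable_fun setT g /\
  exists phi_ : nat -> R * R -> R, (forall n, smooth (phi_ n)) /\
    forall r : R, 0 < r ->
      (\int[leb2]_(z in half_box r)
         ((phi_ n z - v z) ^+ 2 + ('D_dirx (phi_ n) z - wD dirx v z) ^+ 2
          + ('D_diry (phi_ n) z - wD diry v z) ^+ 2)%:E)%E @[n --> \oo]
        --> 0%E /\
      (\int[@lebesgue_measure R]_(x in segment r)
         ((phi_ n (x, 0) - g x) ^+ 2)%:E)%E @[n --> \oo] --> 0%E.

Definition trace_vanishes_on (A : set R) v : Prop :=
  exists2 g : R -> R, has_trace v g &
    {ae @lebesgue_measure R, forall x, A x -> g x = 0}.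

Definition period (eps : R) : R := pi / eps.

(* [theta] is the extension to the closed upper half-plane determined by the
   quasi-periodicity condition; its values for y < 0 play no role. *)
Definition admissible (eps a delta : R) theta : Prop :=
  let l := period eps in
  [/\ trace_vanishes_on [set x | 0 <= x < a * l] theta,
      trace_vanishes_on [set x | a * l <= x < l] (wD diry theta),
      x_periodic l (fun z => theta z - eps * z.1) &
      H2_half_cylinder l (fun z =>
        theta z - (eps * z.1 + Num.sqrt (1 - eps ^+ 2) * z.2 + delta))].

Definition energy (eps : R) theta : \bar R :=
  (\int[leb2]_(z in strip (period eps))
     ((wD dirx (wD dirx theta) z + wD diry (wD diry theta) z) ^+ 2
      + (1 - (wD dirx theta z ^+ 2 + wD diry theta z ^+ 2)) ^+ 2)%:E)%E.

Definition minimizer (eps : R) theta (a delta : R) : Prop :=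
  [/\ 0 <= a <= 1, admissible eps a delta theta &
    forall a' delta' theta', 0 <= a' <= 1 ->
      admissible eps a' delta' theta' ->
      (energy eps theta <= energy eps theta')%E].

End HalfCylinder.

(* Main.v *)
Require Import Defs.
From HB Require Import structures.
From mathcomp Require Import all_boot all_order all_algebra.
From mathcomp Require Import all_classical all_reals all_analysis.
From mathcomp Require Import measurable_realfun ring lra.
Import Order.TTheory GRing.Theory Num.Theory.
Import numFieldNormedType.Exports.
Local Open Scope classical_set_scope.
Local Open Scope ring_scope.
Set Implicit Arguments.
Unset Strict Implicit.
Unset Printing Implicit Defensive.

(* Let l = pi / eps, let b = (1 - a) l be the length of the Neumann part, and
   write p = theta_x, q = theta_y, W = 1 - p^2 - q^2; let F bound the energy.

   b is not small: theta gains pi over one period, and it vanishes at y = 0 on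
   both sides of the Neumann part.  For small r and b <= r, this gain is bounded
   by integrals of |q| over vertical segments of length r and of |p| over
   horizontal ones of length at most 3 r, which are small for suitable segments
   because F controls p^2 + q^2.

   b is not large: b <= C (r + F / r + eps) for every r in (0, 1].  The difference
   quotients of theta in x satisfy a Caccioppoli inequality with cutoffs that
   excise the ends of the two boundary parts, whence the integral of p_x^2 is at
   most C (1 + F / r^2) away from these ends.  Since q = 0 on the Neumann part,
   Poincare's inequality makes q small above it, for y <= 4 r.  The vector field
   of Jin and Kohn, P = q (1 - p^2 - q^2 / 3) and S = p (1 - q^2 - p^2 / 3),
   satisfies P_y - S_x = (q_y - p_x) W.  The flux of P near y = 0 is about 2/3 per
   unit length at most on the Dirichlet part and about 0 on the Neumann part, and
   it must balance the flux at infinity, which is about 2 l / 3.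

   If F, r and eps are small, the two bounds contradict each other; hence the
   lower bound on the energy.  A competitor with one dislocation per period above
   a Neumann part of length 1 has energy bounded uniformly in eps, so for
   minimizers both bounds hold with F and r of order one, and b = (1 - a) pi / eps. *)

(** The energy controls the Laplacian but not [p_x] and [q_y] separately, and the change of boundary
    condition obstructs separate bounds at the ends of its two parts. Away from these ends,
    differences in x respect both homogeneous conditions, and [q_y] then follows from the Laplacian.
    The same bound on [p_x] pays for the flux balance, because [q_y - p_x] is the Laplacian minus
    [2 p_x]. The weight in this balance depends on y alone, so that periodicity removes S, and it
    vanishes up to height [2 r], above the excised ends. Decay at infinity is not uniform among
    admissible functions, but the height at which the upper flux is measured may be chosen after the
    function. The functions are known almost everywhere only. Hence integrations by parts take place
    on almost every horizontal or vertical line, where the function agrees with a primitive whose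
    initial value is the trace. In the competitor the transition must widen upwards: at width d the
    gain pi costs about [d^-3] per unit height, so a width of order [sqrt y] gives finite energy,
    and it fits the period up to a height of order [l^2]. *)

Section Integrable.
Context {d : measure_display} {T : measurableType d} {R : realType}.
Variable m : {measure set T -> \bar R}.
Implicit Types (f g : T -> R) (D : set T).

Definition integ D f := m.-integrable D (EFin \o f).

Lemma integ_mfun D f : integ D f -> measurable_fun D f.
Proof. by move=> /integrableP[/measurable_EFinP]. Qed.

Lemma integD D f g : measurable D -> integ D f -> integ D g ->
  integ D (fun x => f x + g x).
Proof. by move=> mD hf hg; exact: (integrableD mD hf hg). Qed.

Lemma integZ D k f : measurable D -> integ D f -> integ D (fun x => k * f x).
Proof. by move=> mD hf; exact: (integrableZl mD k hf). Qed.

Lemma integB D f g : measurable D -> integ D f -> integ D g ->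
  integ D (fun x => f x - g x).
Proof. by move=> mD hf hg; exact: (integrableB mD hf hg). Qed.

Lemma integ_le D f g : measurable D -> measurable_fun D f ->
  (forall x, D x -> `|f x| <= g x) -> integ D g -> integ D f.
Proof.
move=> mD mf fg; apply: le_integrable => //; first exact/measurable_EFinP.
by move=> x Dx /=; rewrite lee_fin (le_trans (fg x Dx))// ler_norm.
Qed.

Lemma integ_norm D f : measurable D -> integ D f -> integ D (fun x => `|f x|).
Proof. by move=> mD hf; exact: (integrable_abse hf). Qed.

Lemma integS D D' f : measurable D -> measurable D' -> D' `<=` D ->
  integ D f -> integ D' f.
Proof. by move=> mD mD' DD; exact: integrableS. Qed.

Lemma integ_cst D k : measurable D -> (m D < +oo)%E -> integ D (fun=> k).
Proof.
move=> mD Doo.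
apply/integrableP; split; first exact/measurable_EFinP.
under eq_integral do rewrite /=.
by rewrite integral_cst// lte_mul_pinfty// ?lee_fin.
Qed.

Lemma eq_integ D f g : measurable D -> (forall x, D x -> f x = g x) -> integ D f -> integ D g.
Proof.
move=> mD fg; apply: eq_integrable => // x; rewrite inE => Dx /=; congr EFin.
exact: fg.
Qed.

Lemma integ_ae D f g : measurable D -> measurable_fun D g ->
  {ae m, forall x, D x -> f x = g x} -> integ D f -> integ D g.
Proof.
move=> mD mg fg hf; have mf := integ_mfun hf.
move/integrableP : hf => [mf' hf]; apply/integrableP; split.
  exact/measurable_EFinP.
rewrite (@ae_eq_integral _ _ _ m D (abse \o (EFin \o f)))//.
- by apply/measurableT_comp/measurable_EFinP.
- by apply/measurableT_comp/measurable_EFinP.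
- by move: fg; apply: filterS => x fg Dx /=; rewrite fg.
Qed.

Lemma eq_ae_Rint D f g : measurable D -> measurable_fun D f ->
  measurable_fun D g -> {ae m, forall x, D x -> f x = g x} ->
  \int[m]_(x in D) f x = \int[m]_(x in D) g x.
Proof.
move=> mD mf mg fg; rewrite /Rintegral; congr fine.
apply: ae_eq_integral => //; try exact/measurable_EFinP.
by move: fg; apply: filterS => x fg Dx /=; rewrite fg.
Qed.

Lemma ae_le_Rint D f g : measurable D -> integ D f -> integ D g ->
  {ae m, forall x, D x -> f x <= g x} ->
  \int[m]_(x in D) f x <= \int[m]_(x in D) g x.
Proof.
move=> mD hf hg fg.
have mf := integ_mfun hf; have mg := integ_mfun hg.
(* [g'] dominates [f] everywhere and equals [g] almost everywhere. *)
pose g' x := Num.max (f x) (g x).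
have mg' : measurable_fun D g' by exact: measurable_maxr.
have gg' : {ae m, forall x, D x -> g x = g' x}.
  by move: fg; apply: filterS => x h Dx; rewrite /g' max_r ?h.
rewrite (eq_ae_Rint mD mg mg' gg'); apply: le_Rintegral => //.
  exact: integ_ae gg' hg.
by move=> x Dx; rewrite /g' le_max lexx.
Qed.

Lemma Rint_eq0_ae D f : measurable D -> integ D f ->
  (forall x, D x -> 0 <= f x) -> \int[m]_(x in D) f x = 0 ->
  {ae m, forall x, D x -> f x = 0}.
Proof.
move=> mD hf f0 h.
have : (\int[m]_(x in D) `|(f x)%:E| = 0)%E.
  under eq_integral do [].
  rewrite (eq_integral (fun x => (f x)%:E)); last first.
    by move=> x; rewrite inE => Dx; rewrite gee0_abs ?lee_fin ?f0.
  rewrite -[LHS]fineK; last exact: (integrable_fin_num _ hf).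
  by rewrite -[fine _]/(\int[m]_(x in D) f x) h.
have mf : measurable_fun D (EFin \o f).
  by apply/measurable_EFinP; exact: integ_mfun hf.
move/(ae_eq_integral_abs m mD mf).1; apply: filterS => x + Dx.
by move=> /(_ Dx) [].
Qed.

Definition sq_integ D f := measurable_fun D f /\ integ D (fun x => f x ^+ 2).

Lemma mul_integ D f g : measurable D -> sq_integ D f -> sq_integ D g ->
  integ D (fun x => f x * g x).
Proof.
move=> mD [mf hf] [mg hg].
apply: (@integ_le _ _ (fun x => f x ^+ 2 + g x ^+ 2)) => //.
- exact: measurable_funM.
- move=> x _; rewrite ler_norml; have := sqr_ge0 (f x - g x).
  by have := sqr_ge0 (f x + g x); nra.
- exact: integD.
Qed.

Lemma sq_integD D f g : measurable D -> sq_integ D f -> sq_integ D g ->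
  sq_integ D (fun x => f x + g x).
Proof.
move=> mD hf hg; have hfg := mul_integ mD hf hg.
case: hf => mf hf; case: hg => mg hg; split; first exact: measurable_funD.
apply: (@eq_integ _ (fun x => f x ^+ 2 + (2 * (f x * g x) + g x ^+ 2))) => //.
  by move=> x _; ring.
by apply: integD => //; apply: integD => //; exact: integZ.
Qed.

Lemma sq_integ_bndM D f g k : measurable D -> measurable_fun D f ->
  (forall x, D x -> `|f x| <= k) -> sq_integ D g ->
  sq_integ D (fun x => f x * g x).
Proof.
move=> mD mf fk [mg hg]; split; first exact: measurable_funM.
apply: (@integ_le _ _ (fun x => k ^+ 2 * g x ^+ 2)) => //.
- by apply: measurable_funX; exact: measurable_funM.
- move=> x Dx; rewrite normrX normrM exprMn; apply: ler_pM => //.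
  + by rewrite lerXn2r ?nnegrE ?fk// (le_trans _ (fk x Dx)).
  + by rewrite -normrX ger0_norm ?sqr_ge0.
- exact: integZ.
Qed.

Lemma sq_integZ D k f : measurable D -> sq_integ D f ->
  sq_integ D (fun x => k * f x).
Proof. by move=> mD; apply: (@sq_integ_bndM D (fun=> k) f `|k|). Qed.

Lemma sq_integB D f g : measurable D -> sq_integ D f -> sq_integ D g ->
  sq_integ D (fun x => f x - g x).
Proof.
move=> mD hf /(@sq_integZ _ (-1) _ mD) hg.
by under [X in sq_integ _ X]eq_fun do rewrite -mulN1r; exact: sq_integD.
Qed.

Lemma sq_integ_cst D k : measurable D -> (m D < +oo)%E -> sq_integ D (fun=> k).
Proof. by move=> mD Doo; split => //; exact: integ_cst. Qed.

Lemma sq_integ_integ D f : measurable D -> (m D < +oo)%E -> sq_integ D f ->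
  integ D f.
Proof.
move=> mD Doo hf; have := mul_integ mD hf (sq_integ_cst 1 mD Doo).
by apply: eq_integ => // x _; rewrite mulr1.
Qed.

Lemma sq_integS D D' f : measurable D -> measurable D' -> D' `<=` D ->
  sq_integ D f -> sq_integ D' f.
Proof.
by move=> mD mD' DD [mf hf]; split; [exact: measurable_funS mf|exact: integS hf].
Qed.

Lemma sq_integ_ae D f g : measurable D -> measurable_fun D g ->
  {ae m, forall x, D x -> f x = g x} -> sq_integ D f -> sq_integ D g.
Proof.
move=> mD mg fg [mf hf]; split=> //.
apply: integ_ae hf => //; first exact: measurable_funX.
by move: fg; apply: filterS => x + Dx => ->.
Qed.

Lemma integ_bndM D f g k : measurable D -> measurable_fun D f ->
  (forall x, D x -> `|f x| <= k) -> integ D g -> integ D (fun x => f x * g x).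
Proof.
move=> mD mf fk hg; apply: (@integ_le _ _ (fun x => k * `|g x|)) => //.
- by apply: measurable_funM => //; exact: integ_mfun hg.
- by move=> x Dx; rewrite normrM ler_wpM2r ?fk.
- by apply: integZ => //; exact: integ_norm.
Qed.

End Integrable.

(** * Borel sets, translations and Fubini's theorem on the plane *)

Section Plane.
Context {R : realType}.
Local Notation mu := (@lebesgue_measure R).
Local Notation leb2 := (mu \x mu)%E.

(** The measurable sets of the plane are generated by rectangles, so an open set has to be written
    as a countable union: that of the squares with rational centre and half-width that it
    contains. *)
Lemma open_measurable2 (U : set (R * R)) : open U -> measurable U.
Proof.
move=> oU.
pose box (q : rat * rat * rat) : set (R * R) :=
  ball (ratr q.1.1 : R) (ratr q.2 : R) `*` ball (ratr q.1.2 : R) (ratr q.2 : R).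
have mbox q : measurable (box q) by apply: measurableX; exact: measurable_ball.
suff -> : U = \bigcup_(q in [set q | box q `<=` U]) box q.
  rewrite bigcup_mkcond; apply: countable_bigcupT_measurable.
    exact: countableP.
  by move=> q; case: ifP.
apply/seteqP; split => [[x y] Uxy|z [q qU]]; last exact: qU.
have [e /= e0 eU] := (nbhs_ballP _ _).1 (open_nbhs_nbhs (conj oU Uxy)).
(* With a half-width [r] below [e / 2] and a centre within [r] of the point, the square contains the
   point and stays within [2 r] of it. *)
have /rat_in_itvoo [r] : 0 < e / 2 by rewrite divr_gt0.
rewrite in_itv/= => /andP[r0 re].
have hx (t : R) : t - ratr r < t by rewrite gtrBl.
have /rat_in_itvoo [qx] := hx x; rewrite in_itv/= => /andP[qx1 qx2].
have /rat_in_itvoo [qy] := hx y; rewrite in_itv/= => /andP[qy1 qy2].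
exists (qx, qy, r) => /=.
  move=> [u v] [/= hu hv]; apply: eU; split; rewrite /ball/= /ball_ in hu hv *.
    by move: hu; rewrite !ltr_norml; lra.
  by move: hv; rewrite !ltr_norml; lra.
by split; rewrite /ball/= /ball_ ltr_norml; lra.
Qed.

Lemma continuous_measurable2 (f : R * R -> R) : continuous f ->
  measurable_fun setT f.
Proof.
move=> cf; apply: (measurability (@RGenOpens.G R)).
  exact: RGenOpens.measurableE.
move=> _ [_ [a [b ->]] <-]; rewrite setTI; apply: open_measurable2.
by apply: open_comp => // x _; exact: cf.
Qed.

Definition shiftr (c : R) : measurableTypeR R -> measurableTypeR R :=
  fun x => x + c.

Lemma measurable_shift (c : R) : measurable_fun setT (shiftr c).
Proof. exact: measurable_funD. Qed.

HB.instance Definition _ c := isMeasurableFun.Build _ _ _ _ (shiftr c) (measurable_shift c).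

(** Lebesgue measure is determined by its values on half-open intervals, and these are translation
    invariant. *)
Lemma lebesgue_shift (c : R) (A : set R) : measurable A ->
  pushforward mu (shiftr c) A = mu A.
Proof.
move=> mA; apply/esym; apply: lebesgue_measure_unique => //= _ [[a b]] _ <-.
rewrite /pushforward (_ : _ @^-1` _ = `]a - c, b - c]%classic); last first.
  by apply/seteqP; split=> x /=; rewrite !in_itv/= ltrBlDr lerBrDr.
rewrite !lebesgue_measure_itv/= !lte_fin ltrD2r -!EFinD; congr (if _ then _%:E else _); ring.
Qed.

Lemma ge0_int_shift (c : R) (f : R -> \bar R) : measurable_fun setT f ->
  (forall x, 0 <= f x)%E -> (\int[mu]_x f (x + c)%R = \int[mu]_x f x)%E.
Proof.
move=> mf f0.
have := @ge0_integral_pushforward _ _ _ _ R _ (measurable_shift c) mu setT f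
  measurableT mf.
rewrite preimage_setT => <- //.
by apply: eq_measure_integral => A mA _; exact: lebesgue_shift.
Qed.

Lemma ae_shift (c : R) (P : set R) : {ae mu, forall x, P x} ->
  {ae mu, forall x, P (x + c)}.
Proof.
move=> [N [mN N0 PN]].
exists (shiftr c @^-1` N); split.
- by rewrite -[X in measurable X]setTI; exact: measurable_shift.
- by have := lebesgue_shift c mN; rewrite /pushforward N0.
- by move=> x /= nP; exact: PN.
Qed.

End Plane.
Section Fubini_rectangle.
Context {R : realType}.
Local Notation mu := (@lebesgue_measure R).
Local Notation leb2 := (mu \x mu)%E.

Lemma tonelli1 (f : R * R -> \bar R) : measurable_fun setT f ->
  (forall z, 0 <= f z)%E ->
  (\int[leb2]_z f z = \int[mu]_x \int[mu]_y f (x, y))%E.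
Proof. exact: (@fubini_tonelli1 _ _ _ _ R mu mu). Qed.

Lemma tonelli2 (f : R * R -> \bar R) : measurable_fun setT f ->
  (forall z, 0 <= f z)%E ->
  (\int[leb2]_z f z = \int[mu]_y \int[mu]_x f (x, y))%E.
Proof. exact: (@fubini_tonelli2 _ _ _ _ R mu mu). Qed.

Definition xshift (c : R) (z : R * R) : R * R := (z.1 + c, z.2).

Lemma measurable_xshift (c : R) : measurable_fun setT (xshift c).
Proof.
by apply: measurable_fun_pair => //=; exact: measurable_funD.
Qed.

Lemma ge0_int_xshift (c : R) (f : R * R -> \bar R) : measurable_fun setT f ->
  (forall z, 0 <= f z)%E -> (\int[leb2]_z f (xshift c z) = \int[leb2]_z f z)%E.
Proof.
move=> mf f0.
have mfc : measurable_fun setT (fun z => f (xshift c z)).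
  by apply: measurableT_comp => //; exact: measurable_xshift.
rewrite !tonelli2//; apply: eq_integral => y _.
rewrite -(@ge0_int_shift _ c (fun x => f (x, y)))//.
by apply: measurableT_comp => //; exact: pair2_measurable.
Qed.

End Fubini_rectangle.
Section Almost_everywhere.
Context {d : measure_display} {T : measurableType d} {R : realType}.
Variable m : {measure set T -> \bar R}.
Implicit Types P Q S U : T -> Prop.

Lemma aeS P U : {ae m, forall x, P x} -> (forall x, P x -> U x) ->
  {ae m, forall x, U x}.
Proof. by move=> hP h; apply: filterS hP. Qed.

Lemma aeS2 P Q U : {ae m, forall x, P x} -> {ae m, forall x, Q x} ->
  (forall x, P x -> Q x -> U x) -> {ae m, forall x, U x}.
Proof. by move=> hP hQ h; apply: filterS2 hP hQ. Qed.

Lemma aeS3 P Q S U : {ae m, forall x, P x} -> {ae m, forall x, Q x} ->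
  {ae m, forall x, S x} -> (forall x, P x -> Q x -> S x -> U x) ->
  {ae m, forall x, U x}.
Proof. by move=> hP hQ hS h; apply: filterS3 hP hQ hS. Qed.

End Almost_everywhere.

Section Fubini_rectangle_real.
Context {R : realType}.
Local Notation mu := (@lebesgue_measure R).
Local Notation leb2 := (mu \x mu)%E.
Variables (A B : set R) (f : R * R -> R).
Hypotheses (mA : measurable A) (mB : measurable B).
Hypothesis hf : integ leb2 (A `*` B) f.

Let ae_integrableE (D : set R) (g h : R -> \bar R) : measurable D ->
  mu.-integrable D g -> {ae mu, forall x, D x -> g x = h x} ->
  measurable_fun D h -> mu.-integrable D h.
Proof.
move=> mD /integrableP[mg hg] gh mh; apply/integrableP; split => //.
rewrite (@ae_eq_integral _ _ _ mu D (abse \o g))//.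
- exact: measurableT_comp.
- exact: measurableT_comp.
- by apply: (aeS gh) => x gh1 Dx /=; rewrite gh1.
Qed.

(** The extension by zero turns Fubini's theorem on the rectangle into that on the plane. *)
Let F : R * R -> \bar R := (EFin \o f) \_ (A `*` B).

Let hF : leb2.-integrable setT F.
Proof. by rewrite /F -integrable_mkcond//; exact: measurableX. Qed.

Let F1 x : x \in A -> (fun y => F (x, y)) = (EFin \o (fun y => f (x, y))) \_ B.
Proof.
move=> xA; apply/funext => y; rewrite /F !patchE.
by rewrite in_setX/= xA.
Qed.

Let F2 y : y \in B -> (fun x => F (x, y)) = (EFin \o (fun x => f (x, y))) \_ A.
Proof.
move=> yB; apply/funext => x; rewrite /F !patchE.
by rewrite in_setX/= yB andbT.
Qed.

Let F1n x : x \notin A -> (fun y => F (x, y)) = cst 0%E.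
Proof.
move=> xA; apply/funext => y; rewrite /F !patchE.
by rewrite in_setX/= (negbTE xA).
Qed.

Let F2n y : y \notin B -> (fun x => F (x, y)) = cst 0%E.
Proof.
move=> yB; apply/funext => x; rewrite /F !patchE.
by rewrite in_setX/= (negbTE yB) andbF.
Qed.

Lemma ae_integ1 : {ae mu, forall x, A x -> integ mu B (fun y => f (x, y))}.
Proof.
have := @ae_integrable1 _ _ _ _ R mu mu F hF; apply: filterS => x + Ax.
by rewrite /integ integrable_mkcond// -F1 ?inE.
Qed.

Lemma ae_integ2 : {ae mu, forall y, B y -> integ mu A (fun x => f (x, y))}.
Proof.
have := @ae_integrable2 _ _ _ _ R mu mu F hF; apply: filterS => x + Ax.
by rewrite /integ integrable_mkcond// -F2 ?inE.
Qed.

Let E1 x : x \in A -> (\int[mu]_y F (x, y) = \int[mu]_(y in B) (f (x, y))%:E)%E.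
Proof. by move=> xA; rewrite [RHS]integral_mkcond -F1. Qed.

Let E2 y : y \in B -> (\int[mu]_x F (x, y) = \int[mu]_(x in A) (f (x, y))%:E)%E.
Proof. by move=> xA; rewrite [RHS]integral_mkcond -F2. Qed.

Let mG : measurable_fun A (fun x => \int[mu]_(y in B) f (x, y)).
Proof.
apply: (@eq_measurable_fun _ _ _ _ _ (fine \o (fun x => \int[mu]_y F (x, y))%E)).
  by move=> x xA /=; rewrite E1.
apply: measurableT_comp => //.
apply: measurable_funTS.
exact: (@measurable_fubini_F _ _ _ _ R mu mu F hF).
Qed.

Let mH : measurable_fun B (fun y => \int[mu]_(x in A) f (x, y)).
Proof.
apply: (@eq_measurable_fun _ _ _ _ _ (fine \o (fun y => \int[mu]_x F (x, y))%E)).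
  by move=> x xA /=; rewrite E2.
apply: measurableT_comp => //.
apply: measurable_funTS.
exact: (@measurable_fubini_G _ _ _ _ R mu mu F hF).
Qed.

Let fine1 : {ae mu, forall x, A x ->
  (\int[mu]_y F (x, y))%E = (\int[mu]_(y in B) f (x, y))%:E}.
Proof.
apply: (aeS ae_integ1) => x h Ax.
by rewrite E1 ?inE// /Rintegral fineK//; apply: integrable_fin_num (h Ax).
Qed.

Let fine2 : {ae mu, forall y, B y ->
  (\int[mu]_x F (x, y))%E = (\int[mu]_(x in A) f (x, y))%:E}.
Proof.
apply: (aeS ae_integ2) => y h Ay.
by rewrite E2 ?inE// /Rintegral fineK//; apply: integrable_fin_num (h Ay).
Qed.

Lemma integ_int1 : integ mu A (fun x => \int[mu]_(y in B) f (x, y)).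
Proof.
have h := @integrable_fubini_F _ _ _ _ R mu mu F hF.
have {}h := @integrableS _ _ R mu _ _ _ measurableT mA (@subsetT _ A) h.
apply: (ae_integrableE mA h).
- exact: fine1.
- exact/measurable_EFinP.
Qed.

Lemma integ_int2 : integ mu B (fun y => \int[mu]_(x in A) f (x, y)).
Proof.
apply/integrableP; split; first exact/measurable_EFinP.
have /integrableP[mF F_fin] := hF.
have mFa : measurable_fun setT (fun z => `|F z|)%E by exact: measurableT_comp.
apply: le_lt_trans F_fin.
rewrite tonelli2//.
have mG' := @measurable_fun_fubini_tonelli_G _ _ _ _ R mu (fun z => `|F z|)%E mFa
  (fun z => abse_ge0 _).
apply: (@le_trans _ _ (\int[mu]_(y in B) \int[mu]_x `|F (x, y)|))%E; last first.
  by apply: ge0_subset_integral => // y _; exact: integral_ge0.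
apply: ge0_le_integral => //.
- by apply: measurableT_comp => //; exact/measurable_EFinP.
- exact: measurable_funTS.
- move=> y yB; rewrite -inE in yB.
  have mFy : measurable_fun setT (fun x => F (x, y)).
    by apply: measurableT_comp => //; exact: pair2_measurable.
  apply: le_trans (le_abse_integral mu measurableT mFy).
  have fine_le (e : \bar R) : (`|(fine e)%:E| <= `|e|)%E.
    by case: e => [r| |] //=; rewrite normr0 leey.
  by rewrite E2//; exact: fine_le.
Qed.

Let FT1 : (\int[mu]_x \int[mu]_y F (x, y) =
  \int[mu]_(x in A) (\int[mu]_(y in B) f (x, y))%:E)%E.
Proof.
transitivity (\int[mu]_(x in A) \int[mu]_y F (x, y))%E.
  rewrite [RHS]integral_mkcond; apply: eq_integral => x _; rewrite patchE.
  by case: ifPn => // /F1n ->; rewrite integral0.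
apply: ae_eq_integral => //.
- apply: measurable_funTS.
  exact: (@measurable_fubini_F _ _ _ _ R mu mu F hF).
- exact/measurable_EFinP.
Qed.

Let FT2 : (\int[mu]_y \int[mu]_x F (x, y) =
  \int[mu]_(y in B) (\int[mu]_(x in A) f (x, y))%:E)%E.
Proof.
transitivity (\int[mu]_(y in B) \int[mu]_x F (x, y))%E.
  rewrite [RHS]integral_mkcond; apply: eq_integral => x _; rewrite patchE.
  by case: ifPn => // /F2n ->; rewrite integral0.
apply: ae_eq_integral => //.
- apply: measurable_funTS.
  exact: (@measurable_fubini_G _ _ _ _ R mu mu F hF).
- exact/measurable_EFinP.
Qed.

Lemma Rint_rect1 : \int[leb2]_(z in A `*` B) f z =
  \int[mu]_(x in A) \int[mu]_(y in B) f (x, y).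
Proof.
rewrite /Rintegral; congr fine; rewrite integral_mkcond -FT1.
by rewrite -(@integral12_prod_meas1 _ _ _ _ R mu mu F hF).
Qed.

Lemma Rint_rect2 : \int[leb2]_(z in A `*` B) f z =
  \int[mu]_(y in B) \int[mu]_(x in A) f (x, y).
Proof.
rewrite /Rintegral; congr fine; rewrite integral_mkcond -FT2.
by rewrite -(@integral21_prod_meas1 _ _ _ _ R mu mu F hF).
Qed.

End Fubini_rectangle_real.

(** * Absolutely continuous functions as primitives on an interval *)

Section Primitives.
Context {R : realType}.
Local Notation mu := (@lebesgue_measure R).
Local Notation leb2 := (mu \x mu)%E.
Implicit Types (f g : R -> R) (L a b : R).

Lemma itv_finite (a b : R) : (mu `[a, b]%classic < +oo)%E.
Proof. by rewrite lebesgue_measure_itv/=; case: ifP => _; rewrite ltry. Qed.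

Lemma integ_patch (A : set R) f : measurable A -> integ mu A f ->
  integ mu setT (f \_ A).
Proof. by move=> mA; rewrite /integ integrable_mkcond// restrict_EFin. Qed.

Lemma measurable_patch (A : set R) f : measurable A -> measurable_fun A f ->
  measurable_fun setT (f \_ A).
Proof. by move=> mA; move/(measurable_restrictT _ mA).1. Qed.

Lemma integ_prod (A B : set R) f g : measurable A -> measurable B ->
  integ mu A f -> integ mu B g ->
  integ leb2 (A `*` B) (fun z => f z.1 * g z.2).
Proof.
move=> mA mB hf hg.
pose F z := (f \_ A) z.1 * (g \_ B) z.2.
have mAB : measurable (A `*` B) by exact: measurableX.
have mf := measurable_patch mA (integ_mfun hf).
have mg := measurable_patch mB (integ_mfun hg).
have mF : measurable_fun setT F.
  apply: measurable_funM; apply: measurableT_comp => //.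
suff hF : integ leb2 setT F.
  apply: (@eq_integ _ _ _ leb2 (A `*` B) F) => //; last exact: integS hF.
  by move=> [x y] [/= Ax By]; rewrite /F !patchE !mem_set.
have mF' : measurable_fun setT (EFin \o F) by exact/measurable_EFinP.
apply/(@integrable12ltyP _ _ _ _ R mu mu (EFin \o F) mF') => /=.
have h1 (k : R) (f' : R -> R) (C : set R) : measurable C -> integ mu C f' ->
    0 <= k -> (\int[mu]_x `|(k * (f' \_ C) x)%:E| = (k * \int[mu]_x `|(f' \_ C) x|)%:E)%E.
  move=> mC hf' k0.
  have hi := integ_norm measurableT (integ_patch mC hf').
  under eq_integral do rewrite /= normrM (ger0_norm k0) EFinM.
  rewrite ge0_integralZl//; last first.
    by apply/measurable_EFinP; exact: integ_mfun hi.
  by rewrite EFinM /Rintegral fineK//; apply: integrable_fin_num hi.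
have E x : (\int[mu]_y `|(F (x, y))%:E| =
    (`|(f \_ A) x| * \int[mu]_y `|(g \_ B) y|)%:E)%E.
  rewrite -(h1 _ _ _ mB hg)//; apply: eq_integral => y _.
  by rewrite /F /= !normrM normr_id.
under eq_integral do rewrite E mulrC.
have -> : (\int[mu]_x (\int[mu]_y `|(g \_ B) y| * `|(f \_ A) x|)%:E =
   \int[mu]_x `|(\int[mu]_y `|(g \_ B) y| * (f \_ A) x)%:E|)%E.
  apply: eq_integral => x _; rewrite /= normrM ger0_norm//.
  exact: Rintegral_ge0.
by rewrite (h1 _ _ _ mA hf) ?ltry//; exact: Rintegral_ge0.
Qed.

End Primitives.
Section Primitives_product.
Context {R : realType}.
Local Notation mu := (@lebesgue_measure R).
Local Notation leb2 := (mu \x mu)%E.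
Implicit Types (f g : R -> R) (L a b : R).

Lemma integ_sub L y g : y <= L -> integ mu `[0, L]%classic g ->
  integ mu `[0, y]%classic g.
Proof.
move=> yL; apply: integS => //.
by apply: subset_itvl; rewrite bnd_simp.
Qed.

Lemma Rint_truncl (y s : R) g : 0 <= s <= y ->
  \int[mu]_(t in `[0, y]) (g t * \1_(`]-oo, s]) t) = \int[mu]_(t in `[0, s]) g t.
Proof.
move=> /andP[s0 sy].
have -> : `[0, s]%classic = `[0, y]%classic `&` `]-oo, s]%classic :> set R.
  apply/seteqP; split=> t /=; rewrite !in_itv/=.
    by move=> /andP[-> ts]; rewrite (le_trans ts sy).
  by move=> [/andP[-> _]].
rewrite Rintegral_mkcondr; apply: eq_Rintegral => t _.
by rewrite patchE indicE; case: ifP => _; rewrite ?mulr1 ?mulr0.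
Qed.

(** The open end accounts for the strict inequality on one side of the diagonal in
    [Rint_mul_prim]. *)
Lemma Rint_truncl_open (y s : R) g : 0 <= s <= y -> integ mu `[0, y]%classic g ->
  \int[mu]_(t in `[0, y]) (g t * \1_(`]-oo, s[) t) = \int[mu]_(t in `[0, s]) g t.
Proof.
move=> /andP[s0 sy] hg.
rewrite -[RHS]Rintegral_itv_bndo_bndc; last first.
  by apply: integS hg => //; apply: subset_itvl; rewrite bnd_simp.
have -> : `[0, s[%classic = `[0, y]%classic `&` `]-oo, s[%classic :> set R.
  apply/seteqP; split=> t /=; rewrite !in_itv/=.
    by move=> /andP[-> ts]; rewrite (le_trans (ltW ts) sy).
  by move=> [/andP[-> _]].
rewrite Rintegral_mkcondr; apply: eq_Rintegral => t _.
by rewrite patchE indicE; case: ifP => _; rewrite ?mulr1 ?mulr0.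
Qed.

Let below : set (R * R) := [set z | z.2 <= z.1].

Let mbelow : measurable below.
Proof.
have -> : below = (fun z : R * R => z.1 - z.2) @^-1` `[0, +oo[%classic.
  by apply/seteqP; split=> z; rewrite /below/= in_itv/= andbT subr_ge0.
rewrite -[X in measurable X]setTI.
have : measurable_fun setT (fun z : R * R => z.1 - z.2).
  by apply: measurable_funB.
exact.
Qed.

(** Integration by parts for merely integrable functions: Fubini on the square [[0, y]^2] cut along
    its diagonal. The integrability of [g1] times the primitive of [g2] comes out of the same
    argument. *)
Lemma Rint_mul_prim (y : R) g1 g2 : integ mu `[0, y]%classic g1 ->
  integ mu `[0, y]%classic g2 ->
  (\int[mu]_(t in `[0, y]) g1 t) * (\int[mu]_(t in `[0, y]) g2 t) =
  (\int[mu]_(t in `[0, y]) (g1 t * \int[mu]_(s in `[0, t]) g2 s))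
  + \int[mu]_(t in `[0, y]) (g2 t * \int[mu]_(s in `[0, t]) g1 s) /\
  integ mu `[0, y]%classic (fun t => g1 t * \int[mu]_(s in `[0, t]) g2 s).
Proof.
move=> h1 h2; set S := `[0, y]%classic.
have mS : measurable S by exact: measurable_itv.
have mSS : measurable (S `*` S) by exact: measurableX.
have hP := integ_prod mS mS h1 h2.
set P := (fun z : R * R => g1 z.1 * g2 z.2) in hP.
have mI (A : set (R * R)) : measurable A ->
    integ leb2 (S `*` S) (fun z => \1_A z * P z).
  move=> mA; apply: (@integ_bndM _ _ _ leb2 _ _ _ 1) => //.
  by move=> z _; rewrite indicE; case: (_ \in _); rewrite ?normr1 ?normr0.
have hP1 := mI _ mbelow; have hP2 := mI _ (measurableC mbelow).
have E : \int[leb2]_(z in S `*` S) P z =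
    \int[leb2]_(z in S `*` S) (\1_below z * P z) +
    \int[leb2]_(z in S `*` S) (\1_(~` below) z * P z).
  rewrite -RintegralD//; apply: eq_Rintegral => z _.
  by rewrite -mulrDl !indicE in_setC; case: (_ \in _); rewrite ?addr0 ?add0r mul1r.
have hI (A : set R) g : measurable A -> integ mu S g ->
    integ mu S (fun t => g t * \1_A t).
  move=> mA hg; apply: (@eq_integ _ _ _ mu S (fun t => \1_A t * g t)) => //.
    by move=> t _; rewrite mulrC.
  apply: (@integ_bndM _ _ _ mu _ _ _ 1) => //.
  by move=> z _; rewrite indicE; case: (_ \in _); rewrite ?normr1 ?normr0.
have E1 s : s \in S -> \int[mu]_(t in S) (\1_below (s, t) * P (s, t)) =
    g1 s * \int[mu]_(t in `[0, s]) g2 t.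
  rewrite inE /S/= in_itv/= => sS.
  rewrite -(Rint_truncl _ sS) -RintegralZl//.
    apply: eq_Rintegral => t _; rewrite /P/=.
    rewrite (_ : \1_below (s, t) = \1_(`]-oo, s]) t); first by ring.
    by rewrite !indicE; congr (nat_of_bool _)%:R.
  exact: hI.
have E2 t : t \in S -> \int[mu]_(s in S) (\1_(~` below) (s, t) * P (s, t)) =
    g2 t * \int[mu]_(s in `[0, t]) g1 s.
  rewrite inE /S/= in_itv/= => tS.
  rewrite -(Rint_truncl_open tS)// -RintegralZl//.
    apply: eq_Rintegral => s _; rewrite /P/=.
    rewrite (_ : \1_(~` below) (s, t) = \1_(`]-oo, t[) s); first by ring.
    rewrite !indicE; congr (nat_of_bool _)%:R.
    apply/idP/idP; rewrite !inE /below/= in_itv/=; first by move/negP; rewrite -ltNge.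
    by move=> st; apply/negP; rewrite -ltNge.
  exact: hI.
split.
  have := E; rewrite Rint_rect1// (Rint_rect1 mS mS hP1) (Rint_rect2 mS mS hP2).
  under [X in _ = X + _ -> _]eq_Rintegral do rewrite E1//.
  under [X in _ = _ + X -> _]eq_Rintegral do rewrite E2//.
  move=> <-; rewrite -RintegralZr//; apply: eq_Rintegral => s _.
  by rewrite /P/= RintegralZl.
have := integ_int1 mS mS hP1; apply: eq_integ => // s sS.
by rewrite E1 ?inE.
Qed.

End Primitives_product.
Section Primitive_calculus.
Context {R : realType}.
Local Notation mu := (@lebesgue_measure R).
Implicit Types (f g : R -> R) (L a b : R).

(* [f] agrees almost everywhere on [0, L] with a primitive of [g] taking the
   value [a] at 0 and [b] at [L]. *)
Definition prim L a b f g := [/\ integ mu `[0, L]%classic g,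
  {ae mu, forall y, 0 <= y <= L -> f y = a + \int[mu]_(t in `[0, y]) g t} &
  b = a + \int[mu]_(t in `[0, L]) g t].

Lemma prim_int L a b f g : prim L a b f g ->
  \int[mu]_(t in `[0, L]) g t = b - a.
Proof. by move=> [_ _ ->]; rewrite addrAC subrr add0r. Qed.

Lemma primD L a b f g a' b' f' g' : prim L a b f g -> prim L a' b' f' g' ->
  prim L (a + a') (b + b') (fun x => f x + f' x) (fun x => g x + g' x).
Proof.
move=> [hg fE ->] [hg' fE' ->]; split; first exact: integD.
  apply: (aeS2 fE fE') => y E E' /[dup] /andP[y0 yL] /[dup] /E -> /E' ->.
  rewrite RintegralD//; [by ring|exact: integ_sub hg|exact: integ_sub hg'].
by rewrite RintegralD//; ring.
Qed.

Lemma primZ L a b f g k : prim L a b f g ->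
  prim L (k * a) (k * b) (fun x => k * f x) (fun x => k * g x).
Proof.
move=> [hg fE ->]; split; first exact: integZ.
  apply: (aeS fE) => y E /[dup] /andP[y0 yL] /E ->.
  by rewrite RintegralZl ?mulrDr//; exact: integ_sub hg.
by rewrite RintegralZl ?mulrDr.
Qed.

Lemma prim_cst L k : prim L k k (fun=> k) (fun=> 0).
Proof.
split; first exact: integ_cst (itv_finite _ _).
  by apply: aeW => y _; rewrite Rintegral_cst// mul0r addr0.
by rewrite Rintegral_cst// mul0r addr0.
Qed.

Lemma primB L a b f g a' b' f' g' : prim L a b f g -> prim L a' b' f' g' ->
  prim L (a - a') (b - b') (fun x => f x - f' x) (fun x => g x - g' x).
Proof.
move=> hf /(primZ (-1)) hg; have := primD hf hg.
rewrite !mulN1r.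
have -> : (fun x => f x + -1 * f' x) = (fun x => f x - f' x).
  by apply/funext => x; rewrite mulN1r.
by have -> : (fun x => g x + -1 * g' x) = (fun x => g x - g' x)
  by apply/funext => x; rewrite mulN1r.
Qed.

Lemma prim_bound L a b f g : prim L a b f g ->
  {ae mu, forall y, 0 <= y <= L -> `|f y| <= `|a| + \int[mu]_(t in `[0, L]) `|g t|}.
Proof.
move=> [hg fE _]; apply: (aeS fE) => y E /[dup] /andP[y0 yL] /E ->.
have hgy := integ_sub yL hg.
apply: le_trans (ler_normD _ _) _; rewrite lerD2l.
apply: le_trans (le_normr_Rintegral _ hgy) _ => //.
rewrite -(@Rint_truncl R L y (fun t => `|g t|)) ?y0//; apply: le_Rintegral => //.
- apply: (@eq_integ _ _ _ mu _ (fun t => \1_(`]-oo, y]%classic) t * `|g t|)) => //.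
    by move=> t _; rewrite mulrC.
  apply: (@integ_bndM _ _ _ mu _ _ _ 1) => //; last exact: integ_norm.
  by move=> z _; rewrite indicE; case: (_ \in _); rewrite ?normr1 ?normr0.
- exact: (integ_norm _ hg).
- by move=> t _; rewrite indicE; case: (_ \in _); rewrite ?mulr1 ?mulr0.
Qed.

Lemma prim_eq L a b f g g' : (forall x, 0 <= x <= L -> g x = g' x) ->
  prim L a b f g -> 0 <= L -> prim L a b f g'.
Proof.
move=> gg' [hg fE ->] L0; have E y : y <= L ->
    \int[mu]_(t in `[0, y]) g t = \int[mu]_(t in `[0, y]) g' t.
  move=> yL; apply: eq_Rintegral => t; rewrite inE/= in_itv/= => /andP[t0 ty].
  by apply: gg'; rewrite t0 (le_trans ty).
split; last by rewrite E.
  by apply: eq_integ hg => // t; rewrite /= in_itv/=; exact: gg'.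
by apply: (aeS fE) => y h /[dup] /andP[y0 yL] /h ->; rewrite E.
Qed.

Lemma prim_ae L a b f g f' g' : measurable_fun `[0, L]%classic g' ->
  {ae mu, forall x, 0 <= x <= L -> f x = f' x} ->
  {ae mu, forall x, 0 <= x <= L -> g x = g' x} ->
  prim L a b f g -> prim L a b f' g'.
Proof.
move=> mg' ff' gg' [hg fE ->]; have mg := integ_mfun hg.
have E y : y <= L -> \int[mu]_(t in `[0, y]) g t = \int[mu]_(t in `[0, y]) g' t.
  move=> yL; have ySL : (`[0, y]%classic : set R) `<=` `[0, L]%classic.
    by apply: subset_itvl; rewrite bnd_simp.
  apply: eq_ae_Rint => //; try exact: measurable_funS ySL _.
  apply: (aeS gg') => t h /= ty; apply: h.
  by have := ySL t ty; rewrite /= in_itv.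
split; last by rewrite E.
  exact: integ_ae hg.
by apply: (aeS2 fE ff') => y h1 h2 /[dup] /[dup] /andP[y0 yL] /h2 <- /h1 ->; rewrite E.
Qed.

Lemma prim_integ L a b f g : measurable_fun `[0, L]%classic f ->
  prim L a b f g -> integ mu `[0, L]%classic f.
Proof.
move=> mf /prim_bound hf.
pose K := `|a| + \int[mu]_(t in `[0, L]) `|g t|.
(* The bound on [f] holds almost everywhere only; the truncation is bounded everywhere and equals
   [f] almost everywhere. *)
pose f' x := Num.max (- K) (Num.min K (f x)).
apply: (@integ_ae _ _ _ mu _ f') => //.
  apply: (aeS hf) => y h; rewrite /= in_itv/= => /h.
  by rewrite ler_norml /f' => /andP[h1 h2]; rewrite min_r// max_r.
apply: (@integ_le _ _ _ mu _ _ (fun=> K)) => //.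
- apply: measurable_maxr => //; exact: measurable_minr.
- move=> x _; have K0 : 0 <= K by rewrite addr_ge0// Rintegral_ge0.
  rewrite /f' ler_norml le_max lexx/= ge_max ge_min lexx andbT.
  by lra.
- exact: integ_cst (itv_finite _ _).
Qed.

End Primitive_calculus.
Section Primitive_calculus2.
Context {R : realType}.
Local Notation mu := (@lebesgue_measure R).
Implicit Types (f g : R -> R) (L a b : R).

Lemma prim_mul L a1 b1 f1 g1 a2 b2 f2 g2 : 0 <= L ->
  measurable_fun `[0, L]%classic f1 -> measurable_fun `[0, L]%classic f2 ->
  prim L a1 b1 f1 g1 -> prim L a2 b2 f2 g2 ->
  prim L (a1 * a2) (b1 * b2) (fun x => f1 x * f2 x)
    (fun x => g1 x * f2 x + f1 x * g2 x).
Proof.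
move=> L0 mf1 mf2 [h1 E1 ->] [h2 E2 ->].
pose G1 y := \int[mu]_(t in `[0, y]) g1 t.
pose G2 y := \int[mu]_(t in `[0, y]) g2 t.
(* The derivative of the product of the two primitives, with the initial values kept apart so that
   [Rint_mul_prim] applies to the last two terms. *)
pose g t := (a2 * g1 t + a1 * g2 t) + (g1 t * G2 t + g2 t * G1 t).
have hi y : y <= L -> [/\ integ mu `[0, y]%classic g1, integ mu `[0, y]%classic g2,
    integ mu `[0, y]%classic (fun t => g1 t * G2 t) &
    integ mu `[0, y]%classic (fun t => g2 t * G1 t)].
  move=> yL; have k1 := integ_sub yL h1; have k2 := integ_sub yL h2.
  by split => //; [case: (Rint_mul_prim k1 k2)|case: (Rint_mul_prim k2 k1)].
have gE y : y <= L -> \int[mu]_(t in `[0, y]) g t = a2 * G1 y + a1 * G2 y + G1 y * G2 y.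
  move=> yL; have [k1 k2 k3 k4] := hi _ yL.
  have z1 : integ mu `[0, y]%classic (fun t => a2 * g1 t) by exact: integZ.
  have z2 : integ mu `[0, y]%classic (fun t => a1 * g2 t) by exact: integZ.
  rewrite /g RintegralD//; [|exact: integD|exact: integD].
  rewrite RintegralD// [X in _ + X]RintegralD// RintegralZl// RintegralZl//.
  by rewrite (Rint_mul_prim k1 k2).1.
have [k1 k2 k3 k4] := hi _ (lexx L).
have hg : integ mu `[0, L]%classic g.
  by apply: integD => //; apply: integD => //; exact: integZ.
have P : prim L (a1 * a2) ((a1 + G1 L) * (a2 + G2 L))
    (fun x => (a1 + G1 x) * (a2 + G2 x)) g.
  split => //; last by rewrite gE//; ring.
  by apply: aeW => y /andP[y0 yL]; rewrite gE//; ring.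
apply: prim_ae P.
- apply: measurable_funD; apply: measurable_funM => //.
    exact: integ_mfun k1.
  exact: integ_mfun k2.
- by apply: (aeS2 E1 E2) => y e1 e2 yL; rewrite e1// e2.
- by apply: (aeS2 E1 E2) => y e1 e2 yL; rewrite e1// e2// /g /G1 /G2; ring.
Qed.

Lemma prim_C1 L (F G : R -> R) : 0 <= L ->
  (forall x, is_derive x (1 : R) F (G x)) -> continuous G ->
  prim L (F 0) (F L) F G.
Proof.
move=> L0 dF cG.
have iG y : integ mu `[0, y]%classic G.
  apply: continuous_compact_integrable; first exact: segment_compact.
  exact: continuous_subspaceT.
have E y : 0 <= y -> \int[mu]_(t in `[0, y]) G t = F y - F 0.
  rewrite le_eqVlt => /predU1P[<-|y0].
    by rewrite set_itv1 Rintegral_set1 subrr.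
  rewrite /Rintegral (@continuous_FTC2 _ G F)//.
  - exact: continuous_subspaceT.
  - have cF x : {for x, continuous F}.
      by apply/differentiable_continuous/derivable1_diffP; case: (dF x).
    split=> [x _|//|//]; first by case: (dF x).
    + by apply/cvg_at_right_filter/cF.
    + by apply/cvg_at_left_filter/cF.
  - by move=> x _; rewrite derive1E; case: (dF x).
split; [exact: iG| |by rewrite E// subrKC].
by apply: aeW => y /andP[y0 _]; rewrite E// subrKC.
Qed.

Lemma int_shift (c : R) (f : R -> \bar R) : measurable_fun setT f ->
  (\int[mu]_x f (x + c)%R = \int[mu]_x f x)%E.
Proof.
move=> mf; rewrite [RHS]integralE [LHS]integralE.
congr (_ - _)%E.
  transitivity (\int[mu]_x (f^\+)%E (x + c)%R)%E.
  by apply: eq_integral => x _; rewrite funepos_comp.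
apply: (@ge0_int_shift _ c (f^\+)%E) => //.
  exact: (measurable_funepos mf).
transitivity (\int[mu]_x (f^\-)%E (x + c)%R)%E.
  by apply: eq_integral => x _; rewrite funeneg_comp.
apply: (@ge0_int_shift _ c (f^\-)%E) => //.
exact: (measurable_funeneg mf).
Qed.

Lemma Rint_itv_shift (c x y : R) g : measurable_fun `[x + c, y + c]%classic g ->
  \int[mu]_(t in `[x, y]) g (t + c) = \int[mu]_(t in `[x + c, y + c]) g t.
Proof.
move=> mg; rewrite Rintegral_mkcond [RHS]Rintegral_mkcond /Rintegral.
congr fine; rewrite -[RHS](@int_shift c); last first.
  by apply/measurable_EFinP; exact: measurable_patch.
apply: eq_integral => t _; rewrite /= !patchE.
suff -> : (t \in `[x, y]%classic) = (t + c \in `[x + c, y + c]%classic) by [].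
by apply/idP/idP; rewrite !inE/= !in_itv/= !lerD2r.
Qed.

Lemma integ_itv_shift (c x y : R) g : integ mu `[x + c, y + c]%classic g ->
  integ mu `[x, y]%classic (fun t => g (t + c)).
Proof.
move=> /[dup] hg /integrableP[mg]; rewrite integral_mkcond => goo.
have mgp := measurable_patch (measurable_itv _) (integ_mfun hg).
have E t : (t \in `[x, y]%classic) = (t + c \in `[x + c, y + c]%classic).
  by apply/idP/idP; rewrite !inE/= !in_itv/= !lerD2r.
apply/integrableP; split.
  apply/measurable_EFinP/(measurable_restrictT _ _).2 => //.
  have -> : (fun t => g (t + c)) \_ `[x, y]%classic =
      (g \_ `[x + c, y + c]%classic) \o (fun t => t + c).
    by apply/funext => t; rewrite /= !patchE E.
  by apply: measurableT_comp => //; exact: measurable_shift.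
apply: le_lt_trans goo; rewrite integral_mkcond -[leRHS](@int_shift c); last first.
  apply/(measurable_restrictT _ _).1 => //.
  by apply: measurableT_comp => //.
rewrite le_eqVlt; apply/orP; left; apply/eqP.
by apply: eq_integral => t _; rewrite !patchE E.
Qed.

(** The new value at 0 is that of the old primitive at [h]; [f h] itself would be meaningless, since
    [f] is known almost everywhere only. *)
Lemma prim_shift L h a b f g : 0 <= h -> 0 <= L -> prim (L + h) a b f g ->
  prim L (a + \int[mu]_(t in `[0, h]) g t) b (fun x => f (x + h)) (fun x => g (x + h)).
Proof.
move=> h0 L0 [hg fE ->].
have hgs y : 0 <= y <= L -> integ mu `[h, y + h]%classic g.
  move=> /andP[y0 yL]; apply: integS hg => // t /=; rewrite !in_itv/= => /andP[ht ty].
  by rewrite (le_trans h0 ht) (le_trans ty)// lerD2r.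
have E y : 0 <= y <= L -> \int[mu]_(t in `[0, y + h]) g t =
    \int[mu]_(t in `[0, h]) g t + \int[mu]_(t in `[0, y]) g (t + h).
  move=> yL; have /andP[y0 yL'] := yL.
  rewrite Rint_itv_shift ?add0r; last exact: integ_mfun (hgs _ yL).
  rewrite -[X in _ = _ + X]Rintegral_itv_obnd_cbnd; last first.
    by apply: integS (hgs _ yL) => //; apply: subset_itvr; rewrite bnd_simp.
  rewrite (@itv_bndbnd_setU _ _ _ (BRight h))//; last by rewrite bnd_simp lerDr.
  rewrite Rintegral_setU//.
    rewrite -itv_bndbnd_setU//; last by rewrite bnd_simp lerDr.
    by apply: (integ_sub (L := L + h)) => //; rewrite lerD2r.
  by apply/disj_setPLR => t/=; rewrite !in_itv/= => /andP[_ th]; rewrite ltNge th.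
split.
- by apply: integ_itv_shift; rewrite add0r; apply: hgs; rewrite L0/=.
- apply: (aeS (ae_shift h fE)) => y H /[dup] yL /andP[y0 yL'].
  by rewrite H ?E ?addrA// lerD2r yL' addr_ge0.
- by rewrite E ?addrA// L0 lexx.
Qed.

Lemma sqr_Rint_le (y : R) g : 0 <= y -> sq_integ mu `[0, y]%classic g ->
  (\int[mu]_(t in `[0, y]) g t) ^+ 2 <= y * \int[mu]_(t in `[0, y]) (g t ^+ 2).
Proof.
rewrite le_eqVlt => /predU1P[<- _|y0 hg].
  by rewrite set_itv1 !Rintegral_set1 expr2 !mul0r.
have hg1 : integ mu `[0, y]%classic g.
  by apply: sq_integ_integ hg => //; exact: itv_finite.
(* Cauchy-Schwarz against the constant 1: expand the integral of [(g - k)^2], with [k] the mean of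
   [g]. *)
set I := \int[mu]_(t in _) g t; pose k := I / y.
have : 0 <= \int[mu]_(t in `[0, y]) ((g t - k) ^+ 2).
  by apply: Rintegral_ge0 => t _; exact: sqr_ge0.
have -> : \int[mu]_(t in `[0, y]) ((g t - k) ^+ 2) =
    \int[mu]_(t in `[0, y]) (g t ^+ 2 + (- 2 * k) * g t + k ^+ 2).
  by apply: eq_Rintegral => t _; ring.
case: (hg) => mg hg2.
have i1 : integ mu `[0, y]%classic (fun t => - 2 * k * g t) by exact: integZ.
rewrite RintegralD//; last 2 first.
- exact: integD.
- exact: integ_cst (itv_finite _ _).
rewrite RintegralD// RintegralZl// Rintegral_cst//.
have -> : fine (mu `[0, y]%classic) = y.
  by rewrite lebesgue_measure_itv/= lte_fin y0/= subr0.
rewrite -/I => H.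
have := mulr_ge0 (ltW y0) H; rewrite -subr_ge0.
suff -> : y * (\int[mu]_(x in `[0, y]) g x ^+ 2 + - 2 * k * I + k ^+ 2 * y) =
  y * (\int[mu]_(t in `[0, y]) g t ^+ 2) - I ^+ 2 by [].
by rewrite /k; field; rewrite gt_eqF.
Qed.

End Primitive_calculus2.
Section Primitive_calculus3.
Context {R : realType}.
Local Notation mu := (@lebesgue_measure R).
Implicit Types (f g : R -> R) (L a b : R).

Lemma fine_lebesgue_itv a b : a <= b -> fine (mu `[a, b]%classic) = b - a.
Proof.
rewrite lebesgue_measure_itv/= lte_fin le_eqVlt => /predU1P[->|->//].
by rewrite ltxx subrr.
Qed.

Lemma Rint_itv_cat (h y : R) g : 0 <= h -> 0 <= y ->
  integ mu `[0, y + h]%classic g ->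
  \int[mu]_(t in `[0, y + h]) g t =
  \int[mu]_(t in `[0, h]) g t + \int[mu]_(t in `[0, y]) g (t + h).
Proof.
move=> h0 y0 hg.
have := @prim_shift R y h 0 (\int[mu]_(t in `[0, y + h]) g t)
  (fun y => \int[mu]_(t in `[0, y]) g t) g h0 y0.
have H : prim (y + h) 0 (\int[mu]_(t in `[0, y + h]) g t)
    (fun y => \int[mu]_(t in `[0, y]) g t) g.
  split => //; last by rewrite add0r.
  by apply: aeW => z _; rewrite add0r.
by move=> /(_ H)[_ _ ->]; rewrite add0r.
Qed.

Lemma Rint_itv_le (y L : R) g : 0 <= y <= L -> integ mu `[0, L]%classic g ->
  (forall t, 0 <= g t) ->
  \int[mu]_(t in `[0, y]) g t <= \int[mu]_(t in `[0, L]) g t.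
Proof.
move=> yL hg g0; rewrite -(Rint_truncl _ yL); apply: le_Rintegral => //.
  apply: (@eq_integ _ _ _ mu _ (fun t => \1_(`]-oo, y]%classic) t * g t)) => //.
    by move=> t _; rewrite mulrC.
  apply: (@integ_bndM _ _ _ mu _ _ _ 1) => //.
  by move=> z _; rewrite indicE; case: (_ \in _); rewrite ?normr1 ?normr0.
by move=> t _; rewrite indicE; case: (_ \in _); rewrite ?mulr1 ?mulr0.
Qed.

Lemma prim_incr L h a b f g : 0 <= h -> prim (L + h) a b f g ->
  {ae mu, forall x, 0 <= x <= L ->
    f (x + h) - f x = \int[mu]_(s in `[0, h]) g (s + x)}.
Proof.
move=> h0 [hg fE _]; apply: (aeS2 fE (ae_shift h fE)) => x E1 E2 /andP[x0 xL].
rewrite E1 ?E2; last 2 first.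
- by rewrite lerD2r xL addr_ge0.
- by rewrite x0 (le_trans xL)// lerDl.
rewrite [x + h]addrC Rint_itv_cat//; first by ring.
by apply: integ_sub hg; rewrite addrC lerD2r.
Qed.

(** The periodicity of [f] is used at a single good point [x], which exists because [l < L] leaves a
    set of positive measure. There the primitive gains nothing over [[x, x + l]], and the
    periodicity of [g] moves this interval to [[0, l]]. *)
Lemma prim_periodic L l a b f g : 0 <= l -> l < L ->
  prim L a b f g -> {ae mu, forall x, 0 <= x -> f (x + l) = f x} ->
  {ae mu, forall x, 0 <= x -> g (x + l) = g x} ->
  \int[mu]_(t in `[0, l]) g t = 0.
Proof.
move=> l0 lL [hg fE _] fp gp.
have E := aeS3 fE (ae_shift l fE) fp (fun x h1 h2 h3 => conj h1 (conj h2 h3)).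
have /existsNP[x] : ~ forall x, ~ ((0 <= x <= L - l -> a + \int[mu]_(t in `[0, x]) g t =
    a + \int[mu]_(t in `[0, x + l]) g t) /\ 0 <= x <= L - l).
  move=> H.
  have : mu.-negligible `[0, L - l]%classic.
    apply: negligibleS E => x /=; rewrite in_itv/= => xL.
    move=> [h1 [h2 h3]]; apply: (H x); split => // _.
    have /andP[x0 xl] := xL.
    rewrite -h1 ?x0/=; last by rewrite (le_trans xl)// gerBl.
    by rewrite -h2 ?h3// -lerBrDr xl addr_ge0.
  rewrite negligibleP//= lebesgue_measure_itv/= lte_fin subr_gt0 lL.
  by move=> /eqP; rewrite -EFinD subr0 eqe subr_eq0 gt_eqF.
move=> /contrapT[h xxL]; have /addrI := h xxL; have /andP[x0 xL] := xxL.
rewrite Rint_itv_cat//; last by apply: integ_sub hg; rewrite -lerBrDr.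
rewrite -[LHS]add0r => H.
suff E' : \int[mu]_(t in `[0, x]) g (t + l) = \int[mu]_(t in `[0, x]) g t.
  by move: H; rewrite E' => /addIr.
have hgx : integ mu `[0, x]%classic g.
  by apply: integ_sub hg; rewrite (le_trans xL)// gerBl.
suff hgl : integ mu `[0, x]%classic (fun t => g (t + l)).
  apply: eq_ae_Rint => //; [exact: integ_mfun hgl|exact: integ_mfun hgx|].
  by apply: (aeS gp) => t h' /=; rewrite in_itv/= => /andP[/h'].
apply: integ_itv_shift; rewrite add0r.
apply: integS hg => // t /=; rewrite !in_itv/= => /andP[lt tx].
by rewrite (le_trans l0 lt) (le_trans tx)// -lerBrDr.
Qed.

(** Lebesgue's differentiation theorem along the increments [1 / (n + 1)]; the extra length [d]
    leaves room for them up to the end point [L]. *)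
Lemma prim_dq L d a b f g : 0 < d -> 0 <= L -> prim (L + d) a b f g ->
  {ae mu, forall x, 0 <= x <= L ->
    n.+1%:R * (f (x + n.+1%:R^-1) - f x) @[n --> \oo] --> g x}.
Proof.
move=> d0 L0 [hg fE _].
pose h n : R := n.+1%:R^-1.
have h0 n : 0 < h n by rewrite invr_gt0.
pose gp := g \_ `[0, L + d]%classic.
have hgp : integ mu setT gp by exact: integ_patch.
have Fp y : 0 <= y <= L + d -> \int[mu]_(t in `[0, y]) g t =
    \int[mu]_(t in `[0, y]) gp t.
  move=> /andP[y0 yL]; apply: eq_Rintegral => t; rewrite inE/= in_itv/= => /andP[t0 ty].
  by rewrite /gp patchE mem_set//= in_itv/= t0 (le_trans ty).
have locgp : locally_integrable setT gp.
  by apply: open_integrable_locally => //; exact: openT.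
have gpi y : mu.-integrable [set` Interval (BLeft (0 : R)) (BRight y)] (EFin \o gp).
  exact: integS hgp.
have H1 := FTC1 gpi locgp.
have H2 : {ae mu, forall x, forall n, 0 <= x + h n <= L + d ->
    f (x + h n) = a + \int[mu]_(t in `[0, x + h n]) g t}.
  by apply: ae_foralln => n; exact: (ae_shift (h n) fE).
have H3 : {ae mu, forall x : R, x != 0}.
  exists [set 0]; split => //; first exact: lebesgue_measure_set1.
  by move=> x /=; move/negP; rewrite negbK => /eqP.
apply: (aeS3 H1 (aeS2 fE H2 (fun x h1 h2 => conj h1 h2)) H3) => x {}H1 [E1 E2] x0 /andP[x0' xL].
have {}x0 : 0 < x by rewrite lt_neqAle eq_sym x0.
have [|] := H1; first by rewrite lte_fin.
set F := (fun _ => _) => dF FE.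
have cvF : h^-1 *: (F (x + h) - F x) @[h --> 0^'] --> g x.
  have <- : gp x = g x.
    by rewrite /gp patchE mem_set//= in_itv/= x0' (le_trans xL)// lerDl ltW.
  rewrite -FE derive1E /derive; move: dF; rewrite /derivable => dF.
  have -> : (fun h => h^-1 *: (F (x + h) - F x)) =
     (fun h => h^-1 *: ((F \o shift x) (h *: 1) - F x)).
    by apply/funext => k; rewrite [k%:A]mulr1 /= [k + x]addrC.
  exact: dF.
have h_cvg : h n @[n --> \oo] --> 0 by exact: cvg_harmonic.
have hcv : h n @[n --> \oo] --> 0^'.
  move=> A hA; apply: (@filterS _ \oo _ _ _ _ (h_cvg _ hA)) => n; apply.
  exact: lt0r_neq0.
have : (fun k => k^-1 *: (F (x + k) - F x)) \o h @ \oo --> g x.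
  by apply: cvg_comp; [exact: hcv|exact: cvF].
apply: cvg_trans; apply: near_eq_cvg; near=> n.
rewrite /= /h invrK; congr (_ * _).
have hd : h n <= d.
  near: n; move/cvgrPdist_le : h_cvg => /(_ d d0); apply: filterS => n.
  by rewrite sub0r normrN gtr0_norm.
have /andP[xh0 xhd] : 0 <= x + h n <= L + d by rewrite lerD// addr_ge0// ltW.
rewrite E2 ?xh0// E1 ?x0'/=; last by rewrite (le_trans xL)// lerDl ltW.
rewrite /F -!Fp ?x0' ?xh0//=; last by rewrite (le_trans xL)// lerDl ltW.
by ring.
Unshelve. all: by end_near.
Qed.

(** Poincare's inequality from a zero at one end: Cauchy-Schwarz gives one factor [L] pointwise,
    integration the other. *)
Lemma prim0_poincare L f g b : 0 <= L -> measurable_fun `[0, L]%classic f ->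
  prim L 0 b f g -> sq_integ mu `[0, L]%classic g ->
  sq_integ mu `[0, L]%classic f /\
  \int[mu]_(t in `[0, L]) (f t ^+ 2) <= L ^+ 2 * \int[mu]_(t in `[0, L]) (g t ^+ 2).
Proof.
move=> L0 mf [hg fE _] hg2.
set K := \int[mu]_(t in `[0, L]) (g t ^+ 2).
have fK : {ae mu, forall x, `[0, L]%classic x -> f x ^+ 2 <= L * K}.
  apply: (aeS fE) => x E /=; rewrite in_itv/= => /[dup] /andP[x0 xL] /E ->.
  have h2 : sq_integ mu `[0, x]%classic g.
    by apply: sq_integS hg2 => //; apply: subset_itvl; rewrite bnd_simp.
  rewrite add0r; apply: le_trans (sqr_Rint_le x0 h2) _.
  apply: ler_pM => //; first by apply: Rintegral_ge0 => t _; exact: sqr_ge0.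
  apply: Rint_itv_le; [by rewrite x0|by case: hg2|by move=> t; exact: sqr_ge0].
have hK : integ mu `[0, L]%classic (fun=> L * K) by exact: integ_cst (itv_finite _ _).
have hf2 : integ mu `[0, L]%classic (fun x => f x ^+ 2).
  pose f' x := Num.min (L * K) (f x ^+ 2).
  have mf2 : measurable_fun `[0, L]%classic (fun x => f x ^+ 2).
    exact: measurable_funX.
  apply: (@integ_ae _ _ _ mu _ f') => //.
    by apply: (aeS fK) => x h /h ?; rewrite /f' min_r.
  apply: integ_le hK => //; first exact: measurable_minr.
  have K0 : 0 <= L * K.
    by rewrite mulr_ge0// Rintegral_ge0// => t _; exact: sqr_ge0.
  move=> x _; rewrite /f' ger0_norm ?le_min ?sqr_ge0 ?andbT//.
  by rewrite ge_min lexx.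
split; first by split.
apply: le_trans (ae_le_Rint _ hf2 hK fK) _ => //.
by rewrite Rintegral_cst// fine_lebesgue_itv// subr0 mulrAC expr2.
Qed.

End Primitive_calculus3.

(** * Smooth functions and bumps *)

Section Smooth_functions.
Context {R : realType}.
Implicit Types (f g : R -> R) (phi psi : R * R -> R) (k : nat).

(** The counterpart of [Ck] on the line: cutoffs are built from functions of one variable and
    carried to the plane by [smooth_comp] and [tens_smooth]. *)
Fixpoint Ck1 k f : Prop := continuous f /\
  if k is k'.+1 then (forall x, derivable f x 1) /\ Ck1 k' (derive1 f) else True.

Definition smooth1 f := forall k, Ck1 k f.

Lemma Ck1S k f df : continuous f -> (forall x, is_derive x (1 : R) f (df x)) ->
  Ck1 k df -> Ck1 k.+1 f.
Proof.
move=> cf fdf kdf; split => //; split; first by move=> x; case: (fdf x).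
suff -> : (derive1 f) = df by [].
by apply/funext => x; rewrite derive1E; case: (fdf x).
Qed.

Lemma Ck1_is_derive k f x : Ck1 k.+1 f -> is_derive x (1 : R) f ((derive1 f) x).
Proof. by move=> [_ [df _]]; split => //; rewrite derive1E. Qed.

Lemma Ck1W k f : Ck1 k.+1 f -> Ck1 k f.
Proof.
elim: k f => [f [cf _] //|k IH f [cf [df /IH kf]]].
by split.
Qed.

Lemma Ck1_cst k c : Ck1 k (fun=> c).
Proof.
elim: k c => [c|k IH c]; first by split => //; exact: cst_continuous.
apply: (@Ck1S _ _ (fun=> 0)) => //.
exact: cst_continuous.
Qed.

Lemma Ck1_id k : Ck1 k (fun x => x).
Proof.
case: k => [|k]; first by split => // x; exact: cvg_id.
apply: (@Ck1S _ _ (fun=> 1)) => [x|]; [exact: cvg_id|exact: Ck1_cst].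
Qed.

Lemma Ck1D k f g : Ck1 k f -> Ck1 k g -> Ck1 k (fun x => f x + g x).
Proof.
elim: k f g => [f g [cf _] [cg _]|k IH f g hf hg].
  by split => // x; apply: cvgD; [exact: cf|exact: cg].
have [cf [_ hf']] := hf; have [cg [_ hg']] := hg.
apply: Ck1S (IH _ _ hf' hg') => x; first by apply: cvgD; [exact: cf|exact: cg].
have h1 := Ck1_is_derive x hf; have h2 := Ck1_is_derive x hg.
exact: is_deriveD.
Qed.

Lemma Ck1M k f g : Ck1 k f -> Ck1 k g -> Ck1 k (fun x => f x * g x).
Proof.
elim: k f g => [f g [cf _] [cg _]|k IH f g hf hg].
  by split => // x; apply: cvgM; [exact: cf|exact: cg].
have [cf [_ hf']] := hf; have [cg [_ hg']] := hg.
have kk := Ck1D (IH _ _ (Ck1W hf) hg') (IH _ _ (Ck1W hg) hf').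
apply: Ck1S kk => x; first by apply: cvgM; [exact: cf|exact: cg].
have h1 := Ck1_is_derive x hf; have h2 := Ck1_is_derive x hg.
exact: is_deriveM.
Qed.

Lemma Ck1_comp k f g : Ck1 k f -> Ck1 k g -> Ck1 k (fun x => f (g x)).
Proof.
elim: k f g => [f g [cf _] [cg _]|k IH f g hf hg].
  by split => // x; apply: continuous_comp; [exact: cg|exact: cf].
have [cf [_ hf']] := hf; have [cg [_ hg']] := hg.
have kk := Ck1M (IH _ _ hf' (Ck1W hg)) hg'.
apply: Ck1S kk => x; first by apply: continuous_comp; [exact: cg|exact: cf].
have h1 := Ck1_is_derive (g x) hf; have h2 := Ck1_is_derive x hg.
exact: (is_derive1_comp (f := f) (g := g)).
Qed.

Lemma smooth1_cst c : smooth1 (fun=> c). Proof. by move=> k; exact: Ck1_cst. Qed.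
Lemma smooth1D f g : smooth1 f -> smooth1 g -> smooth1 (fun x => f x + g x).
Proof. by move=> hf hg k; exact: Ck1D. Qed.
Lemma smooth1M f g : smooth1 f -> smooth1 g -> smooth1 (fun x => f x * g x).
Proof. by move=> hf hg k; exact: Ck1M. Qed.
Lemma smooth1_comp f g : smooth1 f -> smooth1 g -> smooth1 (fun x => f (g x)).
Proof. by move=> hf hg k; exact: Ck1_comp. Qed.
Lemma smooth1_cont f : smooth1 f -> continuous f.
Proof. by move=> /(_ 0%N)[]. Qed.
Lemma smooth1_derive f : smooth1 f -> smooth1 (derive1 f).
Proof. by move=> hf k; case: (hf k.+1) => _ []. Qed.
Lemma smooth1_is_derive f x : smooth1 f -> is_derive x (1 : R) f ((derive1 f) x).
Proof. by move=> hf; apply: (Ck1_is_derive (k := 0)). Qed.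
Lemma smooth1_primitive f df : (forall x, is_derive x (1 : R) f (df x)) ->
  smooth1 df -> smooth1 f.
Proof.
move=> fdf hdf; have cf : continuous f.
  by move=> x; apply/differentiable_continuous/derivable1_diffP; case: (fdf x).
by case=> [|k]; [split|exact: Ck1S (hdf k)].
Qed.

(** Directional derivatives become derivatives on the line, where the chain rule is at hand. *)
Lemma is_derive_line phi z e d :
  is_derive z e phi d <-> is_derive (0 : R) (1 : R) (fun t => phi (t *: e + z)) d.
Proof.
suff E : (fun h : R => h^-1 *: ((phi \o shift z) (h *: e) - phi z)) =
    (fun h : R => h^-1 *: (((fun t => phi (t *: e + z)) \o shift (0 : R)) (h *: (1 : R))
      - (fun t => phi (t *: e + z)) 0)).
  by split=> -[]; rewrite /derivable /derive ?E => h1 h2; split; rewrite /derivable /derive ?E.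
by apply/funext => h /=; rewrite [h%:A]mulr1 addr0 scale0r add0r.
Qed.

Lemma is_derive_comp f phi z e a b : is_derive (phi z) (1 : R) f a ->
  is_derive z e phi b -> is_derive z e (fun z => f (phi z)) (a * b).
Proof.
move=> hf /is_derive_line hphi; apply/is_derive_line.
apply: (is_derive1_comp (f := f) (g := fun t => phi (t *: e + z))).
by rewrite scale0r add0r.
Qed.

Definition dir (e : R * R) := e = dirx R \/ e = diry R.

Lemma Ck_is_derive k phi e z : dir e -> Ck k.+1 phi ->
  is_derive z e phi ('D_e phi z).
Proof. by move=> he [_ h]; have [df _] := h e he; split. Qed.

Lemma CkS k phi : continuous phi ->
  (forall e, dir e -> exists2 psi, forall z, is_derive z e phi (psi z) & Ck k psi) ->
  Ck k.+1 phi.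
Proof.
move=> cphi h; split => // e /h[psi dpsi kpsi]; split.
  by move=> z; case: (dpsi z).
suff -> : 'D_e phi = psi by [].
by apply/funext => z; case: (dpsi z).
Qed.

Lemma CkW k phi : Ck k.+1 phi -> Ck k phi.
Proof.
elim: k phi => [phi [cphi _] //|k IH phi [cphi h]].
by split => // e /h[dphi /IH].
Qed.

Lemma Ck_cst k (c : R) : Ck k (fun=> c).
Proof.
elim: k c => [c|k IH c]; first by split => //; exact: cst_continuous.
apply: CkS; first exact: cst_continuous.
by move=> e _; exists (fun=> 0) => // z; exact: is_derive_cst.
Qed.

Lemma is_derive_affine (a b x : R) : is_derive x (1 : R) (fun t => t *: a + b) a.
Proof.
apply/is_derive1_caratheodory; exists (fun=> a); split => //.
  by move=> z; rewrite /GRing.scale/=; ring.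
exact: cst_continuous.
Qed.

Lemma Ck_fst k : Ck k (fun z : R * R => z.1).
Proof.
case: k => [|k]; first by split => // z; exact: cvg_fst.
apply: CkS => [z|e _]; first exact: cvg_fst.
exists (fun=> e.1); last exact: Ck_cst.
move=> z; apply/is_derive_line => /=.
exact: is_derive_affine.
Qed.

Lemma Ck_snd k : Ck k (fun z : R * R => z.2).
Proof.
case: k => [|k]; first by split => // z; exact: cvg_snd.
apply: CkS => [z|e _]; first exact: cvg_snd.
exists (fun=> e.2); last exact: Ck_cst.
move=> z; apply/is_derive_line => /=.
exact: is_derive_affine.
Qed.

Lemma CkD k phi psi : Ck k phi -> Ck k psi -> Ck k (fun z => phi z + psi z).
Proof.
elim: k phi psi => [f g [cf _] [cg _]|k IH f g hf hg].
  by split => // x; apply: cvgD; [exact: cf|exact: cg].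
have [cf hf'] := hf; have [cg hg'] := hg.
apply: CkS => [x|e he]; first by apply: cvgD; [exact: cf|exact: cg].
exists (fun z => 'D_e f z + 'D_e g z).
  move=> z; have h1 := Ck_is_derive z he hf; have h2 := Ck_is_derive z he hg.
  exact: is_deriveD.
by apply: IH; [case: (hf' e he)|case: (hg' e he)].
Qed.

Lemma CkM k phi psi : Ck k phi -> Ck k psi -> Ck k (fun z => phi z * psi z).
Proof.
elim: k phi psi => [f g [cf _] [cg _]|k IH f g hf hg].
  by split => // x; apply: cvgM; [exact: cf|exact: cg].
have [cf hf'] := hf; have [cg hg'] := hg.
apply: CkS => [x|e he]; first by apply: cvgM; [exact: cf|exact: cg].
exists (fun z => f z * 'D_e g z + g z * 'D_e f z).
  move=> z; have h1 := Ck_is_derive z he hf; have h2 := Ck_is_derive z he hg.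
  exact: is_deriveM.
have [_ h1] := hf' e he; have [_ h2] := hg' e he.
by apply: CkD; apply: IH => //; exact: CkW.
Qed.

Lemma Ck_comp k f phi : Ck1 k f -> Ck k phi -> Ck k (fun z => f (phi z)).
Proof.
elim: k f phi => [f g [cf _] [cg _]|k IH f g hf hg].
  by split => // x; apply: continuous_comp; [exact: cg|exact: cf].
have [cf [_ hf']] := hf; have [cg hg'] := hg.
apply: CkS => [x|e he].
  by apply: continuous_comp; [exact: cg|exact: cf].
exists (fun z => (derive1 f) (g z) * 'D_e g z).
  move=> z; apply: is_derive_comp; last exact: Ck_is_derive hg.
  exact: Ck1_is_derive hf.
have [_ h2] := hg' e he.
by apply: CkM => //; apply: IH => //; exact: CkW.
Qed.

Lemma smooth_cst c : smooth (fun=> c : R). Proof. by move=> k; exact: Ck_cst. Qed.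
Lemma smooth_fst : smooth (fun z : R * R => z.1). Proof. exact: Ck_fst. Qed.
Lemma smooth_snd : smooth (fun z : R * R => z.2). Proof. exact: Ck_snd. Qed.
Lemma smoothD phi psi : smooth phi -> smooth psi -> smooth (fun z => phi z + psi z).
Proof. by move=> hf hg k; exact: CkD. Qed.
Lemma smoothM phi psi : smooth phi -> smooth psi -> smooth (fun z => phi z * psi z).
Proof. by move=> hf hg k; exact: CkM. Qed.
Lemma smooth_comp f phi : smooth1 f -> smooth phi -> smooth (fun z => f (phi z)).
Proof. by move=> hf hg k; exact: Ck_comp. Qed.
Lemma smooth_cont phi : smooth phi -> continuous phi.
Proof. by move=> /(_ 0%N)[]. Qed.
Lemma smooth_derive phi e : dir e -> smooth phi -> smooth ('D_e phi).
Proof. by move=> he hf k; case: (hf k.+1) => _ /(_ e he)[]. Qed.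
Lemma smooth_is_derive phi e z : dir e -> smooth phi ->
  is_derive z e phi ('D_e phi z).
Proof. by move=> he hf; apply: (Ck_is_derive (k := 0)). Qed.

End Smooth_functions.
Section Bumps.
Context {R : realType}.
Local Notation mu := (@lebesgue_measure R).
Implicit Types (f g : R -> R).

(** The functions [t^-k exp (- 1 / t)], extended by 0. The index [k] makes the family closed under
    differentiation up to linear combinations, whence smoothness by one induction for all [k]. *)
Definition flat (k : nat) (t : R) : R :=
  if 0 < t then t^-1 ^+ k * expR (- t^-1) else 0.

Lemma flat_ge0 k t : 0 <= flat k t.
Proof.
rewrite /flat; case: ltP => // t0.
by rewrite mulr_ge0 ?expR_ge0// exprn_ge0// invr_ge0 ltW.
Qed.

Lemma flat_le0 k t : t <= 0 -> flat k t = 0.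
Proof. by rewrite /flat ltNge => ->. Qed.

Lemma flat_gt0 k t : 0 < t -> 0 < flat k t.
Proof. by move=> t0; rewrite /flat t0 mulr_gt0 ?expR_gt0// exprn_gt0// invr_gt0. Qed.

Lemma flat0_le1 t : flat 0 t <= 1.
Proof.
rewrite /flat; case: ltP => // t0.
by rewrite expr0 mul1r -expR0 ler_expR oppr_le0 invr_ge0 ltW.
Qed.

(** The Taylor term of order [k + 2] of the exponential at [1 / t]. A bound quadratic in [t] is what
    differentiability at 0, with derivative 0, requires. *)
Lemma flat_sqr k t : flat k t <= (k.+2)`!%:R * t ^+ 2.
Proof.
rewrite /flat; case: ltP => [t0|_]; last by rewrite mulr_ge0// sqr_ge0.
have s0 : 0 <= t^-1 by rewrite invr_ge0 ltW.
have := expR_ge1Dxn k.+1 s0; rewrite expRN => h.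
rewrite ler_pdivrMr ?expR_gt0//.
have f0 : 0 < (k.+2)`!%:R :> R by rewrite ltr0n fact_gt0.
have {}h : t^-1 ^+ k.+2 <= (k.+2)`!%:R * expR t^-1.
  by rewrite mulrC -ler_pdivrMr//; apply: le_trans h; rewrite lerDr.
rewrite mulrAC; apply: le_trans (ler_wpM2r (sqr_ge0 t) h).
rewrite -addn2 exprD -mulrA -exprMn mulVf ?expr1n ?mulr1//.
by rewrite gt_eqF.
Qed.

Lemma flat_is_derive k t :
  is_derive t (1 : R) (flat k) (flat k.+2 t - k%:R * flat k.+1 t).
Proof.
have [t0|t0|->] := ltgtP t 0.
- apply: (@near_eq_is_derive _ _ _ (cst 0)) => //.
  + by apply: filterS (lt_le_nbhsl t0) => s ts; rewrite flat_le0.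
  + by rewrite !flat_le0 ?ltW// mulr0 subr0; exact: is_derive_cst.
- apply: (@near_eq_is_derive R R^o R^o (fun s : R => s^-1 ^+ k * expR (- s^-1))) => //.
  + by apply: filterS (lt_nbhsr t0) => s ts; rewrite /flat ifT.
  + have tn : t != 0 by rewrite gt_eqF.
    have dV : is_derive t (1 : R) (fun s : R => s^-1) (- t ^- 2).
      apply: is_derive_eq; first exact: is_deriveV.
      exact: mulr1.
    have dN : is_derive t (1 : R) (fun s : R => - s^-1) (t ^- 2).
      by apply: is_derive_eq; rewrite opprK.
    have dE : is_derive t (1 : R) (fun s : R => expR (- s^-1)) (expR (- t^-1) * t ^- 2).
      exact: (is_derive1_comp (f := expR)).
    have dX : is_derive t (1 : R) (fun s : R => s^-1 ^+ k) (k%:R * t^-1 ^+ k.-1 * - t ^- 2).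
      by have -> : (fun s : R => s^-1 ^+ k) = (fun s : R => s^-1) ^+ k;
        [rewrite exprfctE|exact: is_deriveX].
    apply: (is_derive_eq (is_deriveM dX dE)).
    rewrite /flat t0 -!exprVn /GRing.scale/= !exprS.
    by case: k {dX} => [|k]/=; rewrite ?exprS; ring.
- rewrite !flat_le0// mulr0 subr0.
  (* Caratheodory's form of the derivative: the slope [flat k s / s], set to 0 at 0, is continuous
     there by [flat_sqr]. *)
  apply/is_derive1_caratheodory.
  pose q s := if s == 0 then 0 else flat k s / s.
  exists q; split; last by rewrite /q eqxx.
  + move=> s; rewrite [flat k 0]flat_le0// !subr0 /q; case: eqVneq => [->|s0].
      by rewrite mulr0 flat_le0.
    by rewrite divfK.
  + have q0 : q 0 = 0 by rewrite /q eqxx.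
    rewrite /prop_for /continuous_at q0; apply/cvgrPdist_le => e e0; near=> s.
    rewrite sub0r normrN /q; case: eqVneq => [_|s0]; first by rewrite normr0 ltW.
    rewrite normrM normfV ler_pdivrMr ?normr_gt0//.
    rewrite ger0_norm ?flat_ge0//; apply: le_trans (flat_sqr _ _) _.
    rewrite -real_normK ?num_real// expr2 mulrA ler_wpM2r//.
    rewrite mulrC -ler_pdivlMr ?ltr0n ?fact_gt0//; near: s.
    have d0 : 0 < e / (k.+2)`!%:R by rewrite divr_gt0// ltr0n fact_gt0.
    exists (e / (k.+2)`!%:R) => //= s.
    by rewrite /ball_/= sub0r normrN => /ltW.
Unshelve. all: by end_near.
Qed.

Lemma flat_smooth k : smooth1 (flat k).
Proof.
move=> n; elim: n k => [|n IH] k.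
  split => // x; apply/differentiable_continuous/derivable1_diffP.
  by case: (flat_is_derive k x).
apply: (@Ck1S _ _ _ (fun t => flat k.+2 t + - k%:R * flat k.+1 t)).
- move=> x; apply/differentiable_continuous/derivable1_diffP.
  by case: (flat_is_derive k x).
- by move=> x; rewrite mulNr; exact: flat_is_derive.
- by apply: Ck1D => //; apply: Ck1M => //; exact: Ck1_cst.
Qed.

(** The flanks steepen with [n], and the limit is the indicator of []c, d[]. *)
Definition bump (c d : R) (n : nat) (t : R) : R :=
  flat 0 (n.+1%:R * (t - c)) * flat 0 (n.+1%:R * (d - t)).

Lemma bump_smooth c d n : smooth1 (bump c d n).
Proof.
apply: smooth1M.
  apply: (smooth1_comp (flat_smooth 0)); apply: smooth1M; first exact: smooth1_cst.
  by apply: smooth1D => [k|]; [exact: Ck1_id|exact: smooth1_cst].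
apply: (smooth1_comp (flat_smooth 0)); apply: smooth1M; first exact: smooth1_cst.
apply: smooth1D; first exact: smooth1_cst.
have -> : (-%R : R -> R) = (fun x : R => -1 * x).
  by apply/funext => x; rewrite mulN1r.
by apply: smooth1M => k; [exact: Ck1_cst|exact: Ck1_id].
Qed.

Lemma bump_ge0 c d n t : 0 <= bump c d n t.
Proof. by rewrite mulr_ge0// flat_ge0. Qed.

Lemma bump_le1 c d n t : bump c d n t <= 1.
Proof. by rewrite -[leRHS]mulr1 ler_pM ?flat_ge0 ?flat0_le1. Qed.

Lemma bump_out c d n t : ~~ (c < t < d) -> bump c d n t = 0.
Proof.
rewrite negb_and -!leNgt /bump => /orP[tc|dt].
  by rewrite flat_le0 ?mul0r// pmulr_rle0// subr_le0.
by rewrite [X in _ * X]flat_le0 ?mulr0// pmulr_rle0// subr_le0.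
Qed.

Lemma bump_gt0 c d n t : c < t < d -> 0 < bump c d n t.
Proof.
by move=> /andP[ct td]; rewrite mulr_gt0// flat_gt0// mulr_gt0// subr_gt0.
Qed.

Lemma bump_cvg c d t : bump c d n t @[n --> \oo] --> (\1_(`]c, d[%classic) t : R).
Proof.
have flat_cvg (s : R) : 0 < s -> flat 0 (n.+1%:R * s) @[n --> \oo] --> (1 : R).
  move=> s0; have E n : flat 0 (n.+1%:R * s) = expR (- (n.+1%:R^-1 * s^-1)).
    by rewrite /flat mulr_gt0// expr0 mul1r invfM.
  under eq_fun do rewrite E.
  have h : - (n.+1%:R^-1 * s^-1) @[n --> \oo] --> (- (0 * s^-1) : R).
    by apply: cvgN; apply: cvgMl; exact: cvg_harmonic.
  rewrite mul0r oppr0 in h.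
  have := @continuous_expR R 0; rewrite /continuous_at expR0 => h'.
  exact: (cvg_comp _ _ h h').
rewrite indicE; have [tcd|tcd] := boolP (c < t < d).
  rewrite mem_set/= ?in_itv//; have /andP[ct td] := tcd.
  rewrite -[1%:R]mulr1; apply: cvgM; apply: flat_cvg; rewrite subr_gt0//.
rewrite memNset/=; last by rewrite in_itv/=; exact/negP.
under eq_fun do rewrite bump_out//; exact: cvg_cst.
Qed.

End Bumps.
Section Dominated.
Context {d : measure_display} {T : measurableType d} {R : realType}.
Variable m : {measure set T -> \bar R}.

Lemma Rint_dominated (D : set T) (f_ : nat -> T -> R) (f g : T -> R) :
  measurable D -> (forall n, measurable_fun D (f_ n)) -> measurable_fun D f ->
  (forall x, D x -> f_ n x @[n --> \oo] --> f x) -> integ m D g ->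
  (forall n x, D x -> `|f_ n x| <= g x) ->
  \int[m]_(x in D) f_ n x @[n --> \oo] --> \int[m]_(x in D) f x.
Proof.
move=> mD mf_ mf cvf hg fg.
have hf_ n : integ m D (f_ n) by apply: integ_le hg => //; exact: fg.
have [hf _] := @dominated_convergence _ _ R m D mD
  (fun n x => (f_ n x)%:E) (EFin \o f) (EFin \o g)
  (fun n => (measurable_EFinP _ _).2 (mf_ n)) ((measurable_EFinP _ _).2 mf)
  (aeW _ (fun x Dx => (cvg_comp _ _ (cvf x Dx) (fun _ => id))))
  hg (aeW _ (fun x n Dx => fg n x Dx)).
rewrite -[X in _ --> X -> _]fineK; last exact: integrable_fin_num.
by move=> /fine_cvg.
Qed.

End Dominated.

(** * The fundamental lemma and du Bois-Reymond's lemma on an interval *)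

Section Fundamental_lemma.
Context {R : realType}.
Local Notation mu := (@lebesgue_measure R).
Implicit Types (f g : R -> R) (A B : R).

Lemma Rint_bump_lim A B g c d : integ mu `[A, B]%classic g ->
  (forall n, \int[mu]_(t in `[A, B]) (g t * bump c d n t) = 0) ->
  \int[mu]_(t in `[A, B]) (g t * \1_(`]c, d[%classic) t) = 0.
Proof.
move=> hg H.
have mb n : measurable_fun (`[A, B]%classic : set R) (bump c d n).
  apply: measurable_funTS; apply: continuous_measurable_fun.
  exact/smooth1_cont/bump_smooth.
have mg := integ_mfun hg.
have : \int[mu]_(t in `[A, B]) (g t * bump c d n t) @[n --> \oo] -->
    \int[mu]_(t in `[A, B]) (g t * \1_(`]c, d[%classic) t).
  apply: (@Rint_dominated _ _ _ mu _ _ _ (fun t => `|g t|)) => //.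
  - by move=> n; apply: measurable_funM => //; exact: mb.
  - exact: measurable_funM.
  - by move=> t _; apply: cvgMr; exact: bump_cvg.
  - exact: integ_norm.
  - move=> n t _; rewrite normrM ler_piMr// ger0_norm ?bump_ge0//.
    exact: bump_le1.
under eq_fun do rewrite H; move=> h.
by apply: (@cvg_unique _ (@Rhausdorff R) _ _ _ _ h); exact: cvg_cst.
Qed.

Lemma ae_neq (c : R) : {ae mu, forall x, x != c}.
Proof.
exists [set c]; split => //; first exact: lebesgue_measure_set1.
by move=> x /=; move/negP; rewrite negbK => /eqP.
Qed.

(** The test functions are countably many, so that on almost every line of the plane the hypothesis
    can hold for all of them at once. As [n] grows, they show that the primitive of [g] agrees at
    all rational points; hence it is constant, and [g] is its derivative almost everywhere. *)
Lemma fundamental_lemma A B g : integ mu `[A, B]%classic g ->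
  (forall (c d : rat) n, A < ratr c < B -> A < ratr d < B ->
    \int[mu]_(t in `[A, B]) (g t * bump (ratr c) (ratr d) n t) = 0) ->
  {ae mu, forall t, A <= t <= B -> g t = 0}.
Proof.
move=> hg H.
have [BA|AB] := leP B A.
  exists [set A]; split => //; first exact: lebesgue_measure_set1.
  move=> t /=; apply: contra_notP => tA /andP[At tB]; exfalso; apply: tA.
  by apply/eqP; rewrite eq_le At (le_trans tB).
pose gp := g \_ `[A, B]%classic.
have hgp : integ mu setT gp by exact: integ_patch.
pose F x := \int[mu]_(t in `[A, x]) gp t.
have locgp : locally_integrable setT gp.
  by apply: open_integrable_locally => //; exact: openT.
have gpi y : mu.-integrable [set` Interval (BLeft A) (BRight y)] (EFin \o gp).
  exact: integS hgp.
have cF x : A < x < B -> {for x, continuous F}.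
  move=> xAB; have := parameterized_integral_continuous (ltW AB) (gpi B).
  by move=> /within_continuous_continuous; apply.
have Frat (c d : rat) : A < ratr c < B -> A < ratr d < B -> ratr c <= ratr d :> R ->
    F (ratr c) = F (ratr d).
  move=> cAB dAB cd; have := Rint_bump_lim hg (fun n => H c d n cAB dAB).
  rewrite le_eqVlt in cd; have /predU1P[->//|cd'] := cd.
  have [Ac cB] := andP cAB; have [Ad dB] := andP dAB.
  have E (I : interval R) : [set` I] `<=` `[A, B]%classic ->
      \int[mu]_(t in [set` I]) gp t = \int[mu]_(t in [set` I]) g t.
    by move=> IAB; apply: eq_Rintegral => t; rewrite inE => /IAB tAB; rewrite /gp patchE mem_set.
  have -> : \int[mu]_(t in `[A, B]) (g t * \1_(`]ratr c, ratr d[%classic) t) =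
      \int[mu]_(t in `]ratr c, ratr d[) gp t.
    have sub : `]ratr c, ratr d[%classic `<=` (`[A, B]%classic : set R).
      move=> t /=; rewrite !in_itv/= => /andP[ct td].
      by rewrite (le_trans (ltW Ac) (ltW ct)) (le_trans (ltW td) (ltW dB)).
    rewrite E// -[in RHS](setIidr sub) Rintegral_mkcondr; apply: eq_Rintegral => t _.
    by rewrite patchE indicE; case: ifP => _; rewrite ?mulr1 ?mulr0.
  rewrite Rintegral_itv_bndo_bndc; last exact: integS hgp.
  rewrite -(@Rintegral_itvB _ gp (BLeft A) (BRight (ratr d)) (ratr c))//.
  - by move/eqP; rewrite subr_eq0 eq_sym => /eqP.
  - by rewrite bnd_simp ltW.
  - by rewrite bnd_simp ltW.
pose K := F ((A + B) / 2).
have FK x : A < x < B -> F x = K.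
  move=> xAB; apply/eqP; rewrite -subr_eq0; apply: contraT => neq0.
  have d0 : 0 < `|F x - F ((A + B) / 2)| by rewrite normr_gt0.
  have mAB : A < (A + B) / 2 < B by apply/andP; split; lra.
  have rat_near y e : A < y < B -> 0 < e -> exists2 q : rat, A < ratr q < B & `|F y - F (ratr q)| < e.
    move=> /[dup] /cF /cvgrPdist_lt h /andP[Ay yB] /h [r /= r0 hr].
    have [q] : exists q : rat, ratr q \in `]Num.max A (y - r), Num.min B (y + r)[.
      apply: rat_in_itvoo; rewrite lt_min !gt_max; lra.
    rewrite in_itv/= lt_min gt_max => /andP[/andP[h1 h2] /andP[h3 h4]].
    exists q; first by rewrite h1 h3.
    by apply: hr; rewrite /ball_/= ltr_norml; lra.
  have d2 : 0 < `|F x - F ((A + B) / 2)| / 2 by rewrite divr_gt0.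
  have [q1 q1AB h1] := rat_near _ _ xAB d2.
  have [q2 q2AB h2] := rat_near _ _ mAB d2.
  have E : F (ratr q1) = F (ratr q2).
    by have [|/ltW] := leP (ratr q1 : R) (ratr q2) => /Frat -> //.
  rewrite E in h1.
  have : `|F x - F ((A + B) / 2)| <= `|F x - F (ratr q2)| + `|F ((A + B) / 2) - F (ratr q2)|.
    by rewrite [`|F ((A + B) / 2) - _|]distrC; exact: ler_distD.
  by move: h1 h2; lra.
have H3 : {ae mu, forall x : R, x != A /\ x != B}.
  exact: (aeS2 (ae_neq A) (ae_neq B) (fun x h1 h2 => conj h1 h2)).
apply: (aeS2 (FTC1 gpi locgp) H3) => x H1 [xA xB] /andP[Ax xleB].
have {xA}Ax' : A < x by rewrite lt_neqAle eq_sym xA.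
have {xB}xB' : x < B by rewrite lt_neqAle xB.
have [|_] := H1; first by rewrite lte_fin.
have -> : gp x = g x by rewrite /gp patchE mem_set//= in_itv/= Ax.
move=> <-; rewrite derive1E -/F.
have : is_derive x (1 : R) F 0.
  apply: (@near_eq_is_derive R R^o R^o (cst K)).
  near=> y; rewrite FK//; apply/andP; split; near: y.
    exact: lt_nbhsr.
  exact: lt_nbhsl.
by case.
Unshelve. all: by end_near.
Qed.

End Fundamental_lemma.
Section Weak_primitive.
Context {R : realType}.
Local Notation mu := (@lebesgue_measure R).
Implicit Types (f g h : R -> R) (L c d : R).

Lemma Rint0 (D : set R) f : (forall t, D t -> f t = 0) -> \int[mu]_(t in D) f t = 0.
Proof. by move=> f0; rewrite /Rintegral integral0_eq// => t /f0 ->. Qed.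

(** The integral over [[0, t]] is 0 for negative [t]; since [h] vanishes up to [c > 0], no corner
    appears at 0. *)
Lemma is_derive_int0 h c : 0 < c -> continuous h -> (forall t, t <= c -> h t = 0) ->
  forall t, is_derive t (1 : R) (fun t => \int[mu]_(s in `[0, t]) h s) (h t).
Proof.
move=> c0 ch h0 t; set F := (fun t => _).
have hi y : integ mu `[0, y]%classic h.
  apply: continuous_compact_integrable; first exact: segment_compact.
  exact: continuous_subspaceT.
have [t0|t0] := ltP 0 t.
  have [] := @continuous_FTC1_closed _ h 0 t (t + 1) _ (hi _) t0 (ch t).
    by rewrite ltrDl.
  by move=> dF; rewrite derive1E => EF; split.
have tc : t < c by exact: le_lt_trans c0.
rewrite h0 ?ltW//.
apply: (@near_eq_is_derive R R^o R^o (cst 0)).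
near=> s; rewrite /F /= Rint0// => x /=.
rewrite in_itv/= => /andP[_ xs]; apply: h0; apply: le_trans xs _.
by near: s; exact: lt_le_nbhsl.
Unshelve. all: by end_near.
Qed.

Lemma Rint_continuous_gt0 (A B : R) h t0 : continuous h -> (forall t, 0 <= h t) ->
  A < t0 < B -> 0 < h t0 -> 0 < \int[mu]_(t in `[A, B]) h t.
Proof.
move=> ch h0 t0AB ht0.
have hi y z : integ mu `[y, z]%classic h.
  apply: continuous_compact_integrable; first exact: segment_compact.
  exact: continuous_subspaceT.
rewrite lt_neqAle Rintegral_ge0// andbT; apply/eqP => /esym H.
have Hae : {ae mu, forall x, `[A, B]%classic x -> h x = 0}.
  by apply: Rint_eq0_ae => //; exact: hi.
have : \forall t \near t0, A < t < B /\ 0 < h t.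
  near=> t; split.
    by apply/andP; split; near: t; have /andP[? ?] := t0AB; [exact: lt_nbhsr|exact: lt_nbhsl].
  near: t; have /cvgrPdist_lt /(_ _ ht0) := ch t0.
  by apply: filterS => t; rewrite ltr_norml => /andP[_]; rewrite gtrBl.
move=> [r /= r0 hr].
have : mu.-negligible `]t0 - r, t0 + r[%classic.
  apply: negligibleS Hae => x /=; rewrite in_itv/= => xr.
  have [|/andP[Ax xB] hx0] := hr x; first by rewrite /ball_/= ltr_norml; lra.
  move=> /(_ _)/wrap[]; first by rewrite in_itv/= (ltW Ax) ltW.
  by move=> hE; rewrite hE ltxx in hx0.
rewrite negligibleP//= lebesgue_measure_itv/= lte_fin.
have -> : t0 - r < t0 + r by lra.
by move=> /eqP; rewrite -EFinD eqe; apply/negP; rewrite gt_eqF//; lra.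
Unshelve. all: by end_near.
Qed.

Definition bump0 L := bump (L / 4) (3 * L / 4) 0.

Definition bump_mass L f := \int[mu]_(t in `[0, L]) f t.

(* A bump corrected to have zero mass, so that its primitive is again a
   compactly supported function of ]0, L[. *)
Definition null_bump L c d n t :=
  bump c d n t - bump_mass L (bump c d n) / bump_mass L (bump0 L) * bump0 L t.

Definition primbump L c d n t := \int[mu]_(s in `[0, t]) null_bump L c d n s.

Section null_bump_facts.
Variables (L c d : R) (n : nat).
Hypotheses (c0 : 0 < c < L) (d0 : 0 < d < L).

Lemma continuous_integ (A B : R) h : continuous h -> integ mu `[A, B]%classic h.
Proof.
move=> ch; apply: continuous_compact_integrable; first exact: segment_compact.
exact: continuous_subspaceT.
Qed.

Lemma null_bump_smooth : smooth1 (null_bump L c d n).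
Proof.
rewrite /null_bump; under eq_fun do rewrite -mulNr; apply: smooth1D.
  exact: bump_smooth.
by apply: smooth1M; [exact: smooth1_cst|exact: bump_smooth].
Qed.

Lemma L_gt0 : 0 < L. Proof. by case/andP: c0 => /lt_trans; apply. Qed.

Lemma bump0_mass_gt0 : 0 < bump_mass L (bump0 L).
Proof.
have L0 := L_gt0.
apply: (@Rint_continuous_gt0 0 L _ (L / 2)); last 2 first.
- by apply/andP; split; lra.
- by apply: bump_gt0; apply/andP; split; lra.
- exact/smooth1_cont/bump_smooth.
- by move=> t; exact: bump_ge0.
Qed.

Lemma null_bump_out t : t <= Num.min c (L / 4) \/ Num.max d (3 * L / 4) <= t ->
  null_bump L c d n t = 0.
Proof.
move=> H; rewrite /null_bump /bump0 !bump_out ?mulr0 ?subr0//.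
  by rewrite negb_and -!leNgt; case: H; rewrite ?le_min ?ge_max => /andP[h1 h2];
    rewrite ?h1 ?h2 ?orbT.
by rewrite negb_and -!leNgt; case: H; rewrite ?le_min ?ge_max => /andP[h1 h2];
    rewrite ?h1 ?h2 ?orbT.
Qed.

Lemma null_bump_int : \int[mu]_(s in `[0, L]) null_bump L c d n s = 0.
Proof.
have i1 := @continuous_integ 0 L _ (smooth1_cont (@bump_smooth _ c d n)).
have i2 := @continuous_integ 0 L _ (smooth1_cont (@bump_smooth _ (L / 4) (3 * L / 4) 0)).
rewrite /null_bump RintegralB//; last exact: integZ.
rewrite RintegralZl// -/(bump_mass _ _) -/(bump0 L) -/(bump_mass _ _).
by rewrite divfK ?subrr// gt_eqF// bump0_mass_gt0.
Qed.

Lemma primbump_is_derive t : is_derive t (1 : R) (primbump L c d n) (null_bump L c d n t).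
Proof.
have L0 := L_gt0; have /andP[cc0 _] := c0.
apply: (@is_derive_int0 _ (Num.min c (L / 4))).
- by rewrite lt_min cc0/=; lra.
- exact/smooth1_cont/null_bump_smooth.
- by move=> s hs; apply: null_bump_out; left.
Qed.

Lemma primbump_smooth : smooth1 (primbump L c d n).
Proof. exact: smooth1_primitive primbump_is_derive null_bump_smooth. Qed.

Lemma primbump_out t :  t <= Num.min c (L / 4) \/ Num.max d (3 * L / 4) <= t ->
  primbump L c d n t = 0.
Proof.
have L0 := L_gt0; have /andP[d0' dL] := d0.
move=> [tc|td].
  rewrite /primbump Rint0// => x /=; rewrite in_itv/= => /andP[_ xs]; apply: null_bump_out; left.
  exact: le_trans tc.
have E (y : R) : Num.max d (3 * L / 4) <= y -> primbump L c d n y =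
    \int[mu]_(s in `[0, Num.max d (3 * L / 4)]) null_bump L c d n s.
  move=> hy; set M := Num.max _ _ in hy *.
  have M0 : 0 <= M by rewrite le_max (ltW d0').
  rewrite -(@Rint_truncl _ y M) ?M0//; apply: eq_Rintegral => s _.
  rewrite indicE; have [sM|Ms] := leP s M.
    by rewrite mem_set ?mulr1//= in_itv.
  by rewrite null_bump_out ?mul0r//; right; exact: ltW.
rewrite E// -(E L); first exact: null_bump_int.
by rewrite ge_max (ltW dL)/=; lra.
Qed.

End null_bump_facts.

(** Du Bois-Reymond's lemma: after an integration by parts, [u] minus the primitive of [g] is
    orthogonal to all bumps of zero mass. Subtracting its weighted mean [k] against [bump0] makes it
    orthogonal to all bumps. *)
Lemma weak_prim L (u g : R -> R) : 0 < L -> integ mu `[0, L]%classic u ->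
  integ mu `[0, L]%classic g ->
  (forall (c d : rat) n, 0 < (ratr c : R) < L -> 0 < (ratr d : R) < L ->
    \int[mu]_(t in `[0, L]) (u t * null_bump L (ratr c) (ratr d) n t
      + g t * primbump L (ratr c) (ratr d) n t) = 0) ->
  exists a b, prim L a b u g.
Proof.
move=> L0 hu hg H.
pose G y := \int[mu]_(t in `[0, y]) g t.
have PG : prim L 0 (G L) G g.
  by split; [|apply: aeW => y _; rewrite add0r|rewrite add0r].
have mG : measurable_fun `[0, L]%classic G.
  apply: subspace_continuous_measurable_fun => //.
  exact: (parameterized_integral_continuous (ltW L0) hg).
pose w t := u t - G t.
have hG : integ mu `[0, L]%classic G by exact: prim_integ PG.
have hw : integ mu `[0, L]%classic w by exact: integB.
have cintM f h : integ mu `[0, L]%classic f -> smooth1 h ->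
    (exists K, forall t, `|h t| <= K) ->
    integ mu `[0, L]%classic (fun t => f t * h t).
  move=> hf sh [K hK]; apply: (@eq_integ _ _ _ mu _ (fun t => h t * f t)) => //.
    by move=> t _; rewrite mulrC.
  apply: (@integ_bndM _ _ _ mu _ _ _ K) => //.
  by apply: measurable_funTS; apply: continuous_measurable_fun; exact: smooth1_cont.
have bumpK c d n : exists K, forall t, `|bump c d n t| <= K :> R.
  by exists 1 => t; rewrite ger0_norm ?bump_ge0 ?bump_le1.
have nullK c d n : exists K, forall t, `|null_bump L c d n t| <= K :> R.
  exists (1 + `|bump_mass L (bump c d n) / bump_mass L (bump0 L)|) => t.
  apply: le_trans (ler_normB _ _) _; apply: lerD.
    by rewrite ger0_norm ?bump_ge0 ?bump_le1.
  by rewrite normrM ler_piMr// ger0_norm ?bump_ge0 ?bump_le1.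
pose k := \int[mu]_(t in `[0, L]) (w t * bump0 L t) / bump_mass L (bump0 L).
have m0 : 0 < bump_mass L (bump0 L).
  by apply: (@bump0_mass_gt0 _ (L / 2)); apply/andP; split; lra.
have wE (c d : rat) n : 0 < (ratr c : R) < L -> 0 < (ratr d : R) < L ->
    \int[mu]_(t in `[0, L]) ((w t - k) * bump (ratr c) (ratr d) n t) = 0.
  move=> hc hd; set b := bump _ _ n; set nb := null_bump L (ratr c) (ratr d) n.
  set pb := primbump L (ratr c) (ratr d) n.
  have Ppb : prim L 0 0 pb nb.
    have dpb t : is_derive t (1 : R) pb (nb t) by exact: primbump_is_derive.
    have := prim_C1 (ltW L0) dpb (smooth1_cont (null_bump_smooth _ _ _ _)).
    have -> : pb 0 = 0.
      apply: primbump_out => //; left.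
      by rewrite le_min; have /andP[/ltW -> _] := hc; lra.
    have -> // : pb L = 0.
    apply: primbump_out => //; right.
    by rewrite ge_max; have /andP[_ /ltW ->] := hd; lra.
  have mpb : measurable_fun (`[0, L]%classic : set R) pb.
    apply: measurable_funTS; apply: continuous_measurable_fun.
    by apply: smooth1_cont; exact: primbump_smooth.
  have := prim_int (prim_mul (ltW L0) mG mpb PG Ppb).
  rewrite !mulr0 subrr => E1.
  have [iprim _ _] := prim_mul (ltW L0) mG mpb PG Ppb.
  have iunb := cintM _ _ hu (null_bump_smooth L (ratr c) (ratr d) n) (nullK _ _ _).
  have iGnb := cintM _ _ hG (null_bump_smooth L (ratr c) (ratr d) n) (nullK _ _ _).
  have igpb : integ mu `[0, L]%classic (fun t => g t * pb t).
    apply: (@eq_integ _ _ _ mu _ (fun t => (g t * pb t + G t * nb t) - G t * nb t)) => //.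
      by move=> t _; ring.
    exact: integB.
  have := H c d n hc hd; rewrite -/nb -/pb RintegralD//.
  move: E1; rewrite RintegralD// => E1 E2.
  have E3 : \int[mu]_(t in `[0, L]) (w t * nb t) = 0.
    have -> : \int[mu]_(t in `[0, L]) (w t * nb t) =
        \int[mu]_(t in `[0, L]) (u t * nb t - G t * nb t).
      by apply: eq_Rintegral => t _; rewrite /w; ring.
    by rewrite RintegralB//; lra.
  have iwb := cintM _ _ hw (@bump_smooth _ (ratr c) (ratr d) n) (bumpK _ _ _).
  have iwb0 := cintM _ _ hw (@bump_smooth _ (L / 4) (3 * L / 4) 0) (bumpK _ _ _).
  have ib := @continuous_integ 0 L _ (smooth1_cont (@bump_smooth _ (ratr c) (ratr d) n)).
  have E4 : \int[mu]_(t in `[0, L]) (w t * nb t) =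
      \int[mu]_(t in `[0, L]) (w t * b t) - bump_mass L b * k.
    have -> : \int[mu]_(t in `[0, L]) (w t * nb t) =
        \int[mu]_(t in `[0, L]) (w t * b t -
          bump_mass L b / bump_mass L (bump0 L) * (w t * bump0 L t)).
      by apply: eq_Rintegral => t _; rewrite /nb /null_bump -/b; ring.
    rewrite RintegralB//; last exact: integZ.
    by rewrite RintegralZl// /k; congr (_ - _); rewrite mulrAC -mulrA.
  have -> : \int[mu]_(t in `[0, L]) ((w t - k) * b t) =
     \int[mu]_(t in `[0, L]) (w t * b t - k * b t).
    by apply: eq_Rintegral => t _; ring.
  rewrite RintegralB//; last exact: integZ.
  by rewrite RintegralZl// -/(bump_mass L b) mulrC -E4.
have hwk : integ mu `[0, L]%classic (fun t => w t - k).
  by apply: integB => //; exact: integ_cst (itv_finite _ _).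
exists k, (k + G L); split => //.
apply: (aeS (fundamental_lemma hwk wE)) => y h /h /eqP.
by rewrite subr_eq0 => /eqP <-; rewrite /w -/(G y) subrK.
Qed.

End Weak_primitive.

(** * Weak derivatives on almost every line *)

Section Weak_derivative_lines.
Context {R : realType}.
Local Notation mu := (@lebesgue_measure R).
Local Notation leb2 := (mu \x mu)%E.
Implicit Types (u g h : R * R -> R) (f psi chi : R -> R) (A B C D : R).

Definition rect A B C D : set (R * R) := `[A, B]%classic `*` `[C, D]%classic.

Lemma measurable_rect A B C D : measurable (rect A B C D).
Proof. exact: measurableX. Qed.

Lemma rectE A B C D z : rect A B C D z <-> A <= z.1 <= B /\ C <= z.2 <= D.
Proof. by rewrite /rect /= !in_itv. Qed.

Lemma measurable_half_plane : measurable (@half_plane R).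
Proof.
have -> : @half_plane R = snd @^-1` `]0, +oo[%classic.
  by apply/seteqP; split=> z; rewrite /half_plane/= in_itv/= andbT.
by rewrite -[X in measurable X]setTI; apply: measurable_snd.
Qed.

Lemma Rint_eq_supp (D1 D2 : set (R * R)) h :
  (forall z, D1 z -> ~ D2 z -> h z = 0) -> (forall z, D2 z -> ~ D1 z -> h z = 0) ->
  \int[leb2]_(z in D1) h z = \int[leb2]_(z in D2) h z.
Proof.
move=> h1 h2; rewrite Rintegral_mkcond [RHS]Rintegral_mkcond; congr (Rintegral _ _ _).
apply/funext => z; rewrite !patchE.
have [/set_mem z1|/negP z1] := boolP (z \in D1);
  have [/set_mem z2|/negP z2] := boolP (z \in D2) => //.
  by apply: h1 => // z2'; apply: z2; rewrite inE.
by apply/esym/h2 => // z1'; apply: z1; rewrite inE.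
Qed.

Definition tens psi chi (z : R * R) : R := psi z.1 * chi z.2.

Lemma tens_derive_x psi chi z : smooth1 psi -> smooth1 chi ->
  is_derive z (dirx R) (tens psi chi) (tens (derive1 psi) chi z).
Proof.
move=> sp sc.
have h1 : is_derive z (dirx R) (fun z => psi z.1) (derive1 psi z.1 * 1).
  apply: is_derive_comp; first exact: smooth1_is_derive.
  by apply/is_derive_line => /=; exact: is_derive_affine.
have h2 : is_derive z (dirx R) (fun z => chi z.2) (derive1 chi z.2 * 0).
  apply: is_derive_comp; first exact: smooth1_is_derive.
  by apply/is_derive_line => /=; exact: is_derive_affine.
apply: (is_derive_eq (is_deriveM h1 h2)).
by rewrite /tens /GRing.scale/=; ring.
Qed.

Lemma tens_derive_y psi chi z : smooth1 psi -> smooth1 chi ->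
  is_derive z (diry R) (tens psi chi) (tens psi (derive1 chi) z).
Proof.
move=> sp sc.
have h1 : is_derive z (diry R) (fun z => psi z.1) (derive1 psi z.1 * 0).
  apply: is_derive_comp; first exact: smooth1_is_derive.
  by apply/is_derive_line => /=; exact: is_derive_affine.
have h2 : is_derive z (diry R) (fun z => chi z.2) (derive1 chi z.2 * 1).
  apply: is_derive_comp; first exact: smooth1_is_derive.
  by apply/is_derive_line => /=; exact: is_derive_affine.
apply: (is_derive_eq (is_deriveM h1 h2)).
by rewrite /tens /GRing.scale/=; ring.
Qed.

Lemma tens_smooth psi chi : smooth1 psi -> smooth1 chi -> smooth (tens psi chi).
Proof.
move=> sp sc; apply: smoothM; apply: smooth_comp => //.
  exact: smooth_fst.
exact: smooth_snd.
Qed.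

Definition supp_in f a b := forall t, ~~ (a < t < b) -> f t = 0.

Lemma tens_test psi chi A B C D : smooth1 psi -> smooth1 chi ->
  supp_in psi A B -> supp_in chi C D -> 0 < C -> test_function (tens psi chi).
Proof.
move=> sp sc hp hc C0; split; first exact: tens_smooth.
exists (rect A B C D); split.
- by apply: compact_setX; exact: segment_compact.
- by move=> z /rectE[_ /andP[Cz _]]; exact: lt_le_trans Cz.
- move=> z /rectE; rewrite /tens => /not_andP[|] /negP hz.
    by rewrite hp ?mul0r//; apply: contra hz => /andP[/ltW -> /ltW ->].
  by rewrite hc ?mulr0//; apply: contra hz => /andP[/ltW -> /ltW ->].
Qed.

(** At an end point of the support the one-sided difference quotients taken from outside are 0. *)
Lemma derive1_supp f a b : smooth1 f -> supp_in f a b -> supp_in (derive1 f) a b.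
Proof.
move=> sf hf t; rewrite negb_and -!leNgt => ht.
have ft : f t = 0 by apply: hf; rewrite negb_and -!leNgt.
have cv : (h^-1 *: (f (h + t) - f t)) @[h --> 0^'] --> derive1 f t.
  have [df <-] := smooth1_is_derive t sf.
  have -> : (fun k : R => k^-1 *: (f (k + t) - f t)) =
     (fun k : R => k^-1 *: ((f \o shift t) (k *: 1) - f t)).
    by apply/funext => k; rewrite [k%:A]mulr1.
  exact: df.
case/orP: ht => ht.
- have := cvg_dnbhs_at_left cv => cvl.
  apply: (@cvg_unique _ (@Rhausdorff R) _ _ _ _ cvl).
  apply: cvg_near_cst; near=> h.
  rewrite ft subr0 hf ?scaler0// negb_and -!leNgt; apply/orP; left.
  rewrite (le_trans _ ht)// gerDr ltW//; near: h; exact: nbhs_left_lt.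
- have := cvg_dnbhs_at_right cv => cvl.
  apply: (@cvg_unique _ (@Rhausdorff R) _ _ _ _ cvl).
  apply: cvg_near_cst; near=> h.
  rewrite ft subr0 hf ?scaler0// negb_and -!leNgt; apply/orP; right.
  rewrite (le_trans ht)// lerDr ltW//; near: h; exact: nbhs_right_gt.
Unshelve. all: by end_near.
Qed.

Lemma weak_derivative_y u g psi chi A B C D : is_weak_derivative (diry R) u g ->
  smooth1 psi -> smooth1 chi -> supp_in psi A B -> supp_in chi C D -> 0 < C ->
  \int[leb2]_(z in @half_plane R) (u z * tens psi (derive1 chi) z) =
  - \int[leb2]_(z in @half_plane R) (g z * tens psi chi z).
Proof.
move=> [_ _ _ H] sp sc hp hc C0; rewrite -H; last exact: tens_test hp hc C0.
by apply: eq_Rintegral => z _; case: (tens_derive_y z sp sc) => _ ->.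
Qed.

Lemma weak_derivative_x u g psi chi A B C D : is_weak_derivative (dirx R) u g ->
  smooth1 psi -> smooth1 chi -> supp_in psi A B -> supp_in chi C D -> 0 < C ->
  \int[leb2]_(z in @half_plane R) (u z * tens (derive1 psi) chi z) =
  - \int[leb2]_(z in @half_plane R) (g z * tens psi chi z).
Proof.
move=> [_ _ _ H] sp sc hp hc C0; rewrite -H; last exact: tens_test hp hc C0.
by apply: eq_Rintegral => z _; case: (tens_derive_x z sp sc) => _ ->.
Qed.

Lemma Rint_tens_rect h psi chi A B C D A' B' C' D' :
  supp_in psi A' B' -> supp_in chi C' D' -> A <= A' -> B' <= B -> C <= C' -> D' <= D ->
  0 < C' ->
  \int[leb2]_(z in @half_plane R) (h z * tens psi chi z) =
  \int[leb2]_(z in rect A B C D) (h z * tens psi chi z).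
Proof.
move=> hp hc AA BB CC DD C0; apply: Rint_eq_supp => z; rewrite /tens.
  move=> _ /rectE/not_andP[|] /negP hz.
    rewrite hp ?mul0r ?mulr0//; apply: contra hz => /andP[/ltW h1 /ltW h2].
    by rewrite (le_trans AA) ?(le_trans h2).
  rewrite hc ?mulr0//; apply: contra hz => /andP[/ltW h1 /ltW h2].
  by rewrite (le_trans CC) ?(le_trans h2).
move=> _ /negP; rewrite -leNgt => hz.
by rewrite hc ?mulr0// negb_and -leNgt (le_trans hz (ltW C0)).
Qed.

Lemma smooth1_bounded f a b : continuous f -> supp_in f a b ->
  exists K, forall t, `|f t| <= K.
Proof.
move=> cf hf.
have ab : Num.min a b <= Num.max a b by rewrite ge_min le_max lexx.
have cn : continuous (fun t => `|f t|).
  by move=> t; apply: continuous_comp; [exact: cf|exact: norm_continuous].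
have [c _ hc] := @EVT_max R (fun t => `|f t|) _ _ ab (continuous_subspaceT cn).
exists `|f c| => t; have [tab|tab] := boolP (a < t < b); last by rewrite hf ?normr0.
by apply: hc; rewrite in_itv/= ge_min le_max; have /andP[/ltW -> /ltW ->] := tab; rewrite orbT.
Qed.

End Weak_derivative_lines.
Section Weak_derivative_lines2.
Context {R : realType}.
Local Notation mu := (@lebesgue_measure R).
Local Notation leb2 := (mu \x mu)%E.
Implicit Types (u g h : R * R -> R) (f psi chi : R -> R) (A B C D : R).

Lemma integ_mulfst A B C D h f : integ leb2 (rect A B C D) h -> continuous f ->
  (exists K, forall t, `|f t| <= K) ->
  integ leb2 (rect A B C D) (fun z => h z * f z.1).
Proof.
move=> hh cf [K hK]; apply: (@eq_integ _ _ _ leb2 _ (fun z => f z.1 * h z)).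
- exact: measurable_rect.
- by move=> z _; rewrite mulrC.
apply: (@integ_bndM _ _ _ leb2 _ _ _ K) => //; first exact: measurable_rect.
apply: measurable_funTS.
apply: (@measurableT_comp _ _ _ _ _ _ f _ fst) => //.
exact: continuous_measurable_fun.
Qed.

Lemma integ_mulsnd A B C D h f : integ leb2 (rect A B C D) h -> continuous f ->
  (exists K, forall t, `|f t| <= K) ->
  integ leb2 (rect A B C D) (fun z => h z * f z.2).
Proof.
move=> hh cf [K hK]; apply: (@eq_integ _ _ _ leb2 _ (fun z => f z.2 * h z)).
- exact: measurable_rect.
- by move=> z _; rewrite mulrC.
apply: (@integ_bndM _ _ _ leb2 _ _ _ K) => //; first exact: measurable_rect.
apply: measurable_funTS.
apply: (@measurableT_comp _ _ _ _ _ _ f _ snd) => //.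
exact: continuous_measurable_fun.
Qed.

Lemma bump_bounded (c d : R) n : exists K, forall t, `|bump c d n t| <= K.
Proof. by exists 1 => t; rewrite ger0_norm ?bump_ge0 ?bump_le1. Qed.

(** By Fubini, the integral over a vertical segment is a function of [x] orthogonal to all bumps
    with rational ends. *)
Lemma slice1 A B C D h : integ leb2 (rect A B C D) h ->
  (forall (c d : rat) n, A < (ratr c : R) < B -> A < (ratr d : R) < B ->
    \int[leb2]_(z in rect A B C D) (h z * bump (ratr c) (ratr d) n z.1) = 0) ->
  {ae mu, forall x, A <= x <= B -> \int[mu]_(y in `[C, D]) h (x, y) = 0}.
Proof.
move=> hh H; apply: fundamental_lemma.
  exact: (integ_int1 (measurable_itv _) (measurable_itv _) hh).
move=> c d n hc hd; rewrite -[RHS](H c d n hc hd) /rect Rint_rect1//; last first.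
  by apply: integ_mulfst => //; [exact/smooth1_cont/bump_smooth|exact: bump_bounded].
apply: eq_ae_Rint => //.
- apply: measurable_funM; last first.
    by apply: measurable_funTS; apply: continuous_measurable_fun; exact/smooth1_cont/bump_smooth.
  exact: integ_mfun (integ_int1 (measurable_itv _) (measurable_itv _) hh).
- have h1 := @integ_mulfst A B C D h _ hh (smooth1_cont (@bump_smooth _ (ratr c) (ratr d) n))
    (bump_bounded _ _ _).
  exact: integ_mfun (integ_int1 (measurable_itv _) (measurable_itv _) h1).
- have := ae_integ1 (measurable_itv _) (measurable_itv _) hh.
  move=> hae; apply: (aeS hae) => x hx xAB /=.
  by rewrite RintegralZr//; exact: hx.
Qed.

Lemma slice2 A B C D h : integ leb2 (rect A B C D) h ->
  (forall (c d : rat) n, C < (ratr c : R) < D -> C < (ratr d : R) < D ->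
    \int[leb2]_(z in rect A B C D) (h z * bump (ratr c) (ratr d) n z.2) = 0) ->
  {ae mu, forall y, C <= y <= D -> \int[mu]_(x in `[A, B]) h (x, y) = 0}.
Proof.
move=> hh H; apply: fundamental_lemma.
  exact: (integ_int2 (measurable_itv _) (measurable_itv _) hh).
move=> c d n hc hd; rewrite -[RHS](H c d n hc hd) /rect Rint_rect2//; last first.
  by apply: integ_mulsnd => //; [exact/smooth1_cont/bump_smooth|exact: bump_bounded].
apply: eq_ae_Rint => //.
- apply: measurable_funM; last first.
    by apply: measurable_funTS; apply: continuous_measurable_fun; exact/smooth1_cont/bump_smooth.
  exact: integ_mfun (integ_int2 (measurable_itv _) (measurable_itv _) hh).
- have h1 := @integ_mulsnd A B C D h _ hh (smooth1_cont (@bump_smooth _ (ratr c) (ratr d) n))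
    (bump_bounded _ _ _).
  exact: integ_mfun (integ_int2 (measurable_itv _) (measurable_itv _) h1).
- have := ae_integ2 (measurable_itv _) (measurable_itv _) hh.
  move=> hae; apply: (aeS hae) => x hx xAB /=.
  by rewrite RintegralZr//; exact: hx.
Qed.

Lemma bump_supp (c d : R) n : supp_in (bump c d n) c d.
Proof. by move=> t; exact: bump_out. Qed.

Lemma ae_all_rat (P : rat -> rat -> nat -> R -> Prop) :
  (forall c d n, {ae mu, forall x, P c d n x}) ->
  {ae mu, forall x, forall c d n, P c d n x}.
Proof.
move=> H.
have : {ae mu, forall x, forall k : nat,
    if unpickle k is Some (c, d, n) then P c d n x else True}.
  apply: ae_foralln => k; case: (unpickle k) => [[[c d] n]|]; first exact: H.
  exact: aeW.
move=> h; apply: (aeS h) => x hx c d n.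
by have := hx (pickle (c, d, n)); rewrite pickleK.
Qed.

Lemma primbump_props L (c d : rat) n : 0 < (ratr c : R) < L -> 0 < (ratr d : R) < L ->
  exists a b, [/\ 0 < a, b < L,
    supp_in (null_bump L (ratr c) (ratr d) n) a b,
    supp_in (primbump L (ratr c) (ratr d) n) a b &
    smooth1 (primbump L (ratr c) (ratr d) n) /\
    derive1 (primbump L (ratr c) (ratr d) n) = null_bump L (ratr c) (ratr d) n].
Proof.
move=> hc hd; have L0 : 0 < L by case/andP: hc => /lt_trans; apply.
exists (Num.min (ratr c) (L / 4)), (Num.max (ratr d) (3 * L / 4)); split.
- by rewrite lt_min; case/andP: hc => -> _ /=; lra.
- by rewrite gt_max; case/andP: hd => _ -> /=; lra.
- move=> t; rewrite negb_and -!leNgt => /orP h.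
  by apply: null_bump_out.
- move=> t; rewrite negb_and -!leNgt => /orP h.
  by apply: primbump_out.
- split; first exact: primbump_smooth.
  apply/funext => t; rewrite derive1E.
  have dpb : is_derive t (1:R) (primbump L (ratr c) (ratr d) n)
      (null_bump L (ratr c) (ratr d) n t) by exact: primbump_is_derive.
  by case: dpb.
Qed.

(** Products of a bump in [x] and a [primbump] in [y] turn the weak derivative into countably many
    identities on almost every vertical line, to which [weak_prim] applies line by line. The
    rectangle may reach [y = 0], because each [primbump] is supported at a positive distance from
    it. *)
Lemma weak_lines_y A B L u g : A < B -> 0 < L ->
  is_weak_derivative (diry R) u g ->
  integ leb2 (rect A B 0 L) u -> integ leb2 (rect A B 0 L) g ->
  {ae mu, forall x, A <= x <= B ->
    exists a b, prim L a b (fun y => u (x, y)) (fun y => g (x, y))}.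
Proof.
move=> AB L0 wd hu hg.
pose h c d n z := u z * null_bump L (ratr c) (ratr d) n z.2
  + g z * primbump L (ratr c) (ratr d) n z.2.
have hh (c d : rat) n : 0 < (ratr c : R) < L -> 0 < (ratr d : R) < L ->
    integ leb2 (rect A B 0 L) (fun z => u z * null_bump L (ratr c) (ratr d) n z.2) /\
    integ leb2 (rect A B 0 L) (fun z => g z * primbump L (ratr c) (ratr d) n z.2).
  move=> hc hd; have [a [b [a0 bL hn hp [sp dp]]]] := primbump_props n hc hd.
  split; apply: integ_mulsnd => //.
  - exact/smooth1_cont/null_bump_smooth.
  - apply: smooth1_bounded hn; exact/smooth1_cont/null_bump_smooth.
  - exact: smooth1_cont.
  - by apply: smooth1_bounded hp; exact: smooth1_cont.
have H c d n : {ae mu, forall x, 0 < (ratr c : R) < L -> 0 < (ratr d : R) < L ->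
    A <= x <= B -> \int[mu]_(y in `[0, L]) h c d n (x, y) = 0}.
  have [hc|hc] := boolP (0 < (ratr c : R) < L); last by apply: aeW => x h1; case/negP: hc.
  have [hd|hd] := boolP (0 < (ratr d : R) < L); last by apply: aeW => x _ h1; case/negP: hd.
  have [h1 h2] := hh c d n hc hd.
  have ih : integ leb2 (rect A B 0 L) (h c d n).
    by apply: integD => //; exact: measurable_rect.
  suff S : {ae mu, forall x, A <= x <= B -> \int[mu]_(y in `[0, L]) h c d n (x, y) = 0}.
    by apply: (aeS S).
  apply: slice1 => // c' d' n' hc' hd'.
  have [a [b [a0 bL hn hp [sp dp]]]] := primbump_props n hc hd.
  have := weak_derivative_y wd (@bump_smooth _ (ratr c') (ratr d') n') sp (@bump_supp _ _ _) hp a0.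
  have /andP[/ltW Ac' _] := hc'; have /andP[_ /ltW dB'] := hd'.
  rewrite (@Rint_tens_rect _ _ _ _ A B 0 L _ _ _ _ (@bump_supp _ _ _) (derive1_supp sp hp))//; try exact: ltW.
  rewrite (@Rint_tens_rect _ _ _ _ A B 0 L _ _ _ _ (@bump_supp _ _ _) hp)//; try exact: ltW.
  rewrite dp => E.
  set b' := bump _ _ n'.
  have i1 : integ leb2 (rect A B 0 L) (fun z => u z * null_bump L (ratr c) (ratr d) n z.2 * b' z.1).
    by apply: integ_mulfst => //; [exact/smooth1_cont/bump_smooth|exact: bump_bounded].
  have i2 : integ leb2 (rect A B 0 L) (fun z => g z * primbump L (ratr c) (ratr d) n z.2 * b' z.1).
    by apply: integ_mulfst => //; [exact/smooth1_cont/bump_smooth|exact: bump_bounded].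
  transitivity (\int[leb2]_(z in rect A B 0 L)
     (u z * null_bump L (ratr c) (ratr d) n z.2 * b' z.1 +
      g z * primbump L (ratr c) (ratr d) n z.2 * b' z.1)).
    by apply: eq_Rintegral => z _; rewrite /h mulrDl.
  rewrite RintegralD//; last exact: measurable_rect.
  apply/eqP; rewrite addr_eq0; apply/eqP.
  transitivity (\int[leb2]_(z in rect A B 0 L) (u z * tens b' (null_bump L (ratr c) (ratr d) n) z)).
    by apply: eq_Rintegral => z _; rewrite /tens; ring.
  by rewrite E; congr (- _); apply: eq_Rintegral => z _; rewrite /tens /b'; ring.
have mI : measurable `[A, B]%classic by []. have mJ : measurable `[0, L]%classic by [].
have Su := ae_integ1 mI mJ hu; have Sg := ae_integ1 mI mJ hg.
apply: (aeS3 Su Sg (ae_all_rat H)) => x ux gx Hx xAB.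
by apply: weak_prim => //; [exact: ux|exact: gx|move=> c d n hc hd; exact: Hx].
Qed.

Lemma weak_lines_x B L u g : 0 < B -> 0 < L ->
  is_weak_derivative (dirx R) u g ->
  integ leb2 (rect 0 B 0 L) u -> integ leb2 (rect 0 B 0 L) g ->
  {ae mu, forall y, 0 <= y <= L ->
    exists a b, prim B a b (fun x => u (x, y)) (fun x => g (x, y))}.
Proof.
move=> AB L0 wd hu hg.
pose h c d n z := u z * null_bump B (ratr c) (ratr d) n z.1
  + g z * primbump B (ratr c) (ratr d) n z.1.
have hh (c d : rat) n : 0 < (ratr c : R) < B -> 0 < (ratr d : R) < B ->
    integ leb2 (rect 0 B 0 L) (fun z => u z * null_bump B (ratr c) (ratr d) n z.1) /\
    integ leb2 (rect 0 B 0 L) (fun z => g z * primbump B (ratr c) (ratr d) n z.1).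
  move=> hc hd; have [a [b [a0 bL hn hp [sp dp]]]] := primbump_props n hc hd.
  split; apply: integ_mulfst => //.
  - exact/smooth1_cont/null_bump_smooth.
  - apply: smooth1_bounded hn; exact/smooth1_cont/null_bump_smooth.
  - exact: smooth1_cont.
  - by apply: smooth1_bounded hp; exact: smooth1_cont.
have H c d n : {ae mu, forall y, 0 < (ratr c : R) < B -> 0 < (ratr d : R) < B ->
    0 <= y <= L -> \int[mu]_(x in `[0, B]) h c d n (x, y) = 0}.
  have [hc|hc] := boolP (0 < (ratr c : R) < B); last by apply: aeW => x h1; case/negP: hc.
  have [hd|hd] := boolP (0 < (ratr d : R) < B); last by apply: aeW => x _ h1; case/negP: hd.
  have [h1 h2] := hh c d n hc hd.
  have ih : integ leb2 (rect 0 B 0 L) (h c d n).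
    by apply: integD => //; exact: measurable_rect.
  suff S : {ae mu, forall y, 0 <= y <= L -> \int[mu]_(x in `[0, B]) h c d n (x, y) = 0}.
    by apply: (aeS S).
  apply: slice2 => // c' d' n' hc' hd'.
  have [a [b [a0 bL hn hp [sp dp]]]] := primbump_props n hc hd.
  have /andP[c'0 _] := hc'; have /andP[_ /ltW dB'] := hd'.
  have := weak_derivative_x wd sp (@bump_smooth _ (ratr c') (ratr d') n') hp (@bump_supp _ _ _) c'0.
  rewrite (@Rint_tens_rect _ _ _ _ 0 B 0 L _ _ _ _ (derive1_supp sp hp) (@bump_supp _ _ _))//; try exact: ltW.
  rewrite (@Rint_tens_rect _ _ _ _ 0 B 0 L _ _ _ _ hp (@bump_supp _ _ _))//; try exact: ltW.
  rewrite dp => E.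
  set b' := bump _ _ n'.
  have i1 : integ leb2 (rect 0 B 0 L) (fun z => u z * null_bump B (ratr c) (ratr d) n z.1 * b' z.2).
    by apply: integ_mulsnd => //; [exact/smooth1_cont/bump_smooth|exact: bump_bounded].
  have i2 : integ leb2 (rect 0 B 0 L) (fun z => g z * primbump B (ratr c) (ratr d) n z.1 * b' z.2).
    by apply: integ_mulsnd => //; [exact/smooth1_cont/bump_smooth|exact: bump_bounded].
  transitivity (\int[leb2]_(z in rect 0 B 0 L)
     (u z * null_bump B (ratr c) (ratr d) n z.1 * b' z.2 +
      g z * primbump B (ratr c) (ratr d) n z.1 * b' z.2)).
    by apply: eq_Rintegral => z _; rewrite /h mulrDl.
  rewrite RintegralD//; last exact: measurable_rect.
  apply/eqP; rewrite addr_eq0; apply/eqP.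
  transitivity (\int[leb2]_(z in rect 0 B 0 L) (u z * tens (null_bump B (ratr c) (ratr d) n) b' z)).
    by apply: eq_Rintegral => z _; rewrite /tens; ring.
  by rewrite E; congr (- _); apply: eq_Rintegral => z _; rewrite /tens /b'; ring.
have mI : measurable `[0, B]%classic by []. have mJ : measurable `[0, L]%classic by [].
have Su := ae_integ2 mI mJ hu; have Sg := ae_integ2 mI mJ hg.
apply: (aeS3 Su Sg (ae_all_rat H)) => y ux gx Hx xAB.
by apply: weak_prim => //; [exact: ux|exact: gx|move=> c d n hc hd; exact: Hx].
Qed.

End Weak_derivative_lines2.

(** * Null sets by sections, uniqueness and translation of weak derivatives *)

Section Sections_of_null_sets.
Context {R : realType}.
Local Notation mu := (@lebesgue_measure R).
Local Notation leb2 := (mu \x mu)%E.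

Lemma ae_ysection (P : set (R * R)) : {ae leb2, forall z, P z} ->
  {ae mu, forall y, {ae mu, forall x, P (x, y)}}.
Proof.
move=> [N [mN N0 PN]].
have mI : measurable_fun setT (fun z : R * R => (\1_N z)%:E : \bar R).
  exact/measurable_EFinP.
have I0 z : (0 <= (\1_N z)%:E :> \bar R)%E by rewrite lee_fin.
have : (\int[leb2]_z (\1_N z)%:E)%E = 0%E by rewrite integral_indic// setIT.
rewrite tonelli2// => H.
have mG := @measurable_fun_fubini_tonelli_G _ _ _ _ R mu _ mI I0.
have [+ _] := ae_eq_integral_abs mu measurableT mG.
have -> : (\int[mu]_y `|fubini_G mu (fun z => (\1_N z)%:E) y| = 0)%E.
  rewrite -[RHS]H; apply: eq_integral => y _.
  by rewrite gee0_abs// integral_ge0.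
move=> /(_ erefl) h; apply: (aeS h) => y /(_ I); rewrite /fubini_G /=.
have my : measurable (ysection N y) by exact: measurable_ysection.
rewrite (_ : (\int[mu]_x (\1_N (x, y))%:E = mu (ysection N y))%E); last first.
  rewrite -[X in mu X]setIT -integral_indic//; apply: eq_integral => x _.
  by rewrite /ysection !indicE mem_setE.
move=> Ny0; exists (ysection N y); split => //.
by move=> x /= nP; rewrite /ysection/= inE; exact: PN.
Qed.

Lemma ae_of_xsections (P : set (R * R)) : measurable P ->
  {ae mu, forall x, {ae mu, forall y, P (x, y)}} -> {ae leb2, forall z, P z}.
Proof.
move=> mP H; exists (~` P); split => //; first exact: measurableC.
have mN : measurable (~` P) by exact: measurableC.
have mI : measurable_fun setT (fun z : R * R => (\1_(~` P) z)%:E : \bar R).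
  exact/measurable_EFinP.
have I0 z : (0 <= (\1_(~` P) z)%:E :> \bar R)%E by rewrite lee_fin.
rewrite -[X in leb2 X]setIT -integral_indic// tonelli1//.
rewrite (ae_eq_integral (cst 0%E))//; first by rewrite integral0.
- exact: (@measurable_fun_fubini_tonelli_F _ _ _ _ R mu _ mI I0).
- apply: (aeS H) => x hx _ /=.
  rewrite (ae_eq_integral (cst 0%E))//; first by rewrite integral0.
    exact: (measurableT_comp mI (pair1_measurable x)).
  by apply: (aeS hx) => y hy _ /=; rewrite indicE memNset//; exact.
Qed.

(** Measurability of [P] is what lets null sections imply a null set, whose sections in the other
    direction are then null for almost every line. *)
Lemma ae_swap (P : set (R * R)) : measurable P ->
  {ae mu, forall x, {ae mu, forall y, P (x, y)}} ->
  {ae mu, forall y, {ae mu, forall x, P (x, y)}}.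
Proof. by move=> mP H; apply: ae_ysection; exact: ae_of_xsections. Qed.

(** These rectangles exhaust the open half-plane and are compact in it, so that locally integrable
    functions are integrable on each. *)
Lemma ae_half_plane (P : set (R * R)) :
  (forall n : nat, {ae leb2, forall z, rect (- n.+1%:R) n.+1%:R n.+1%:R^-1 n.+1%:R z -> P z}) ->
  {ae leb2, forall z, half_plane z -> P z}.
Proof.
move=> H; have h := ae_foralln H; apply: (aeS h) => z hz z0.
pose M := `|z.1| + z.2 + z.2^-1.
have M0 : 0 <= M by rewrite !addr_ge0// ?invr_ge0 ltW.
pose n := Num.trunc M.
have Mn : M < n.+1%:R by exact: truncnS_gt.
have zi0 : 0 < z.2^-1 by rewrite invr_gt0.
have zn : `|z.1| <= n.+1%:R by apply: le_trans (ltW Mn); rewrite /M -addrA lerDl addr_ge0// ltW.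
have z2n : z.2 <= n.+1%:R.
  by apply: le_trans (ltW Mn); rewrite /M [_ + z.2]addrC -addrA lerDl addr_ge0// ltW.
apply: (hz n); apply/rectE; split; first by rewrite -ler_norml.
apply/andP; split=> //; rewrite -[z.2]invrK lef_pV2 ?posrE//.
by apply: le_trans (ltW Mn); rewrite /M lerDr addr_ge0// ltW.
Qed.

End Sections_of_null_sets.
Section Weak_derivatives.
Context {R : realType}.
Local Notation mu := (@lebesgue_measure R).
Local Notation leb2 := (mu \x mu)%E.
Implicit Types (u g h : R * R -> R) (f psi chi : R -> R) (A B C D : R) (e : R * R).

Lemma rect_half_plane A B C D : 0 < C -> rect A B C D `<=` @half_plane R.
Proof. by move=> C0 z /rectE[_ /andP[h _]]; exact: lt_le_trans h. Qed.

Lemma rect_compact A B C D : compact (rect A B C D).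
Proof. by apply: compact_setX; exact: segment_compact. Qed.

Lemma loc_integ u A B C D : loc_integrable u -> 0 < C -> integ leb2 (rect A B C D) u.
Proof.
move=> [mu0 hu] C0; have sub := @rect_half_plane A B C D C0.
apply/integrableP; split.
  apply/measurable_EFinP; apply: measurable_funS mu0 => //; exact: measurable_half_plane.
exact: hu (@rect_compact _ _ _ _) sub.
Qed.

(** Products of bumps in one variable already separate functions. In this form the lemma serves both
    the uniqueness of weak derivatives and the equality of mixed ones. *)
Lemma weak_unique_tens g1 g2 : loc_integrable g1 -> loc_integrable g2 ->
  (forall psi chi A B C D, smooth1 psi -> smooth1 chi -> supp_in psi A B ->
    supp_in chi C D -> 0 < C ->
    \int[leb2]_(z in @half_plane R) (g1 z * tens psi chi z) =
    \int[leb2]_(z in @half_plane R) (g2 z * tens psi chi z)) ->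
  {ae leb2, forall z, half_plane z -> g1 z = g2 z}.
Proof.
move=> l1 l2 H; apply: ae_half_plane => N.
set A : R := - _; set B : R := N.+1%:R; set C : R := _^-1.
have C0 : 0 < C by rewrite invr_gt0.
have i1 := @loc_integ g1 A B C B l1 C0; have i2 := @loc_integ g2 A B C B l2 C0.
pose h z := g1 z - g2 z.
have ih : integ leb2 (rect A B C B) h by apply: integB => //; exact: measurable_rect.
have ib g (c d : rat) n : integ leb2 (rect A B C B) g ->
    integ leb2 (rect A B C B) (fun z => g z * bump (ratr c) (ratr d) n z.2).
  by move=> hg; apply: integ_mulsnd => //; [exact/smooth1_cont/bump_smooth|exact: bump_bounded].
have ib1 g (c d : rat) n : integ leb2 (rect A B C B) g ->
    integ leb2 (rect A B C B) (fun z => g z * bump (ratr c) (ratr d) n z.1).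
  by move=> hg; apply: integ_mulfst => //; [exact/smooth1_cont/bump_smooth|exact: bump_bounded].
have S c d n : {ae mu, forall x, C < (ratr c : R) < B -> C < (ratr d : R) < B ->
    A <= x <= B -> \int[mu]_(y in `[C, B]) (h (x, y) * bump (ratr c) (ratr d) n y) = 0}.
  have [hc|hc] := boolP (C < (ratr c : R) < B); last by apply: aeW => x h1; case/negP: hc.
  have [hd|hd] := boolP (C < (ratr d : R) < B); last by apply: aeW => x _ h1; case/negP: hd.
  have S := @slice1 _ A B C B (fun z => h z * bump (ratr c) (ratr d) n z.2) (ib _ _ _ _ ih).
  suff S' : {ae mu, forall x, A <= x <= B ->
      \int[mu]_(y in `[C, B]) (h (x, y) * bump (ratr c) (ratr d) n y) = 0}.
    by apply: (aeS S').
  apply: S => c' d' n' hc' hd'.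
  have := H _ _ _ _ _ _ (@bump_smooth _ (ratr c') (ratr d') n')
    (@bump_smooth _ (ratr c) (ratr d) n) (@bump_supp _ _ _ _) (@bump_supp _ _ _ _).
  have /andP[Cc cB] := hc; have /andP[_ /ltW dB] := hd.
  have /andP[/ltW Ac' _] := hc'; have /andP[_ /ltW dB'] := hd'.
  move=> /(_ (lt_trans C0 Cc)).
  rewrite (@Rint_tens_rect _ g1 _ _ A B C B _ _ _ _ (@bump_supp _ _ _ _) (@bump_supp _ _ _ _))//; try exact: ltW; last exact: lt_trans Cc.
  rewrite (@Rint_tens_rect _ g2 _ _ A B C B _ _ _ _ (@bump_supp _ _ _ _) (@bump_supp _ _ _ _))//; try exact: ltW; last exact: lt_trans Cc.
  move=> E.
  have E' g : \int[leb2]_(z in rect A B C B) (g z * tens (bump (ratr c') (ratr d') n') (bump (ratr c) (ratr d) n) z) =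
    \int[leb2]_(z in rect A B C B) (g z * bump (ratr c) (ratr d) n z.2 * bump (ratr c') (ratr d') n' z.1).
    by apply: eq_Rintegral => z _; rewrite /tens; ring.
  rewrite -[RHS](subrr (\int[leb2]_(z in rect A B C B) (g1 z * tens (bump (ratr c') (ratr d') n') (bump (ratr c) (ratr d) n) z))).
  rewrite [in X in _ = _ - X]E !E' -RintegralB//; last 3 first.
  - exact: measurable_rect.
  - by apply: ib1; exact: ib.
  - by apply: ib1; exact: ib.
  by apply: eq_Rintegral => z _; rewrite /h; ring.
pose P := [set z | (h \_ (rect A B C B)) z = 0].
have mR := @measurable_rect R A B C B.
have mP : measurable P.
  have mh : measurable_fun setT (h \_ (rect A B C B)).
    exact: ((measurable_restrictT h mR).1 (integ_mfun ih)).
  by have := mh measurableT [set 0] (measurable_set1 _); rewrite setTI.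
have mI : measurable `[A, B]%classic by []. have mJ : measurable `[C, B]%classic by [].
have Sh := ae_integ1 mI mJ ih.
suff aP : {ae leb2, forall z, P z}.
  apply: (aeS aP) => z; rewrite /P /= patchE => + hz; rewrite mem_set//.
  by rewrite /h => /eqP; rewrite subr_eq0 => /eqP.
apply: ae_of_xsections => //.
apply: (aeS2 Sh (ae_all_rat S)) => x hx Sx.
have [xAB|xAB] := boolP (A <= x <= B); last first.
  apply: aeW => y; rewrite /P /= patchE memNset// => /rectE[h1 _].
  by rewrite h1 in xAB.
have := @fundamental_lemma R C B (fun y => h (x, y)) (hx _) => hf.
have {}hf : {ae mu, forall t, C <= t <= B -> h (x, t) = 0}.
  by apply: hf => [//|c d n hc hd]; exact: Sx.
apply: (aeS hf) => y hy; rewrite /P /= patchE; case: ifPn => //.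
by rewrite inE => /rectE[_]; exact: hy.
Qed.

Lemma weak_unique e u g1 g2 : is_weak_derivative e u g1 -> is_weak_derivative e u g2 ->
  {ae leb2, forall z, half_plane z -> g1 z = g2 z}.
Proof.
move=> [_ l1 _ H1] [_ l2 _ H2]; apply: weak_unique_tens => //.
move=> psi chi A B C D sp sc hp hc C0.
have ht := tens_test sp sc hp hc C0.
by apply: oppr_inj; rewrite -H1// -H2.
Qed.

Lemma wD_is_weak e u : weakly_derivable e u -> is_weak_derivative e u (wD e u).
Proof. by move=> [g hg]; rewrite /wD; case: xgetP => [g' _|/(_ g)]. Qed.

Lemma wD_ae e u g : is_weak_derivative e u g ->
  {ae leb2, forall z, half_plane z -> wD e u z = g z}.
Proof.
move=> h; apply: (weak_unique _ h); apply: wD_is_weak; by exists g.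
Qed.

Lemma loc_integrable_ae u u' : measurable_fun (@half_plane R) u' ->
  {ae leb2, forall z, half_plane z -> u z = u' z} -> loc_integrable u -> loc_integrable u'.
Proof.
move=> mu' uu' [mu0 hu]; split=> // K cK KH; rewrite (le_lt_trans _ (hu K cK KH))//.
have mK : measurable K.
  rewrite -[K]setCK; apply: measurableC; apply: open_measurable2; apply: closed_openC.
  by apply: compact_closed => //; exact: pair_hausdorff.
have mE (v : R * R -> R) : measurable_fun (@half_plane R) v -> measurable_fun K (fun z => `|v z|%:E).
  move=> mv; apply/measurable_EFinP; apply: measurableT_comp => //.
  by apply: measurable_funS KH mv; exact: measurable_half_plane.
rewrite le_eqVlt; apply/orP; left; apply/eqP; apply: ae_eq_integral => //; try exact: mE.
by apply: (aeS uu') => z h /KH/h ->.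
Qed.

Lemma Rint_half_plane_ae u u' phi : measurable_fun (@half_plane R) u ->
  measurable_fun (@half_plane R) u' -> measurable_fun setT phi ->
  {ae leb2, forall z, half_plane z -> u z = u' z} ->
  \int[leb2]_(z in @half_plane R) (u z * phi z) = \int[leb2]_(z in @half_plane R) (u' z * phi z).
Proof.
move=> m1 m2 mphi uu'; apply: eq_ae_Rint; first exact: measurable_half_plane.
- by apply: measurable_funM => //; exact: measurable_funTS.
- by apply: measurable_funM => //; exact: measurable_funTS.
- by apply: (aeS uu') => z h /h ->.
Qed.

Lemma test_measurable (phi : R * R -> R) : test_function phi -> measurable_fun setT phi.
Proof. by move=> [sp _]; apply: continuous_measurable2; exact: smooth_cont. Qed.

Lemma test_derive_measurable e (phi : R * R -> R) : dir e -> test_function phi ->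
  measurable_fun setT ('D_e phi).
Proof.
move=> he [sp _]; apply: continuous_measurable2; apply: smooth_cont.
exact: smooth_derive.
Qed.

Lemma weak_ae e u u' g g' : dir e -> measurable_fun (@half_plane R) u' ->
  measurable_fun setT g' ->
  {ae leb2, forall z, half_plane z -> u z = u' z} ->
  {ae leb2, forall z, half_plane z -> g z = g' z} ->
  is_weak_derivative e u g -> is_weak_derivative e u' g'.
Proof.
move=> he mu' mg' uu' gg' [lu lg mg H].
have mg'h : measurable_fun (@half_plane R) g' by exact: measurable_funTS.
split=> //; [exact: loc_integrable_ae lu|exact: loc_integrable_ae lg|].
move=> phi tphi.
rewrite -(@Rint_half_plane_ae u u' _ lu.1 mu' (test_derive_measurable he tphi) uu').
rewrite -(@Rint_half_plane_ae g g' _ lg.1 mg'h (test_measurable tphi) gg').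
exact: H.
Qed.

End Weak_derivatives.
Section Classical_weak_derivatives.
Context {R : realType}.
Local Notation mu := (@lebesgue_measure R).
Local Notation leb2 := (mu \x mu)%E.
Implicit Types (u g h phi Phi : R * R -> R) (A B C D : R) (e : R * R).

Lemma slice_derive_y phi x t : smooth phi ->
  is_derive t (1 : R) (fun t => phi (x, t)) ('D_(diry R) phi (x, t)).
Proof.
move=> sphi; have [df _] := smooth_is_derive (x, t) (or_intror erefl) sphi.
suff E : (fun h : R => h^-1 *: (((fun t => phi (x, t)) \o shift t) (h *: (1 : R)) - phi (x, t))) =
    (fun h : R => h^-1 *: ((phi \o shift (x, t)) (h *: diry R) - phi (x, t))).
  by split; [rewrite /derivable E|rewrite /derive E].
apply/funext => h /=; congr (_ *: (phi _ - _)).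
by rewrite /diry; congr pair; rewrite /= /GRing.scale/= ?mulr0 ?add0r.
Qed.

Lemma slice_derive_x phi y t : smooth phi ->
  is_derive t (1 : R) (fun t => phi (t, y)) ('D_(dirx R) phi (t, y)).
Proof.
move=> sphi; have [df _] := smooth_is_derive (t, y) (or_introl erefl) sphi.
suff E : (fun h : R => h^-1 *: (((fun t => phi (t, y)) \o shift t) (h *: (1 : R)) - phi (t, y))) =
    (fun h : R => h^-1 *: ((phi \o shift (t, y)) (h *: dirx R) - phi (t, y))).
  by split; [rewrite /derivable E|rewrite /derive E].
apply/funext => h /=; congr (_ *: (phi _ - _)).
by rewrite /dirx; congr pair; rewrite /= /GRing.scale/= ?mulr0 ?add0r.
Qed.

Lemma continuous_slice_y phi x : continuous phi -> continuous (fun t => phi (x, t)).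
Proof.
move=> cp t; apply: (@continuous_comp _ _ _ (fun t => (x, t)) phi); last exact: cp.
have h1 : (cst x : R -> R) @ t --> x by exact: cvg_cst.
have h2 : (id : R -> R) @ t --> t by exact: cvg_id.
exact: (cvg_pair h1 h2).
Qed.

Lemma continuous_slice_x phi y : continuous phi -> continuous (fun t => phi (t, y)).
Proof.
move=> cp t; apply: (@continuous_comp _ _ _ (fun t => (t, y)) phi); last exact: cp.
have h1 : (cst y : R -> R) @ t --> y by exact: cvg_cst.
have h2 : (id : R -> R) @ t --> t by exact: cvg_id.
exact: (cvg_pair h2 h1).
Qed.

Lemma slice_prim_y phi x L : 0 <= L -> smooth phi ->
  prim L (phi (x, 0)) (phi (x, L)) (fun y => phi (x, y)) (fun y => 'D_(diry R) phi (x, y)).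
Proof.
move=> L0 sphi; apply: (@prim_C1 R L (fun y => phi (x, y))) => //.
  by move=> t; exact: slice_derive_y.
exact: (@continuous_slice_y ('D_(diry R) phi) x (smooth_cont (smooth_derive (or_intror erefl) sphi))).
Qed.

Lemma compact_bounded2 (K : set (R * R)) : compact K ->
  exists2 M : R, 0 < M & forall z, K z -> `|z.1| < M /\ `|z.2| < M.
Proof.
move=> /compact_bounded[M [Mr hM]].
exists (`|M| + 2); first by rewrite ltr_wpDl.
move=> z Kz; have := hM (`|M| + 1) _ z Kz.
rewrite (le_lt_trans (ler_norm M)) ?ltrDl// => /(_ isT).
rewrite /= prod_normE ge_max => /andP[h1 h2].
by split; [apply: le_lt_trans h1 _|apply: le_lt_trans h2 _]; rewrite ltrD2l ltr1n.
Qed.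

Lemma rect_finite A B C D : (leb2 (rect A B C D) < +oo)%E.
Proof.
rewrite /rect product_measure1E//; try exact: measurable_itv.
by rewrite lte_mul_pinfty// ?ge0_fin_numE// itv_finite.
Qed.

Lemma continuous_bounded2 u A B C D : continuous u ->
  exists M, forall z, rect A B C D z -> `|u z| <= M.
Proof.
move=> cu.
have := @continuous_compact _ _ u (rect A B C D) (continuous_subspaceT cu) (@rect_compact _ _ _ _ _).
move=> /compact_bounded[M [Mr hM]]; exists (`|M| + 1) => z hz.
apply: (hM (`|M| + 1)); last by exists z.
by rewrite (le_lt_trans (ler_norm M)) ?ltrDl.
Qed.

Lemma continuous_integ2 u A B C D : continuous u -> integ leb2 (rect A B C D) u.
Proof.
move=> cu; have [M hM] := @continuous_bounded2 u A B C D cu.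
have mR := @measurable_rect R A B C D.
apply: (@integ_le _ _ _ leb2 _ _ (fun=> M)) => //.
  by apply: measurable_funTS; exact: continuous_measurable2.
by apply: integ_cst => //; exact: rect_finite.
Qed.

Lemma continuous_loc_integrable u : continuous u -> loc_integrable u.
Proof.
move=> cu; have mu0 := continuous_measurable2 cu.
split; first exact: measurable_funTS.
move=> K cK KH; have [M M0 hM] := compact_bounded2 cK.
have mK : measurable K.
  rewrite -[K]setCK; apply: measurableC; apply: open_measurable2; apply: closed_openC.
  by apply: compact_closed => //; exact: pair_hausdorff.
have mR := @measurable_rect R (- M) M (- M) M.
have /integrableP[_] := @continuous_integ2 u (- M) M (- M) M cu.
apply: le_lt_trans; apply: ge0_subset_integral => //.
- by apply/measurable_EFinP; apply: measurableT_comp => //; exact: measurable_funTS.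
- by move=> z /hM[/ltW h1 /ltW h2]; apply/rectE; rewrite -!ler_norml.
Qed.

Lemma derive_out phi e (K : set (R * R)) z : compact K ->
  (forall z, ~ K z -> phi z = 0) -> ~ K z -> 'D_e phi z = 0.
Proof.
move=> cK h0 nK; have oK : open (~` K).
  by apply: closed_openC; apply: compact_closed => //; exact: pair_hausdorff.
have nz : \forall w \near nbhs z, (cst 0 : R * R -> R) w = phi w.
  have : nbhs z (~` K) by exact: open_nbhs_nbhs.
  by apply: filterS => w nw /=; rewrite h0.
by rewrite -(@near_eq_derive _ _ _ (cst 0) phi z e nz) derive_cst.
Qed.

(** On each line in the direction [e] the integral is a difference of two values of [phi] outside
    its support. *)
Lemma Rint_derive_test e phi : dir e -> test_function phi ->
  \int[leb2]_(z in @half_plane R) 'D_e phi z = 0.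
Proof.
move=> he [sphi [K [cK KH hK]]].
have [M M0 hM] := compact_bounded2 cK.
set S := rect (- M) M 0 M.
have cD : continuous ('D_e phi) by apply/smooth_cont/smooth_derive.
have d0 z : ~ K z -> 'D_e phi z = 0 by exact: derive_out.
have -> : \int[leb2]_(z in @half_plane R) 'D_e phi z = \int[leb2]_(z in S) 'D_e phi z.
  apply: Rint_eq_supp => z hz hz'; apply: d0 => Kz; apply: hz' => /=.
    have [/ltW h1 /ltW h2] := hM z Kz; apply/rectE; rewrite -ler_norml; split=> //.
    by rewrite (ltW hz) (le_trans (ler_norm _)).
  exact: KH.
have iD := @continuous_integ2 _ (- M) M 0 M cD.
case: he => ee; subst e.
- rewrite /S /rect Rint_rect2//; apply: Rint0 => y /=; rewrite in_itv/= => /andP[y0 yM].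
  have cx : continuous (fun t => 'D_(dirx R) phi (t, y)) by exact: (@continuous_slice_x ('D_(dirx R) phi) y cD).
  have E : `[- M, M]%classic = `[0 + (- M), (M + M) + (- M)]%classic :> set R.
    by rewrite add0r addrK.
  rewrite E -Rint_itv_shift; last first.
    by apply: measurable_funTS; exact: continuous_measurable_fun.
  have MM : 0 <= M + M by rewrite addr_ge0 ?ltW.
  have := @prim_C1 R (M + M) (fun t => phi (t - M, y)) (fun t => 'D_(dirx R) phi (t - M, y)) MM.
  have h1 t : is_derive t (1 : R) (fun t => phi (t - M, y)) ('D_(dirx R) phi (t - M, y)).
    have h2 : is_derive t (1 : R) (fun t : R => t - M) 1.
      have -> : (fun t : R => t - M) = (fun t => t *: 1 - M).
        by apply/funext => z; rewrite /GRing.scale/= mulr1.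
      exact: is_derive_affine.
    have := @is_derive1_comp R (fun t => phi (t, y)) (fun t => t - M) t _ _ (slice_derive_x y (t - M) sphi) h2.
    by rewrite mulr1.
  have h2 : continuous (fun t => 'D_(dirx R) phi (t - M, y)).
    move=> t; apply: (@continuous_comp _ _ _ (fun t => t - M) (fun t => 'D_(dirx R) phi (t, y))).
      by apply: cvgB; [exact: cvg_id|exact: cvg_cst].
    exact: cx.
  move=> /(_ h1 h2) /prim_int ->.
  rewrite !hK ?subrr//= => /hM/= [+ _].
    by rewrite add0r normrN gtr0_norm// ltxx.
  by rewrite addrK gtr0_norm// ltxx.
- rewrite /S /rect Rint_rect1//; apply: Rint0 => x _.
  rewrite (prim_int (slice_prim_y x (ltW M0) sphi)).
  rewrite !hK ?subrr//= => [/KH|/hM/= [_]]; first by rewrite /half_plane/= ltxx.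
  by rewrite gtr0_norm// ltxx.
Qed.

(** The product of [phi] with a test function is a test function; its derivative has integral 0 and
    splits by the product rule. *)
Lemma smooth_weak e phi : dir e -> smooth phi -> is_weak_derivative e phi ('D_e phi).
Proof.
move=> he sphi.
have cphi := smooth_cont sphi; have cD := smooth_cont (smooth_derive he sphi).
split; [exact: continuous_loc_integrable|exact: continuous_loc_integrable|
  exact: continuous_measurable2|].
move=> psi [spsi [K [cK KH hK]]].
have tP : test_function (fun z => phi z * psi z).
  split; first exact: smoothM.
  by exists K; split => // z /hK ->; rewrite mulr0.
have cpsi := smooth_cont spsi; have cDpsi := smooth_cont (smooth_derive he spsi).
have E z : 'D_e (fun z => phi z * psi z) z = phi z * 'D_e psi z + 'D_e phi z * psi z.
  have h1 := smooth_is_derive z he sphi; have h2 := smooth_is_derive z he spsi.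
  have [_ ->] := is_deriveM h1 h2.
  by rewrite /GRing.scale/= [psi z * _]mulrC.
have [M M0 hM] := compact_bounded2 cK.
have D0 z : ~ K z -> 'D_e psi z = 0 by exact: derive_out.
have S (w phi' : R * R -> R) : (forall z, ~ K z -> w z = 0) ->
    \int[leb2]_(z in @half_plane R) (phi' z * w z) = \int[leb2]_(z in rect (- M) M 0 M) (phi' z * w z).
  move=> w0; apply: Rint_eq_supp => z hz hz'; rewrite w0 ?mulr0// => Kz; apply: hz' => /=.
    have [/ltW h1 /ltW h2] := hM z Kz; apply/rectE; rewrite -ler_norml; split=> //.
    by rewrite (ltW hz) (le_trans (ler_norm _)).
  exact: KH.
have := Rint_derive_test he tP.
have -> : \int[leb2]_(z in @half_plane R) 'D_e (fun z => phi z * psi z) z =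
    \int[leb2]_(z in @half_plane R) ((cst 1 : R * R -> R) z * (phi z * 'D_e psi z + 'D_e phi z * psi z)).
  by apply: eq_Rintegral => z _; rewrite E mul1r.
rewrite (S (fun z => phi z * 'D_e psi z + 'D_e phi z * psi z)); last first.
  by move=> z nK; rewrite D0// hK// !mulr0 addr0.
rewrite S// S//; under eq_Rintegral do rewrite mul1r.
have cM (f g : R * R -> R) : continuous f -> continuous g -> continuous (fun z => f z * g z).
  by move=> cf cg z; apply: cvgM; [exact: cf|exact: cg].
rewrite RintegralD//.
- by move/eqP; rewrite addr_eq0 => /eqP.
- exact: measurable_rect.
- by apply: continuous_integ2; exact: cM.
- by apply: continuous_integ2; exact: cM.
Qed.

Lemma weakD e u1 g1 u2 g2 : dir e -> is_weak_derivative e u1 g1 -> is_weak_derivative e u2 g2 ->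
  is_weak_derivative e (fun z => u1 z + u2 z) (fun z => g1 z + g2 z).
Proof.
move=> he [lu1 lg1 mg1 H1] [lu2 lg2 mg2 H2].
have lD (f g : R * R -> R) : loc_integrable f -> loc_integrable g -> loc_integrable (fun z => f z + g z).
  move=> [mf hf] [mg hg]; split; first exact: measurable_funD.
  move=> K cK KH.
  have mK : measurable K.
    rewrite -[K]setCK; apply: measurableC; apply: open_measurable2; apply: closed_openC.
    by apply: compact_closed => //; exact: pair_hausdorff.
  have i (w : R * R -> R) : measurable_fun (@half_plane R) w -> (\int[leb2]_(z in K) `|w z|%:E < +oo)%E ->
      integ leb2 K w.
    move=> mw hw; apply/integrableP; split => //.
    apply/measurable_EFinP; apply: measurable_funS KH mw; exact: measurable_half_plane.
  have hh : integ leb2 K (fun z => f z + g z).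
    by apply: integD => //; [apply: i mf _|apply: i mg _]; [exact: hf|exact: hg].
  by case/integrableP: hh.
split; [exact: lD|exact: lD|exact: measurable_funD|].
move=> psi tpsi; have [spsi [K [cK KH hK]]] := tpsi.
have D0 z : ~ K z -> 'D_e psi z = 0 by exact: derive_out.
have mK : measurable K.
  rewrite -[K]setCK; apply: measurableC; apply: open_measurable2; apply: closed_openC.
  by apply: compact_closed => //; exact: pair_hausdorff.
have [M M0 hM] := compact_bounded2 cK.
have S (w phi' : R * R -> R) : (forall z, ~ K z -> w z = 0) ->
    \int[leb2]_(z in @half_plane R) (phi' z * w z) = \int[leb2]_(z in K) (phi' z * w z).
  by move=> w0; apply: Rint_eq_supp => z hz hz'; [rewrite w0 ?mulr0|have := hz' (KH z hz)].
have I (w phi' : R * R -> R) : continuous w -> loc_integrable phi' -> integ leb2 K (fun z => phi' z * w z).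
  move=> cw [mf hf].
  have iK : integ leb2 K phi'.
    apply/integrableP; split; last exact: hf.
    apply/measurable_EFinP; apply: measurable_funS KH mf; exact: measurable_half_plane.
  have [C hC] := @continuous_bounded2 w (- M) M (- M) M cw.
  apply: (@eq_integ _ _ _ leb2 _ (fun z => w z * phi' z)) => //.
    by move=> z _; rewrite mulrC.
  apply: (@integ_bndM _ _ _ leb2 _ _ _ C) => //.
    by apply: measurable_funTS; exact: continuous_measurable2.
  move=> z /hM[/ltW h1 /ltW h2]; apply: hC; apply/rectE; by rewrite -!ler_norml.
have cpsi := smooth_cont spsi; have cD := smooth_cont (smooth_derive he spsi).
transitivity (\int[leb2]_(z in K) (u1 z * 'D_e psi z + u2 z * 'D_e psi z)).
  by rewrite S//; apply: eq_Rintegral => z _; rewrite mulrDl.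
transitivity (- \int[leb2]_(z in K) (g1 z * psi z + g2 z * psi z)); last first.
  by congr (- _); rewrite [RHS]S//; apply: eq_Rintegral => z _; rewrite mulrDl.
by rewrite !RintegralD//; try exact: I; rewrite -!S// H1// H2// opprD.
Qed.

End Classical_weak_derivatives.
Section Translation_of_weak_derivatives.
Context {R : realType}.
Local Notation mu := (@lebesgue_measure R).
Local Notation leb2 := (mu \x mu)%E.
Implicit Types (u g h phi : R * R -> R) (c : R) (e : R * R).

Lemma int_xshift c (f : R * R -> \bar R) : measurable_fun setT f ->
  (\int[leb2]_z f (xshift c z) = \int[leb2]_z f z)%E.
Proof.
move=> mf; rewrite [RHS]integralE [LHS]integralE; congr (_ - _)%E.
  transitivity (\int[leb2]_z (f^\+)%E (xshift c z))%E.
    by apply: eq_integral => z _; rewrite funepos_comp.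
  by apply: (@ge0_int_xshift _ c (f^\+)%E) => //; exact: measurable_funepos.
transitivity (\int[leb2]_z (f^\-)%E (xshift c z))%E.
  by apply: eq_integral => z _; rewrite funeneg_comp.
by apply: (@ge0_int_xshift _ c (f^\-)%E) => //; exact: measurable_funeneg.
Qed.

Lemma Rint_xshift c h : measurable_fun (@half_plane R) h ->
  \int[leb2]_(z in @half_plane R) h (xshift c z) = \int[leb2]_(z in @half_plane R) h z.
Proof.
move=> mh; rewrite Rintegral_mkcond [RHS]Rintegral_mkcond /Rintegral; congr fine.
rewrite -[RHS](@int_xshift c (EFin \o (h \_ (@half_plane R)))).
  by apply: eq_integral => z _ /=; rewrite !patchE.
apply/measurable_EFinP.
exact: ((measurable_restrictT h (@measurable_half_plane R)).1 mh).
Qed.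

Lemma is_derive_xshift c phi z e : dir e -> smooth phi ->
  is_derive z e (fun z => phi (xshift c z)) ('D_e phi (xshift c z)).
Proof.
move=> he sphi; have /is_derive_line h := smooth_is_derive (xshift c z) he sphi.
apply/is_derive_line; move: h; congr (is_derive _ _ _ _).
apply/funext => t; rewrite /xshift; congr phi; congr pair; by rewrite /= addrA.
Qed.

Lemma continuous_xshift c : continuous (@xshift R c).
Proof.
move=> z.
have h1 : (fun z : R * R => z.1 + c) @ z --> z.1 + c by apply: cvgD; [exact: cvg_fst|exact: cvg_cst].
have h2 : (snd : R * R -> R) @ z --> z.2 by exact: cvg_snd.
exact: (cvg_pair h1 h2).
Qed.

Lemma smooth_xshift c phi : smooth phi -> smooth (fun z => phi (xshift c z)).
Proof.
move=> sphi k; elim: k phi sphi => [|k IH] phi sphi.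
  split=> // z; apply: (@continuous_comp _ _ _ (xshift c) phi); first exact: continuous_xshift.
  exact: smooth_cont.
split.
  move=> z; apply: (@continuous_comp _ _ _ (xshift c) phi); first exact: continuous_xshift.
  exact: smooth_cont.
move=> e he; split=> [z|]; first by case: (is_derive_xshift c z he sphi).
have -> : 'D_e (fun z => phi (xshift c z)) = (fun z => 'D_e phi (xshift c z)).
  by apply/funext => z; case: (is_derive_xshift c z he sphi).
exact: (IH ('D_e phi) (smooth_derive he sphi)).
Qed.

Lemma xshiftNK c z : xshift (- c) (xshift c z) = z.
Proof. by case: z => x y; rewrite /xshift /= addrK. Qed.

Lemma test_xshift c phi : test_function phi -> test_function (fun z => phi (xshift c z)).
Proof.
move=> [sphi [K [cK KH hK]]]; split; first exact: smooth_xshift.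
exists (xshift (- c) @` K); split.
- by apply: continuous_compact => //; exact/continuous_subspaceT/continuous_xshift.
- by move=> _ [z /KH hz <-].
- by move=> z nz; apply: hK => Kz; apply: nz; exists (xshift c z); rewrite ?xshiftNK.
Qed.

Lemma measurable_half_xshift c u : measurable_fun (@half_plane R) u ->
  measurable_fun (@half_plane R) (fun z => u (xshift c z)).
Proof.
move=> mu0; apply: (measurable_comp (measurable_half_plane (R := R)) _ mu0) => //.
  by move=> _ [z hz <-].
by apply: measurable_funTS; exact: measurable_xshift.
Qed.

Lemma loc_integrable_xshift c u : loc_integrable u -> loc_integrable (fun z => u (xshift c z)).
Proof.
move=> [mu0 hu]; split; first exact: measurable_half_xshift.
move=> K cK KH.
have cK' : compact (xshift c @` K).
  by apply: continuous_compact => //; exact/continuous_subspaceT/continuous_xshift.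
have KH' : xshift c @` K `<=` @half_plane R by move=> _ [z /KH hz <-].
have mK' : measurable (xshift c @` K).
  rewrite -[_ @` _]setCK; apply: measurableC; apply: open_measurable2; apply: closed_openC.
  by apply: compact_closed => //; exact: pair_hausdorff.
apply: le_lt_trans (hu _ cK' KH').
have mf : measurable_fun setT (((fun z => `|u z|%:E) : R * R -> \bar R) \_ (xshift c @` K)).
  apply: (measurable_restrictT _ mK').1.
  apply/measurable_EFinP; apply: measurableT_comp => //; apply: measurable_funS KH' mu0.
  exact: measurable_half_plane.
rewrite integral_mkcond [leRHS]integral_mkcond -(@int_xshift c _ mf).
rewrite le_eqVlt; apply/orP; left; apply/eqP; apply: eq_integral => z _.
rewrite !patchE; suff -> : (xshift c z \in xshift c @` K) = (z \in K) by [].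
apply/idP/idP; rewrite !inE; last by exists z.
by move=> [w Kw /(congr1 (xshift (- c)))]; rewrite !xshiftNK => <-.
Qed.

Lemma weak_xshift c e u g : dir e -> is_weak_derivative e u g ->
  is_weak_derivative e (fun z => u (xshift c z)) (fun z => g (xshift c z)).
Proof.
move=> he [lu lg mg H]; split; try exact: loc_integrable_xshift.
  by apply: measurableT_comp mg _; exact: measurable_xshift.
move=> phi tphi; have tphi' := test_xshift (- c) tphi.
have mphi := test_measurable tphi'; have mD := test_derive_measurable he tphi'.
have [sphi _] := tphi.
have -> : \int[leb2]_(z in @half_plane R) (u (xshift c z) * 'D_e phi z) =
    \int[leb2]_(z in @half_plane R) (u z * 'D_e (fun z => phi (xshift (- c) z)) z).
  rewrite -[RHS](@Rint_xshift c); last first.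
    by apply: measurable_funM; [case: lu|exact: measurable_funTS].
  apply: eq_Rintegral => z _; congr (_ * _).
  by have [_ ->] := is_derive_xshift (- c) (xshift c z) he sphi; rewrite xshiftNK.
rewrite (H _ tphi'); congr (- _).
rewrite -[LHS](@Rint_xshift c); last first.
  by apply: measurable_funM; [case: lg|exact: measurable_funTS].
by apply: eq_Rintegral => z _; rewrite xshiftNK.
Qed.

(** [g] and its translate are weak derivatives of functions that differ by a constant, so uniqueness
    applies. The constant [k] is [pi] for [theta] and 0 for its derivatives. *)
Lemma weak_periodic c k e u g : dir e -> is_weak_derivative e u g ->
  {ae leb2, forall z, half_plane z -> u (xshift c z) = u z + k} ->
  {ae leb2, forall z, half_plane z -> g (xshift c z) = g z}.
Proof.
move=> he wu hu.
have h1 := weak_xshift c he wu.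
have h2 := weakD he wu (smooth_weak he (smooth_cst k)).
have h3 : is_weak_derivative e (fun z => u z + k) (fun z => g (xshift c z)).
  apply: (weak_ae he _ _ _ _ h1).
  - by case: h2 => -[].
  - by case: h1.
  - exact: hu.
  - exact: aeW.
have h4 := weak_unique h3 h2; apply: (aeS h4) => z h /h ->.
by rewrite derive_cst addr0.
Qed.

End Translation_of_weak_derivatives.

(** * Integrals over intervals and rectangles *)

Section Interval_and_rectangle.
Context {R : realType}.
Local Notation mu := (@lebesgue_measure R).
Local Notation leb2 := (mu \x mu)%E.
Implicit Types (a b c d k : R) (f g : R -> R) (F G : R * R -> R).

Lemma i1D a b f g : integ mu `[a, b]%classic f -> integ mu `[a, b]%classic g ->
  integ mu `[a, b]%classic (fun x => f x + g x).
Proof. by move=> hf hg; apply: integD. Qed.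
Lemma i1B a b f g : integ mu `[a, b]%classic f -> integ mu `[a, b]%classic g ->
  integ mu `[a, b]%classic (fun x => f x - g x).
Proof. by move=> hf hg; apply: integB. Qed.
Lemma i1Z a b k f : integ mu `[a, b]%classic f -> integ mu `[a, b]%classic (fun x => k * f x).
Proof. by move=> hf; apply: integZ. Qed.
Lemma i1c a b k : integ mu `[a, b]%classic (fun=> k).
Proof. by apply: integ_cst => //; exact: itv_finite. Qed.
Lemma s1B a b f g : sq_integ mu `[a, b]%classic f -> sq_integ mu `[a, b]%classic g ->
  sq_integ mu `[a, b]%classic (fun x => f x - g x).
Proof. by move=> hf hg; apply: sq_integB. Qed.
Lemma s1i a b f : sq_integ mu `[a, b]%classic f -> integ mu `[a, b]%classic f.
Proof. by move=> hf; apply: sq_integ_integ => //; exact: itv_finite. Qed.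
Lemma s1S a b c d f : a <= c -> d <= b -> sq_integ mu `[a, b]%classic f ->
  sq_integ mu `[c, d]%classic f.
Proof.
move=> ac db hf; apply: sq_integS hf => //.
by apply: subset_itv; rewrite bnd_simp.
Qed.
Lemma i1S a b c d f : a <= c -> d <= b -> integ mu `[a, b]%classic f ->
  integ mu `[c, d]%classic f.
Proof. by move=> ac db hf; apply: integS hf => //; apply: subset_itv; rewrite bnd_simp. Qed.

Lemma i2D a b c d F G : integ leb2 (rect a b c d) F -> integ leb2 (rect a b c d) G ->
  integ leb2 (rect a b c d) (fun x => F x + G x).
Proof. by move=> hf hg; apply: integD => //; exact: measurable_rect. Qed.
Lemma i2B a b c d F G : integ leb2 (rect a b c d) F -> integ leb2 (rect a b c d) G ->
  integ leb2 (rect a b c d) (fun x => F x - G x).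
Proof. by move=> hf hg; apply: integB => //; exact: measurable_rect. Qed.
Lemma i2Z a b c d k F : integ leb2 (rect a b c d) F -> integ leb2 (rect a b c d) (fun x => k * F x).
Proof. by move=> hf; apply: integZ => //; exact: measurable_rect. Qed.
Lemma i2c a b c d k : integ leb2 (rect a b c d) (fun=> k).
Proof. by apply: integ_cst; [exact: measurable_rect|exact: rect_finite]. Qed.
Lemma s2D a b c d F G : sq_integ leb2 (rect a b c d) F -> sq_integ leb2 (rect a b c d) G ->
  sq_integ leb2 (rect a b c d) (fun x => F x + G x).
Proof. by move=> hf hg; apply: sq_integD => //; exact: measurable_rect. Qed.
Lemma s2B a b c d F G : sq_integ leb2 (rect a b c d) F -> sq_integ leb2 (rect a b c d) G ->
  sq_integ leb2 (rect a b c d) (fun x => F x - G x).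
Proof. by move=> hf hg; apply: sq_integB => //; exact: measurable_rect. Qed.
Lemma s2Z a b c d k F : sq_integ leb2 (rect a b c d) F ->
  sq_integ leb2 (rect a b c d) (fun x => k * F x).
Proof. by move=> hf; apply: sq_integZ => //; exact: measurable_rect. Qed.
Lemma s2c a b c d k : sq_integ leb2 (rect a b c d) (fun=> k).
Proof. by apply: sq_integ_cst; [exact: measurable_rect|exact: rect_finite]. Qed.
Lemma s2i a b c d F : sq_integ leb2 (rect a b c d) F -> integ leb2 (rect a b c d) F.
Proof. by move=> hf; apply: sq_integ_integ => //; [exact: measurable_rect|exact: rect_finite]. Qed.
Lemma s2M a b c d F G : sq_integ leb2 (rect a b c d) F -> sq_integ leb2 (rect a b c d) G ->
  integ leb2 (rect a b c d) (fun x => F x * G x).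
Proof. by move=> hf hg; apply: mul_integ => //; exact: measurable_rect. Qed.
Lemma rectS a b c d a' b' c' d' : a <= a' -> b' <= b -> c <= c' -> d' <= d ->
  rect a' b' c' d' `<=` rect a b c d.
Proof.
move=> aa bb cc dd z /rectE[/andP[h1 h2] /andP[h3 h4]]; apply/rectE.
by rewrite (le_trans aa) ?(le_trans h2) ?(le_trans cc) ?(le_trans h4).
Qed.
Lemma s2S a b c d a' b' c' d' F : a <= a' -> b' <= b -> c <= c' -> d' <= d ->
  sq_integ leb2 (rect a b c d) F -> sq_integ leb2 (rect a' b' c' d') F.
Proof.
move=> aa bb cc dd hf; apply: sq_integS hf; [exact: measurable_rect|exact: measurable_rect|].
exact: rectS.
Qed.
Lemma i2S a b c d a' b' c' d' F : a <= a' -> b' <= b -> c <= c' -> d' <= d ->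
  integ leb2 (rect a b c d) F -> integ leb2 (rect a' b' c' d') F.
Proof.
move=> aa bb cc dd hf; apply: integS hf; [exact: measurable_rect|exact: measurable_rect|].
exact: rectS.
Qed.

Lemma R1D a b f g : integ mu `[a, b]%classic f -> integ mu `[a, b]%classic g ->
  \int[mu]_(x in `[a, b]) (f x + g x) = \int[mu]_(x in `[a, b]) f x + \int[mu]_(x in `[a, b]) g x.
Proof. by move=> hf hg; rewrite RintegralD. Qed.
Lemma R1B a b f g : integ mu `[a, b]%classic f -> integ mu `[a, b]%classic g ->
  \int[mu]_(x in `[a, b]) (f x - g x) = \int[mu]_(x in `[a, b]) f x - \int[mu]_(x in `[a, b]) g x.
Proof. by move=> hf hg; rewrite RintegralB. Qed.
Lemma R1Z a b k f : integ mu `[a, b]%classic f ->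
  \int[mu]_(x in `[a, b]) (k * f x) = k * \int[mu]_(x in `[a, b]) f x.
Proof. by move=> hf; rewrite RintegralZl. Qed.
Lemma R1c a b k : a <= b -> \int[mu]_(x in `[a, b]) k = k * (b - a).
Proof. by move=> ab; rewrite Rintegral_cst// fine_lebesgue_itv. Qed.
Lemma R1le a b f g : integ mu `[a, b]%classic f -> integ mu `[a, b]%classic g ->
  {ae mu, forall x, a <= x <= b -> f x <= g x} ->
  \int[mu]_(x in `[a, b]) f x <= \int[mu]_(x in `[a, b]) g x.
Proof.
by move=> hf hg h; apply: ae_le_Rint.
Qed.
Lemma R2D a b c d F G : integ leb2 (rect a b c d) F -> integ leb2 (rect a b c d) G ->
  \int[leb2]_(z in rect a b c d) (F z + G z) =
  \int[leb2]_(z in rect a b c d) F z + \int[leb2]_(z in rect a b c d) G z.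
Proof. by move=> hf hg; rewrite RintegralD//; exact: measurable_rect. Qed.
Lemma R2B a b c d F G : integ leb2 (rect a b c d) F -> integ leb2 (rect a b c d) G ->
  \int[leb2]_(z in rect a b c d) (F z - G z) =
  \int[leb2]_(z in rect a b c d) F z - \int[leb2]_(z in rect a b c d) G z.
Proof. by move=> hf hg; rewrite RintegralB//; exact: measurable_rect. Qed.
Lemma R2Z a b c d k F : integ leb2 (rect a b c d) F ->
  \int[leb2]_(z in rect a b c d) (k * F z) = k * \int[leb2]_(z in rect a b c d) F z.
Proof. by move=> hf; rewrite RintegralZl//; exact: measurable_rect. Qed.
Lemma R2le a b c d F G : integ leb2 (rect a b c d) F -> integ leb2 (rect a b c d) G ->
  {ae leb2, forall z, rect a b c d z -> F z <= G z} ->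
  \int[leb2]_(z in rect a b c d) F z <= \int[leb2]_(z in rect a b c d) G z.
Proof. by move=> hf hg h; apply: ae_le_Rint => //; exact: measurable_rect. Qed.
Lemma R2x a b c d F : integ leb2 (rect a b c d) F ->
  \int[leb2]_(z in rect a b c d) F z = \int[mu]_(x in `[a, b]) \int[mu]_(y in `[c, d]) F (x, y).
Proof. by move=> h; rewrite /rect Rint_rect1. Qed.
Lemma R2y a b c d F : integ leb2 (rect a b c d) F ->
  \int[leb2]_(z in rect a b c d) F z = \int[mu]_(y in `[c, d]) \int[mu]_(x in `[a, b]) F (x, y).
Proof. by move=> h; rewrite /rect Rint_rect2. Qed.
Lemma i2ae1 a b c d F : integ leb2 (rect a b c d) F ->
  {ae mu, forall x, a <= x <= b -> integ mu `[c, d]%classic (fun y => F (x, y))}.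
Proof.
move=> h; have H := ae_integ1 (measurable_itv _) (measurable_itv _) h.
by apply: (aeS H) => x hx xab; apply: hx; rewrite /= in_itv/=.
Qed.
Lemma i2ae2 a b c d F : integ leb2 (rect a b c d) F ->
  {ae mu, forall y, c <= y <= d -> integ mu `[a, b]%classic (fun x => F (x, y))}.
Proof.
move=> h; have H := ae_integ2 (measurable_itv _) (measurable_itv _) h.
by apply: (aeS H) => x hx xab; apply: hx; rewrite /= in_itv/=.
Qed.
Lemma i2int1 a b c d F : integ leb2 (rect a b c d) F ->
  integ mu `[a, b]%classic (fun x => \int[mu]_(y in `[c, d]) F (x, y)).
Proof. by move=> h; exact: (integ_int1 (measurable_itv _) (measurable_itv _) h). Qed.
Lemma i2int2 a b c d F : integ leb2 (rect a b c d) F ->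
  integ mu `[c, d]%classic (fun y => \int[mu]_(x in `[a, b]) F (x, y)).
Proof. by move=> h; exact: (integ_int2 (measurable_itv _) (measurable_itv _) h). Qed.
Lemma s2ae1 a b c d F : measurable_fun setT F -> sq_integ leb2 (rect a b c d) F ->
  {ae mu, forall x, a <= x <= b -> sq_integ mu `[c, d]%classic (fun y => F (x, y))}.
Proof.
move=> mF [_ /i2ae1 h]; apply: (aeS h) => x hx xab; split; last exact: hx.
by apply: measurable_funTS; exact: (measurableT_comp mF (pair1_measurable x)).
Qed.
Lemma s2ae2 a b c d F : measurable_fun setT F -> sq_integ leb2 (rect a b c d) F ->
  {ae mu, forall y, c <= y <= d -> sq_integ mu `[a, b]%classic (fun x => F (x, y))}.
Proof.
move=> mF [_ /i2ae2 h]; apply: (aeS h) => x hx xab; split; last exact: hx.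
by apply: measurable_funTS; exact: (measurableT_comp mF (pair2_measurable x)).
Qed.

End Interval_and_rectangle.

(** * Traces as initial values on vertical lines *)

Section Traces.
Context {R : realType}.
Local Notation mu := (@lebesgue_measure R).
Local Notation leb2 := (mu \x mu)%E.

(** This replaces the extraction of an almost everywhere convergent subsequence: the infimum over
    [n] has integral 0, hence vanishes almost everywhere. *)
Lemma ae_inf_lt (E : nat -> R -> \bar R) : (forall n, measurable_fun setT (E n)) ->
  (forall n x, (0 <= E n x)%E) -> (\int[mu]_x E n x)%E @[n --> \oo] --> 0%E ->
  {ae mu, forall x, forall d : R, 0 < d -> exists n, (E n x < d%:E)%E}.
Proof.
move=> mE E0 cE; pose G x := einfs (E^~ x) 0%N.
have mG : measurable_fun setT G by exact: measurable_fun_einfs.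
have G0 x : (0 <= G x)%E by apply: le_ereal_inf_tmp => _ [n _ <-].
have GE n : (\int[mu]_x G x <= \int[mu]_x E n x)%E.
  apply: ge0_le_integral; [by []|by move=> x _; exact: G0|exact: mG|exact: mE|].
  by move=> x _; apply: ereal_inf_lbound; exists n.
have G_eq0 : (\int[mu]_x G x = 0)%E.
  apply/eqP; rewrite eq_le integral_ge0// andbT.
  by apply: (cvge_to_ge cE); near=> n; exact: GE.
have [+ _] := ae_eq_integral_abs mu measurableT mG.
under eq_integral do rewrite gee0_abs//.
move=> /(_ G_eq0) h; apply: (aeS h) => x /(_ I) /= Gx d d0.
have : (G x < d%:E)%E by rewrite Gx lte_fin.
by rewrite /G /einfs /sdrop => /ereal_inf_lt[_ [n _ <-] h']; exists n.
Unshelve. all: by end_near.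
Qed.

(** The defect [A] between [v] and the primitive of [q0] from [g0] is at most the error of any
    approximation: in the function, in the initial value and, through Cauchy-Schwarz, in the
    derivative. As [d] is arbitrary, [A^2] has integral 0. *)
Lemma prim_limit (r g0 : R) (v q0 : R -> R) : 0 < r ->
  sq_integ mu `[0, r]%classic v -> sq_integ mu `[0, r]%classic q0 ->
  (forall d, 0 < d -> exists c b phi dphi, [/\ prim r c b phi dphi,
    sq_integ mu `[0, r]%classic phi, sq_integ mu `[0, r]%classic dphi,
    (c - g0) ^+ 2 < d &
    \int[mu]_(y in `[0, r]) ((phi y - v y) ^+ 2 + (dphi y - q0 y) ^+ 2) < d]) ->
  exists b, prim r g0 b v q0.
Proof.
move=> r0 sv sq H; have mS : measurable (`[0, r]%classic : set R) by [].
have fS := @itv_finite R 0 r.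
have ic (k : R) : integ mu `[0, r]%classic (fun=> k) by apply: integ_cst.
set S := `[0, r]%classic in mS fS ic sv sq H *.
have iq : integ mu S q0 by exact: sq_integ_integ.
pose A y := v y - (g0 + \int[mu]_(t in `[0, y]) q0 t).
have mprim : measurable_fun S (fun y => \int[mu]_(t in `[0, y]) q0 t).
  have [_ h] := Rint_mul_prim (ic 1) iq.
  have h' : integ mu S (fun y => \int[mu]_(t in `[0, y]) q0 t).
    by apply: eq_integ h => // y _; exact: mul1r.
  exact: integ_mfun h'.
have mA : measurable_fun S A.
  by apply: measurable_funB; [case: sv|exact: measurable_funD].
(* From [(a + b + c)^2 <= 3 (a^2 + b^2 + c^2)], integrated over [[0, r]]. *)
pose T d := 3 * (d + r * d + r ^+ 2 * d).
have AT d : 0 < d -> exists2 h, integ mu S h & (forall y, S y -> 0 <= h y) /\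
   {ae mu, forall y, S y -> A y ^+ 2 <= h y} /\ \int[mu]_(y in S) h y <= T d.
  move=> d0; have [c [b [phi [dphi [hp sphi sdphi hc hI]]]]] := H d d0.
  have s1 := s1B sphi sv; have s2 := s1B sdphi sq.
  have i1 := s1.2; have i2 := s2.2.
  set I1 := \int[mu]_(y in S) (phi y - v y) ^+ 2.
  set I2 := \int[mu]_(y in S) (dphi y - q0 y) ^+ 2.
  have I1_0 : 0 <= I1 by apply: Rintegral_ge0 => y _; exact: sqr_ge0.
  have I2_0 : 0 <= I2 by apply: Rintegral_ge0 => y _; exact: sqr_ge0.
  move: hI; rewrite RintegralD// -/I1 -/I2 => hI.
  pose k := 3 * ((c - g0) ^+ 2 + r * I2).
  have k0 : 0 <= k by rewrite mulr_ge0// addr_ge0 ?sqr_ge0// mulr_ge0// ltW.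
  exists (fun y => 3 * (phi y - v y) ^+ 2 + k).
    exact: i1D (i1Z 3 i1) (ic k).
  split; first by move=> y _; rewrite addr_ge0// mulr_ge0// sqr_ge0.
  split.
    have [idp hphi _] := hp; apply: (aeS hphi) => y hphiy yS.
    have hy : 0 <= y <= r by move: yS; rewrite /S /= in_itv/=.
    have Ephi := hphiy hy; have /andP[y0 yr] := hy.
    have sub := @i1S _ 0 r 0 y _ (lexx 0) yr.
    have EA : A y = - (phi y - v y) + ((c - g0) + \int[mu]_(t in `[0, y]) (dphi t - q0 t)).
      by rewrite RintegralB//; [rewrite /A Ephi; ring|exact: sub|exact: sub].
    have J2 : (\int[mu]_(t in `[0, y]) (dphi t - q0 t)) ^+ 2 <= r * I2.
      have sy : sq_integ mu `[0, y]%classic (fun t => dphi t - q0 t).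
        exact: s1S s2.
      apply: le_trans (sqr_Rint_le y0 sy) _.
      apply: ler_pM => //; first by apply: Rintegral_ge0 => t _; exact: sqr_ge0.
      by apply: Rint_itv_le => // t; exact: sqr_ge0.
    rewrite EA /k; set J := \int[mu]_(t in _) _ in J2 *.
    set a := phi y - v y; set b' := c - g0.
    have := sqr_ge0 (a + b'); have := sqr_ge0 (a + J); have := sqr_ge0 (b' - J).
    by move: J2; rewrite !expr2; nra.
  rewrite (R1D (i1Z 3 i1) (ic k)) (R1Z 3 i1) R1c ?ltW// subr0 -/I1 /T /k.
  have h1 : I1 <= d by lra.
  have h2 : I2 <= d by lra.
  have h3 : r * I2 <= r * d by rewrite ler_pM2l.
  have h4 : r * (r * I2) <= r * (r * d) by rewrite ler_pM2l.
  have h5 : r * (c - g0) ^+ 2 <= r * d by rewrite ler_pM2l// ltW.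
  by rewrite mulrAC -mulrA mulrDr [r ^+ 2]expr2 -[r * r * d]mulrA; lra.
have A2 : integ mu S (fun y => A y ^+ 2).
  have [h ih [h0 [Ah _]]] := AT 1 ltr01.
  pose A' y := Num.min (A y ^+ 2) (h y).
  have mh := integ_mfun ih.
  have mA2 : measurable_fun S (fun y => A y ^+ 2) by exact: measurable_funX.
  apply: (@integ_ae _ _ _ mu _ A') => //.
    by apply: (aeS Ah) => y Ay /Ay h1; rewrite /A' min_l.
  apply: integ_le ih => //; first exact: measurable_minr.
  by move=> y Sy; rewrite /A' ger0_norm ?ge_min ?lexx ?orbT// le_min sqr_ge0 h0.
have A0 : {ae mu, forall y, S y -> A y ^+ 2 = 0}.
  apply: Rint_eq0_ae => //; first by move=> y _; exact: sqr_ge0.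
  apply/eqP; rewrite eq_le Rintegral_ge0 ?andbT; last by move=> y _; exact: sqr_ge0.
  apply/ler_addgt0Pr => e e0; rewrite add0r.
  pose K := 3 * (1 + r + r ^+ 2).
  have K0 : 0 < K by rewrite mulr_gt0// addr_gt0 ?exprn_gt0// addr_gt0.
  have [h ih [h0 [Ah hT]]] := AT (e / K) (divr_gt0 e0 K0).
  have hAh : \int[mu]_(y in S) A y ^+ 2 <= \int[mu]_(y in S) h y by apply: ae_le_Rint.
  apply: (le_trans hAh (le_trans hT _)).
  have -> : T (e / K) = K * (e / K) by rewrite /T /K; ring.
  by rewrite mulrC divfK ?gt_eqF.
exists (g0 + \int[mu]_(t in `[0, r]) q0 t); split => //.
apply: (aeS A0) => y h hy; have := h _; rewrite /S /= in_itv/= hy => /(_ isT) /eqP.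
by rewrite expf_eq0/= subr_eq0 => /eqP.
Qed.

End Traces.
Section Trace_lines.
Context {R : realType}.
Local Notation mu := (@lebesgue_measure R).
Local Notation leb2 := (mu \x mu)%E.

Lemma measurable_sqrB (D : set (R * R)) (f g : R * R -> R) : measurable_fun D f ->
  measurable_fun D g -> measurable_fun D (fun z => (f z - g z) ^+ 2).
Proof. by move=> mf mg; apply: measurable_funX; exact: measurable_funB. Qed.

(** The integral of a nonnegative function is a supremum over the simple functions below it, hence
    monotone without measurability. The half-boxes of [has_trace] contain a segment of the line
    [y = 0], on which [v] may fail to be measurable. *)
Lemma ge0_le_int_nonmeasurable d (T : measurableType d) (m : {measure set T -> \bar R})
    (f1 f2 : T -> \bar R) : (forall x, 0 <= f1 x)%E -> (forall x, f1 x <= f2 x)%E ->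
  (\int[m]_x f1 x <= \int[m]_x f2 x)%E.
Proof.
move=> f10 f12; have f20 x : (0 <= f2 x)%E by exact: le_trans (f12 x).
rewrite !ge0_integralTE//; apply: ub_ereal_sup => _ [h hf1 <-].
by apply: ereal_sup_ubound; exists h => // x; exact: le_trans (f12 x).
Qed.

Lemma ae_neq1 (c : R) : {ae leb2, forall z, z.1 != c}.
Proof.
apply: ae_of_xsections.
  suff h : measurable [set z : R * R | z.1 != c] by exact: h.
  have -> : [set z : R * R | z.1 != c] = ~` (fst @^-1` [set c]).
    by apply/seteqP; split=> z /= => /eqP.
  by apply: measurableC; rewrite -[X in measurable X]setTI; apply: measurable_fst.
by apply: (aeS (ae_neq c)) => x hx; exact: aeW.
Qed.

Lemma ae_neq2 (c : R) : {ae leb2, forall z, z.2 != c}.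
Proof.
apply: ae_of_xsections; last by apply: aeW => x; exact: ae_neq.
suff h : measurable [set z : R * R | z.2 != c] by exact: h.
have -> : [set z : R * R | z.2 != c] = ~` (snd @^-1` [set c]).
  by apply/seteqP; split=> z /= => /eqP.
by apply: measurableC; rewrite -[X in measurable X]setTI; apply: measurable_snd.
Qed.

(** [E n x] adds the errors of the [n]-th smooth approximation along the vertical line over [x] and
    at its foot. Its integral in [x] tends to 0, so almost every line has arbitrarily good
    approximations, and [prim_limit] applies. Cutting [v] to 0 outside the open half-plane makes it
    measurable on the plane. *)
Lemma trace_line (v : R * R -> R) (g : R -> R) (r : R) : 0 < r -> has_trace v g ->
  measurable_fun (@half_plane R) v ->
  measurable_fun setT (wD (dirx R) v) -> measurable_fun setT (wD (diry R) v) ->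
  sq_integ leb2 (rect 0 r 0 r) (v \_ (@half_plane R)) -> sq_integ leb2 (rect 0 r 0 r) (wD (diry R) v) ->
  {ae mu, forall x, 0 <= x <= r -> exists b,
    prim r (g x) b (fun y => (v \_ (@half_plane R)) (x, y)) (fun y => wD (diry R) v (x, y))}.
Proof.
move=> r0 [mg [phi [sphi H]]] mv mx my sv sy.
have [Ha Hb] := H r r0.
pose a_ n := (\int[leb2]_(z in half_box r)
         ((phi n z - v z) ^+ 2 + ('D_(dirx R) (phi n) z - wD (dirx R) v z) ^+ 2
          + ('D_(diry R) (phi n) z - wD (diry R) v z) ^+ 2)%:E)%E.
pose b_ n := (\int[mu]_(x in segment r) ((phi n (x, 0) - g x) ^+ 2)%:E)%E.
rewrite -/(a_ _) in Ha; rewrite -/(b_ _) in Hb.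
have mHc := @measurable_half_plane R.
pose vt := v \_ (@half_plane R); rewrite -/vt in sv *.
have vtE z : 0 < z.2 -> vt z = v z by move=> z2; rewrite /vt patchE mem_set.
have mvt : measurable_fun setT vt by exact: ((measurable_restrictT v mHc).1 mv).
have mphi n : measurable_fun setT (phi n) by apply: continuous_measurable2; exact: smooth_cont.
have mphix n : measurable_fun setT ('D_(dirx R) (phi n)).
  by apply: continuous_measurable2; apply: smooth_cont; apply: smooth_derive => //; left.
have cphiy n : continuous ('D_(diry R) (phi n)).
  by apply: smooth_cont; apply: smooth_derive => //; right.
have mphiy n : measurable_fun setT ('D_(diry R) (phi n)) by exact: continuous_measurable2.
pose G n z := (phi n z - vt z) ^+ 2 + ('D_(diry R) (phi n) z - wD (diry R) v z) ^+ 2.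
have mG n : measurable_fun setT (G n).
  exact: measurable_funD (measurable_sqrB (mphi n) mvt) (measurable_sqrB (mphiy n) my).
have G0 n z : 0 <= G n z by rewrite addr_ge0 ?sqr_ge0.
pose S := rect 0 r 0 r.
have mS : measurable S by exact: measurable_rect.
pose F n := (EFin \o G n) \_ S.
have mF n : measurable_fun setT (F n).
  by apply: (measurable_restrictT _ mS).1; apply/measurable_EFinP; exact: measurable_funTS.
have F0 n z : (0 <= F n z)%E by rewrite /F patchE; case: ifP => // _; rewrite lee_fin.
pose B n x := (phi n (x, 0) - g x) ^+ 2.
have mB n : measurable_fun setT (B n).
  apply: measurable_funX; apply: measurable_funB => //.
  apply: continuous_measurable_fun; exact: (@continuous_slice_x _ (phi n) 0 (smooth_cont (sphi n))).
have B0 n x : 0 <= B n x by exact: sqr_ge0.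
have mI : measurable (`[0, r]%classic : set R) by [].
pose B' n := (EFin \o B n) \_ `[0, r]%classic.
have mB' n : measurable_fun setT (B' n).
  by apply: (measurable_restrictT _ mI).1; apply/measurable_EFinP; exact: measurable_funTS.
have B'0 n z : (0 <= B' n z)%E by rewrite /B' patchE; case: ifP => // _; rewrite lee_fin.
pose E n x := (\int[mu]_y F n (x, y) + B' n x)%E.
have mFF n : measurable_fun setT (fun x => \int[mu]_y F n (x, y))%E.
  by apply: (@measurable_fun_fubini_tonelli_F _ _ _ _ R mu _ (mF n)).
have FF0 n x : (0 <= \int[mu]_y F n (x, y))%E by apply: integral_ge0 => y _.
have mE n : measurable_fun setT (E n) by exact: emeasurable_funD.
have E0 n x : (0 <= E n x)%E by apply: adde_ge0.
have mhb : measurable (half_box r) by exact: (@measurable_rect R (- r) r 0 r).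
have Ea n : (\int[leb2]_z F n z <= a_ n)%E.
  rewrite /a_ [leRHS]integral_mkcond.
  have -> : (\int[leb2]_z F n z = \int[leb2]_z (F n \_ (@half_plane R)) z)%E.
    have mFT : measurable_fun setT (F n) := mF n.
    have mFh : measurable_fun setT (F n \_ (@half_plane R)).
      by apply: (measurable_restrictT _ mHc).1; exact: measurable_funS mFT.
    apply: ae_eq_integral; [by []|exact: mFT|exact: mFh|].
    apply: (aeS (ae_neq2 0)) => z z2 _; rewrite patchE; case: ifPn => //.
    rewrite notin_setE /half_plane /= => /negP; rewrite -leNgt /F patchE => z20.
    case: ifPn => //; rewrite inE => /rectE[_ /andP[z2' _]].
    by move: z2; rewrite eq_le z20 z2'.
  apply: ge0_le_int_nonmeasurable => z; first by rewrite patchE; case: ifPn.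
  rewrite patchE; case: ifPn; last first.
    by move=> _; rewrite patchE; case: ifPn => // _; rewrite lee_fin !addr_ge0 ?sqr_ge0.
  rewrite inE => zh; rewrite /F !patchE; case: ifPn => zS; last first.
    by case: ifPn => // _; rewrite lee_fin !addr_ge0 ?sqr_ge0.
  move: zS; rewrite inE => /rectE[/andP[h1 h2] h3]; rewrite mem_set.
    by rewrite lee_fin /G vtE// lerD2r lerDl sqr_ge0.
  split; rewrite /segment /= in_itv/=; last by [].
  by rewrite h2 andbT (le_trans _ h1)// oppr_le0 ltW.
have Eb n : (\int[mu]_x B' n x <= b_ n)%E.
  rewrite /B' -integral_mkcond /b_ /segment; apply: ge0_subset_integral => //.
  - apply/measurable_EFinP; exact: (measurable_funS measurableT (@subsetT _ _) (mB n)).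
  - by move=> z _; rewrite lee_fin.
  - by apply: subset_itvr; rewrite bnd_simp oppr_le0 ltW.
have Eab n : (\int[mu]_x E n x <= a_ n + b_ n)%E.
  have h := tonelli1 (mF n) (F0 n).
  have hd : (\int[mu]_x E n x = \int[mu]_x \int[mu]_y F n (x, y) + \int[mu]_x B' n x)%E.
    by apply: (@ge0_integralD _ _ R mu setT measurableT (fun x => \int[mu]_y F n (x, y))%E (B' n)
      (fun x _ => FF0 n x) (mFF n) (fun x _ => B'0 n x) (mB' n)).
  by rewrite hd -h; exact: leeD.
have cE : (\int[mu]_x E n x)%E @[n --> \oo] --> 0%E.
  apply: (@squeeze_cvge _ _ _ _ (cst 0%E) _ (fun n => (a_ n + b_ n)%E)).
  - by near=> n; rewrite integral_ge0//= Eab.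
  - exact: cvg_cst.
  - by rewrite -[X in _ --> X]adde0; apply: cvgeD.
have ysv := s2ae1 mvt sv; have ysy := s2ae1 my sy.
apply: (aeS3 (ae_inf_lt mE E0 cE) ysv ysy) => x hx hv hy x0r.
apply: prim_limit => //; [exact: hv|exact: hy|].
move=> d d0; have [n hn] := hx d d0.
exists (phi n (x, 0)), (phi n (x, r)), (fun y => phi n (x, y)),
  (fun y => 'D_(diry R) (phi n) (x, y)).
have sq1 (h : R * R -> R) : continuous h -> sq_integ mu `[0, r]%classic (fun y => h (x, y)).
  move=> ch; have chx := @continuous_slice_y _ h x ch; split.
    by apply: measurable_funTS; exact: continuous_measurable_fun.
  by apply: continuous_integ => t; apply: cvgM; exact: chx.
have s1 := sq1 _ (smooth_cont (sphi n)); have s2 := sq1 _ (cphiy n).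
have i1 : integ mu `[0, r]%classic (fun y => G n (x, y)).
  apply: i1D; [have := (s1B s1 (hv x0r)).2|have := (s1B s2 (hy x0r)).2]; exact.
have B'E : B' n x = (B n x)%:E by rewrite /B' patchE mem_set//= in_itv.
have FE : (\int[mu]_y F n (x, y) = (\int[mu]_(y in `[0, r]) G n (x, y))%:E)%E.
  rewrite /Rintegral fineK; last by apply: integrable_fin_num.
  rewrite [RHS]integral_mkcond; apply: eq_integral => y _; rewrite /F !patchE.
  suff -> : ((x, y) \in S) = (y \in `[0, r]%classic) by [].
  apply/idP/idP; rewrite !inE /= in_itv/=; first by move=> /rectE[].
  by move=> h; apply/rectE.
move: hn; rewrite /E FE B'E -EFinD lte_fin => hd.
have G1 : 0 <= \int[mu]_(y in `[0, r]) G n (x, y) by apply: Rintegral_ge0 => y _; exact: G0.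
split => //; [exact: slice_prim_y (ltW r0) (sphi n)| |].
  by apply: le_lt_trans hd; rewrite -/(B n x) lerDr.
by apply: le_lt_trans hd; rewrite lerDl.
Unshelve. all: by end_near.
Qed.

End Trace_lines.

(** * From admissible functions to facts on almost every line *)

Section Admissible.
Context {R : realType}.
Local Notation mu := (@lebesgue_measure R).
Local Notation leb2 := (mu \x mu)%E.
Implicit Types (u v g phi theta p q : R * R -> R) (l : R).

Lemma measurable_strip l : measurable (strip l).
Proof.
have -> : strip l = fst @^-1` `[0, l[%classic `&` snd @^-1` `[0, +oo[%classic.
  by apply/seteqP; split=> z; rewrite /strip /= !in_itv/= andbT.
apply: measurableI; rewrite -[X in measurable X]setTI.
  exact: measurable_fst.
exact: measurable_snd.
Qed.

Lemma int_patch_le (A B C : set (R * R)) g : measurable A -> measurable B -> measurable C ->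
  measurable_fun setT g -> (forall z, 0 <= g z) ->
  {ae leb2, forall z, C z -> A z \/ B z} ->
  (\int[leb2]_(z in C) (g z)%:E <= \int[leb2]_(z in A) (g z)%:E + \int[leb2]_(z in B) (g z)%:E)%E.
Proof.
move=> mA mB mC mg g0 CAB.
pose P (D : set (R * R)) := (EFin \o g) \_ D.
have mP D : measurable D -> measurable_fun setT (P D).
  move=> mD; apply: (measurable_restrictT _ mD).1; apply/measurable_EFinP; exact: measurable_funTS.
have P0 D z : (0 <= P D z)%E by rewrite /P patchE; case: ifP => // _; rewrite lee_fin.
have h1 : (\int[leb2]_z (P A z + P B z) = \int[leb2]_z P A z + \int[leb2]_z P B z)%E.
  by apply: (@ge0_integralD _ _ R leb2 setT measurableT (P A) (P B)
    (fun z _ => P0 A z) (mP A mA) (fun z _ => P0 B z) (mP B mB)).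
rewrite integral_mkcond [X in (_ <= X + _)%E]integral_mkcond [X in (_ <= _ + X)%E]integral_mkcond.
rewrite -[leRHS]h1; apply: ae_ge0_le_integral => //.
- by move=> z _; exact: (P0 C z).
- exact: mP.
- by move=> z _; apply: adde_ge0.
- by apply: emeasurable_funD; exact: mP.
apply: (aeS CAB) => z h _; rewrite /P !patchE; case: ifPn => [|_]; last first.
  by apply: adde_ge0; case: ifP => // _; rewrite lee_fin.
rewrite inE => /h[zA|zB].
  by rewrite [z \in A]mem_set//=; case: ifP => _; rewrite ?adde0// -EFinD lee_fin lerDl.
by rewrite [z \in B]mem_set//=; case: ifP => _; rewrite ?add0e// -EFinD lee_fin lerDr.
Qed.

Lemma int_rect_shift a b c d k g : measurable_fun setT g -> (forall z, 0 <= g z) ->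
  {ae leb2, forall z, half_plane z -> g (xshift k z) = g z} -> 0 <= c ->
  (\int[leb2]_(z in rect (a + k)%R (b + k)%R c d) (g z)%:E =
   \int[leb2]_(z in rect a b c d) (g z)%:E)%E.
Proof.
move=> mg g0 gk c0.
have mP a' b' c' d' : measurable_fun setT ((EFin \o g) \_ (rect a' b' c' d')).
  apply: (measurable_restrictT _ (measurable_rect _ _ _ _)).1.
  by apply/measurable_EFinP; exact: measurable_funTS.
rewrite integral_mkcond [RHS]integral_mkcond -[LHS](@int_xshift _ k)//.
apply: ae_eq_integral => //.
- by apply: measurableT_comp; [exact: mP|exact: measurable_xshift].
- exact: mP.
apply: (aeS2 gk (ae_neq2 0)) => z h z20 _; rewrite /= !patchE.
have -> : (xshift k z \in rect (a + k) (b + k) c d) = (z \in rect a b c d).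
  by apply/idP/idP; rewrite !inE => /rectE[/= h1 h2]; apply/rectE; move: h1; rewrite /= !lerD2r.
case: ifPn => //; rewrite inE => /rectE[_ /andP[z2 _]] /=.
by rewrite h// /half_plane /= lt_neqAle eq_sym z20 (le_trans c0).
Qed.

Lemma int_periodic l k H g : 0 < l -> measurable_fun setT g -> (forall z, 0 <= g z) ->
  {ae leb2, forall z, half_plane z -> g (xshift l z) = g z} ->
  (\int[leb2]_(z in rect 0 (k.+1%:R * l)%R 0 H) (g z)%:E <=
   k.+1%:R%:E * \int[leb2]_(z in strip l) (g z)%:E)%E.
Proof.
move=> l0 mg g0 gl.
have B1 : (\int[leb2]_(z in rect 0 l 0 H) (g z)%:E <= \int[leb2]_(z in strip l) (g z)%:E)%E.
  have := @int_patch_le (strip l) set0 (rect 0 l 0 H) g (@measurable_strip l) measurable0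
    (measurable_rect _ _ _ _) mg g0.
  rewrite integral_set0 adde0; apply.
  apply: (aeS (ae_neq1 l)) => z zl /rectE[/andP[h1 h2] /andP[h3 _]]; left.
  by split => //; rewrite h1 lt_neqAle zl h2.
elim: k => [|k IH]; first by rewrite mul1r mul1e.
have -> : k.+2%:R * l = k.+1%:R * l + l by rewrite -[in LHS]natr1 mulrDl mul1r.
have kl0 : 0 <= k.+1%:R * l by rewrite mulr_ge0// ltW.
apply: le_trans (@int_patch_le (rect 0 l 0 H) (rect (0 + l) (k.+1%:R * l + l) 0 H) _ g
  (measurable_rect _ _ _ _) (measurable_rect _ _ _ _) (measurable_rect _ _ _ _) mg g0 _) _.
  apply: aeW => z /rectE[/andP[h1 h2] h3].
  have [zl|/ltW zl] := leP z.1 l; [left|right]; apply/rectE; split => //.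
    by rewrite h1.
  by rewrite add0r zl.
rewrite int_rect_shift//.
have -> : (k.+2%:R%:E * \int[leb2]_(z in strip l) (g z)%:E =
  \int[leb2]_(z in strip l) (g z)%:E + k.+1%:R%:E * \int[leb2]_(z in strip l) (g z)%:E)%E.
  by rewrite -[in LHS]nat1r EFinD ge0_muleDl ?lee_fin// mul1e.
exact: leeD.
Qed.

Lemma integ_periodic l k H g M : 0 < l -> measurable_fun setT g -> (forall z, 0 <= g z) ->
  {ae leb2, forall z, half_plane z -> g (xshift l z) = g z} ->
  (\int[leb2]_(z in strip l) (g z)%:E <= M%:E)%E ->
  integ leb2 (rect 0 (k.+1%:R * l) 0 H) g /\
  \int[leb2]_(z in rect 0 (k.+1%:R * l) 0 H) g z <= k.+1%:R * M.
Proof.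
move=> l0 mg g0 gl hM.
have h : (\int[leb2]_(z in rect 0 (k.+1%:R * l)%R 0 H) (g z)%:E <= (k.+1%:R * M)%:E)%E.
  apply: le_trans (int_periodic k H l0 mg g0 gl) _.
  by rewrite EFinM lee_wpmul2l// lee_fin.
have ig : integ leb2 (rect 0 (k.+1%:R * l) 0 H) g.
  apply/integrableP; split.
    by apply/measurable_EFinP; exact: measurable_funTS.
  apply: le_lt_trans (ltry (k.+1%:R * M)); apply: le_trans h.
  by under eq_integral do rewrite /= ger0_norm//.
split => //; rewrite -lee_fin /Rintegral fineK//.
apply: integrable_fin_num => //; exact: measurable_rect.
Qed.

Lemma weakly_derivable_add (e' : R * R) u v phi : dir e' -> weakly_derivable e' v -> smooth phi ->
  measurable_fun (@half_plane R) u ->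
  {ae leb2, forall z, half_plane z -> v z + phi z = u z} ->
  weakly_derivable e' u /\
  {ae leb2, forall z, half_plane z -> wD e' u z = wD e' v z + 'D_e' phi z}.
Proof.
move=> he wv sphi mu0 uv.
have h1 := weakD he (wD_is_weak wv) (smooth_weak he sphi).
have h2 : is_weak_derivative e' u (fun z => wD e' v z + 'D_e' phi z).
  apply: (weak_ae he mu0 _ uv _ h1); last exact: aeW.
  by case: h1.
by split; [exists (fun z => wD e' v z + 'D_e' phi z)|exact: wD_ae].
Qed.

End Admissible.
Section Cell.
Context {R : realType}.
Local Notation mu := (@lebesgue_measure R).
Local Notation leb2 := (mu \x mu)%E.
Implicit Types (u v g theta p q : R * R -> R) (l e : R).

Lemma measurable_subc (f : R * R -> R) (c : R) : measurable_fun setT f ->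
  measurable_fun setT (fun z => f z - c).
Proof. by move=> mf; exact: measurable_funB. Qed.

Lemma measurable_W (f g : R * R -> R) : measurable_fun setT f -> measurable_fun setT g ->
  measurable_fun setT (fun z => 1 - (f z ^+ 2 + g z ^+ 2)).
Proof.
move=> mf mg; apply: measurable_funB => //.
exact: measurable_funD (measurable_funX 2 mf) (measurable_funX 2 mg).
Qed.

Lemma measurable_energy (f g h k : R * R -> R) : measurable_fun setT f ->
  measurable_fun setT g -> measurable_fun setT h -> measurable_fun setT k ->
  measurable_fun setT (fun z => (h z + k z) ^+ 2 + (1 - (f z ^+ 2 + g z ^+ 2)) ^+ 2).
Proof.
move=> mf mg mh mk; have mW := measurable_W mf mg.
exact: measurable_funD (measurable_funX 2 (measurable_funD mh mk)) (measurable_funX 2 mW).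
Qed.

Lemma line_dirx (t : R) (z : R * R) : t *: dirx R + z = (t + z.1, z.2).
Proof. by case: z => x y; congr pair; rewrite /= /GRing.scale/= ?mulr1 ?mulr0 ?add0r. Qed.

Lemma line_diry (t : R) (z : R * R) : t *: diry R + z = (z.1, t + z.2).
Proof. by case: z => x y; congr pair; rewrite /= /GRing.scale/= ?mulr1 ?mulr0 ?add0r. Qed.

(** Tested against [psi (x) chi (y)], both sides equal the integral of [theta] against
    [psi' chi']. *)
Lemma mixed_weak_derivatives theta p q py qx :
  is_weak_derivative (dirx R) theta p -> is_weak_derivative (diry R) theta q ->
  is_weak_derivative (diry R) p py -> is_weak_derivative (dirx R) q qx ->
  {ae leb2, forall z, half_plane z -> py z = qx z}.
Proof.
move=> wp wq wpy wqx; apply: weak_unique_tens; [by case: wpy|by case: wqx|].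
move=> psi chi A B C D sp sc hp hc C0.
have E1 := weak_derivative_y wpy sp sc hp hc C0.
have E2 := weak_derivative_x wqx sp sc hp hc C0.
have E3 := weak_derivative_x wp sp (smooth1_derive sc) hp (derive1_supp sc hc) C0.
have E4 := weak_derivative_y wq (smooth1_derive sp) sc (derive1_supp sp hp) hc C0.
by apply: oppr_inj; rewrite -E1 -E2; apply: oppr_inj; rewrite -E3 -E4.
Qed.

(* The a.e. facts on an admissible function [theta] of energy at most [F] that
   the estimates use; [al] is the length of the Dirichlet part, and subscripts
   denote weak derivatives of [p = theta_x] and [q = theta_y]. *)
Record cell (eps l al F : R) (theta p q px qx qy : R * R -> R) : Prop := Cell {
  cell_meas : [/\ measurable_fun setT theta, measurable_fun setT p & measurable_fun setT q] /\
    [/\ measurable_fun setT px, measurable_fun setT qx & measurable_fun setT qy];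
  cell_sq : forall H, [/\ sq_integ leb2 (rect 0 (3 * l) 0 H) theta,
      sq_integ leb2 (rect 0 (3 * l) 0 H) p & sq_integ leb2 (rect 0 (3 * l) 0 H) q] /\
    [/\ sq_integ leb2 (rect 0 (3 * l) 0 H) px,
      sq_integ leb2 (rect 0 (3 * l) 0 H) qx & sq_integ leb2 (rect 0 (3 * l) 0 H) qy];
  cell_theta_per : forall z, half_plane z -> theta (xshift l z) = theta z + pi;
  cell_per : {ae leb2, forall z, half_plane z ->
    [/\ p (xshift l z) = p z, q (xshift l z) = q z, px (xshift l z) = px z,
        qx (xshift l z) = qx z & qy (xshift l z) = qy z]};
  cell_linex : forall H, 0 < H -> {ae mu, forall y, 0 <= y <= H ->
    [/\ exists a b, prim (3 * l) a b (fun x => theta (x, y)) (fun x => p (x, y)),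
        exists a b, prim (3 * l) a b (fun x => p (x, y)) (fun x => px (x, y)) &
        exists a b, prim (3 * l) a b (fun x => q (x, y)) (fun x => qx (x, y))]};
  cell_liney : forall H, 0 < H -> {ae mu, forall x, 0 <= x <= 3 * l ->
    [/\ exists a b, prim H a b (fun y => theta (x, y)) (fun y => q (x, y)),
        exists a b, prim H a b (fun y => p (x, y)) (fun y => qx (x, y)) &
        exists a b, prim H a b (fun y => q (x, y)) (fun y => qy (x, y))]};
  cell_bcD : forall H, 0 < H -> {ae mu, forall x, 0 <= x < al ->
    exists b, prim H 0 b (fun y => theta (x, y)) (fun y => q (x, y))};
  cell_bcN : forall H, 0 < H -> {ae mu, forall x, al <= x < l ->
    exists b, prim H 0 b (fun y => q (x, y)) (fun y => qy (x, y))};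
  cell_energy : forall H,
    integ leb2 (rect 0 (3 * l) 0 H) (fun z => (1 - (p z ^+ 2 + q z ^+ 2)) ^+ 2) /\
    forall k, (k < 3)%N -> \int[leb2]_(z in rect 0 (k.+1%:R * l) 0 H)
      ((px z + qy z) ^+ 2 + (1 - (p z ^+ 2 + q z ^+ 2)) ^+ 2) <= k.+1%:R * F;
  cell_decay : exists A, forall H, \int[leb2]_(z in rect 0 l 0 H)
    ((p z - eps) ^+ 2 + (q z - Num.sqrt (1 - eps ^+ 2)) ^+ 2) <= A
}.

Lemma half_plane_theta l (eps : R) theta : x_periodic l (fun z => theta z - eps * z.1) ->
  forall z, half_plane z -> theta (xshift l z) = theta z + eps * l.
Proof.
move=> hper [x y] /= y0; have := hper x y (ltW y0); rewrite /xshift /= => h.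
by apply/eqP; rewrite -(inj_eq (addIr (- (eps * (x + l))))) h; apply/eqP; ring.
Qed.

(** Weak derivatives pass from [v], which lies in [H^2], to [theta] by adding the smooth affine
    profile [phi]. The function [th] of the cell is [theta] cut to 0 outside the open half-plane,
    which makes it measurable on the plane. *)
Lemma cell_of_admissible (eps a delta F : R) theta : 0 < eps <= 1 -> 0 <= a <= 1 ->
  admissible eps a delta theta -> (energy eps theta <= F%:E)%E ->
  exists th p q px qx qy, cell eps (period eps) (a * period eps) F th p q px qx qy.
Proof.
move=> /andP[e0 e1] a01; rewrite /admissible; set l := period eps.
set s := Num.sqrt _;
move=> [[gD trD gD0] [gN trN gN0] hper [vper [v2 vH1] vH2]] hF.
set v := (fun z => theta z - _) in vper v2 vH1 vH2.
have l0 : 0 < l by rewrite divr_gt0// pi_gt0.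
have el : eps * l = pi by rewrite mulrCA divff ?mulr1// gt_eqF.
have s0 : 0 <= s by exact: sqrtr_ge0.
pose phi (z : R * R) := eps * z.1 + s * z.2 + delta.
have sphi : smooth phi.
  apply: smoothD; last exact: smooth_cst.
  apply: smoothD; apply: smoothM; by [exact: smooth_cst|exact: smooth_fst|exact: smooth_snd].
have dx z : 'D_(dirx R) phi z = eps.
  suff h : is_derive z (dirx R) phi eps by case: h.
  apply/is_derive_line; have := is_derive_affine eps (phi z) 0.
  congr (is_derive _ _ _ _); apply/funext => t; rewrite line_dirx /phi /GRing.scale/=; ring.
have dy z : 'D_(diry R) phi z = s.
  suff h : is_derive z (diry R) phi s by case: h.
  apply/is_derive_line; have := is_derive_affine s (phi z) 0.
  congr (is_derive _ _ _ _); apply/funext => t; rewrite line_diry /phi /GRing.scale/=; ring.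
have vE z : v z + phi z = theta z by rewrite /v /phi; ring.
have [wvx vx2] := vH1 _ (or_introl erefl); have [wvy vy2] := vH1 _ (or_intror erefl).
have [_ Hx] := vH2 _ (or_introl erefl); have [_ Hy] := vH2 _ (or_intror erefl).
have [wvxx vxx2] := Hx _ (or_introl erefl); have [wvxy vxy2] := Hx _ (or_intror erefl).
have [wvyx vyx2] := Hy _ (or_introl erefl); have [wvyy vyy2] := Hy _ (or_intror erefl).
have lv : loc_integrable v by case: (wD_is_weak wvx).
have mth : measurable_fun (@half_plane R) theta.
  have -> : theta = (fun z => v z + phi z) by apply/funext => z; rewrite vE.
  apply: measurable_funD; first by case: lv.
  by apply: measurable_funTS; apply: continuous_measurable2; exact: smooth_cont.
have dX : dir (dirx R) by left. have dY : dir (diry R) by right.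
have aev : {ae leb2, forall z, half_plane z -> v z + phi z = theta z}.
  by apply: aeW => z _; exact: vE.
have aer (u : R * R -> R) : {ae leb2, forall z, half_plane z -> u z = u z} by exact: aeW.
have [wtx tx] := weakly_derivable_add dX wvx sphi mth aev.
have [wty ty] := weakly_derivable_add dY wvy sphi mth aev.
have mfun (e' : R * R) u : weakly_derivable e' u -> measurable_fun setT (wD e' u).
  by move=> /wD_is_weak[].
pose p := wD (dirx R) theta; pose q := wD (diry R) theta.
have mp : measurable_fun setT p by exact: mfun.
have mq : measurable_fun setT q by exact: mfun.
have second (e' e'' : R * R) (c : R) : dir e' -> dir e'' -> weakly_derivable e'' (wD e' v) ->
    weakly_derivable e' theta ->
    {ae leb2, forall z, half_plane z -> wD e' theta z = wD e' v z + 'D_e' phi z} ->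
    (forall z, 'D_e' phi z = c) ->
    weakly_derivable e'' (wD e' theta) /\
    {ae leb2, forall z, half_plane z -> wD e'' (wD e' theta) z = wD e'' (wD e' v) z}.
  move=> he' he'' w1 w2 E Ec.
  have mt : measurable_fun (@half_plane R) (wD e' theta) by apply: measurable_funTS; exact: mfun.
  have E' : {ae leb2, forall z, half_plane z -> wD e' v z + (fun=> c) z = wD e' theta z}.
    by apply: (aeS E) => z h /h ->; rewrite Ec.
  have [h1 h2] := weakly_derivable_add he'' w1 (smooth_cst c) mt E'.
  have dc z : 'D_e'' (fun=> c : R) z = 0 by exact: derive_cst.
  split; first exact: h1.
  by apply: (aeS h2) => z h hz; rewrite (h hz) dc addr0.
have [wpx pxE] := second _ _ eps dX dX wvxx wtx tx dx.
have [wpy pyE] := second _ _ eps dX dY wvxy wtx tx dx.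
have [wqx qxE] := second _ _ s dY dX wvyx wty ty dy.
have [wqy qyE] := second _ _ s dY dY wvyy wty ty dy.
rewrite -/p in wpx pxE wpy pyE; rewrite -/q in wqx qxE wqy qyE.
pose px := wD (dirx R) p; pose qx := wD (dirx R) q; pose qy := wD (diry R) q.
have mpx : measurable_fun setT px by exact: mfun.
have mqx : measurable_fun setT qx by exact: mfun.
have mqy : measurable_fun setT qy by exact: mfun.
have thper := half_plane_theta hper; rewrite el in thper.
have aeth : {ae leb2, forall z, half_plane z -> theta (xshift l z) = theta z + pi} by exact: aeW.
have perp := weak_periodic dX (wD_is_weak wtx) aeth.
have perq := weak_periodic dY (wD_is_weak wty) aeth.
rewrite -/p in perp; rewrite -/q in perq.
have add0 u : {ae leb2, forall z, half_plane z -> u (xshift l z) = u z} ->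
    {ae leb2, forall z, half_plane z -> u (xshift l z) = u z + 0}.
  by move=> h; apply: (aeS h) => z hz /hz ->; rewrite addr0.
have perpx := weak_periodic dX (wD_is_weak wpx) (add0 _ perp).
have perqx := weak_periodic dX (wD_is_weak wqx) (add0 _ perq).
have perqy := weak_periodic dY (wD_is_weak wqy) (add0 _ perq).
rewrite -/px in perpx; rewrite -/qx in perqx; rewrite -/qy in perqy.
have mhp := @measurable_half_plane R.
pose th := theta \_ (@half_plane R).
have thE z : half_plane z -> th z = theta z by move=> hz; rewrite /th patchE mem_set.
have mtht : measurable_fun setT th by exact: ((measurable_restrictT theta mhp).1 mth).
pose vt := v \_ (@half_plane R).
have mv : measurable_fun (@half_plane R) v by case: lv.
have mvt : measurable_fun setT vt by exact: ((measurable_restrictT v mhp).1 mv).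
have pervt : {ae leb2, forall z, half_plane z -> vt (xshift l z) = vt z}.
  apply: aeW => -[x y] /= y0; rewrite /vt !patchE !mem_set//.
  by rewrite /xshift /= vper// ltW.
have offaxis : {ae leb2, forall z, strip l z -> half_plane z}.
  apply: (aeS (ae_neq2 0)) => z z2 [_ z20].
  by rewrite /half_plane /= lt_neqAle eq_sym z2.
have l2 (w u : R * R -> R) : measurable_fun setT w ->
    {ae leb2, forall z, half_plane z -> w (xshift l z) = w z} ->
    {ae leb2, forall z, half_plane z -> w z = u z} -> L2_strip l u ->
    exists M, forall k H, sq_integ leb2 (rect 0 (k.+1%:R * l) 0 H) w /\
      \int[leb2]_(z in rect 0 (k.+1%:R * l) 0 H) (w z ^+ 2) <= k.+1%:R * M.
  move=> mw perw wu [mu0 hu].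
  have mw2 : measurable_fun setT (fun z => w z ^+ 2) by exact: measurable_funX.
  have Ew : (\int[leb2]_(z in strip l) (w z ^+ 2)%:E = \int[leb2]_(z in strip l) (u z ^+ 2)%:E)%E.
    apply: ae_eq_integral; first exact: measurable_strip.
    - by apply/measurable_EFinP; exact: measurable_funTS.
    - by apply/measurable_EFinP; exact: measurable_funX.
    - by apply: (aeS2 wu offaxis) => z h1 h2 /h2/h1 ->.
  have fin : (\int[leb2]_(z in strip l) (w z ^+ 2)%:E)%E \is a fin_num.
    rewrite ge0_fin_numE ?Ew//; apply: integral_ge0 => z _; rewrite lee_fin; exact: sqr_ge0.
  exists (fine (\int[leb2]_(z in strip l) (w z ^+ 2)%:E)%E) => k H.
  have [] := @integ_periodic R l k H _ (fine (\int[leb2]_(z in strip l) (w z ^+ 2)%:E)%E) l0 mw2.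
  - by move=> z; exact: sqr_ge0.
  - by apply: (aeS perw) => z h /h ->.
  - by rewrite fineK.
  - by move=> h1 h2; split => //; split => //; exact: measurable_funTS.
have mpe : measurable_fun setT (fun z => p z - eps) by exact: (measurable_subc eps mp).
have mqs : measurable_fun setT (fun z => q z - s) by exact: (measurable_subc s mq).
have perpe : {ae leb2, forall z, half_plane z -> p (xshift l z) - eps = p z - eps}.
  by apply: (aeS perp) => z h /h ->.
have perqs : {ae leb2, forall z, half_plane z -> q (xshift l z) - s = q z - s}.
  by apply: (aeS perq) => z h /h ->.
have Ep : {ae leb2, forall z, half_plane z -> p z - eps = wD (dirx R) v z}.
  by apply: (aeS tx) => z h /h; rewrite -/p => ->; rewrite dx addrK.
have Eq : {ae leb2, forall z, half_plane z -> q z - s = wD (diry R) v z}.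
  by apply: (aeS ty) => z h /h; rewrite -/q => ->; rewrite dy addrK.
have [Mp hMp] := l2 _ _ mpe perpe Ep vx2.
have [Mq hMq] := l2 _ _ mqs perqs Eq vy2.
have [Mpx hMpx] := l2 _ _ mpx perpx pxE vxx2.
have [Mqx hMqx] := l2 _ _ mqx perqx qxE vyx2.
have [Mqy hMqy] := l2 _ _ mqy perqy qyE vyy2.
have vtE : {ae leb2, forall z, half_plane z -> vt z = v z}.
  by apply: aeW => z hz; rewrite /vt patchE mem_set.
have [Mv hMv] := l2 _ _ mvt pervt vtE v2.
have rE (f g : R * R -> R) A B H : (forall z, half_plane z -> f z = g z) ->
    {ae leb2, forall z, rect A B 0 H z -> f z = g z}.
  move=> fg; apply: (aeS (ae_neq2 0)) => z z2 /rectE[_ /andP[h1 _]].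
  by apply: fg; rewrite /half_plane /= lt_neqAle eq_sym z2.
have sqp k H : sq_integ leb2 (rect 0 (k.+1%:R * l) 0 H) p.
  have := s2D (hMp k H).1 (s2c 0 (k.+1%:R * l) 0 H eps).
  by under [X in sq_integ _ _ X -> _]eq_fun do rewrite subrK.
have sqq k H : sq_integ leb2 (rect 0 (k.+1%:R * l) 0 H) q.
  have := s2D (hMq k H).1 (s2c 0 (k.+1%:R * l) 0 H s).
  by under [X in sq_integ _ _ X -> _]eq_fun do rewrite subrK.
have sqth k H : sq_integ leb2 (rect 0 (k.+1%:R * l) 0 H) th.
  have sqphi : sq_integ leb2 (rect 0 (k.+1%:R * l) 0 H) phi.
    have cphi := smooth_cont sphi; split.
      by apply: measurable_funTS; exact: continuous_measurable2.
    by apply: continuous_integ2 => z; apply: cvgM; exact: cphi.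
  have := s2D (hMv k H).1 sqphi; apply: sq_integ_ae.
  - exact: measurable_rect.
  - exact: measurable_funTS.
  - by apply: rE => z hz; rewrite thE// /vt patchE mem_set.
pose En z := (px z + qy z) ^+ 2 + (1 - (p z ^+ 2 + q z ^+ 2)) ^+ 2.
have mW : measurable_fun setT (fun z => 1 - (p z ^+ 2 + q z ^+ 2)).
  exact: measurable_W mp mq.
have mEn : measurable_fun setT En.
  exact: measurable_energy mp mq mpx mqy.
have En0 z : 0 <= En z by rewrite addr_ge0 ?sqr_ge0.
have perEn : {ae leb2, forall z, half_plane z -> En (xshift l z) = En z}.
  apply: (aeS2 (aeS2 perp perq (fun z a b => conj a b)) (aeS2 perpx perqy (fun z a b => conj a b))).
  by move=> z [h1 h2] [h3 h4] hz; rewrite /En h1// h2// h3// h4.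
have hEn k H := integ_periodic k H l0 mEn En0 perEn hF.
have wth : is_weak_derivative (dirx R) th p.
  by apply: (weak_ae dX _ mp _ (aer _) (wD_is_weak wtx)); [exact: measurable_funTS|apply: aeW => z /thE].
have wthy : is_weak_derivative (diry R) th q.
  by apply: (weak_ae dY _ mq _ (aer _) (wD_is_weak wty)); [exact: measurable_funTS|apply: aeW => z /thE].
(* One representative [qx] serves for [p_y] on vertical lines and for [q_x] on horizontal ones. *)
have wpy' : is_weak_derivative (diry R) p qx.
  have mix := mixed_weak_derivatives wth wthy (wD_is_weak wpy) (wD_is_weak wqx).
  have mph : measurable_fun (@half_plane R) p by exact: (measurable_funTS mp).
  exact: (weak_ae dY mph mqx (aer p) mix (wD_is_weak wpy)).
have l3 : 0 < 3 * l by rewrite mulr_gt0.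
have axis0 (f g : R -> R) H : (forall y, 0 < y -> f y = g y) ->
    {ae mu, forall y, 0 <= y <= H -> f y = g y}.
  by move=> fg; apply: (aeS (ae_neq 0)) => y y0 /andP[h1 _]; apply: fg; rewrite lt_neqAle eq_sym y0.
have primS r H c b (f g : R -> R) : H <= r -> prim r c b f g -> exists b', prim H c b' f g.
  move=> Hr [hg fE _]; exists (c + \int[mu]_(t in `[0, H]) g t); split => //.
    exact: integ_sub hg.
  by apply: (aeS fE) => y h /andP[h1 h2]; apply: h; rewrite h1 (le_trans h2).
(* [trace_line] works on squares [[0, r]^2]: a multiple [r] of the period that exceeds the wanted
   height covers both a full period and this height. *)
have big H : exists k, H <= k.+1%:R * l /\ l <= k.+1%:R * l.
  exists (Num.trunc (`|H| / l)); split.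
    rewrite -ler_pdivrMr//; apply: le_trans (ltW (truncnS_gt _)).
    by rewrite ler_pM2r ?invr_gt0// ler_norm.
  by rewrite ler_peMl ?(ltW l0)// ler1n.
exists th, p, q, px, qx, qy; split.
- by [].
- move=> H; split; split; [exact: (sqth 2%N)|exact: (sqp 2%N)|exact: (sqq 2%N)|
    exact: (hMpx 2%N H).1|exact: (hMqx 2%N H).1|exact: (hMqy 2%N H).1].
- by move=> z hz; rewrite !thE// thper.
- apply: (aeS2 (aeS2 perp perq (fun z a b => conj a b))
    (aeS3 perpx perqx perqy (fun z a b c => conj a (conj b c)))).
  by move=> z [h1 h2] [h3 [h4 h5]] hz; split; [exact: h1|exact: h2|exact: h3|exact: h4|exact: h5].
- move=> H H0.
  have h1 := weak_lines_x l3 H0 wth (s2i (sqth 2%N H)) (s2i (sqp 2%N H)).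
  have h2 := weak_lines_x l3 H0 (wD_is_weak wpx) (s2i (sqp 2%N H)) (s2i (hMpx 2%N H).1).
  have h3 := weak_lines_x l3 H0 (wD_is_weak wqx) (s2i (sqq 2%N H)) (s2i (hMqx 2%N H).1).
  by apply: (aeS3 h1 h2 h3) => y a1 a2 a3 hy; split; [exact: a1|exact: a2|exact: a3].
- move=> H H0.
  have h1 := weak_lines_y l3 H0 wthy (s2i (sqth 2%N H)) (s2i (sqq 2%N H)).
  have h2 := weak_lines_y l3 H0 wpy' (s2i (sqp 2%N H)) (s2i (hMqx 2%N H).1).
  have h3 := weak_lines_y l3 H0 (wD_is_weak wqy) (s2i (sqq 2%N H)) (s2i (hMqy 2%N H).1).
  by apply: (aeS3 h1 h2 h3) => x a1 a2 a3 hx; split; [exact: a1|exact: a2|exact: a3].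
- move=> H H0; have [k [Hk lk]] := big H; set r := _ * l in Hk lk.
  have r0 : 0 < r by exact: lt_le_trans H0 Hk.
  have h := trace_line r0 trD mth mp mq (sqth k r) (sqq k r).
  apply: (aeS2 h gD0) => x hx g0 /andP[x0 xal].
  have xr : 0 <= x <= r.
    rewrite x0 (le_trans (ltW xal))// (le_trans _ lk)// ler_piMl ?(ltW l0)//.
    by case/andP: a01.
  have hg0 : gD x = 0 by apply: g0; rewrite /= x0.
  have [b hb] := hx xr; rewrite hg0 in hb.
  exact: (primS _ _ _ _ _ _ Hk hb).
- move=> H H0; have [k [Hk lk]] := big H; set r := _ * l in Hk lk.
  have r0 : 0 < r by exact: lt_le_trans H0 Hk.
  have sqqt : sq_integ leb2 (rect 0 r 0 r) (q \_ (@half_plane R)).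
    apply: sq_integ_ae (sqq k r); [exact: measurable_rect| |].
      by apply: measurable_funTS; apply: (measurable_restrictT q mhp).1; exact: (measurable_funTS mq).
    by apply: rE => z hz; rewrite patchE mem_set.
  have mqh : measurable_fun (@half_plane R) q by exact: (measurable_funTS mq).
  have h := trace_line r0 trN mqh mqx mqy sqqt (hMqy k r).1.
  apply: (aeS2 h gN0) => x hx g0 /andP[x0 xal].
  have x00 : 0 <= x by apply: le_trans x0; rewrite mulr_ge0 ?(ltW l0)//; case/andP: a01.
  have xr : 0 <= x <= r by rewrite x00 (le_trans (ltW xal)).
  have hg0 : gN x = 0 by apply: g0; rewrite /= x0.
  have [b hb] := hx xr; rewrite hg0 in hb.
  have [b' hb'] := primS _ _ _ _ _ _ Hk hb.
  exists b'; apply: prim_ae hb'.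
  + have [[_ mqy'] _] := hMqy k H.
    by apply: measurable_funTS; exact: (measurableT_comp mqy (pair1_measurable x)).
  + by apply: axis0 => y y0; rewrite patchE mem_set.
  + exact: aeW.
- move=> H; split; last by move=> k _; exact: (hEn k H).2.
  apply: integ_le (hEn 2%N H).1; first exact: measurable_rect.
    by apply: measurable_funTS; exact: (measurable_funX 2 mW).
  by move=> z _; rewrite ger0_norm ?sqr_ge0// /En lerDr sqr_ge0.
(* The bound depends on [theta] but not on the height [H]. *)
- exists (Mp + Mq) => H.
  have [[_ i1] b1] := hMp 0%N H; have [[_ i2] b2] := hMq 0%N H.
  move: i1 i2 b1 b2; rewrite !mul1r => i1 i2 b1 b2.
  by rewrite R2D//; exact: lerD.
Qed.

End Cell.

(** * Moving averages and choice of good points *)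

Section Averages.
Context {R : realType}.
Local Notation mu := (@lebesgue_measure R).
Local Notation leb2 := (mu \x mu)%E.
Implicit Types (f g u : R -> R) (h L l a b : R).

Lemma i1eq a b f g : (forall x, a <= x <= b -> f x = g x) ->
  integ mu `[a, b]%classic f -> integ mu `[a, b]%classic g.
Proof. by move=> fg hf; apply: eq_integ hf => // x; rewrite /= in_itv/=; exact: fg. Qed.

Lemma R1eq a b f g : (forall x, a <= x <= b -> f x = g x) ->
  \int[mu]_(x in `[a, b]) f x = \int[mu]_(x in `[a, b]) g x.
Proof. by move=> fg; apply: eq_Rintegral => x; rewrite inE /= in_itv/=; exact: fg. Qed.

Lemma prim_sub L H a b f g : H <= L -> prim L a b f g -> exists b', prim H a b' f g.
Proof.
move=> HL [hg fE _]; exists (a + \int[mu]_(t in `[0, H]) g t); split => //.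
  exact: integ_sub hg.
by apply: (aeS fE) => y h /andP[h1 h2]; apply: h; rewrite h1 (le_trans h2).
Qed.

Lemma integ_primitive L u : integ mu `[0, L]%classic u ->
  integ mu `[0, L]%classic (fun y => \int[mu]_(t in `[0, y]) u t).
Proof.
move=> hu; have [_ h] := Rint_mul_prim (i1c 0 L 1) hu.
by apply: eq_integ h => // y _; exact: mul1r.
Qed.

Lemma window_primitive L h x u : 0 <= h -> 0 <= x <= L -> integ mu `[0, L + h]%classic u ->
  \int[mu]_(s in `[0, h]) u (s + x) =
  \int[mu]_(t in `[0, x + h]) u t - \int[mu]_(t in `[0, x]) u t.
Proof.
move=> h0 /andP[x0 xL] hu; rewrite [x + h]addrC Rint_itv_cat//; first by rewrite addrAC subrr add0r.
by apply: integ_sub hu; rewrite [h + x]addrC lerD2r.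
Qed.

(** Up to the factor [h], a difference quotient is the derivative of a moving average; this is how
    difference quotients get integrated by parts. *)
Lemma prim_window L h u : 0 <= h -> 0 <= L -> integ mu `[0, L + h]%classic u ->
  prim L (\int[mu]_(t in `[0, h]) u t)
    (\int[mu]_(t in `[0, L + h]) u t - \int[mu]_(t in `[0, L]) u t)
    (fun x => \int[mu]_(s in `[0, h]) u (s + x)) (fun x => u (x + h) - u x).
Proof.
move=> h0 L0 hu.
have LLh : L <= L + h by rewrite lerDl.
pose U x := \int[mu]_(t in `[0, x]) u t.
have P1 : prim (L + h) 0 (U (L + h)) U u.
  by split; [exact: hu|apply: aeW => y _; rewrite add0r|rewrite add0r].
have P2 : prim L 0 (U L) U u.
  by split; [exact: integ_sub hu|apply: aeW => y _; rewrite add0r|rewrite add0r].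
have := primB (prim_shift h0 L0 P1) P2; rewrite add0r subr0 => -[h1 h2 h3].
split => //; apply: (aeS h2) => x E xL; rewrite -E//.
by rewrite (window_primitive h0 xL hu).
Qed.

(** Each point of [[0, L + h]] lies in the window of a set of [x] of length at most [h]. The proof
    stays in one variable by telescoping the primitive [U]. *)
Lemma window_le L h u : 0 <= h -> 0 <= L -> integ mu `[0, L + h]%classic u ->
  (forall t, 0 <= u t) ->
  integ mu `[0, L]%classic (fun x => \int[mu]_(s in `[0, h]) u (s + x)) /\
  \int[mu]_(x in `[0, L]) (\int[mu]_(s in `[0, h]) u (s + x)) <=
    h * \int[mu]_(t in `[0, L + h]) u t.
Proof.
move=> h0 L0 hu u0.
have LLh : L <= L + h by rewrite lerDl.
pose U x := \int[mu]_(t in `[0, x]) u t.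
have iU : integ mu `[0, L + h]%classic U by exact: integ_primitive.
have iUL : integ mu `[0, L]%classic U by exact: integ_sub iU.
have iUh : integ mu `[0, h]%classic U by apply: integ_sub iU; rewrite lerDr.
have iUs : integ mu `[0, L]%classic (fun x => U (x + h)).
  by apply: integ_itv_shift; apply: i1S iU; rewrite ?add0r.
have iUs' : integ mu `[0, h]%classic (fun x => U (x + L)).
  by apply: integ_itv_shift; apply: i1S iU; rewrite ?add0r// addrC.
have E x : 0 <= x <= L -> U (x + h) - U x = \int[mu]_(s in `[0, h]) u (s + x).
  by move=> xL; rewrite (window_primitive h0 xL hu).
have iD := i1B iUs iUL.
split; first exact: i1eq E iD.
rewrite -(R1eq E) R1B//.
have E1 := Rint_itv_cat h0 L0 iU.
have E2 : \int[mu]_(t in `[0, L + h]) U t = \int[mu]_(t in `[0, L]) U t + \int[mu]_(t in `[0, h]) U (t + L).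
  by rewrite [L + h]addrC Rint_itv_cat// [h + L]addrC.
have U0 x : 0 <= U x by apply: Rintegral_ge0.
have -> : \int[mu]_(x in `[0, L]) U (x + h) - \int[mu]_(x in `[0, L]) U x =
    \int[mu]_(t in `[0, h]) U (t + L) - \int[mu]_(x in `[0, h]) U x.
  have alg (a b c d : R) : a + b = c + d -> b - c = d - a by clear => e; lra.
  exact: (alg _ _ _ _ (etrans (esym E1) E2)).
apply: (@le_trans _ _ (\int[mu]_(t in `[0, h]) U (t + L))).
  by rewrite gerBl Rintegral_ge0.
apply: (@le_trans _ _ (\int[mu]_(t in `[0, h]) (U (L + h)))).
  apply: R1le => //; first exact: i1c.
  apply: aeW => t /andP[t0 th]; apply: Rint_itv_le => //.
  by rewrite addr_ge0//= addrC lerD2l.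
by rewrite R1c// subr0 mulrC.
Qed.

Lemma window_sqr_le L h x u : 0 < h -> 0 <= x <= L -> sq_integ mu `[0, L + h]%classic u ->
  (h^-1 * \int[mu]_(s in `[0, h]) u (s + x)) ^+ 2 <=
  h^-1 * \int[mu]_(s in `[0, h]) (u (s + x) ^+ 2).
Proof.
move=> h0 /andP[x0 xL] su.
have S : sq_integ mu `[x, h + x]%classic u.
  by apply: s1S su => //; rewrite addrC lerD2r.
have S' : sq_integ mu `[0 + x, h + x]%classic u by rewrite add0r.
have sw : sq_integ mu `[0, h]%classic (fun s => u (s + x)).
  split; last by have := integ_itv_shift S'.2.
  exact: integ_mfun (integ_itv_shift (s1i S')).
rewrite exprMn expr2 -mulrA ler_pM2l ?invr_gt0//.
by rewrite -ler_pdivlMl ?invr_gt0// invrK; exact: sqr_Rint_le (ltW h0) sw.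
Qed.

(** If [f] exceeded [k] at all good points, its integral would be too large; exceptional null sets
    do not matter. *)
Lemma mean_point a b k f (P : R -> Prop) : a < b -> integ mu `[a, b]%classic f ->
  {ae mu, forall x, a < x < b -> P x} -> \int[mu]_(x in `[a, b]) f x < k * (b - a) ->
  exists2 x, a < x < b & P x /\ f x <= k.
Proof.
move=> ab hf hP hk; apply: contrapT => nex.
have : k * (b - a) <= \int[mu]_(x in `[a, b]) f x.
  rewrite -(R1c k (ltW ab)); apply: R1le => //; first exact: i1c.
  apply: (aeS3 hP (ae_neq a) (ae_neq b)) => x Px xa xb /andP[h1 h2].
  rewrite leNgt; apply/negP => fk; apply: nex.
  have xab : a < x < b by rewrite !lt_neqAle eq_sym xa xb h1 h2.
  by exists x => //; split; [exact: Px|exact: ltW].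
by rewrite leNgt hk.
Qed.

Lemma Rint_indic_le a b c d : c <= d -> \int[mu]_(x in `[a, b]) \1_(`[c, d]%classic) x <= d - c.
Proof.
move=> cd; rewrite /Rintegral integral_indic//.
have -> : d - c = fine (mu `[c, d]%classic) by rewrite fine_lebesgue_itv.
apply: fine_le.
- by rewrite ge0_fin_numE// (le_lt_trans _ (itv_finite c d))// le_measure// inE//; exact: measurableI.
- by rewrite ge0_fin_numE// itv_finite.
- by rewrite le_measure// inE//; exact: measurableI.
Qed.

Lemma primitive_increment_le a b L x1 x2 g : 0 <= a -> a <= x1 -> x1 <= x2 -> x2 <= b -> b <= L ->
  integ mu `[0, L]%classic g ->
  `|\int[mu]_(t in `[0, x2]) g t - \int[mu]_(t in `[0, x1]) g t| <= \int[mu]_(t in `[a, b]) `|g t|.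
Proof.
move=> a0 ax xx xb bL hg.
have x10 : 0 <= x1 by exact: le_trans ax.
have hg2 : integ mu `[0, (x2 - x1) + x1]%classic g.
  by rewrite subrK; apply: integ_sub hg; exact: le_trans bL.
have := Rint_itv_cat x10 (_ : 0 <= x2 - x1) hg2; rewrite subr_ge0 subrK => /(_ xx) ->.
rewrite addrAC subrr add0r Rint_itv_shift ?add0r ?subrK; last first.
  by apply: (@measurable_funS _ _ _ _ `[0, L]%classic) (integ_mfun hg) => //;
    apply: subset_itv; rewrite bnd_simp ?add0r ?subrK// (le_trans xb).
have i12 : integ mu `[x1, x2]%classic g by apply: i1S hg => //; exact: le_trans bL.
apply: le_trans (le_normr_Rintegral _ i12) _ => //.
have iab : integ mu `[a, b]%classic g by apply: i1S hg.
have nab : integ mu `[a, b]%classic (fun t => `|g t|) by exact: integ_norm.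
have n12 : integ mu `[x1, x2]%classic (fun t => `|g t|) by exact: integ_norm.
rewrite /Rintegral; apply: fine_le.
- by apply: integrable_fin_num.
- by apply: integrable_fin_num.
- apply: ge0_subset_integral => //.
  + exact: (integrableP _ _ _ nab).1.
  + by apply: subset_itv; rewrite bnd_simp.
Qed.

End Averages.

(** * Pointwise inequalities *)

Section Elementary_inequalities.
Context {R : realType}.
Implicit Types (a c p q s w K M n m F X J G : R).

Lemma abs_le_young K M a w : 0 < K -> 0 < M -> a ^+ 2 <= 1 - w ->
  a <= K + (1 + M) / (4 * K) + (16 * K * M)^-1 * w ^+ 2.
Proof.
move=> K0 M0 aW.
have h1 : 4 * K * a <= 4 * K ^+ 2 + a ^+ 2.
  by have := sqr_ge0 (2 * K - a); rewrite !expr2; lra.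
have h2 : - w * (4 * M) <= 4 * M ^+ 2 + w ^+ 2.
  by have := sqr_ge0 (2 * M + w); rewrite !expr2; lra.
have -> : K + (1 + M) / (4 * K) + (16 * K * M)^-1 * w ^+ 2 =
    (16 * K * M)^-1 * (16 * M * K ^+ 2 + 4 * M * (1 + M) + w ^+ 2).
  by field; rewrite !gt_eqF.
rewrite mulrC ler_pdivlMr ?mulr_gt0//.
have h3 : 4 * M * (4 * K * a) <= 4 * M * (4 * K ^+ 2 + (1 - w)).
  by rewrite ler_pM2l ?mulr_gt0// (le_trans h1)// lerD2l.
by move: h3 h2; rewrite !expr2; lra.
Qed.

(* The first component of the Jin-Kohn vector field. *)
Definition jk p q := q * (1 - p ^+ 2 - q ^+ 2 / 3).

Lemma jkE p q : jk p q = q * (1 - (p ^+ 2 + q ^+ 2)) + 2 / 3 * q ^+ 3.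
Proof. by rewrite /jk; field. Qed.

Lemma young_half a c : a * c <= a ^+ 2 / 2 + c ^+ 2 / 2.
Proof. by have := sqr_ge0 (a - c); rewrite !expr2; lra. Qed.

(** Over [q >= 0] the maximum of [q - q^3 / 3] is [2 / 3], at [q = 1], and [p] only lowers the
    value. For [q < 0] the cubic term in [jkE] is negative, and [q w] is absorbed by [w^2] and part
    of the constant. *)
Lemma jk_le p q : jk p q <= 2 / 3 + 2 * (1 - (p ^+ 2 + q ^+ 2)) ^+ 2.
Proof.
have p2 := sqr_ge0 p; have q2 := sqr_ge0 q.
set w := 1 - _; have w2 := sqr_ge0 w.
have [q0|q0] := leP 0 q.
  have h : 0 <= q * p ^+ 2 by rewrite mulr_ge0.
  have h2 : 0 <= (q - 1) ^+ 2 * (q + 2) by rewrite mulr_ge0 ?sqr_ge0// addr_ge0.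
  have -> : jk p q = 2 / 3 - q * p ^+ 2 - (q - 1) ^+ 2 * (q + 2) / 3 by rewrite /jk; field.
  by move: h h2 w2; lra.
rewrite jkE -/w.
have h1 : q ^+ 3 <= 0 by rewrite exprS mulr_le0_ge0// ltW.
have h2 : q * w <= q ^+ 2 / 4 + w ^+ 2.
  by have := sqr_ge0 (q / 2 - w); rewrite !expr2; lra.
have h3 : - w <= 1 / 2 + w ^+ 2 / 2.
  by have := sqr_ge0 (1 + w); rewrite !expr2; lra.
have h4 : q ^+ 2 <= 1 - w by rewrite /w; lra.
by lra.
Qed.

(** There is no constant term: this is the bound for the region above the Neumann part, where [q] is
    small in [L^2]. A large [q] forces [- w >= q^2 / 2], so that [w^2] pays for the quartic term. *)
Lemma jk_le_sqr p q : jk p q <= 2 * q ^+ 2 + 2 * (1 - (p ^+ 2 + q ^+ 2)) ^+ 2.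
Proof.
have p2 := sqr_ge0 p; have q2 := sqr_ge0 q.
rewrite jkE; set w := 1 - _; have w2 := sqr_ge0 w.
have h1 := young_half q w.
have h2 : q ^+ 3 <= q ^+ 2 / 2 + (q ^+ 2) ^+ 2 / 2.
  by rewrite exprS; exact: le_trans (young_half _ _) _.
have h3 : (q ^+ 2) ^+ 2 <= 2 * q ^+ 2 + 4 * w ^+ 2.
  have [q22|q22] := leP (q ^+ 2) 2.
    have : q ^+ 2 * q ^+ 2 <= 2 * q ^+ 2 by rewrite ler_wpM2r.
    by rewrite [(q ^+ 2) ^+ 2]expr2; lra.
  have hw : q ^+ 2 / 2 <= - w by rewrite /w; lra.
  have : (q ^+ 2 / 2) ^+ 2 <= (- w) ^+ 2 by rewrite lerXn2r// nnegrE; lra.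
  by rewrite sqrrN expr_div_n [(2 : R) ^+ 2]expr2; lra.
by lra.
Qed.

(** Only the squares of [q - s] and [W] have integrals bounded uniformly in the height, so the
    linear remainder of the expansion at [q = s] is split by Young's inequality with a free
    parameter [m]. *)
Lemma jk_ge p q s m : 0 <= s <= 1 -> 0 < m <= 1 ->
  2 / 3 * s ^+ 3 - 2 * (m + ((q - s) ^+ 2 + (1 - (p ^+ 2 + q ^+ 2)) ^+ 2) / m) <= jk p q.
Proof.
move=> /andP[s0 s1] /andP[m0 m1].
have p2 := sqr_ge0 p; rewrite jkE; set w := 1 - _; set c := q - s.
have w2 := sqr_ge0 w; have c2 := sqr_ge0 c.
set n := m^-1; have n1 : 1 <= n by rewrite /n invf_ge1.
have mn : m * n = 1 by rewrite /n mulfV// gt_eqF.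
have young a : 2 * a <= m + a ^+ 2 * n.
  have h : 0 <= n * (a - m) ^+ 2 by rewrite mulr_ge0 ?sqr_ge0// (le_trans ler01).
  have E : n * (a - m) ^+ 2 = a ^+ 2 * n - 2 * a * (m * n) + m * (m * n) by ring.
  by move: h; rewrite E mn !mulr1; lra.
have wn : w ^+ 2 <= w ^+ 2 * n by rewrite ler_peMr.
have cn : c ^+ 2 <= c ^+ 2 * n by rewrite ler_peMr.
have y1 := young `|w|; rewrite real_normK ?num_real// in y1.
have y2 := young `|c|; rewrite real_normK ?num_real// in y2.
have aw0 := normr_ge0 w; have ac0 := normr_ge0 c.
have sw : - `|w| <= s * w.
  have : `|s * w| <= `|w| by rewrite normrM ler_piMl// ger0_norm.
  by rewrite ler_norml => /andP[].
have yc := young_half c (- w); rewrite sqrrN mulrN in yc.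
have yc' := young_half `|c| `|w|; rewrite !real_normK ?num_real// in yc'.
pose T := q ^+ 2 + q * s + s ^+ 2.
have T0 : 0 <= T.
  have -> : T = (q + s / 2) ^+ 2 + 3 / 4 * s ^+ 2 by rewrite /T; field.
  by rewrite addr_ge0 ?sqr_ge0// mulr_ge0 ?sqr_ge0// divr_ge0.
have s21 : s ^+ 2 <= 1 by rewrite expr_le1.
have q2w : q ^+ 2 <= 1 - w by rewrite /w; lra.
have wle : - w <= `|w| by rewrite -normrN ler_norm.
have Tle : T <= 3 + 3 / 2 * `|w|.
  have := young_half q s; rewrite /T => h; lra.
have cT : - (`|c| * (3 + 3 / 2 * `|w|)) <= c * T.
  have h1 : `|c * T| <= `|c| * (3 + 3 / 2 * `|w|).
    by rewrite normrM [`|T|]ger0_norm// ler_wpM2l.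
  exact: lerNnormlW h1.
have -> : q * w + 2 / 3 * q ^+ 3 = s * w + c * w + (2 / 3 * s ^+ 3 + 2 / 3 * (c * T)).
  by rewrite /c /T; ring.
by move: cT; rewrite mulrDl mulrDr mulrCA; lra.
Qed.

Lemma young_cutoff e ex ey w wx wy :
  - (2 * e * w * (ex * wx + ey * wy)) <=
  1 / 4 * (e ^+ 2 * (wx ^+ 2 + wy ^+ 2)) + 4 * ((ex ^+ 2 + ey ^+ 2) * w ^+ 2) :> R.
Proof.
have h1 := sqr_ge0 (e * wx / 2 + 2 * w * ex); have h2 := sqr_ge0 (e * wy / 2 + 2 * w * ey).
by move: h1 h2; rewrite !expr2; lra.
Qed.

Lemma young_window e ex w wx ph : 0 <= e <= 1 ->
  (2 * (e * ex) * w + e ^+ 2 * wx) * ph <=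
  ex ^+ 2 * w ^+ 2 + 1 / 4 * (e ^+ 2 * wx ^+ 2) + 2 * ph ^+ 2 :> R.
Proof.
move=> /andP[e0 e1].
have h1 := sqr_ge0 (ex * w - e * ph); have h2 := sqr_ge0 (e * wx / 2 - e * ph).
have e2 : e ^+ 2 <= 1 by rewrite expr_le1.
have h3 : e ^+ 2 * ph ^+ 2 <= ph ^+ 2 by rewrite ler_piMl ?sqr_ge0.
by move: h1 h2 h3; rewrite !expr2; lra.
Qed.

Lemma window_pointwise (e ex w wx ph d v : R) : 0 <= e <= 1 -> ph ^+ 2 <= v ->
  - (e ^+ 2 * w * d) <= ex ^+ 2 * w ^+ 2 + 1 / 4 * (e ^+ 2 * wx ^+ 2) + 2 * v -
    ((2 * (e * ex) * w + e * e * wx) * ph + e * e * w * d) :> R.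
Proof.
move=> e01 phv; have := young_window ex w wx ph e01.
by rewrite !expr2 in phv *; lra.
Qed.

Lemma caccioppoli_pointwise (e ex ey w wx wy wxx wyy : R) :
  3 / 4 * (e ^+ 2 * (wx ^+ 2 + wy ^+ 2)) <=
  2 * (e * ex) * (w * wx) + e * e * (wx * wx + w * wxx) +
  (2 * (e * ey) * (w * wy) + e * e * (wy * wy + w * wyy)) +
  4 * ((ex ^+ 2 + ey ^+ 2) * w ^+ 2) - e ^+ 2 * w * (wxx + wyy) :> R.
Proof.
have := young_cutoff e ex ey w wx wy.
by rewrite !expr2; lra.
Qed.

Lemma sqr_le_W (p q : R) : p ^+ 2 <= 2 + (1 - (p ^+ 2 + q ^+ 2)) ^+ 2 :> R.
Proof.
have q2 := sqr_ge0 q; set w := 1 - _.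
have h := sqr_ge0 (1 + w); have w2 := sqr_ge0 w; have pw : p ^+ 2 <= 1 - w by rewrite /w; lra.
by clearbody w; rewrite !expr2 in h w2 pw *; lra.
Qed.

(** Of the [3 X / 4] on the left, [X / 4] is used to absorb the term from [IX]; doubling what
    remains gives the constants. *)
Lemma caccioppoli_combine (M F X J ID IX MW If G : R) : J <= 2 * G + MW -> ID <= IX + 2 * If ->
  IX <= J + 1 / 4 * X -> 3 / 4 * X <= 4 * J + ID -> MW <= M * (2 * F) -> If <= 2 * F ->
  X <= 20 * G + (20 * M + 8) * F :> R.
Proof. by lra. Qed.

End Elementary_inequalities.

(** * Lower bound for the length of the Neumann part *)

Section Lower_bound_on_Neumann_length.
Context {R : realType}.
Local Notation mu := (@lebesgue_measure R).
Local Notation leb2 := (mu \x mu)%E.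
Variables (eps l al F : R) (th p q px qx qy : R * R -> R).
Hypothesis C : cell eps l al F th p q px qx qy.
Hypothesis l0 : 0 < l.

Let W z := 1 - (p z ^+ 2 + q z ^+ 2).

Lemma cell_F_ge0 : 0 <= F.
Proof.
have [_ /(_ 0%N isT)] := cell_energy C 0; rewrite !mul1r; apply: le_trans.
by apply: Rintegral_ge0 => z _; rewrite addr_ge0// sqr_ge0.
Qed.

Lemma cell_measurable_W : measurable_fun setT W.
Proof. by have [[_ mp mq] _] := cell_meas C; exact: measurable_W. Qed.

Lemma cell_sq_W H : sq_integ leb2 (rect 0 (3 * l) 0 H) W.
Proof.
split; last by have [] := cell_energy C H.
by apply: measurable_funTS; exact: cell_measurable_W.
Qed.

Lemma cell_sq_f H : sq_integ leb2 (rect 0 (3 * l) 0 H) (fun z => px z + qy z).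
Proof. by have [_ [h1 _ h2]] := cell_sq C H; exact: s2D. Qed.

Lemma cell_energy_le H (k : nat) : (k < 3)%N ->
  \int[leb2]_(z in rect 0 (k.+1%:R * l) 0 H) (px z + qy z) ^+ 2 +
  \int[leb2]_(z in rect 0 (k.+1%:R * l) 0 H) (W z ^+ 2) <= k.+1%:R * F.
Proof.
move=> k3; have [_ /(_ k k3)] := cell_energy C H; rewrite R2D//.
- have [_ h] := cell_sq_f H; apply: i2S h => //.
  by rewrite ler_pM2r// ler_nat.
- have [_ h] := cell_sq_W H; apply: i2S h => //.
  by rewrite ler_pM2r// ler_nat.
Qed.

Lemma cell_int_sub A B D E H (g : R * R -> R) (k : nat) : (k < 3)%N ->
  0 <= A -> B <= k.+1%:R * l -> 0 <= D -> E <= H ->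
  sq_integ leb2 (rect 0 (3 * l) 0 H) g ->
  \int[leb2]_(z in rect A B D E) (g z ^+ 2) <= \int[leb2]_(z in rect 0 (k.+1%:R * l) 0 H) (g z ^+ 2).
Proof.
move=> k3 A0 Bl D0 EH [mg hg].
have hk : integ leb2 (rect 0 (k.+1%:R * l) 0 H) (fun z => g z ^+ 2).
  by apply: i2S hg => //; rewrite ler_pM2r// ler_nat.
have hs : integ leb2 (rect A B D E) (fun z => g z ^+ 2) by exact: i2S hk.
have m1 := @measurable_rect R A B D E. have m2 := @measurable_rect R 0 (k.+1%:R * l) 0 H.
rewrite /Rintegral; apply: fine_le.
- by apply: integrable_fin_num.
- by apply: integrable_fin_num.
- apply: ge0_subset_integral => //.
  + exact: (integrableP _ _ _ hk).1.
  + by move=> z _; rewrite lee_fin sqr_ge0.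
  + exact: rectS.
Qed.

Lemma cell_W_le A B D E H : 0 <= A -> B <= 2 * l -> 0 <= D -> E <= H ->
  \int[leb2]_(z in rect A B D E) (W z ^+ 2) <= 2 * F.
Proof.
move=> A0 Bl D0 EH.
apply: le_trans (@cell_int_sub A B D E H W 1%N isT A0 Bl D0 EH (cell_sq_W H)) _.
apply: le_trans (@cell_energy_le H 1%N isT).
by rewrite lerDr; apply: Rintegral_ge0 => z _; exact: sqr_ge0.
Qed.

Lemma cell_abs_le A B D E H K M (g : R * R -> R) : 0 < K -> 0 < M -> 0 <= A -> B <= 2 * l ->
  0 <= D -> E <= H -> A <= B -> D <= E ->
  measurable_fun setT g -> (forall z, g z ^+ 2 <= 1 - W z) ->
  integ leb2 (rect A B D E) (fun z => `|g z|) /\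
  \int[leb2]_(z in rect A B D E) `|g z| <=
    (K + (1 + M) / (4 * K)) * ((B - A) * (E - D)) + F / (8 * K * M).
Proof.
move=> K0 M0 A0 Bl D0 EH AB DE mg gW.
have sW := cell_sq_W H.
have sWs : sq_integ leb2 (rect A B D E) W.
  by apply: s2S sW => //; rewrite (le_trans Bl)// ler_pM2r// ler_nat.
pose G z := (K + (1 + M) / (4 * K)) + (16 * K * M)^-1 * (W z ^+ 2).
have iG : integ leb2 (rect A B D E) G by apply: i2D; [exact: i2c|apply: i2Z; exact: sWs.2].
have gG z : `|g z| <= G z.
  have a0 := normr_ge0 (g z); set a := `|g z| in a0 *.
  have aW : a ^+ 2 <= 1 - W z by rewrite /a real_normK ?num_real.
  exact: abs_le_young.
have ig : integ leb2 (rect A B D E) (fun z => `|g z|).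
  apply: integ_le iG; first exact: measurable_rect.
    by apply: measurable_funTS; exact: measurableT_comp.
  by move=> z _; rewrite normr_id.
split => //; apply: le_trans (R2le ig iG _) _; first exact: aeW.
rewrite R2D ?R2Z//; [|exact: sWs.2|exact: i2c|by apply: i2Z; exact: sWs.2].
rewrite (R2x (i2c _ _ _ _ _)).
under eq_Rintegral do rewrite R1c//.
rewrite R1c//.
have h := cell_W_le A0 Bl D0 EH.
have := ler_wpM2l (_ : 0 <= (16 * K * M)^-1) h; rewrite invr_ge0 !mulr_ge0 ?(ltW K0) ?(ltW M0)// => /(_ isT).
have -> : (16 * K * M)^-1 * (2 * F) = F / (8 * K * M).
  by field; rewrite !gt_eqF.
by move=> h'; rewrite -mulrA [(E - D) * _]mulrC lerD2l.
Qed.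

Hypothesis al0 : 0 <= al <= l.

(** Over the Dirichlet part [th] starts at 0 on almost every vertical line. The bound is needed on
    horizontal lines, hence the exchange of quantifiers, for which it is expressed by the measurable
    set [P]. *)
Lemma cell_theta_le r : 0 < r ->
  {ae mu, forall y, {ae mu, forall x, 0 <= x < al -> 0 <= y <= r ->
    `|th (x, y)| <= \int[mu]_(t in `[0, r]) `|q (x, t)|}}.
Proof.
move=> r0; have [[mth mp mq] _] := cell_meas C.
have [[_ _ sq] _] := cell_sq C r.
pose Q x := \int[mu]_(t in `[0, r]) `|q (x, t)|.
have iq : integ leb2 (rect 0 (3 * l) 0 r) (fun z => `|q z|).
  by apply: integ_norm; [exact: measurable_rect|exact: s2i].
have mQ : measurable_fun `[0, 3 * l]%classic Q := integ_mfun (i2int1 iq).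
pose Qt := Q \_ `[0, 3 * l]%classic.
have mQt : measurable_fun setT Qt by exact: measurable_patch.
have mR := @measurable_rect R 0 al 0 r.
pose h0 z := `|th z| - Qt z.1.
have mh0 : measurable_fun setT h0.
  apply: measurable_funB; first exact: measurableT_comp.
  by apply: (@measurableT_comp _ _ _ _ _ _ Qt _ fst).
have mh : measurable_fun setT (h0 \_ (rect 0 al 0 r)).
  by apply: (measurable_restrictT _ mR).1; exact: measurable_funTS.
pose P := [set z | (h0 \_ (rect 0 al 0 r)) z <= 0].
have mP : measurable P.
  have -> : P = (h0 \_ (rect 0 al 0 r)) @^-1` `]-oo, 0]%classic.
    by apply/seteqP; split=> z; rewrite /P /= in_itv.
  by have := mh measurableT _ (measurable_itv `]-oo, (0:R)]); rewrite setTI.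
have l30 : al <= 3 * l by case/andP: al0 => _ h1; rewrite (le_trans h1)// ler_peMl ?(ltW l0)// ler1n.
have H : {ae mu, forall x, {ae mu, forall y, P (x, y)}}.
  apply: (aeS2 (cell_bcD C r0) (ae_neq al)) => x hx xal.
  have [x0al|x0al] := boolP (0 <= x < al); last first.
    apply: aeW => y; rewrite /P /= patchE memNset// => /rectE[/= /andP[h1 h2] _].
    by move: x0al; rewrite h1 lt_neqAle xal h2.
  have [b hb] := hx x0al; apply: (aeS (prim_bound hb)) => y hy.
  rewrite /P /= patchE; case: ifPn => //; rewrite inE => /rectE[/= h1 h2].
  have := hy h2; rewrite normr0 add0r /h0 subr_le0 /Qt patchE mem_set//= in_itv/=.
  by have /andP[-> /ltW h3] := x0al; rewrite (le_trans h3).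
have := ae_swap mP H; move=> H'; apply: (aeS H') => y hy; apply: (aeS hy) => x hx x0al yr.
move: hx; rewrite /P /= patchE mem_set; last first.
  by apply/rectE; split => //=; have /andP[-> /ltW ->] := x0al.
rewrite /h0 subr_le0 /Qt patchE mem_set//= in_itv/=.
by have /andP[-> /ltW h3] := x0al; rewrite (le_trans h3).
Qed.

(** A path goes up from a point [x1] before the Neumann part, across it at a height [y], and down to
    a point [x2 + l] of the next Dirichlet part. [th] changes by at most [k] on each of the three
    pieces; comparison of [x2 + l] with [x2] brings in the gain [pi]. *)
Lemma cell_gap r T k : 0 < r -> r <= al -> l - al <= r -> r <= l / 2 ->
  (forall A B, 0 <= A -> A <= B -> B <= 2 * l -> B - A <= 3 * r ->
    \int[leb2]_(z in rect A B 0 r) `|p z| <= T /\ \int[leb2]_(z in rect A B 0 r) `|q z| <= T) ->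
  T < k * r -> pi <= 3 * k.
Proof.
move=> r0 ral br rl hT Tk; have /andP[al00 all] := al0.
have r20 : 0 <= 2 * l by rewrite mulr_ge0// ltW.
have l23 : 2 * l <= 3 * l by rewrite ler_pM2r// ler_nat.
have lr2 : l + r <= 2 * l.
  rewrite mulr_natl mulr2n lerD2l (le_trans rl)// ler_pdivrMr// ler_peMr ?(ltW l0)// ler1n//.
have [[_ sp sq] _] := cell_sq C r.
have ip g A B : sq_integ leb2 (rect 0 (3 * l) 0 r) g -> 0 <= A -> B <= 2 * l ->
    integ leb2 (rect A B 0 r) (fun z => `|g z|).
  move=> sg A0 B2; apply: integ_norm; first exact: measurable_rect.
  by apply: s2i; apply: s2S sg => //; exact: le_trans l23.
pose Q x := \int[mu]_(t in `[0, r]) `|q (x, t)|.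
set A := al - r; set B := l + r.
have A0 : 0 <= A by rewrite subr_ge0.
have AB : A < B by rewrite /A /B ltrBlDr -addrA (le_lt_trans all)// ltrDl addr_gt0.
have BA : B - A <= 3 * r.
  rewrite /A /B (_ : l + r - (al - r) = (l - al) + 2 * r); last by ring.
  by rewrite (_ : 3 * r = r + 2 * r) ?lerD2r//; ring.
have [TpAB _] := hT A B A0 (ltW AB) lr2 BA.
(* The height comes before the two feet, because the vertical bound holds for almost every [x] only
   after [y] is fixed. *)
have [y /andP[y0 yr] [[[a [b hab]] hth] hy]] : exists2 y, 0 < y < r &
    ((exists a b, prim (3 * l) a b (fun x => th (x, y)) (fun x => p (x, y))) /\
     {ae mu, forall x, 0 <= x < al -> 0 <= y <= r -> `|th (x, y)| <= Q x}) /\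
    \int[mu]_(x in `[A, B]) `|p (x, y)| <= k.
  apply: (@mean_point R 0 r k) => //.
  - exact: (i2int2 (ip _ _ _ sp A0 lr2)).
  - apply: (aeS2 (cell_linex C r0) (cell_theta_le r0)) => y h1 h2 /andP[/ltW h3 /ltW h4].
    have [h5 _ _] : [/\ _, _ & _] := h1 (introT andP (conj h3 h4)).
    by split; [exact: h5|exact: h2].
  - rewrite subr0; apply: le_lt_trans Tk.
    by rewrite -(R2y (ip _ _ _ sp A0 lr2)).
have yr' : 0 <= y <= r by rewrite !ltW.
have [ipy fE _] := hab.
have [x1 /andP[Ax1 x1al] [[E1 Q1] k1]] : exists2 x, A < x < al &
    (th (x, y) = a + \int[mu]_(t in `[0, x]) p (t, y) /\ `|th (x, y)| <= Q x) /\ Q x <= k.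
  have al2 : al <= 2 * l by rewrite (le_trans all)// mulr_natl mulr2n lerDr ltW.
  have Aal : A <= al by rewrite /A gerBl ltW.
  have alA : al - A = r by rewrite /A opprB addrCA subrr addr0.
  have r3 : al - A <= 3 * r by rewrite alA ler_peMl ?(ltW r0)// ler1n.
  have [_ Tq] := hT A al A0 Aal al2 r3.
  apply: (@mean_point R A al k) => //.
  - by rewrite /A ltrBlDr ltrDl.
  - exact: (i2int1 (ip _ _ _ sq A0 al2)).
  - apply: (aeS2 fE hth) => x h1 h2 /andP[/ltW h3 h4].
    have x0 : 0 <= x by exact: le_trans h3.
    split; last by apply: h2 => //; rewrite x0.
    by apply: h1; rewrite x0 (le_trans (ltW h4))// (le_trans al2).
  - by rewrite alA; apply: le_lt_trans Tk; rewrite -(R2x (ip _ _ _ sq A0 al2)).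
have [x2 /andP[x20 x2r] [[E2 Q2] k2]] : exists2 x, 0 < x < r &
    (th (x + l, y) = a + \int[mu]_(t in `[0, x + l]) p (t, y) /\ `|th (x, y)| <= Q x) /\ Q x <= k.
  have r2 : r <= 2 * l by rewrite (le_trans _ lr2)// /B lerDr ltW.
  have r3 : r - 0 <= 3 * r by rewrite subr0 ler_peMl ?(ltW r0)// ler1n.
  have [_ Tq] := hT 0 r (lexx 0) (ltW r0) r2 r3.
  apply: (@mean_point R 0 r k) => //.
  - exact: (i2int1 (ip _ _ _ sq (lexx 0) r2)).
  - apply: (aeS2 (ae_shift l fE) hth) => x h1 h2 /andP[h3 h4].
    split; last by apply: h2 => //; rewrite (ltW h3) (lt_le_trans h4).
    apply: h1; apply/andP; split; first by apply: addr_ge0; exact: ltW.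
    apply: (le_trans _ l23); apply: (le_trans _ lr2).
    by rewrite addrC lerD2l ltW.
  - by rewrite subr0; apply: le_lt_trans Tk; rewrite -(R2x (ip _ _ _ sq (lexx 0) r2)).
have Ex : th (x2 + l, y) = th (x2, y) + pi by apply: (cell_theta_per C (z := (x2, y))).
have inc : `|\int[mu]_(t in `[0, x2 + l]) p (t, y) - \int[mu]_(t in `[0, x1]) p (t, y)| <= k.
  apply: le_trans hy.
  apply: (@primitive_increment_le R A B (3 * l)) => //; [exact: ltW| | |exact: le_trans l23].
    by rewrite (le_trans (ltW x1al))// (le_trans all)// lerDr ltW.
  by rewrite /B addrC lerD2l ltW.
have -> : pi = (\int[mu]_(t in `[0, x2 + l]) p (t, y) - \int[mu]_(t in `[0, x1]) p (t, y))
    + (th (x1, y) - th (x2, y)).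
  have e1 : th (x2 + l, y) - th (x2, y) = pi by rewrite Ex addrAC subrr add0r.
  by rewrite -e1 E2 E1; ring.
rewrite (_ : 3 * k = k + (k + k)); last by ring.
apply: lerD; first exact: le_trans (ler_norm _) inc.
apply: le_trans (ler_norm _) _; apply: le_trans (ler_normB _ _) _.
by apply: lerD; [exact: le_trans Q1 k1|exact: le_trans Q2 k2].
Qed.

Lemma cell_gap_lower E0 : 0 < E0 -> F <= E0 -> 2 <= l ->
  (41 * (1 + 27 * E0 / 2))^-1 <= l - al.
Proof.
move=> E00 FE l2; rewrite leNgt; apply/negP; set r := _^-1 => br.
(* With [K = 1 / (9 r)] this value turns the energy term of [cell_abs_le] into [r / 12], and
   [r (1 + M) = 1 / 41] makes the middle term negligible. *)
pose M := 27 * E0 / 2; have M0 : 0 < M by rewrite /M divr_gt0// mulr_gt0.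
have F0 := cell_F_ge0.
have D0 : 0 < 41 * (1 + M) by rewrite mulr_gt0// addr_gt0.
have r0 : 0 < r by rewrite invr_gt0.
have r1 : r <= 1 / 41.
  by rewrite /r -/M ler_pdivlMr// mulrC -ler_pdivlMr ?invr_gt0// invrK mul1r ler_peMr// lerDl ltW.
have rM : r * (1 + M) = 1 / 41 by rewrite /r -/M; field; rewrite gt_eqF// addr_gt0.
have ral : r <= al by move: br r1 l2; lra.
have rl : r <= l / 2 by move: r1 l2; lra.
have K0 : 0 < (9 * r)^-1 by rewrite invr_gt0 mulr_gt0.
pose T := ((9 * r)^-1 + (1 + M) / (4 * (9 * r)^-1)) * (3 * r * r) + E0 / (8 * (9 * r)^-1 * M).
have TE : T = r / 3 + 27 / 4 * r * (r * (r * (1 + M))) + r / 12.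
  by rewrite /T /M; field; rewrite !gt_eqF// mulr_gt0.
(* [T] is about [5 r / 12], hence below [k r], while [3 k = 19 / 10] is below [2 <= pi]. *)
pose k := 19 / 30 : R.
have Tk : T < k * r.
  rewrite TE rM /k; have : r * r <= 1 / 41 * r by rewrite ler_pM2r.
  by move: r0; lra.
have [[_ mp mq] _] := cell_meas C.
have big (g : R * R -> R) : measurable_fun setT g -> (forall z, g z ^+ 2 <= 1 - W z) ->
    forall A B, 0 <= A -> A <= B -> B <= 2 * l -> B - A <= 3 * r ->
    \int[leb2]_(z in rect A B 0 r) `|g z| <= T.
  move=> mg gW A B A0 AB B2 BA.
  have [_] := cell_abs_le K0 M0 A0 B2 (lexx 0) (lexx r) AB (ltW r0) mg gW.
  move=> /le_trans; apply; rewrite /T subr0; apply: lerD.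
    apply: ler_wpM2l; last by rewrite ler_wpM2r// ltW.
    by rewrite addr_ge0 ?(ltW K0)// divr_ge0 ?mulr_ge0 ?addr_ge0 ?(ltW K0) ?(ltW M0).
  have P0 : 0 < 8 * (9 * r)^-1 * M by rewrite !mulr_gt0.
  by rewrite ler_pM2r ?invr_gt0.
have : pi <= 3 * k.
  apply: (@cell_gap r T k r0 ral (ltW br) rl) => // A B A0 AB B2 BA; split.
    apply: big => // z; rewrite /W opprB addrCA subrr addr0 lerDl; exact: sqr_ge0.
  apply: big => // z; rewrite /W opprB addrCA subrr addr0 lerDr; exact: sqr_ge0.
have := pi_ge2 R; rewrite /k; move: (pi : R) => x h1 h2; lra.
Qed.

End Lower_bound_on_Neumann_length.

(** * Smooth steps and plateaus *)

Section Plateau.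
Context {R : realType}.
Local Notation mu := (@lebesgue_measure R).
Implicit Types t : R.

Lemma step_exists : exists Z : R -> R, [/\ smooth1 Z, forall t, t <= 1 -> Z t = 1,
  forall t, 2 <= t -> Z t = 0, forall t, 0 <= Z t <= 1 & forall t, derive1 Z t <= 0].
Proof.
pose h : R -> R := bump 1 2 1.
have sh : smooth1 h := @bump_smooth R 1 2 1.
have ch : continuous h := smooth1_cont sh.
have h0 t : 0 <= h t by exact: bump_ge0.
have hout t : ~~ (1 < t < 2) -> h t = 0 by exact: bump_out.
pose I t := \int[mu]_(s in `[0, t]) h s.
have m0 : 0 < I 2.
  apply: (@Rint_continuous_gt0 R 0 2 h (3 / 2)) => //; first by lra.
  by apply: bump_gt0; lra.
have I1 t : t <= 1 -> I t = 0.
  move=> t1; apply: Rint0 => s; rewrite /= in_itv/= => /andP[_ st]; apply: hout.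
  by rewrite negb_and -!leNgt (le_trans st t1).
have I2 t : 2 <= t -> I t = I 2.
  move=> t2; have -> : t = (t - 2) + 2 by rewrite subrK.
  rewrite /I Rint_itv_cat ?subr_ge0//; last exact: continuous_integ.
  rewrite [X in _ + X]Rint0 ?addr0// => s; rewrite /= in_itv/= => /andP[s0 _].
  by apply: hout; rewrite negb_and -!leNgt lerDr s0 orbT.
have I0 t : 0 <= I t by apply: Rintegral_ge0 => s _; exact: h0.
have Im t : I t <= I 2.
  have [t2|/ltW t2] := leP t 2; last by rewrite I2.
  have [t0|/ltW t0] := leP 0 t; last by rewrite I1 ?(ltW m0)// (le_trans t0)// ler01.
  by apply: Rint_itv_le => //; [rewrite t0|exact: continuous_integ].
have dI t : is_derive t (1 : R) I (h t).
  apply: (@is_derive_int0 R h 1) => // s s1; apply: hout.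
  by rewrite negb_and -!leNgt s1.
pose Z t := 1 + (- (I 2)^-1) * I t.
have dZ t : is_derive t (1 : R) Z ((- (I 2)^-1) * h t).
  have d1 : is_derive t (1 : R) (fun=> 1 : R) 0 by exact: is_derive_cst.
  have d2 : is_derive t (1 : R) (fun=> - (I 2)^-1 : R) 0 by exact: is_derive_cst.
  apply: (is_derive_eq (is_deriveD d1 (is_deriveM d2 (dI t)))).
  by rewrite /GRing.scale/= mulr0 addr0 add0r.
exists Z; split.
- apply: (smooth1_primitive dZ); apply: smooth1M => //; exact: smooth1_cst.
- by move=> t t1; rewrite /Z (I1 t t1) mulr0 addr0.
- by move=> t t2; rewrite /Z (I2 t t2) mulNr mulVf ?subrr// gt_eqF.
- move=> t; rewrite /Z mulNr mulrC subr_ge0 ler_pdivrMr// mul1r Im/=.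
  by rewrite gerBl divr_ge0// ltW.
- move=> t; rewrite derive1E; have [_ ->] := dZ t.
  by rewrite mulNr oppr_le0 mulr_ge0// invr_ge0 ltW.
Qed.

Lemma plateau_exists : exists (B : R -> R) (C0 : R), [/\ smooth1 B,
  forall t, `|t| <= 1 -> B t = 1, forall t, 2 <= `|t| -> B t = 0,
  forall t, 0 <= B t <= 1 & [/\ forall t, 0 <= t -> derive1 B t <= 0,
  1 <= C0 & forall t, `|derive1 B t| <= C0]].
Proof.
have [Z [sZ Z1 Z0 Z01 dZ]] := step_exists.
(* Squaring the argument makes the plateau even and smooth at 0. *)
pose B t := Z (t * t).
have sid : smooth1 (fun t : R => t).
  by apply: (@smooth1_primitive R _ (fun=> 1)); exact: smooth1_cst.
have sB : smooth1 B by apply: smooth1_comp => //; exact: smooth1M.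
have B0 t : 2 <= `|t| -> B t = 0.
  move=> t2; apply: Z0; rewrite -expr2 -real_normK ?num_real// expr2.
  by rewrite (le_trans t2)// ler_peMl// (le_trans _ t2)// ler1n.
have suppB : supp_in B (- 2) 2.
  by move=> t ht; apply: B0; rewrite leNgt ltr_norml.
have [K hK] := smooth1_bounded (smooth1_cont (smooth1_derive sB)) (derive1_supp sB suppB).
exists B, (Num.max 1 K); split => //.
- move=> t t1; apply: Z1; rewrite -expr2 -real_normK ?num_real// expr2.
  by rewrite mulr_ile1.
- by move=> t; exact: Z01.
- split; last by move=> t; rewrite le_max hK orbT.
    move=> t t0; rewrite derive1E.
    have d1 : is_derive t (1 : R) (fun t : R => t * t) (t + t).
      have di : is_derive t (1 : R) (fun t : R => t) 1 by exact: is_derive_id.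
      by apply: (is_derive_eq (is_deriveM di di)); rewrite /GRing.scale/= !mulr1.
    have [_ ->] := @is_derive1_comp R Z (fun t => t * t) t _ _ (smooth1_is_derive (t * t) sZ) d1.
    by rewrite mulr_le0_ge0// ?dZ// addr_ge0.
  by rewrite le_max lexx.
Qed.

Lemma smooth1_affine (k c : R) : smooth1 (fun t => k * (t - c)).
Proof.
apply: (@smooth1_primitive R _ (fun=> k)); last exact: smooth1_cst.
move=> t; have := is_derive_affine k (- (k * c)) t; congr (is_derive _ _ _ _).
by apply/funext => s; rewrite /GRing.scale/=; ring.
Qed.

Lemma is_derive_rescale (B : R -> R) (k c t : R) : smooth1 B ->
  is_derive t (1 : R) (fun t => B (k * (t - c))) (k * derive1 B (k * (t - c))).
Proof.
move=> sB.
have d1 : is_derive t (1 : R) (fun t => k * (t - c)) k.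
  have := is_derive_affine k (- (k * c)) t; congr (is_derive _ _ _ _).
  by apply/funext => s; rewrite /GRing.scale/=; ring.
have := @is_derive1_comp R B (fun t => k * (t - c)) t _ _ (smooth1_is_derive _ sB) d1.
by rewrite mulrC.
Qed.

Lemma derive1_rescale (B : R -> R) (k c t : R) : smooth1 B ->
  derive1 (fun t => B (k * (t - c))) t = k * derive1 B (k * (t - c)).
Proof. by move=> sB; rewrite derive1E; case: (is_derive_rescale k c t sB). Qed.

Lemma derive1M_smooth (f g : R -> R) t : smooth1 f -> smooth1 g ->
  derive1 (fun t => f t * g t) t = derive1 f t * g t + f t * derive1 g t.
Proof.
move=> sf sg; have [_ E] := is_deriveM (smooth1_is_derive t sf) (smooth1_is_derive t sg).
by rewrite [LHS]derive1E E /GRing.scale/= addrC [g t * _]mulrC.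
Qed.

Lemma derive1B_smooth (f g : R -> R) t : smooth1 f -> smooth1 g ->
  derive1 (fun t => f t - g t) t = derive1 f t - derive1 g t.
Proof.
move=> sf sg; have [_ E] := is_deriveB (smooth1_is_derive t sf) (smooth1_is_derive t sg).
by rewrite [LHS]derive1E E.
Qed.

End Plateau.

(** * Difference quotients and the Caccioppoli inequality *)

Section Difference_quotients.
Context {R : realType}.
Local Notation mu := (@lebesgue_measure R).
Local Notation leb2 := (mu \x mu)%E.
Implicit Types (u c : R * R -> R) (h l H : R).

Definition dq h u (z : R * R) : R := h^-1 * (u (xshift h z) - u z).

Lemma measurable_dq h u : measurable_fun setT u -> measurable_fun setT (dq h u).
Proof.
move=> mu0; apply: measurable_funM => //; apply: measurable_funB => //.
by apply: measurableT_comp mu0 _; exact: measurable_xshift.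
Qed.

Lemma sq_integ_xshift A B D E h u : measurable_fun setT u ->
  sq_integ leb2 (rect (A + h) (B + h) D E) u ->
  sq_integ leb2 (rect A B D E) (fun z => u (xshift h z)).
Proof.
move=> mu0 [_ hu].
have mus : measurable_fun setT (fun z => u (xshift h z)).
  by apply: measurableT_comp mu0 _; exact: measurable_xshift.
split; first exact: measurable_funTS.
have mR := @measurable_rect R (A + h) (B + h) D E.
case/integrableP: hu => mu2 hu; apply/integrableP; split.
  by apply/measurable_EFinP; apply: measurable_funTS; exact: measurable_funX.
rewrite integral_mkcond; apply: le_lt_trans hu; rewrite [leRHS]integral_mkcond.
have mP : measurable_fun setT ((abse \o (EFin \o (fun z => u z ^+ 2))) \_ (rect (A + h) (B + h) D E)).
  by apply: (measurable_restrictT _ mR).1; exact: measurableT_comp.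
rewrite -(@int_xshift R h _ mP) le_eqVlt; apply/orP; left; apply/eqP.
apply: eq_integral => z _; rewrite !patchE.
have -> // : (xshift h z \in rect (A + h) (B + h) D E) = (z \in rect A B D E).
by apply/idP/idP; rewrite !inE => /rectE[/= h1 h2]; apply/rectE; move: h1; rewrite /= !lerD2r.
Qed.

Lemma sq_integ_dq h l H u : 0 <= h <= l -> measurable_fun setT u ->
  sq_integ leb2 (rect 0 (3 * l) 0 H) u -> sq_integ leb2 (rect 0 (2 * l) 0 H) (dq h u).
Proof.
move=> /andP[h0 hl] mu0 su; apply: s2Z.
have l0 : 0 <= l by exact: le_trans hl.
have E3 : 3 * l = 2 * l + l by ring.
apply: s2B; last by apply: s2S su => //; rewrite E3 lerDl.
by apply: sq_integ_xshift => //; apply: s2S su; rewrite ?add0r// E3 lerD2l.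
Qed.

Lemma integ_contM A B D E c u : continuous c -> integ leb2 (rect A B D E) u ->
  integ leb2 (rect A B D E) (fun z => c z * u z).
Proof.
move=> cc hu; have [K hK] := @continuous_bounded2 R c A B D E cc.
apply: (@integ_bndM _ _ _ leb2 _ _ _ K) => //; first exact: measurable_rect.
by apply: measurable_funTS; exact: continuous_measurable2.
Qed.

Lemma prim_dq_line L h a b (f g : R -> R) : 0 <= h -> 0 <= L -> prim (L + h) a b f g ->
  exists a' b', prim L a' b' (fun x => h^-1 * (f (x + h) - f x)) (fun x => h^-1 * (g (x + h) - g x)).
Proof.
move=> h0 L0 hf; have LLh : L <= L + h by rewrite lerDl.
have [b' hf'] := prim_sub LLh hf.
by have := primZ h^-1 (primB (prim_shift h0 L0 hf) hf'); do 2 eexists; exact: H.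
Qed.

End Difference_quotients.

Section Caccioppoli.
Context {R : realType}.
Local Notation mu := (@lebesgue_measure R).
Local Notation leb2 := (mu \x mu)%E.
Variables (eps l al F : R) (th p q px qx qy : R * R -> R).
Hypothesis C : cell eps l al F th p q px qx qy.
Hypothesis l0 : 0 < l.
Hypothesis al0 : 0 <= al <= l.
Variables (r h H : R) (eta : R * R -> R).
Hypothesis r0 : 0 < r.
Hypothesis hr : 0 < h < r.
Hypothesis rl : r <= l.
Hypothesis H0 : 0 < H.
Hypothesis seta : smooth eta.
Hypothesis eta01 : forall z, 0 <= z.2 -> 0 <= eta z <= 1.
Hypothesis eta_top : forall x, eta (x, H) = 0.
Hypothesis eta_corner : forall x, `|x| < r \/ `|x - al| < r \/ `|x - l| < r -> eta (x, 0) = 0.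
Hypothesis eta_per : forall y, eta (l, y) = eta (0, y).

Let W z := 1 - (p z ^+ 2 + q z ^+ 2).
Let f z := px z + qy z.
Let w := dq h th.
Let wx := dq h p.
Let wy := dq h q.
Let wxx := dq h px.
Let wyy := dq h qy.
Let ex := 'D_(dirx R) eta.
Let ey := 'D_(diry R) eta.

Let h0 : 0 < h. Proof. by case/andP: hr. Qed.
Let hl : 0 <= h <= l.
Proof. by rewrite (ltW h0)/=; case/andP: hr => _ /ltW /le_trans; apply. Qed.

Let mw : measurable_fun setT w.
Proof. by have [[m _ _] _] := cell_meas C; exact: measurable_dq. Qed.
Let mwx : measurable_fun setT wx.
Proof. by have [[_ m _] _] := cell_meas C; exact: measurable_dq. Qed.
Let mwy : measurable_fun setT wy.
Proof. by have [[_ _ m] _] := cell_meas C; exact: measurable_dq. Qed.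

Let sw : sq_integ leb2 (rect 0 (2 * l) 0 H) w.
Proof. by have [[m _ _] _] := cell_meas C; have [[s _ _] _] := cell_sq C H; exact: sq_integ_dq. Qed.
Let swx : sq_integ leb2 (rect 0 (2 * l) 0 H) wx.
Proof. by have [[_ m _] _] := cell_meas C; have [[_ s _] _] := cell_sq C H; exact: sq_integ_dq. Qed.
Let swy : sq_integ leb2 (rect 0 (2 * l) 0 H) wy.
Proof. by have [[_ _ m] _] := cell_meas C; have [[_ _ s] _] := cell_sq C H; exact: sq_integ_dq. Qed.
Let swxx : sq_integ leb2 (rect 0 (2 * l) 0 H) wxx.
Proof. by have [_ [m _ _]] := cell_meas C; have [_ [s _ _]] := cell_sq C H; exact: sq_integ_dq. Qed.
Let swyy : sq_integ leb2 (rect 0 (2 * l) 0 H) wyy.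
Proof. by have [_ [_ _ m]] := cell_meas C; have [_ [_ _ s]] := cell_sq C H; exact: sq_integ_dq. Qed.

Let l2 : l <= 2 * l. Proof. by rewrite mulr_natl mulr2n lerDr ltW. Qed.
Let ll u : sq_integ leb2 (rect 0 (2 * l) 0 H) u -> sq_integ leb2 (rect 0 l 0 H) u.
Proof. by move=> s; apply: s2S s. Qed.

Let ceta : continuous eta. Proof. exact: smooth_cont. Qed.
Let cex : continuous ex. Proof. by apply: smooth_cont; apply: smooth_derive => //; left. Qed.
Let cey : continuous ey. Proof. by apply: smooth_cont; apply: smooth_derive => //; right. Qed.
Let cM (f1 g1 : R * R -> R) : continuous f1 -> continuous g1 -> continuous (fun z => f1 z * g1 z).
Proof. by move=> cf cg z; apply: cvgM; [exact: cf|exact: cg]. Qed.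

(** [TX] and [TY] are the two terms of the divergence of [eta^2 w (w_x, w_y)], which integrates to
    0. *)
Let TX z := 2 * (eta z * ex z) * (w z * wx z) + eta z * eta z * (wx z * wx z + w z * wxx z).
Let TY z := 2 * (eta z * ey z) * (w z * wy z) + eta z * eta z * (wy z * wy z + w z * wyy z).

Let iTX : integ leb2 (rect 0 l 0 H) TX.
Proof.
apply: i2D.
  have c2 : continuous (fun z => 2 * (eta z * ex z)).
    by apply: cM; [exact: cst_continuous|exact: cM].
  by apply: integ_contM => //; apply: s2M; exact: ll.
have c2 : continuous (fun z => eta z * eta z) by exact: cM.
by apply: integ_contM => //; apply: i2D; apply: s2M; exact: ll.
Qed.

Let iTY : integ leb2 (rect 0 l 0 H) TY.
Proof.
apply: i2D.
  have c2 : continuous (fun z => 2 * (eta z * ey z)).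
    by apply: cM; [exact: cst_continuous|exact: cM].
  by apply: integ_contM => //; apply: s2M; exact: ll.
have c2 : continuous (fun z => eta z * eta z) by exact: cM.
by apply: integ_contM => //; apply: i2D; apply: s2M; exact: ll.
Qed.

Let line_y (u : R * R -> R) (x : R) : measurable_fun setT u ->
  measurable_fun `[0, H]%classic (fun y => u (x, y)).
Proof. by move=> m; apply: measurable_funTS; exact: (measurableT_comp m (pair1_measurable x)). Qed.
Let line_x (u : R * R -> R) (L y : R) : measurable_fun setT u ->
  measurable_fun `[0, L]%classic (fun x => u (x, y)).
Proof. by move=> m; apply: measurable_funTS; exact: (measurableT_comp m (pair2_measurable y)). Qed.

Let sqeta_y x : prim H (eta (x, 0) * eta (x, 0)) (eta (x, H) * eta (x, H))
  (fun y => eta (x, y) * eta (x, y)) (fun y => 2 * (eta (x, y) * ey (x, y))).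
Proof.
have e1 := slice_prim_y x (ltW H0) seta.
have meta : measurable_fun setT eta by exact: continuous_measurable2.
have e2 := prim_mul (ltW H0) (line_y x meta) (line_y x meta) e1 e1.
by apply: prim_eq e2 (ltW H0) => y _; rewrite /ey; ring.
Qed.

Let sqeta_x y : prim l (eta (0, y) * eta (0, y)) (eta (l, y) * eta (l, y))
  (fun x => eta (x, y) * eta (x, y)) (fun x => 2 * (eta (x, y) * ex (x, y))).
Proof.
have e1 : prim l (eta (0, y)) (eta (l, y)) (fun x => eta (x, y)) (fun x => ex (x, y)).
  apply: (@prim_C1 R l (fun x => eta (x, y))); first exact: ltW.
    by move=> t; exact: slice_derive_x.
  exact: (@continuous_slice_x R ex y cex).
have meta : measurable_fun setT eta by exact: continuous_measurable2.
have e2 := prim_mul (ltW l0) (line_x y meta) (line_x y meta) e1 e1.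
by apply: prim_eq e2 (ltW l0) => x _; rewrite /ex; ring.
Qed.

Let msq : measurable_fun setT (fun z => eta z * eta z).
Proof. by apply: continuous_measurable2; exact: cM. Qed.

(* At y = 0 one of the factors of [eta^2 w w_y] vanishes: [w] on the Dirichlet
   part, [w_y] on the Neumann part, and [eta] near the end points of both. *)
Let TY_line : {ae mu, forall x, 0 <= x <= l -> \int[mu]_(y in `[0, H]) TY (x, y) = 0}.
Proof.
have a1 := cell_liney C H0; have a2 := ae_shift h a1.
have b1 := cell_bcD C H0; have b2 := ae_shift h b1.
have c1 := cell_bcN C H0; have c2 := ae_shift h c1.
have ab := aeS3 (aeS2 a1 a2 (fun x u v => conj u v)) (aeS2 b1 b2 (fun x u v => conj u v))
  (aeS2 c1 c2 (fun x u v => conj u v)) (fun x u v t => conj u (conj v t)).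
apply: (aeS ab) => x [[A1 A2] [[B1 B2] [D1 D2]]] /andP[x0 xl].
have l3 : l <= 3 * l by rewrite ler_peMl ?(ltW l0)// ler1n.
have x3 : 0 <= x <= 3 * l by rewrite x0 (le_trans xl).
have xh3 : 0 <= x + h <= 3 * l.
  rewrite addr_ge0 ?(ltW h0)//= (_ : 3 * l = l + (l + l)); last by ring.
  by rewrite lerD// (le_trans _ (_ : l <= _)) ?lerDl ?(ltW l0)//; case/andP: hl.
have [[t1 [t2 T1]] _ [q1 [q2 Q1]]] : [/\ _, _ & _] := A1 x3.
have [[t3 [t4 T2]] _ [q3 [q4 Q2]]] : [/\ _, _ & _] := A2 xh3.
(* [a] and [a'] are the boundary values of [w] and [wy] at [y = 0]; at height [H] the boundary term
   vanishes with [eta]. *)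
have key a b a' b' : prim H a b (fun y => w (x, y)) (fun y => wy (x, y)) ->
    prim H a' b' (fun y => wy (x, y)) (fun y => wyy (x, y)) ->
    eta (x, 0) * eta (x, 0) * (a * a') = 0 ->
    \int[mu]_(y in `[0, H]) TY (x, y) = 0.
  move=> P1 P2 e0.
  have P3 := prim_mul (ltW H0) (line_y x mw) (line_y x mwy) P1 P2.
  have mwwy : measurable_fun setT (fun z => w z * wy z) by exact: measurable_funM.
  have P4 := prim_mul (ltW H0) (line_y x msq) (line_y x mwwy) (sqeta_y x) P3.
  by rewrite (prim_int P4) e0 eta_top !mul0r subrr.
have hI : h^-1 * (0 - 0) = 0 by rewrite subrr mulr0.
have [xr|xr] := pselect (`|x| < r \/ `|x - al| < r \/ `|x - l| < r).
  apply: (key _ _ _ _ (primZ h^-1 (primB T2 T1)) (primZ h^-1 (primB Q2 Q1))).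
  by rewrite (eta_corner xr) !mul0r.
(* At distance at least [r > h] from the ends, [x] and [x + h] lie in the same boundary part, so the
   difference quotient inherits its condition. *)
have [n1 n2] : r <= `|x| /\ r <= `|x - al| /\ r <= `|x - l|.
  by split; [|split]; rewrite leNgt; apply/negP => hx; apply: xr; [left|right; left|right; right].
have {n2}[n2 n3] := n2; case/andP: (hr) => _ hltr.
have [xal|xal] := ltP x al.
  have xhal : x + h < al.
    move: n2; rewrite distrC gtr0_norm ?subr_gt0// => n2.
    by rewrite -ltrBrDl (lt_le_trans hltr).
  have [bb P1] := B1 (introT andP (conj x0 xal)).
  have xh0 : 0 <= x + h by rewrite addr_ge0 ?(ltW h0).
  have [bb' P2] := B2 (introT andP (conj xh0 xhal)).
  have := primZ h^-1 (primB P2 P1); rewrite hI => P3.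
  by apply: (key _ _ _ _ P3 (primZ h^-1 (primB Q2 Q1))); rewrite mul0r mulr0.
have xl' : x < l.
  rewrite lt_neqAle xl andbT; apply/negP => /eqP E; move: n3.
  by rewrite E subrr normr0 leNgt r0.
have xhl : x + h < l.
  move: n3; rewrite distrC gtr0_norm ?subr_gt0// => n3.
  by rewrite -ltrBrDl (lt_le_trans hltr).
have [bb P1] := D1 (introT andP (conj xal xl')).
have xhal : al <= x + h by rewrite (le_trans xal)// lerDl ltW.
have [bb' P2] := D2 (introT andP (conj xhal xhl)).
have := primZ h^-1 (primB P2 P1); rewrite hI => P3.
by apply: (key _ _ _ _ (primZ h^-1 (primB T2 T1)) P3); rewrite !mulr0.
Qed.

Let perH : {ae mu, forall y, {ae mu, forall x, 0 < y ->
  [/\ th (x + l, y) = th (x, y) + pi, p (x + l, y) = p (x, y), q (x + l, y) = q (x, y),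
     px (x + l, y) = px (x, y) & qy (x + l, y) = qy (x, y)]}}.
Proof.
apply: (aeS (ae_ysection (cell_per C))) => y hy; apply: (aeS hy) => x hx y0.
have [h1 h2 h3 _ h5] := hx y0; split => //.
exact: (cell_theta_per C (z := (x, y))).
Qed.

(** Of the three periods of a cell, difference quotients consume one; a second is needed to see that
    the values at both ends of a period agree. *)
Let lines : {ae mu, forall y, 0 <= y <= H -> exists a b,
  [/\ prim l a a (fun x => w (x, y)) (fun x => wx (x, y)),
      prim l b b (fun x => wx (x, y)) (fun x => wxx (x, y)),
      {ae mu, forall x, 0 <= x <= l -> w (x, y) = h^-1 * \int[mu]_(s in `[0, h]) p (s + x, y)} &
      {ae mu, forall x, f (x + l, y) = f (x, y)}]}.
Proof.
apply: (aeS3 (cell_linex C H0) perH (ae_neq 0)) => y A hp y0 yH.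
have yp : 0 < y by rewrite lt_neqAle eq_sym y0; case/andP: yH.
have [[t1 [t2 T1]] [p1 [p2 P1]] _] : [/\ _, _ & _] := A yH.
have l3 : 2 * l + h <= 3 * l.
  rewrite (_ : 3 * l = 2 * l + l); last by ring.
  by rewrite lerD2l; case/andP: hl.
have l20 : 0 <= 2 * l by rewrite mulr_ge0// ltW.
have [t2' T2] := prim_sub l3 T1; have [p2' P2] := prim_sub l3 P1.
have pers : {ae mu, forall x, [/\ w (x + l, y) = w (x, y), wx (x + l, y) = wx (x, y),
    wxx (x + l, y) = wxx (x, y) & f (x + l, y) = f (x, y)]}.
  apply: (aeS2 hp (ae_shift h hp)) => x u v.
  have [u1 u2 u3 u4 u5] := u yp; have [v1 v2 v3 v4 v5] := v yp.
  rewrite /w /wx /wxx /dq /xshift /=.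
  have E : x + l + h = x + h + l by rewrite addrAC.
  rewrite !E v1 u1 v2 u2 v4 u4 /f u4 u5; split => //.
  by congr (_ * _); ring.
(* The derivative has integral 0 over a period by [prim_periodic], so the two end values
   coincide. *)
have per1 (k g : R -> R) a b : prim (2 * l) a b k g ->
    {ae mu, forall x, k (x + l) = k x} -> {ae mu, forall x, g (x + l) = g x} ->
    exists c, prim l c c k g.
  move=> P pk pg; have [b' P'] := prim_sub l2 P.
  have ll2 : l < 2 * l by rewrite mulr_natl mulr2n ltrDl.
  have pk0 : {ae mu, forall x, 0 <= x -> k (x + l) = k x} by apply: (aeS pk).
  have pg0 : {ae mu, forall x, 0 <= x -> g (x + l) = g x} by apply: (aeS pg).
  have I0 := prim_periodic (ltW l0) ll2 P pk0 pg0.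
  by have := prim_int P'; rewrite I0 => /esym/eqP; rewrite subr_eq0 => /eqP E; exists a; rewrite -{2}E.
have [a1 [a2 W1]] := prim_dq_line (ltW h0) l20 T2.
have [b1 [b2 W2]] := prim_dq_line (ltW h0) l20 P2.
have [a Wa] : exists c, prim l c c (fun x => w (x, y)) (fun x => wx (x, y)).
  apply: per1 W1 _ _; [by apply: (aeS pers) => x []|by apply: (aeS pers) => x []].
have [b Wb] : exists c, prim l c c (fun x => wx (x, y)) (fun x => wxx (x, y)).
  apply: per1 W2 _ _; [by apply: (aeS pers) => x []|by apply: (aeS pers) => x []].
exists a, b; split => //; last by apply: (aeS pers) => x [].
have lh2 : l + h <= 2 * l + h by rewrite lerD2r.
have [t2'' T3] := prim_sub lh2 T2.
apply: (aeS (prim_incr (ltW h0) T3)) => x hx xl.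
by rewrite /w /dq /xshift /= hx.
Qed.

Let R1ae0 (a b : R) (k : R -> R) : integ mu `[a, b]%classic k ->
  {ae mu, forall x, a <= x <= b -> k x = 0} -> \int[mu]_(x in `[a, b]) k x = 0.
Proof.
move=> ik k0; have ic := i1c a b (0 : R).
apply/eqP; rewrite eq_le -[X in _ <= X](Rint0 (D := `[a, b]%classic) (f := fun=> 0))//.
rewrite -[X in _ && (X <= _)](Rint0 (D := `[a, b]%classic) (f := fun=> 0))//.
by apply/andP; split; apply: R1le => //; apply: (aeS k0) => x hx xab; rewrite hx.
Qed.

Let TX_line : {ae mu, forall y, 0 <= y <= H -> \int[mu]_(x in `[0, l]) TX (x, y) = 0}.
Proof.
apply: (aeS lines) => y hy yH; have [a [b [Wa Wb _ _]]] := hy yH.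
have P3 := prim_mul (ltW l0) (line_x y mw) (line_x y mwx) Wa Wb.
have mwwx : measurable_fun setT (fun z => w z * wx z) by exact: measurable_funM.
have P4 := prim_mul (ltW l0) (line_x y msq) (line_x y mwwx) (sqeta_x y) P3.
by rewrite (prim_int P4) eta_per subrr.
Qed.

Let TX0 : \int[leb2]_(z in rect 0 l 0 H) TX z = 0.
Proof. by rewrite (R2y iTX); apply: R1ae0 TX_line; exact: i2int2. Qed.

Let TY0 : \int[leb2]_(z in rect 0 l 0 H) TY z = 0.
Proof. by rewrite (R2x iTY); apply: R1ae0 TY_line; exact: i2int1. Qed.

Let G2 z := ex z ^+ 2 + ey z ^+ 2.
Let X1 z := ex z ^+ 2 * w z ^+ 2 + 1 / 4 * (eta z ^+ 2 * wx z ^+ 2).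
Let Dw z := - (eta z ^+ 2 * w z * (wxx z + wyy z)).

Let c2 (k : R * R -> R) : continuous k -> continuous (fun z => k z ^+ 2).
Proof. by move=> ck; exact: cM. Qed.

Let iX1 : integ leb2 (rect 0 l 0 H) X1.
Proof.
apply: i2D.
  by apply: (integ_contM (c2 cex)); have [_] := ll sw.
by apply: i2Z; apply: (integ_contM (c2 ceta)); have [_] := ll swx.
Qed.

Let iDw : integ leb2 (rect 0 l 0 H) Dw.
Proof.
have h1 : integ leb2 (rect 0 l 0 H) (fun z => - 1 * (eta z ^+ 2 * (w z * (wxx z + wyy z)))).
  apply: i2Z; apply: (integ_contM (c2 ceta)); apply: s2M; first exact: ll.
  by apply: ll; exact: s2D.
by apply: eq_integ h1 => [|z _]; [exact: measurable_rect|rewrite /Dw; ring].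
Qed.

Let l2h : l + h <= 2 * l.
Proof. by rewrite mulr_natl mulr2n lerD2l; case/andP: hl. Qed.

Let i2l (u : R * R -> R) : sq_integ leb2 (rect 0 (3 * l) 0 H) u ->
  sq_integ leb2 (rect 0 (2 * l) 0 H) u.
Proof. by move=> s; apply: s2S s => //; rewrite ler_pM2r// ler_nat. Qed.

Let sf : sq_integ leb2 (rect 0 (2 * l) 0 H) f.
Proof. by apply: i2l; exact: (cell_sq_f C H). Qed.
Let sp : sq_integ leb2 (rect 0 (2 * l) 0 H) p.
Proof. by apply: i2l; have [[_ s _] _] := cell_sq C H. Qed.
Let sW : sq_integ leb2 (rect 0 (2 * l) 0 H) W.
Proof. by apply: i2l; exact: (cell_sq_W C H). Qed.
Let mf : measurable_fun setT f.
Proof. by have [_ [m1 _ m2]] := cell_meas C; exact: measurable_funD. Qed.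
Let mp : measurable_fun setT p.
Proof. by have [[_ m _] _] := cell_meas C. Qed.
Let mW : measurable_fun setT W.
Proof. exact: (cell_measurable_W C). Qed.

(** The difference quotient of the Laplacian [f] is the derivative of its moving average over
    [[x, x + h]]. Integration by parts moves this derivative to [eta^2 w], so that only [f^2]
    enters, uniformly in [h]. *)
Let f_line : {ae mu, forall y, 0 <= y <= H ->
  \int[mu]_(x in `[0, l]) Dw (x, y) <=
  \int[mu]_(x in `[0, l]) X1 (x, y) + 2 * \int[mu]_(x in `[0, 2 * l]) (f (x, y) ^+ 2)}.
Proof.
have a1 := s2ae2 mf sf; have a2 := i2ae2 iX1; have a3 := i2ae2 iDw.
apply: (aeS2 (aeS3 a1 a2 a3 (fun y u v t => conj u (conj v t))) lines).
move=> y [A1 [A2 A3]] hy yH; have [a [b [Wa Wb _ fper]]] := hy yH.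
have sfy := A1 yH; have iX := A2 yH; have iD := A3 yH.
have sfl : sq_integ mu `[0, l + h]%classic (fun x => f (x, y)) by exact: s1S sfy.
have hh0 := ltW h0.
have P1 := primZ h^-1 (prim_window hh0 (ltW l0) (s1i sfl)).
(* By periodicity the moving average has equal values at both ends of the period, and no boundary
   term is left. *)
have Eend : \int[mu]_(t in `[0, l + h]) f (t, y) - \int[mu]_(t in `[0, l]) f (t, y) =
    \int[mu]_(t in `[0, h]) f (t, y).
  have ih : integ mu `[0, h + l]%classic (fun x => f (x, y)) by rewrite addrC; exact: s1i.
  have E := Rint_itv_cat (ltW l0) hh0 ih; rewrite [l + h]addrC E addrAC subrr add0r.
  have sub1 : l + h <= 2 * l by exact: l2h.
  apply: eq_ae_Rint => //.
  - have iT : integ mu `[0, h]%classic (fun t => f (t + l, y)).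
      apply: (@integ_itv_shift R l 0 h (fun t => f (t, y))).
      by apply: i1S (s1i sfy); rewrite ?add0r ?(ltW l0)// addrC.
    exact: integ_mfun iT.
  - exact: line_x.
  - by apply: (aeS fper) => x ->.
rewrite Eend in P1.
have P2 := prim_mul (ltW l0) (line_x y msq) (line_x y mw) (sqeta_x y) Wa.
have mg : measurable_fun setT (fun z => eta z * eta z * w z) by exact: measurable_funM.
have mPh : measurable_fun `[0, l]%classic (fun x => h^-1 * \int[mu]_(s in `[0, h]) f (s + x, y)).
  have E x : 0 <= x <= l -> \int[mu]_(t in `[0, x + h]) f (t, y) - \int[mu]_(t in `[0, x]) f (t, y)
      = \int[mu]_(s in `[0, h]) f (s + x, y).
    by move=> xl; rewrite (window_primitive hh0 xl (s1i sfl)).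
  have iU := integ_primitive (s1i sfl).
  have iU1 : integ mu `[0, l]%classic (fun x => \int[mu]_(t in `[0, x + h]) f (t, y)).
    by apply: (@integ_itv_shift R h 0 l (fun x => \int[mu]_(t in `[0, x]) f (t, y)));
      apply: i1S iU; rewrite ?add0r ?(ltW h0).
  have iU2 : integ mu `[0, l]%classic (fun x => \int[mu]_(t in `[0, x]) f (t, y)).
    by apply: i1S iU => //; rewrite lerDl ltW.
  exact: integ_mfun (i1Z h^-1 (i1eq E (i1B iU1 iU2))).
have P3 := prim_mul (ltW l0) (line_x y mg) mPh P2 P1.
have T0 := prim_int P3; rewrite eta_per subrr in T0.
have [iT _ _] := P3.
have [iV0 hV] := window_le hh0 (ltW l0) sfl.2 (fun t => sqr_ge0 (f (t, y))).
have iV := i1Z h^-1 iV0.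
set V := (fun x => h^-1 * _) in iV.
have IV : \int[mu]_(x in `[0, l]) V x <= \int[mu]_(x in `[0, 2 * l]) (f (x, y) ^+ 2).
  rewrite R1Z// ler_pdivrMl//; apply: le_trans hV _; rewrite ler_pM2l//.
  apply: Rint_itv_le; [by rewrite addr_ge0 ?(ltW l0) ?(ltW h0)|exact: sfy.2|].
  by move=> t; exact: sqr_ge0.
apply: (@le_trans _ _ (\int[mu]_(x in `[0, l]) (X1 (x, y) + 2 * V x -
   ((2 * (eta (x, y) * ex (x, y)) * w (x, y) + eta (x, y) * eta (x, y) * wx (x, y)) *
     (h^-1 * \int[mu]_(s in `[0, h]) f (s + x, y)) +
    eta (x, y) * eta (x, y) * w (x, y) * (h^-1 * (f (x + h, y) - f (x, y))))))).
  apply: R1le => //; first by apply: i1B => //; apply: i1D => //; exact: i1Z.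
  apply: aeW => x xl.
  have V2 := window_sqr_le h0 xl sfl; rewrite -/(V x) in V2.
  have e01 : 0 <= eta (x, y) <= 1 by apply: eta01; case/andP: yH.
  have Ed : wxx (x, y) + wyy (x, y) = h^-1 * (f (x + h, y) - f (x, y)).
    by rewrite /wxx /wyy /dq /f /xshift /=; ring.
  by rewrite /X1 /Dw Ed; exact: window_pointwise.
rewrite R1B//; [|by apply: i1D => //; exact: i1Z].
rewrite T0 subr0 R1D//; last exact: i1Z.
by rewrite R1Z// lerD2l ler_pM2l.
Qed.

Variable M : R.
Hypothesis G2M : forall z, 0 <= z.2 -> G2 z <= M.

Let M0 : 0 <= M.
Proof. by apply: le_trans (G2M (z := (0, 0)) (lexx 0)); rewrite addr_ge0 ?sqr_ge0. Qed.

Let cG2 : continuous G2.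
Proof. by move=> z; apply: cvgD; apply: c2. Qed.

Let iG2 : integ leb2 (rect 0 l 0 H) G2.
Proof. exact: continuous_integ2. Qed.

Let iG2w : integ leb2 (rect 0 l 0 H) (fun z => G2 z * w z ^+ 2).
Proof. by apply: (integ_contM cG2); have [_] := ll sw. Qed.

(** [w] is the mean of [p] over a window, so [w^2] is at most the mean of [p^2], which [sqr_le_W]
    bounds by the mean of [2 + W^2], independently of [h]. *)
Let w_line : {ae mu, forall y, 0 <= y <= H ->
  \int[mu]_(x in `[0, l]) (G2 (x, y) * w (x, y) ^+ 2) <=
  2 * \int[mu]_(x in `[0, l]) G2 (x, y) + M * \int[mu]_(x in `[0, 2 * l]) (W (x, y) ^+ 2)}.
Proof.
have a1 := aeS2 (s2ae2 mp sp) (s2ae2 mW sW) (fun y u v => conj u v).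
have a2 := i2ae2 iG2; have a3 := i2ae2 iG2w.
apply: (aeS2 (aeS3 a1 a2 a3 (fun y u v t => conj u (conj v t))) lines).
move=> y [[A0 A1] [A2 A3]] hy yH; have [a [b [_ _ wE _]]] := hy yH.
have sWl : sq_integ mu `[0, l + h]%classic (fun x => W (x, y)) by apply: s1S (A1 yH).
have spl : sq_integ mu `[0, l + h]%classic (fun x => p (x, y)) by apply: s1S (A0 yH).
have hh0 := ltW h0.
have [iV0 hV] := window_le hh0 (ltW l0) sWl.2 (fun t => sqr_ge0 (W (t, y))).
have iV := i1Z h^-1 iV0; set V := (fun x => h^-1 * _) in iV.
have IV : \int[mu]_(x in `[0, l]) V x <= \int[mu]_(x in `[0, 2 * l]) (W (x, y) ^+ 2).
  rewrite R1Z// ler_pdivrMl//; apply: le_trans hV _; rewrite ler_pM2l//.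
  apply: Rint_itv_le; [by rewrite addr_ge0 ?(ltW l0) ?(ltW h0)|exact: (A1 yH).2|].
  by move=> t; exact: sqr_ge0.
apply: (@le_trans _ _ (\int[mu]_(x in `[0, l]) (2 * G2 (x, y) + M * V x))); last first.
  have iG := A2 yH; rewrite (R1D (i1Z 2 iG) (i1Z M iV)) (R1Z 2 iG) (R1Z M iV).
  by rewrite lerD2l ler_wpM2l.
apply: R1le; [exact: (A3 yH)|by apply: i1D; apply: i1Z => //; exact: (A2 yH)|].
apply: (aeS wE) => x wx0 xl.
have G0 : 0 <= G2 (x, y) by rewrite addr_ge0 ?sqr_ge0.
have GM : G2 (x, y) <= M by apply: G2M; case/andP: yH.
have V0 : 0 <= V x by rewrite mulr_ge0 ?invr_ge0 ?Rintegral_ge0// => t _; exact: sqr_ge0.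
have wV : w (x, y) ^+ 2 <= 2 + V x.
  rewrite wx0//; apply: le_trans (window_sqr_le h0 xl spl) _.
  have -> : 2 + V x = h^-1 * (h * 2 + \int[mu]_(s in `[0, h]) (W (s + x, y) ^+ 2)).
    by rewrite /V [RHS]mulrDr [h^-1 * (h * 2)]mulrA mulVf ?gt_eqF// mul1r.
  rewrite ler_pM2l ?invr_gt0//.
  have xlh : x + h <= l + h by case/andP: xl => _; rewrite lerD2r.
  have x0 : 0 <= x by case/andP: xl.
  have iw (u : R -> R) : integ mu `[0, l + h]%classic u -> integ mu `[0, h]%classic (fun s => u (s + x)).
    by move=> iu; apply: integ_itv_shift; apply: i1S iu; rewrite ?add0r// addrC.
  have -> : h * 2 = \int[mu]_(s in `[0, h]) 2 by rewrite R1c// subr0 mulrC.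
  have i2 := i1c 0 h (2 : R); have iW2 := iw _ sWl.2.
  rewrite -(R1D i2 iW2); apply: R1le; [exact: (iw _ spl.2)|exact: i1D|].
  by apply: aeW => s _; exact: sqr_le_W.
apply: (@le_trans _ _ (G2 (x, y) * (2 + V x))); first by rewrite ler_wpM2l.
by rewrite mulrDr [G2 _ * 2]mulrC lerD2l ler_wpM2r.
Qed.

(** Since [TX + TY] integrates to 0, [caccioppoli_pointwise] leaves the terms with the gradient of
    [eta] and with the Laplacian. The bound is free of [h], which permits the limit [h -> 0]. *)
Lemma caccioppoli : integ leb2 (rect 0 l 0 H) (fun z => eta z ^+ 2 * (wx z ^+ 2 + wy z ^+ 2)) /\
  \int[leb2]_(z in rect 0 l 0 H) (eta z ^+ 2 * (wx z ^+ 2 + wy z ^+ 2)) <=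
  20 * \int[leb2]_(z in rect 0 l 0 H) G2 z + (20 * M + 8) * F.
Proof.
have iX : integ leb2 (rect 0 l 0 H) (fun z => eta z ^+ 2 * (wx z ^+ 2 + wy z ^+ 2)).
  by apply: (integ_contM (c2 ceta)); apply: i2D; [have [_] := ll swx|have [_] := ll swy].
split => //; set X := \int[leb2]_(z in _) _; set G := \int[leb2]_(z in _) _.
have fF : \int[leb2]_(z in rect 0 (2 * l) 0 H) (f z ^+ 2) + \int[leb2]_(z in rect 0 (2 * l) 0 H) (W z ^+ 2) <= 2 * F.
  exact: (@cell_energy_le _ _ _ _ _ _ _ _ _ _ _ C l0 H 1%N isT).
have f0 : 0 <= \int[leb2]_(z in rect 0 (2 * l) 0 H) (f z ^+ 2).
  by apply: Rintegral_ge0 => z _; exact: sqr_ge0.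
have W0 : 0 <= \int[leb2]_(z in rect 0 (2 * l) 0 H) (W z ^+ 2).
  by apply: Rintegral_ge0 => z _; exact: sqr_ge0.
set If := \int[leb2]_(z in _) _ in fF f0; set IW := \int[leb2]_(z in _) _ in fF W0.
pose J := \int[leb2]_(z in rect 0 l 0 H) (G2 z * w z ^+ 2).
have HJ : J <= 2 * G + M * IW.
  rewrite /J /G /IW (R2y iG2w) (R2y iG2) (R2y sW.2).
  have i1 := i2int2 iG2; have i2 := i2int2 sW.2.
  rewrite -R1Z// -R1Z// -R1D; [|exact: i1Z|exact: i1Z].
  by apply: R1le; [exact: (i2int2 iG2w)|by apply: i1D; exact: i1Z|exact: w_line].
pose ID := \int[leb2]_(z in rect 0 l 0 H) Dw z.
pose IX1 := \int[leb2]_(z in rect 0 l 0 H) X1 z.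
have HD : ID <= IX1 + 2 * If.
  rewrite /ID /IX1 /If (R2y iDw) (R2y iX1) (R2y sf.2).
  have i1 := i2int2 iX1; have i2 := i2int2 sf.2.
  rewrite -R1Z// -R1D//; last exact: i1Z.
  by apply: R1le; [exact: (i2int2 iDw)|by apply: i1D => //; exact: i1Z|exact: f_line].
have HX1 : IX1 <= J + 1 / 4 * X.
  rewrite /IX1 /J /X -R2Z// -R2D//; last exact: i2Z.
  apply: R2le => //; first by apply: i2D => //; exact: i2Z.
  apply: aeW => z _; apply: lerD.
    by rewrite ler_wpM2r ?sqr_ge0// lerDl sqr_ge0.
  by rewrite ler_wpM2l ?divr_ge0// ler_wpM2l ?sqr_ge0// lerDl sqr_ge0.
have HX : 3 / 4 * X <= 4 * J + ID.
  have E1 : \int[leb2]_(z in rect 0 l 0 H) (TX z + TY z + 4 * (G2 z * w z ^+ 2) + Dw z) = 4 * J + ID.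
    rewrite R2D//; last by apply: i2D; [exact: i2D|exact: i2Z].
    rewrite R2D//; [|exact: i2D|exact: i2Z].
    by rewrite R2D// TX0 TY0 R2Z// !add0r.
  rewrite -E1 /X -R2Z//; apply: R2le; [exact: i2Z| |].
    by apply: i2D => //; apply: i2D; [exact: i2D|exact: i2Z].
  by apply: aeW => z _; exact: caccioppoli_pointwise.
have FF := cell_F_ge0 C.
have MW : M * IW <= M * (2 * F) by rewrite ler_wpM2l// (le_trans _ fF)// lerDr.
have If2 : If <= 2 * F by rewrite (le_trans _ fF)// lerDl.
exact: (caccioppoli_combine HJ HD HX1 HX MW If2).
Qed.

End Caccioppoli.

(** * Fatou's lemma on lines and the cutoff around the ends of the boundary parts *)

Section Gradient_bound.
Context {R : realType}.

Lemma gradient_pointwise (dz x k f dk z dx N I c h : R) :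
  dz ^+ 2 <= 3 * c ^+ 2 * N -> x ^+ 2 <= I -> 0 <= k ^+ 2 <= 1 -> 0 <= f ^+ 2 <= 1 ->
  dk ^+ 2 <= 4 * h ^+ 2 -> z ^+ 2 <= N -> dx ^+ 2 <= c ^+ 2 * I -> 0 <= N -> 0 <= I ->
  (- (dz * (x * k))) ^+ 2 + (f * dk - z * (dx * k)) ^+ 2 <=
  5 * c ^+ 2 * (N * I) + 8 * h ^+ 2.
Proof.
move=> h1 h2 /andP[k0 k1] /andP[f0 f1] h3 h4 h5 N0 I0.
have P (a b A D : R) : 0 <= a -> 0 <= b -> a <= A -> b <= D -> a * b <= A * D.
  by move=> *; exact: ler_pM.
have a1 : (dz * (x * k)) ^+ 2 <= 3 * c ^+ 2 * N * I.
  rewrite !exprMn; apply: (P _ _ _ _ (sqr_ge0 _) _ h1 _); first by exact: mulr_ge0 (sqr_ge0 x) (sqr_ge0 k).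
  by rewrite -[I]mulr1; exact: (P _ _ _ _ (sqr_ge0 _) (sqr_ge0 _) h2 k1).
have a2 : (f * dk) ^+ 2 <= 4 * h ^+ 2.
  by rewrite exprMn -[4 * _]mul1r; exact: (P _ _ _ _ (sqr_ge0 _) (sqr_ge0 _) f1 h3).
have a3 : (z * (dx * k)) ^+ 2 <= N * (c ^+ 2 * I).
  rewrite !exprMn; apply: (P _ _ _ _ (sqr_ge0 _) _ h4 _); first by exact: mulr_ge0 (sqr_ge0 dx) (sqr_ge0 k).
  by rewrite -[c ^+ 2 * I]mulr1; exact: (P _ _ _ _ (sqr_ge0 _) (sqr_ge0 _) h5 k1).
have a4 : (f * dk - z * (dx * k)) ^+ 2 <= 2 * (f * dk) ^+ 2 + 2 * (z * (dx * k)) ^+ 2.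
  by have := sqr_ge0 (f * dk + z * (dx * k)); move: (f * dk) (z * _) => a b; rewrite !expr2; lra.
rewrite sqrrN; move: a1 a2 a3 a4.
move: ((dz * (x * k)) ^+ 2) ((f * dk) ^+ 2) ((z * (dx * k)) ^+ 2) ((f * dk - z * (dx * k)) ^+ 2).
by move=> A1 A2 A3 A4; rewrite !mulrA; lra.
Qed.

End Gradient_bound.

Section Fatou_on_lines.
Context {R : realType}.
Local Notation mu := (@lebesgue_measure R).
Local Notation leb2 := (mu \x mu)%E.

(** Convergence is known on almost every horizontal line, as [prim_dq] provides it. Fatou's lemma is
    applied in the plane to the measurable lower limit, which is then compared with [u^2] line by
    line through Tonelli. *)
Lemma fatou_lines A B D E K (u_ : nat -> R * R -> R) (u : R * R -> R) :
  (forall n, measurable_fun setT (u_ n)) -> measurable_fun setT u ->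
  (forall n, integ leb2 (rect A B D E) (fun z => u_ n z ^+ 2)) ->
  (forall n, \int[leb2]_(z in rect A B D E) (u_ n z ^+ 2) <= K) ->
  integ leb2 (rect A B D E) (fun z => u z ^+ 2) ->
  {ae mu, forall y, D <= y <= E -> {ae mu, forall x, A <= x <= B ->
    u_ n (x, y) @[n --> \oo] --> u (x, y)}} ->
  \int[leb2]_(z in rect A B D E) (u z ^+ 2) <= K.
Proof.
move=> mu_ mu0 iu_ uK iu cvu.
have mS := @measurable_rect R A B D E; set S := rect A B D E in mS iu_ uK iu *.
pose U := (EFin \o (fun z => u z ^+ 2)) \_ S.
pose Un n := (EFin \o (fun z => u_ n z ^+ 2)) \_ S.
have mU : measurable_fun setT U.
  apply: (measurable_restrictT _ mS).1; apply/measurable_EFinP.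
  by apply: measurable_funTS; exact: measurable_funX.
have mUn n : measurable_fun setT (Un n).
  apply: (measurable_restrictT _ mS).1; apply/measurable_EFinP.
  by apply: measurable_funTS; exact: measurable_funX.
have Un0 n z : (0 <= Un n z)%E by rewrite /Un patchE; case: ifP => // _; rewrite lee_fin sqr_ge0.
have U0 z : (0 <= U z)%E by rewrite /U patchE; case: ifP => // _; rewrite lee_fin sqr_ge0.
pose g z := limn_einf (Un ^~ z).
have mg : measurable_fun setT g.
  apply: (emeasurable_fun_cvg (fun n z => einfs (Un ^~ z) n)).
    by move=> n; exact: measurable_fun_einfs.
  by move=> z _; rewrite /g limn_einf_lim; exact: is_cvg_einfs.
have g0 z : (0 <= g z)%E.
  rewrite /g limn_einf_lim; apply: lime_ge; first exact: is_cvg_einfs.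
  by apply: nearW => n; apply: le_ereal_inf_tmp => _ [k _ <-].
have UnK n : (\int[leb2]_z Un n z <= K%:E)%E.
  rewrite /Un -integral_mkcond.
  have := uK n; rewrite /Rintegral -lee_fin fineK//.
  by apply: integrable_fin_num => //; exact: iu_.
have gK : (\int[leb2]_z g z <= K%:E)%E.
  apply: le_trans (fatou leb2 measurableT mUn (fun n z _ => Un0 n z)) _.
  rewrite limn_einf_lim; apply: lime_le; first exact: is_cvg_einfs.
  apply: nearW => n; apply: le_trans (UnK n); apply: ereal_inf_lbound.
  by exists n => //=; exact: leqnn.
have Ug : (\int[leb2]_z U z <= \int[leb2]_z g z)%E.
  rewrite tonelli2// tonelli2//; apply: ae_ge0_le_integral => //.
  - by move=> y _; apply: integral_ge0.
  - exact: (@measurable_fun_fubini_tonelli_G _ _ _ _ R mu _ mU U0).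
  - by move=> y _; apply: integral_ge0.
  - exact: (@measurable_fun_fubini_tonelli_G _ _ _ _ R mu _ mg g0).
  apply: (aeS cvu) => y hy _; have [yDE|yDE] := boolP (D <= y <= E); last first.
    rewrite integral0_eq; first exact: integral_ge0.
    move=> x _; rewrite /U patchE memNset// => /rectE[_ h].
    by rewrite h in yDE.
  apply: ae_ge0_le_integral => //.
  - exact: (measurableT_comp mU (pair2_measurable y)).
  - exact: (measurableT_comp mg (pair2_measurable y)).
  apply: (aeS (hy yDE)) => x hx _; have [xAB|xAB] := boolP (A <= x <= B); last first.
    by rewrite /U patchE memNset// => /rectE[h _]; rewrite h in xAB.
  have xyS : (x, y) \in S by rewrite inE; apply/rectE.
  suff -> : g (x, y) = U (x, y) by [].
  have cv : Un n (x, y) @[n --> \oo] --> U (x, y).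
    rewrite /Un /U patchE xyS /=; under eq_fun do rewrite patchE xyS /=.
    by apply/fine_cvgP => /=; split; [exact: nearW|]; have := cvgM (hx xAB) (hx xAB); exact.
  by rewrite /g (cvg_limn_einf_sup cv).1.
rewrite -lee_fin /Rintegral fineK; last by apply: integrable_fin_num.
by rewrite integral_mkcond; exact: le_trans Ug gK.
Qed.

End Fatou_on_lines.

Section Cutoff_function.
Context {R : realType}.
Local Notation mu := (@lebesgue_measure R).
Local Notation leb2 := (mu \x mu)%E.
Variables (B : R -> R) (C0 : R).
Hypothesis sB : smooth1 B.
Hypothesis B1 : forall t, `|t| <= 1 -> B t = 1.
Hypothesis B0 : forall t, 2 <= `|t| -> B t = 0.
Hypothesis B01 : forall t, 0 <= B t <= 1.
Hypothesis C01 : 1 <= C0.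
Hypothesis dB : forall t, `|derive1 B t| <= C0.
Variables (l al r H : R).
Hypothesis l0 : 0 < l.
Hypothesis al0 : 0 <= al <= l.
Hypothesis r0 : 0 < r.
Hypothesis H0 : 0 < H.

Let Bc c x := B (r^-1 * (x - c)).
Let u c x := 1 - Bc c x.
(** The complement of a product, rather than a sum of plateaus, stays in [[0, 1]] even when the
    three points are close together. *)
Definition zeta x := 1 - u 0 x * (u al x * u l x).
Let xi y := B (r^-1 * (y - 0)).
Let ka y := B (2 / H * (y - 0)).
(** Boxes of size of order [r] around the ends of the boundary parts are excised, and [ka] tapers
    off at heights of order [H]. *)
Definition cutoff (z : R * R) := (1 - zeta z.1 * xi z.2) * ka z.2.
(** A majorant for [zeta^2] and, up to a factor, for the square of its derivative, with an integral
    of order [r]. *)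
Definition corners x : R := \1_(`[0 - 2 * r, 0 + 2 * r]%classic) x +
  \1_(`[al - 2 * r, al + 2 * r]%classic) x + \1_(`[l - 2 * r, l + 2 * r]%classic) x.

Let sBc c : smooth1 (Bc c). Proof. exact: smooth1_comp sB (smooth1_affine _ _). Qed.
Let s1B (f g : R -> R) : smooth1 f -> smooth1 g -> smooth1 (fun x => f x - g x).
Proof.
move=> sf sg; have sN : smooth1 (fun x => -1 * g x) by apply: smooth1M => //; exact: smooth1_cst.
by have := smooth1D sf sN; congr smooth1; apply/funext => x; rewrite mulN1r.
Qed.
Let su c : smooth1 (u c). Proof. by apply: s1B => //; exact: smooth1_cst. Qed.
Let szeta : smooth1 zeta.
Proof. by apply: s1B; [exact: smooth1_cst|apply: smooth1M => //; exact: smooth1M]. Qed.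
Let sxi : smooth1 xi. Proof. exact: smooth1_comp sB (smooth1_affine _ _). Qed.
Let ska : smooth1 ka. Proof. exact: smooth1_comp sB (smooth1_affine _ _). Qed.

Let u01 c x : 0 <= u c x <= 1.
Proof. by have /andP[h1 h2] := B01 (r^-1 * (x - c)); rewrite /u /Bc subr_ge0 h2 gerBl. Qed.

Let prod01 (a b : R) : 0 <= a <= 1 -> 0 <= b <= 1 -> 0 <= a * b <= 1.
Proof. by move=> /andP[a0 a1] /andP[b0 b1]; rewrite mulr_ge0//= mulr_ile1. Qed.

Lemma zeta01 x : 0 <= zeta x <= 1.
Proof.
have /andP[h1 h2] := prod01 (u01 0 x) (prod01 (u01 al x) (u01 l x)).
by rewrite /zeta subr_ge0 h2 gerBl.
Qed.

Lemma cutoff01 z : 0 <= cutoff z <= 1.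
Proof.
apply: prod01; last exact: B01.
have /andP[h1 h2] := prod01 (zeta01 z.1) (B01 (r^-1 * (z.2 - 0))).
by rewrite subr_ge0 h2 gerBl.
Qed.

Lemma cutoff_smooth : smooth cutoff.
Proof.
have h : smooth (fun z => tens (fun=> 1) ka z + tens (fun x => -1 * zeta x) (fun y => xi y * ka y) z).
  apply: smoothD; apply: tens_smooth => //; first exact: smooth1_cst.
    by apply: smooth1M => //; exact: smooth1_cst.
  exact: smooth1M.
by move: h; congr smooth; apply/funext => z; rewrite /tens /cutoff; ring.
Qed.

Lemma cutoff_top x : cutoff (x, H) = 0.
Proof.
rewrite /cutoff /ka /= subr0 mulrVK ?unitfE ?gt_eqF//.
by rewrite B0 ?mulr0// ger0_norm.
Qed.

Lemma zeta_corner x : `|x| < r \/ `|x - al| < r \/ `|x - l| < r -> zeta x = 1.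
Proof.
have h c : `|x - c| < r -> u c x = 0.
  move=> xc; rewrite /u /Bc B1 ?subrr// normrM gtr0_norm ?invr_gt0//.
  by rewrite ler_pdivrMl// mulr1 ltW.
by rewrite -{1}[x]subr0 /zeta; case=> [/h|[/h|/h]] ->; rewrite ?mul0r ?mulr0 ?mul0r ?mulr0 subr0.
Qed.

Lemma cutoff_corner x : `|x| < r \/ `|x - al| < r \/ `|x - l| < r -> cutoff (x, 0) = 0.
Proof.
move=> /zeta_corner xc; rewrite /cutoff /= xc /xi subrr mulr0 B1 ?normr0//.
by rewrite mulr1 subrr mul0r.
Qed.

Lemma cutoff_per y : cutoff (l, y) = cutoff (0, y).
Proof.
by rewrite /cutoff /= !zeta_corner// ?normr0; [left|right; right; rewrite subrr normr0].
Qed.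

Lemma zeta_far x : 2 * r <= `|x| -> 2 * r <= `|x - al| -> 2 * r <= `|x - l| -> zeta x = 0.
Proof.
have h c : 2 * r <= `|x - c| -> u c x = 1.
  move=> xc; rewrite /u /Bc B0 ?subr0// normrM gtr0_norm ?invr_gt0//.
  by rewrite ler_pdivlMl// mulrC.
by rewrite -{1}[x]subr0 /zeta => /h -> /h -> /h ->; rewrite !mulr1 subrr.
Qed.

Let half_le1 y : 0 <= y -> y <= H / 2 -> `|2 / H * y| <= 1.
Proof.
move=> y0 yH; rewrite ger0_norm; last by rewrite mulr_ge0// divr_ge0// ltW.
by rewrite mulrAC ler_pdivrMr// mul1r mulrC -ler_pdivlMr.
Qed.

Lemma cutoff1_above z : 2 * r <= z.2 <= H / 2 -> cutoff z = 1.
Proof.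
move=> /andP[z1 z2]; have z0 : 0 <= z.2 by apply: le_trans z1; rewrite mulr_ge0// ltW.
rewrite /cutoff /xi /ka !subr0 B0; last first.
  by rewrite ger0_norm ?mulr_ge0 ?invr_ge0 ?(ltW r0)// ler_pdivlMl// mulrC.
rewrite mulr0 subr0 mul1r B1//; exact: half_le1.
Qed.

Lemma cutoff1_far z : zeta z.1 = 0 -> 0 <= z.2 <= H / 2 -> cutoff z = 1.
Proof.
move=> z10 /andP[z0 z2]; rewrite /cutoff z10 mul0r subr0 mul1r /ka subr0 B1//.
exact: half_le1.
Qed.

Let ind_near c x : `|x - c| < 2 * r -> \1_(`[c - 2 * r, c + 2 * r]%classic) x = 1 :> R.
Proof.
by rewrite ltr_distl => /andP[h1 h2]; rewrite indicE mem_set//= in_itv/= !ltW.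
Qed.

Let ind0 c x : 0 <= (\1_(`[c - 2 * r, c + 2 * r]%classic) x : R) <= 1.
Proof. by rewrite indicE; case: (_ \in _); rewrite ?lexx ler01. Qed.

Lemma corners_ge0 x : 0 <= corners x <= 3.
Proof.
have /andP[a1 a2] := ind0 0 x; have /andP[b1 b2] := ind0 al x; have /andP[d1 d2] := ind0 l x.
by rewrite /corners; lra.
Qed.

Let zeta_le x : zeta x ^+ 2 <= corners x.
Proof.
have /andP[z0 z1] := zeta01 x; have /andP[c0 _] := corners_ge0 x.
have z21 : zeta x ^+ 2 <= 1 by rewrite expr_le1.
have /andP[a1 a2] := ind0 0 x; have /andP[b1 b2] := ind0 al x; have /andP[d1 d2] := ind0 l x.
have [xc|x1] := ltP `|x - 0| (2 * r).
  by rewrite (le_trans z21)// /corners (ind_near xc) -addrA lerDl addr_ge0.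
have [xc|x2] := ltP `|x - al| (2 * r).
  by rewrite (le_trans z21)// /corners (ind_near xc) addrAC lerDr addr_ge0.
have [xc|x3] := ltP `|x - l| (2 * r).
  by rewrite (le_trans z21)// /corners (ind_near xc) lerDr addr_ge0.
by rewrite subr0 in x1; rewrite zeta_far// expr2 mul0r.
Qed.

Let dBc c x : `|derive1 (Bc c) x| <= C0 / r * \1_(`[c - 2 * r, c + 2 * r]%classic) x.
Proof.
have C00 : 0 <= C0 / r by rewrite divr_ge0 ?(ltW r0)// (le_trans ler01).
rewrite /Bc derive1_rescale// normrM gtr0_norm ?invr_gt0//.
have [xc|xc] := ltP `|x - c| (2 * r).
  by rewrite ind_near// mulr1 mulrC ler_pM2r ?invr_gt0.
have suppB : supp_in B (- 2) 2 by move=> t ht; apply: B0; rewrite leNgt ltr_norml.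
rewrite (derive1_supp sB suppB) ?normr0 ?mulr0.
  by rewrite mulr_ge0//; case/andP: (ind0 c x).
rewrite -ltr_norml -leNgt normrM gtr0_norm ?invr_gt0//.
by rewrite ler_pdivlMl// mulrC.
Qed.

Let du c x : derive1 (u c) x = - derive1 (Bc c) x.
Proof.
rewrite /u derive1B_smooth//; last exact: smooth1_cst.
by rewrite derive1_cst sub0r.
Qed.

Let dzeta x : derive1 zeta x ^+ 2 <= 3 * (C0 / r) ^+ 2 * corners x.
Proof.
have C00 : 0 <= C0 / r by rewrite divr_ge0 ?(ltW r0)// (le_trans ler01).
have suu : smooth1 (fun x => u al x * u l x) by exact: smooth1M.
have E : derive1 zeta x = derive1 (Bc 0) x * (u al x * u l x) +
   derive1 (Bc al) x * (u 0 x * u l x) + derive1 (Bc l) x * (u 0 x * u al x).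
  rewrite /zeta derive1B_smooth; [|exact: smooth1_cst|exact: smooth1M].
  by rewrite derive1_cst derive1M_smooth// derive1M_smooth// !du; ring.
have small (a b : R) : 0 <= b <= 1 -> `|a * b| <= `|a|.
  by move=> /andP[b0 b1]; rewrite normrM [`|b|]ger0_norm// ler_piMr.
have h : `|derive1 zeta x| <= C0 / r * corners x.
  have hD c b : 0 <= b <= 1 -> `|derive1 (Bc c) x * b| <= C0 / r * \1_(`[c - 2 * r, c + 2 * r]%classic) x.
    by move=> hb; apply: le_trans (dBc c x); exact: small.
  rewrite E /corners [leRHS]mulrDr [X in _ <= X + _]mulrDr.
  apply: le_trans (ler_normD _ _) _; apply: lerD; last by apply: hD; exact: prod01.
  apply: le_trans (ler_normD _ _) _; apply: lerD; by apply: hD; exact: prod01.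
have /andP[c0 c3] := corners_ge0 x.
have : `|derive1 zeta x| ^+ 2 <= (C0 / r * corners x) ^+ 2.
  by rewrite lerXn2r// nnegrE// mulr_ge0.
rewrite real_normK ?num_real// => /le_trans; apply.
by rewrite exprMn [3 * _]mulrC -[leRHS]mulrA ler_wpM2l ?sqr_ge0// expr2 ler_wpM2r.
Qed.

Lemma cutoff_gradient z : 0 <= z.2 ->
  'D_(dirx R) cutoff z ^+ 2 + 'D_(diry R) cutoff z ^+ 2 <=
  5 * (C0 / r) ^+ 2 * (corners z.1 * \1_(`]-oo, 2 * r]%classic) z.2) + 8 * (C0 / H) ^+ 2.
Proof.
move=> z0; have C00 : 0 <= C0 by exact: le_trans C01.
have smx : smooth1 (fun y => xi y * ka y) by exact: smooth1M.
have Ec : cutoff = (fun z => tens (fun=> 1) ka z - tens zeta (fun y => xi y * ka y) z).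
  by apply/funext => t; rewrite /tens /cutoff; ring.
have s1 : smooth1 (fun=> 1 : R) by exact: smooth1_cst.
have Ex : 'D_(dirx R) cutoff z = - (derive1 zeta z.1 * (xi z.2 * ka z.2)).
  rewrite Ec; have [_ ->] := is_deriveB (tens_derive_x z s1 ska) (tens_derive_x z szeta smx).
  by rewrite /tens derive1_cst mul0r sub0r.
have Ey : 'D_(diry R) cutoff z = (1 - zeta z.1 * xi z.2) * derive1 ka z.2 -
    zeta z.1 * (derive1 xi z.2 * ka z.2).
  rewrite Ec; have [_ ->] := is_deriveB (tens_derive_y z s1 ska) (tens_derive_y z szeta smx).
  by rewrite /tens derive1M_smooth//; ring.
set I := (\1_(`]-oo, 2 * r]%classic) z.2 : R).
have I01 : 0 <= I <= 1 by rewrite /I indicE; case: (_ \in _); rewrite ?lexx ler01.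
have Inear : z.2 <= 2 * r -> I = 1 by move=> h; rewrite /I indicE mem_set//= in_itv.
have xiI : xi z.2 ^+ 2 <= I.
  have [h|h] := leP z.2 (2 * r).
    by rewrite Inear// expr_le1//; have /andP[] := B01 (r^-1 * (z.2 - 0)).
  rewrite /xi B0 ?expr2 ?mul0r; first by case/andP: I01.
  by rewrite subr0 ger0_norm ?mulr_ge0 ?invr_ge0 ?(ltW r0)// ler_pdivlMl// mulrC ltW.
have dxiI : derive1 xi z.2 ^+ 2 <= (C0 / r) ^+ 2 * I.
  rewrite /xi derive1_rescale//.
  have [h|h] := leP z.2 (2 * r).
    rewrite Inear// mulr1 -real_normK ?num_real// lerXn2r ?nnegrE ?divr_ge0 ?(ltW r0)//.
    by rewrite normrM gtr0_norm ?invr_gt0// mulrC ler_pM2r ?invr_gt0.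
  have suppB : supp_in B (- 2) 2 by move=> t ht; apply: B0; rewrite leNgt ltr_norml.
  rewrite (derive1_supp sB suppB) ?mulr0 ?expr2 ?mul0r.
    by have /andP[i0 _] := I01; exact: mulr_ge0 (mulr_ge0 (divr_ge0 C00 (ltW r0)) (divr_ge0 C00 (ltW r0))) i0.
  rewrite -ltr_norml -leNgt subr0 ger0_norm ?mulr_ge0 ?invr_ge0 ?(ltW r0)//.
  by rewrite ler_pdivlMl// mulrC ltW.
have dka : derive1 ka z.2 ^+ 2 <= 4 * (C0 / H) ^+ 2.
  have h2 : 0 <= 2 / H by rewrite divr_ge0// ltW.
  rewrite /ka derive1_rescale// (_ : 4 * _ = (2 / H * C0) ^+ 2); last by rewrite !exprMn; ring.
  rewrite -real_normK ?num_real// lerXn2r ?nnegrE//.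
    exact: mulr_ge0 h2 C00.
  by rewrite normrM ger0_norm// ler_wpM2l.
have ka01 : 0 <= ka z.2 ^+ 2 <= 1.
  by rewrite sqr_ge0 expr_le1//; have /andP[] := B01 (2 / H * (z.2 - 0)).
have f01 : 0 <= (1 - zeta z.1 * xi z.2) ^+ 2 <= 1.
  have /andP[h1 h2] := prod01 (zeta01 z.1) (B01 (r^-1 * (z.2 - 0))).
  by rewrite sqr_ge0 expr_le1// ?subr_ge0// gerBl.
have /andP[cg0 cg3] := corners_ge0 z.1.
rewrite Ex Ey; apply: gradient_pointwise (dzeta z.1) xiI ka01 f01 dka (zeta_le z.1) dxiI _ _ => //.
Qed.

End Cutoff_function.

(** * Bound on [p_x] and flux balance for the Jin-Kohn vector field *)

Section Jin_Kohn.
Context {R : realType}.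
Local Notation mu := (@lebesgue_measure R).
Local Notation leb2 := (mu \x mu)%E.
Variables (B : R -> R) (C0 : R).
Hypothesis sB : smooth1 B.
Hypothesis B1 : forall t, `|t| <= 1 -> B t = 1.
Hypothesis B0 : forall t, 2 <= `|t| -> B t = 0.
Hypothesis B01 : forall t, 0 <= B t <= 1.
Hypothesis dBle0 : forall t, 0 <= t -> derive1 B t <= 0.
Hypothesis C01 : 1 <= C0.
Hypothesis dB : forall t, `|derive1 B t| <= C0.
Variables (eps l al F : R) (th p q px qx qy : R * R -> R).
Hypothesis C : cell eps l al F th p q px qx qy.
Hypothesis l0 : 0 < l.
Hypothesis al0 : 0 <= al <= l.
Variables (r H : R).
Hypothesis r0 : 0 < r.
Hypothesis rl : r <= l.
Hypothesis lH : l <= H.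
Hypothesis rH : 8 * r <= H.

Let H0 : 0 < H. Proof. exact: lt_le_trans lH. Qed.
Let W z := 1 - (p z ^+ 2 + q z ^+ 2).
Let eta := cutoff B l al r H.
Let seta : smooth eta. Proof. exact: cutoff_smooth. Qed.
Let ceta : continuous eta. Proof. exact: smooth_cont. Qed.
Let c2 : continuous (fun z => eta z ^+ 2).
Proof. by move=> z; apply: cvgM; exact: ceta. Qed.
Let G2 z := 'D_(dirx R) eta z ^+ 2 + 'D_(diry R) eta z ^+ 2.
Definition cutoff_const := 15 * (C0 / r) ^+ 2 + 8 * (C0 / H) ^+ 2.
(** The right-hand side of [caccioppoli] for this cutoff; its first part does not depend on the
    scale [r]. *)
Definition gradient_const := 20 * (128 * C0 ^+ 2) + (20 * cutoff_const + 8) * F.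

Lemma cutoff_gradient_bound z : 0 <= z.2 -> G2 z <= cutoff_const.
Proof.
move=> z0; have := cutoff_gradient sB B0 B01 C01 dB l al r0 H0 z0.
move=> /le_trans; apply; rewrite lerD2r.
have c0 := sqr_ge0 (C0 / r); have /andP[g0 g3] := corners_ge0 l al r z.1.
set I := \1_(_) _; have : 0 <= I <= 1 by rewrite /I indicE; case: (_ \in _); rewrite ?lexx ler01.
move=> /andP[i0 i1]; have h : corners l al r z.1 * I <= 3 * 1 by exact: ler_pM.
have h' := ler_wpM2l c0 h; move: h'; rewrite mulr1.
by move: (corners _ _ _ _ * I) ((C0 / r) ^+ 2) => u D; lra.
Qed.

Let i1_ind (a b c d : R) : integ mu `[a, b]%classic (\1_(`[c, d]%classic) : R -> R).
Proof.
apply: (@integ_le _ _ _ mu _ _ (fun=> 1)) (i1c a b 1) => //.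
by move=> x _; rewrite indicE; case: (_ \in _); rewrite ?normr1 ?normr0.
Qed.

(** Scale invariance: [5 (C0 / r)^2] on a region of area at most [2 r] times [12 r] gives
    [120 C0^2]; the taper gives [8 C0^2], because [l <= H]. *)
Lemma cutoff_gradient_integral : \int[leb2]_(z in rect 0 l 0 H) G2 z <= 128 * C0 ^+ 2.
Proof.
have hc c : \int[mu]_(x in `[0, l]) (\1_(`[c - 2 * r, c + 2 * r]%classic) x : R) <= 4 * r.
  have r0' := r0; have h : c - 2 * r <= c + 2 * r by lra.
  by apply: le_trans (Rint_indic_le 0 l h) _; lra.
have C00 : 0 <= C0 by exact: le_trans C01.
have dX : dir (dirx R) by left. have dY : dir (diry R) by right.
have cD e : dir e -> continuous (fun z => 'D_e eta z ^+ 2).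
  by move=> he z; apply: cvgM; exact: (smooth_cont (smooth_derive he seta)).
have cG : continuous G2.
  by move=> z; apply: cvgD; [exact: (cD _ dX)|exact: (cD _ dY)].
pose J (y : R) := (\1_(`[0, 2 * r]%classic) y : R).
have iC : integ mu `[0, l]%classic (corners l al r) by apply: i1D; [apply: i1D|]; exact: i1_ind.
have iJ : integ mu `[0, H]%classic J by exact: i1_ind.
have iCJ : integ leb2 (rect 0 l 0 H) (fun z => corners l al r z.1 * J z.2) by exact: integ_prod.
have iR : integ leb2 (rect 0 l 0 H) (fun z => 5 * (C0 / r) ^+ 2 * (corners l al r z.1 * J z.2) + 8 * (C0 / H) ^+ 2).
  by apply: i2D; [exact: i2Z|exact: i2c].
apply: le_trans (R2le (@continuous_integ2 _ _ 0 l 0 H cG) iR _) _.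
  apply: aeW => z /rectE[z1 /andP[z20 z2H]].
  apply: le_trans (cutoff_gradient sB B0 B01 C01 dB l al r0 H0 z20) _.
  by rewrite /J !indicE !mem_setE !in_itv/= z20.
rewrite R2D//; [|by exact: i2Z|exact: i2c].
rewrite R2Z// (R2x (i2c _ _ _ _ _)).
under [X in _ + X]eq_Rintegral do rewrite R1c ?(ltW H0)//.
rewrite R1c ?(ltW l0)// !subr0.
have -> : \int[leb2]_(z in rect 0 l 0 H) (corners l al r z.1 * J z.2) =
    (\int[mu]_(y in `[0, H]) J y) * \int[mu]_(x in `[0, l]) corners l al r x.
  rewrite R2x// -R1Z//; apply: R1eq => x _ /=.
  by rewrite R1Z// mulrC.
have J2 : \int[mu]_(y in `[0, H]) J y <= 2 * r.
  by apply: le_trans (Rint_indic_le _ _ _) _; rewrite ?subr0// mulr_ge0// ltW.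
have J0 : 0 <= \int[mu]_(y in `[0, H]) J y.
  by apply: Rintegral_ge0 => y _; rewrite /J indicE; case: (_ \in _).
have r2 : 0 <= 2 * r by rewrite mulr_ge0// ltW.
have Cr : \int[mu]_(x in `[0, l]) corners l al r x <= 12 * r.
  rewrite /corners R1D; [|by apply: i1D; exact: i1_ind|exact: i1_ind].
  rewrite R1D; [|exact: i1_ind|exact: i1_ind].
  apply: le_trans (lerD (lerD (hc 0) (hc al)) (hc l)) _.
  by rewrite [leRHS](_ : _ = 4 * r + 4 * r + 4 * r)//; ring.
have P0 : 0 <= \int[mu]_(x in `[0, l]) corners l al r x.
  by apply: Rintegral_ge0 => x _; case/andP: (corners_ge0 l al r x).
have JC := ler_pM J0 P0 J2 Cr.
have := ler_wpM2l (mulr_ge0 (ler0n R 5) (sqr_ge0 (C0 / r))) JC.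
have -> : 5 * (C0 / r) ^+ 2 * (2 * r * (12 * r)) = 120 * C0 ^+ 2.
  by field; rewrite gt_eqF.
have h8 : 8 * (C0 / H) ^+ 2 * H * l <= 8 * C0 ^+ 2.
  have -> : 8 * (C0 / H) ^+ 2 * H * l = 8 * C0 ^+ 2 * (l / H) by field; rewrite gt_eqF.
  by rewrite ler_piMr ?mulr_ge0 ?sqr_ge0// ler_pdivrMr// mul1r.
by move=> /lerD/(_ h8); move=> /le_trans; apply; rewrite -mulrDl -natrD.
Qed.

(** The limit of [caccioppoli] along the increments [1 / (n + N + 1)], where [N] is chosen to keep
    them below [r]. *)
Lemma px_cutoff : integ leb2 (rect 0 l 0 H) (fun z => (eta z * px z) ^+ 2) /\
  \int[leb2]_(z in rect 0 l 0 H) ((eta z * px z) ^+ 2) <= gradient_const.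
Proof.
have [[mth mp mq] [mpx mqx mqy]] := cell_meas C.
have [_ [spxH _ _]] := cell_sq C H.
have meta := continuous_measurable2 ceta.
have ll3 : l <= 3 * l by rewrite ler_peMl ?(ltW l0)// ler1n.
have i_px : integ leb2 (rect 0 l 0 H) (fun z => (eta z * px z) ^+ 2).
  apply: (@eq_integ _ _ _ leb2 _ (fun z => eta z ^+ 2 * px z ^+ 2)).
  - exact: measurable_rect.
  - by move=> z _; rewrite [RHS]exprMn.
  - by apply: (integ_contM c2); apply: i2S spxH.2.
split => //; pose N := Num.truncn (r^-1); pose h n : R := (n + N).+1%:R^-1.
have h0 n : 0 < h n by rewrite invr_gt0.
have hr n : 0 < h n < r.
  rewrite h0/= /h -[r]invrK ltf_pV2 ?posrE ?invr_gt0//.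
  by apply: lt_le_trans (truncnS_gt _) _; rewrite ler_nat ltnS leq_addl.
have Hc n : integ leb2 (rect 0 l 0 H) (fun z => eta z ^+ 2 * (dq (h n) p z ^+ 2 + dq (h n) q z ^+ 2)) /\
   \int[leb2]_(z in rect 0 l 0 H) (eta z ^+ 2 * (dq (h n) p z ^+ 2 + dq (h n) q z ^+ 2)) <= gradient_const.
  have [|||||i1 i2] := @caccioppoli R eps l al F th p q px qx qy C l0 r (h n) H eta r0 (hr n) rl H0 seta _ _ _ _ cutoff_const _.
  - by move=> z _; exact: cutoff01.
  - by move=> x; exact: cutoff_top.
  - by move=> x; exact: cutoff_corner.
  - by move=> y; exact: cutoff_per.
  - by move=> z; exact: cutoff_gradient_bound.
  split => //; apply: le_trans i2 _; rewrite lerD2r ler_pM2l//.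
  exact: cutoff_gradient_integral.
have hl n : 0 <= h n <= l by have /andP[a b] := hr n; rewrite (ltW a) (le_trans (ltW b)).
have l2 : l <= 2 * l by rewrite mulr_natl mulr2n lerDl ltW.
have spH : sq_integ leb2 (rect 0 (3 * l) 0 H) p by have [[]] := cell_sq C H.
have iu n : integ leb2 (rect 0 l 0 H) (fun z => (eta z * dq (h n) p z) ^+ 2).
  apply: (@eq_integ _ _ _ leb2 _ (fun z => eta z ^+ 2 * dq (h n) p z ^+ 2)).
  - exact: measurable_rect.
  - by move=> z _; rewrite [RHS]exprMn.
  - apply: (integ_contM c2); have [_] := sq_integ_dq (hl n) mp spH.
    by apply: i2S.
apply: (@fatou_lines R 0 l 0 H gradient_const (fun n z => eta z * dq (h n) p z)).
- by move=> n; apply: measurable_funM => //; exact: measurable_dq.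
- exact: measurable_funM.
- exact: iu.
- move=> n; have [j1 j2] := Hc n; apply: le_trans j2; apply: R2le => //.
  by apply: aeW => z _; rewrite [leLHS]exprMn ler_wpM2l ?sqr_ge0// lerDl sqr_ge0.
- exact: i_px.
apply: (aeS (cell_linex C H0)) => y hy yH.
have [_ [a [b hab]] _] := hy yH.
have l20 : 0 < 2 * l by rewrite mulr_gt0.
have E3 : l + 2 * l = 3 * l by ring.
rewrite -E3 in hab.
apply: (aeS (prim_dq l20 (ltW l0) hab)) => x hx xl.
have := hx xl; rewrite -(cvg_shiftn N) => hx'.
have E : (fun n => eta (x, y) * dq (h n) p (x, y)) =
    (fun n => eta (x, y) * ((n + N).+1%:R * (p (x + (n + N).+1%:R^-1, y) - p (x, y)))).
  by apply/funext => n; rewrite /dq /h invrK.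
by rewrite E; exact: cvgM (cvg_cst (eta (x, y))) hx'.
Qed.

Let far x := al + 2 * r <= x <= l - 2 * r.

Let eta_far z : far z.1 -> 0 <= z.2 <= H / 2 -> eta z = 1.
Proof.
move=> /andP[x1 x2]; have /andP[al1 al2] := al0; apply: cutoff1_far => //.
by apply: zeta_far => //; rewrite ler_normr; apply/orP; [left|left|right]; lra.
Qed.

Let le_of_add (u v w : R) : 0 <= v -> u + v <= 1 * w -> u <= w.
Proof. by rewrite mul1r => v0; apply: le_trans; rewrite lerDl. Qed.

(** Poincare's inequality from [q = 0] at [y = 0], over the height [4 r] that contains the low flux
    layer; [q_y] is the Laplacian minus [p_x], and the cutoff equals 1 on this rectangle. *)
Lemma q_far : \int[leb2]_(z in rect (al + 2 * r) (l - 2 * r) 0 (4 * r)) (q z ^+ 2) <=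
  32 * r ^+ 2 * (gradient_const + F).
Proof.
have [[mth mp mq] [mpx mqx mqy]] := cell_meas C.
have r40 : 0 < 4 * r by rewrite mulr_gt0.
have /andP[al1 al2] := al0.
have x1 : 0 <= al + 2 * r by lra. have x2 : l - 2 * r <= l by lra.
have x3 : l - 2 * r <= 3 * l by lra.
have rH' := rH; have H4 : 4 * r <= H by lra.
have [[_ _ sqH] [spxH _ sqyH]] := cell_sq C H.
set SN := rect _ _ _ _.
have iq : integ leb2 SN (fun z => q z ^+ 2) by apply: i2S sqH.2.
have iqy : integ leb2 SN (fun z => qy z ^+ 2) by apply: i2S sqyH.2.
have sqyS : sq_integ leb2 SN qy by apply: s2S sqyH.
have sqS : sq_integ leb2 SN q by apply: s2S sqH.
have i_f : integ leb2 SN (fun z => (px z + qy z) ^+ 2) by apply: i2S (cell_sq_f C H).2.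
have [ipx Ipx] := px_cutoff.
have ipxS : integ leb2 SN (fun z => (eta z * px z) ^+ 2) by apply: i2S ipx.
have step1 : \int[leb2]_(z in SN) (q z ^+ 2) <= (4 * r) ^+ 2 * \int[leb2]_(z in SN) (qy z ^+ 2).
  rewrite (R2x iq) (R2x iqy) -R1Z; last exact: (i2int1 iqy).
  apply: R1le; [exact: (i2int1 iq)|by apply: i1Z; exact: (i2int1 iqy)|].
  apply: (aeS2 (cell_bcN C r40) (s2ae1 mqy sqyS)) => x h1 h2 xS.
  have [b hb] : exists b, prim (4 * r) 0 b (fun y => q (x, y)) (fun y => qy (x, y)).
    by apply: h1; case/andP: xS => ? ?; apply/andP; split; lra.
  have [_ hh] := prim0_poincare (ltW r40) (measurable_funTS (measurableT_comp mq (pair1_measurable x))) hb (h2 xS).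
  exact: hh.
have step2 : \int[leb2]_(z in SN) (qy z ^+ 2) <= 2 * (gradient_const + F).
  have iG : integ leb2 SN (fun z => 2 * ((eta z * px z) ^+ 2 + (px z + qy z) ^+ 2)) by apply: i2Z; exact: i2D.
  apply: le_trans (R2le iqy iG _) _.
    apply: aeW => z /rectE[z1 /andP[z2 z3]]; rewrite eta_far//; last by rewrite z2; lra.
    by rewrite mul1r; have := sqr_ge0 (px z + (px z + qy z)); rewrite !expr2; lra.
  rewrite R2Z; last exact: i2D.
  rewrite ler_pM2l// R2D//; apply: lerD.
    apply: le_trans Ipx; rewrite /Rintegral; apply: fine_le.
    - by apply: integrable_fin_num ipxS; exact: measurable_rect.
    - by apply: integrable_fin_num ipx; exact: measurable_rect.
    - apply: ge0_subset_integral; [exact: measurable_rect|exact: measurable_rect| | |].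
      + exact: (integrableP _ _ _ ipx).1.
      + by move=> z _; rewrite lee_fin sqr_ge0.
      + exact: rectS.
  have x2' : l - 2 * r <= 0.+1%:R * l by rewrite mul1r.
  have hsub := cell_int_sub l0 (isT : (0 < 3)%N) x1 x2' (lexx 0) H4 (cell_sq_f C H).
  apply: le_trans hsub _.
  apply: le_of_add (cell_energy_le C l0 H (isT : (0 < 3)%N)).
  by apply: Rintegral_ge0 => z _; exact: sqr_ge0.
apply: le_trans step1 _; have := ler_wpM2l (sqr_ge0 (4 * r)) step2.
by move=> /le_trans; apply; rewrite exprMn [leRHS](_ : _ = 4 ^+ 2 * r ^+ 2 * (2 * (gradient_const + F)))//; ring.
Qed.

(** Zero up to height [2 r] and from [H / 2] on. Its derivative weighs the flux in a low layer,
    between [2 r] and [4 r], against that in a high layer, between [H / 4] and [H / 2]. *)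
Let psi y := B (4 / H * (y - 0)) - B ((2 * r)^-1 * (y - 0)).
Let dpsi y := 4 / H * derive1 B (4 / H * (y - 0)) - (2 * r)^-1 * derive1 B ((2 * r)^-1 * (y - 0)).

Let psi_derive y : is_derive y (1 : R) psi (dpsi y).
Proof. exact: is_deriveB (is_derive_rescale _ _ _ sB) (is_derive_rescale _ _ _ sB). Qed.

Let cdB : continuous (derive1 B). Proof. exact: smooth1_cont (smooth1_derive sB). Qed.
Let cres (f : R -> R) (k : R) : continuous f -> continuous (fun y => f (k * (y - 0))).
Proof.
move=> cf y; apply: (@continuous_comp _ _ _ (fun y => k * (y - 0)) f); last exact: cf.
exact: (smooth1_cont (smooth1_affine k 0)).
Qed.

Let cdpsi : continuous dpsi.
Proof.
by move=> y; apply: cvgB; apply: cvgM; try exact: cvg_cst; exact: (cres cdB).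
Qed.
Let cpsi : continuous psi.
Proof. by move=> y; apply: cvgB; exact: (cres (smooth1_cont sB)). Qed.

Let c_snd (f : R -> R) : continuous f -> continuous (fun z : R * R => f z.2).
Proof. by move=> cf z; apply: (@continuous_comp _ _ _ snd f); [exact: cvg_snd|exact: cf]. Qed.

Let psi_0 : psi 0 = 0.
Proof. by rewrite /psi subrr !mulr0 subrr. Qed.
Let psi_H : psi H = 0.
Proof.
have r20 : 0 < 2 * r by rewrite mulr_gt0.
rewrite /psi !subr0 !B0 ?subrr//.
- rewrite ger0_norm; last by rewrite mulr_ge0 ?invr_ge0 ?(ltW r20) ?(ltW H0).
  by rewrite ler_pdivlMl//; have := rH; have := r0; lra.
- by rewrite divfK ?gt_eqF// ger0_norm// ler_nat.
Qed.

Let P z := jk (p z) (q z).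
(** [TY] and [TX] are [P_y] and [S_x], with [q_x] in place of [p_y]; the mixed terms cancel in their
    difference. *)
Let TY z := qy z * W z - 2 * (p z * q z) * qx z.
Let TX z := px z * W z - 2 * (p z * q z) * qx z.

(** With the arguments exchanged, [jk] is also the second component S of the field, so this one rule
    yields both [P_y] and [S_x]. *)
Let jk_prim (L a b a' b' : R) (u v u' v' : R -> R) : 0 <= L ->
  measurable_fun setT u -> measurable_fun setT v ->
  prim L a b u u' -> prim L a' b' v v' -> prim L (jk a a') (jk b b') (fun t => jk (u t) (v t))
    (fun t => v' t * (1 - (u t ^+ 2 + v t ^+ 2)) - 2 * (u t * v t) * u' t).
Proof.
move=> L0 mu0 mv hu hv.
have mS (f : R -> R) : measurable_fun setT f -> measurable_fun `[0, L]%classic f by exact: measurable_funTS.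
have huu := prim_mul L0 (mS _ mu0) (mS _ mu0) hu hu.
have hvv := prim_mul L0 (mS _ mv) (mS _ mv) hv hv.
have hg := primB (primB (prim_cst L 1) huu) (primZ (1 / 3) hvv).
have mg : measurable_fun setT (fun t => 1 - u t * u t - 1 / 3 * (v t * v t)).
  apply: measurable_funB; first by apply: measurable_funB => //; exact: measurable_funM.
  by apply: measurable_funM => //; exact: measurable_funM.
have := prim_mul L0 (mS _ mv) (mS _ mg) hv hg.
have E (x y : R) : y * (1 - x * x - 1 / 3 * (y * y)) = jk x y by rewrite /jk; field.
rewrite !E => h.
have := prim_eq _ h L0 => /(_ (fun t => v' t * (1 - (u t ^+ 2 + v t ^+ 2)) - 2 * (u t * v t) * u' t)).
have -> : (fun t => jk (u t) (v t)) = (fun t => v t * (1 - u t * u t - 1 / 3 * (v t * v t))).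
  by apply/funext => t; rewrite E.
by apply => t _; field.
Qed.

Let lines_zero (a b : R) (g : R -> R) : a <= b -> integ mu `[a, b]%classic g ->
  {ae mu, forall x, a <= x <= b -> g x = 0} -> \int[mu]_(x in `[a, b]) g x = 0.
Proof.
move=> ab ig g0; have z0 : \int[mu]_(x in `[a, b]) (0 : R) = 0 by rewrite R1c// mul0r.
apply/eqP; rewrite eq_le -{1}z0 -[X in _ && (X <= _)]z0; apply/andP; split.
- by apply: R1le => //; [exact: i1c|apply: (aeS g0) => x h /h ->].
- by apply: R1le => //; [exact: i1c|apply: (aeS g0) => x h /h ->].
Qed.

Let l3 : l <= 3 * l. Proof. by rewrite ler_peMl ?(ltW l0)// ler1n. Qed.
Let restr u : sq_integ leb2 (rect 0 (3 * l) 0 H) u -> sq_integ leb2 (rect 0 l 0 H) u.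
Proof. by move=> s; apply: s2S s. Qed.

Let sW : sq_integ leb2 (rect 0 l 0 H) W. Proof. exact: restr (cell_sq_W C H). Qed.
Let sp : sq_integ leb2 (rect 0 l 0 H) p.
Proof. by have [[_ s _] _] := cell_sq C H; exact: restr. Qed.
Let sq : sq_integ leb2 (rect 0 l 0 H) q.
Proof. by have [[_ _ s] _] := cell_sq C H; exact: restr. Qed.
Let spx : sq_integ leb2 (rect 0 l 0 H) px.
Proof. by have [_ [s _ _]] := cell_sq C H; exact: restr. Qed.
Let sqx : sq_integ leb2 (rect 0 l 0 H) qx.
Proof. by have [_ [_ s _]] := cell_sq C H; exact: restr. Qed.
Let sqy : sq_integ leb2 (rect 0 l 0 H) qy.
Proof. by have [_ [_ _ s]] := cell_sq C H; exact: restr. Qed.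
Let sf : sq_integ leb2 (rect 0 l 0 H) (fun z => px z + qy z).
Proof. exact: restr (cell_sq_f C H). Qed.

Let sq_leW (u : R * R -> R) : measurable_fun setT u -> (forall z, `|u z| <= 1 - W z) ->
  sq_integ leb2 (rect 0 l 0 H) u.
Proof.
move=> mu0 uW; split; first exact: measurable_funTS.
have s1W : sq_integ leb2 (rect 0 l 0 H) (fun z => 1 - W z) by apply: s2B => //; exact: s2c.
apply: integ_le s1W.2; first exact: measurable_rect.
  by apply: measurable_funTS; exact: measurable_funX.
move=> z _; rewrite ger0_norm ?sqr_ge0// -real_normK ?num_real//.
by rewrite lerXn2r// nnegrE// (le_trans _ (uW z)).
Qed.

Let sqq : sq_integ leb2 (rect 0 l 0 H) (fun z => q z ^+ 2).
Proof.
have [[_ _ mq] _] := cell_meas C; apply: sq_leW; first exact: measurable_funX.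
by move=> z; rewrite ger0_norm ?sqr_ge0// /W subKr lerDr sqr_ge0.
Qed.

Let spq : sq_integ leb2 (rect 0 l 0 H) (fun z => p z * q z).
Proof.
have [[_ mp mq] _] := cell_meas C; apply: sq_leW; first exact: measurable_funM.
move=> z; rewrite /W subKr ler_norml; have := sqr_ge0 (p z + q z); have := sqr_ge0 (p z - q z).
by have := sqr_ge0 (p z); have := sqr_ge0 (q z); move: (p z) (q z) => a b; rewrite !expr2 => *; apply/andP; split; lra.
Qed.

Let iP : integ leb2 (rect 0 l 0 H) P.
Proof.
have := i2D (s2M sq sW) (i2Z (2 / 3) (s2M sq sqq)); apply: eq_integ => //; first exact: measurable_rect.
by move=> z _; rewrite /P jkE /W exprS.
Qed.

Let iTY : integ leb2 (rect 0 l 0 H) TY.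
Proof. exact: i2B (s2M sqy sW) (s2M (s2Z 2 spq) sqx). Qed.
Let iTX : integ leb2 (rect 0 l 0 H) TX.
Proof. exact: i2B (s2M spx sW) (s2M (s2Z 2 spq) sqx). Qed.

Let cdpsi2 : continuous (fun z : R * R => dpsi z.2). Proof. exact: c_snd. Qed.
Let cpsi2 : continuous (fun z : R * R => psi z.2). Proof. exact: c_snd. Qed.

(** On vertical lines the derivative of [psi P] integrates to 0, as [psi] vanishes at both ends; on
    horizontal lines [S_x] does, by periodicity. *)
Lemma jk_identity : integ leb2 (rect 0 l 0 H) (fun z => dpsi z.2 * P z + psi z.2 * ((qy z - px z) * W z)) /\
  \int[leb2]_(z in rect 0 l 0 H) (dpsi z.2 * P z + psi z.2 * ((qy z - px z) * W z)) = 0.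
Proof.
have [[mth mp mq] [mpx mqx mqy]] := cell_meas C.
have iY : integ leb2 (rect 0 l 0 H) (fun z => dpsi z.2 * P z + psi z.2 * TY z).
  by apply: i2D; [exact: integ_contM cdpsi2 iP|exact: integ_contM cpsi2 iTY].
have iX : integ leb2 (rect 0 l 0 H) (fun z => psi z.2 * TX z) by exact: integ_contM cpsi2 iTX.
have Y0 : \int[leb2]_(z in rect 0 l 0 H) (dpsi z.2 * P z + psi z.2 * TY z) = 0.
  rewrite (R2x iY); apply: lines_zero; [exact: ltW|exact: (i2int1 iY)|].
  apply: (aeS (cell_liney C H0)) => x hx /andP[x0 xl].
  have hx3 : 0 <= x <= 3 * l by rewrite x0 (le_trans xl).
  have [_ [a [b hp]] [a' [b' hq]]] := hx hx3.
  have mx (u : R * R -> R) : measurable_fun setT u -> measurable_fun setT (fun y => u (x, y)).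
    by move=> mu0; exact: measurableT_comp mu0 (pair1_measurable x).
  have hP := jk_prim (ltW H0) (mx _ mp) (mx _ mq) hp hq.
  have hpsi := @prim_C1 R H psi dpsi (ltW H0) psi_derive cdpsi.
  have mP : measurable_fun setT (fun y => jk (p (x, y)) (q (x, y))).
    rewrite (_ : (fun y => _) = (fun y => q (x, y) * (1 - p (x, y) ^+ 2 - 1 / 3 * q (x, y) ^+ 2))); last first.
      by apply/funext => y; rewrite /jk; field.
    have mpx2 := measurable_funX 2 (mx _ mp); have mqx2 := measurable_funX 2 (mx _ mq).
    apply: measurable_funM; first exact: mx.
    by apply: measurable_funB; [exact: measurable_funB|exact: measurable_funM].
  have mpsi : measurable_fun `[0, H]%classic psi by apply: measurable_funTS; exact: continuous_measurable_fun.
  have := prim_int (prim_mul (ltW H0) mpsi (measurable_funTS mP) hpsi hP).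
  by rewrite psi_0 psi_H !mul0r subrr.
have X0 : \int[leb2]_(z in rect 0 l 0 H) (psi z.2 * TX z) = 0.
  rewrite (R2y iX); apply: lines_zero; [exact: ltW|exact: (i2int2 iX)|].
  apply: (aeS2 (aeS2 (cell_linex C H0) (ae_ysection (cell_per C)) (fun z a b => conj a b))
    (aeS2 (i2ae2 iTX) (ae_neq 0) (fun z a b => conj a b))) => y [hy pery] [iy y0] yH.
  have [_ [a [b hp]] [a' [b' hq]]] := hy yH.
  have hz x : half_plane (x, y) by rewrite /half_plane /= lt_neqAle eq_sym y0; case/andP: yH.
  have my (u : R * R -> R) : measurable_fun setT u -> measurable_fun setT (fun x => u (x, y)).
    by move=> mu0; exact: measurableT_comp mu0 (pair2_measurable y).
  have l30 : 0 <= 3 * l by rewrite mulr_ge0// ltW.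
  have hP := jk_prim l30 (my _ mq) (my _ mp) hq hp.
  rewrite (@R1eq _ 0 l _ (fun x => psi y * TX (x, y)))// R1Z; last exact: iy.
  have ll3 : l < 3 * l by rewrite ltr_pMl// ltr1n.
  have := prim_periodic (ltW l0) ll3 hP _ _.
  rewrite (_ : \int[mu]_(t in `[0, l]) _ = \int[mu]_(x in `[0, l]) TX (x, y)); last first.
    by apply: R1eq => x _; rewrite /TX /W [q _ ^+ 2 + _]addrC [q _ * p _]mulrC.
  move=> -> ; first by rewrite mulr0.
    by apply: (aeS pery) => x hx x0; have [h1 h2 _ _ _] := hx (hz x); rewrite /xshift /= in h1 h2; rewrite h1 h2.
  by apply: (aeS pery) => x hx x0; have [h1 h2 h3 h4 _] := hx (hz x); rewrite /xshift /= in h1 h2 h3 h4; rewrite h1 h2 h3 h4.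
have E : (fun z => dpsi z.2 * P z + psi z.2 * ((qy z - px z) * W z)) =
    (fun z => dpsi z.2 * P z + psi z.2 * TY z - psi z.2 * TX z).
  by apply/funext => z; rewrite /TY /TX; ring.
rewrite E; split; first exact: i2B.
by rewrite R2B// X0 Y0 subrr.
Qed.

(** A density of mass 1 concentrated between the heights [1 / k] and [2 / k]; [dpsi] is the
    difference of two of these. *)
Let tau (k y : R) := - (k * derive1 B (k * (y - 0))).

Let tau_cont k : continuous (tau k).
Proof. by move=> y; apply: cvgN; apply: cvgM; [exact: cvg_cst|exact: (cres cdB)]. Qed.

Let tau_bound k y : 0 <= k -> 0 <= y -> 0 <= tau k y <= C0 * k.
Proof.
move=> k0 y0; have h1 : derive1 B (k * (y - 0)) <= 0 by apply: dBle0; rewrite subr0 mulr_ge0.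
have := dB (k * (y - 0)); rewrite ler0_norm// => h2.
by rewrite /tau -mulrN mulr_ge0 ?oppr_ge0//= mulrC ler_wpM2r.
Qed.

Let tau_far k y : 0 <= k -> 0 <= y -> 2 <= k * y -> tau k y = 0.
Proof.
move=> k0 y0 ky; have suppB : supp_in B (- 2) 2 by move=> t ht; apply: B0; rewrite leNgt ltr_norml.
rewrite /tau (derive1_supp sB suppB) ?mulr0 ?oppr0//.
by rewrite -ltr_norml -leNgt addr0 ger0_norm// mulr_ge0.
Qed.

Let tau_int k : 0 <= k -> 2 <= k * H -> \int[mu]_(y in `[0, H]) tau k y = 1.
Proof.
move=> k0 kH.
have dh y : is_derive y (1 : R) (fun y => - B (k * (y - 0))) (tau k y).
  exact: is_deriveN (is_derive_rescale _ _ _ sB).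
have h := prim_int (@prim_C1 R H _ (tau k) (ltW H0) dh (@tau_cont k)).
rewrite h !subr0 mulr0 [B (k * H)]B0; last by rewrite ger0_norm// mulr_ge0// ltW.
by rewrite B1 ?normr0// opprK oppr0 add0r.
Qed.

(** Marks the region over and near the Dirichlet part, where the flux is bounded through [2 / 3];
    over the rest the bound by [q^2] is used, up to height [4 r]. *)
Let chi x : R := \1_(`[0, al + 2 * r]%classic) x + \1_(`[l - 2 * r, l]%classic) x.
Let S := rect (al + 2 * r) (l - 2 * r) 0 (4 * r).

Let chi_near x : 0 <= x <= l -> ~~ far x -> 1 <= chi x.
Proof.
move=> /andP[x0 xl]; rewrite /far negb_and -!ltNge /chi !indicE => /orP[h|h].
  by rewrite mem_set ?lerDl//= in_itv/= x0 ltW.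
by rewrite addrC mem_set ?lerDl//= in_itv/= xl ltW.
Qed.

Let chi_ge0 x : 0 <= chi x.
Proof. by rewrite /chi !indicE addr_ge0. Qed.

Let chi_int : integ mu `[0, l]%classic chi /\ \int[mu]_(x in `[0, l]) chi x <= al + 4 * r.
Proof.
have /andP[al1 al2] := al0; have r0' := r0.
split; first by apply: i1D; exact: i1_ind.
rewrite /chi R1D; [|exact: i1_ind|exact: i1_ind].
have h1 : \int[mu]_(x in `[0, l]) (\1_(`[0, al + 2 * r]%classic) x : R) <= al + 2 * r - 0.
  by apply: Rint_indic_le; lra.
have h2 : \int[mu]_(x in `[0, l]) (\1_(`[l - 2 * r, l]%classic) x : R) <= l - (l - 2 * r).
  by apply: Rint_indic_le; lra.
by lra.
Qed.

Let pw_beta (b cb s3 m e Pz : R) : 0 <= b <= cb -> 0 < m -> 0 <= e ->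
  2 / 3 * s3 - 2 * (m + e / m) <= Pz -> (2 / 3 * s3 - 2 * m) * b - 2 * cb / m * e <= b * Pz.
Proof.
move=> /andP[b0 bc] m0 e0 h; have h1 := ler_wpM2l b0 h.
have em : 0 <= e / m by exact: divr_ge0 e0 (ltW m0).
have h2 := ler_wpM2r em bc.
have -> : 2 * cb / m * e = 2 * (cb * (e / m)) by field; rewrite gt_eqF.
by move: h1 h2; move: (e / m) => v; lra.
Qed.

(** The alternatives are: a point marked by [chi], a point above the low layer, or a point of
    [S]. *)
Let pw_tau (t ct Pz c W2 q2 i : R) : 0 <= t <= ct -> 0 <= W2 -> 0 <= q2 -> 0 <= i -> 0 <= c ->
  Pz <= 2 / 3 + 2 * W2 -> Pz <= 2 * q2 + 2 * W2 -> [\/ 1 <= c, t = 0 | i = 1] ->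
  t * Pz <= 2 / 3 * (c * t) + 2 * ct * W2 + 2 * ct * (q2 * i).
Proof.
move=> /andP[t0 tc] W20 q20 i0 c0 h1 h2 hc.
have ct0 : 0 <= ct by exact: le_trans tc.
have tW := ler_wpM2r W20 tc; have k1 := ler_wpM2l t0 h1; have k2 := ler_wpM2l t0 h2.
have n1 : 0 <= ct * (q2 * i) by rewrite !mulr_ge0.
have n2 : 0 <= c * t by rewrite mulr_ge0.
have n3 : 0 <= ct * W2 by rewrite mulr_ge0.
case: hc => [c1|t00|i1].
- by have := ler_peMl t0 c1; lra.
- by rewrite t00 mul0r mulr0 mulr0 add0r -mulrA -[2 * ct * (q2 * i)]mulrA; lra.
- by have := ler_wpM2r q20 tc; rewrite i1 mulr1; lra.
Qed.

(** [y - x] is split as [(x + y) - 2 x], with [x] for [p_x] and [y] for [q_y]; the parameter [k],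
    later [r], balances [p_x^2] against [W^2]. *)
Let pw_psi (ps x y e w k : R) : `|ps| <= 1 -> 0 < k -> ps = 0 \/ e = 1 ->
  ps * ((y - x) * w) <= 1 / 2 * (x + y) ^+ 2 + w ^+ 2 + (k * (e * x) ^+ 2 + k^-1 * w ^+ 2).
Proof.
move=> ps1 k0 hc; have ki : 0 < k^-1 by rewrite invr_gt0.
case: hc => [->|->].
  rewrite mul0r; apply: addr_ge0; apply: addr_ge0; rewrite ?sqr_ge0//.
  - exact: mulr_ge0 (divr_ge0 ler01 (ler0n R 2)) (sqr_ge0 _).
  - exact: mulr_ge0 (ltW k0) (sqr_ge0 _).
  - exact: mulr_ge0 (ltW ki) (sqr_ge0 _).
have k1 : 0 <= k^-1 * (k * x - w) ^+ 2 by rewrite mulr_ge0 ?sqr_ge0// ltW.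
have k2 : 0 <= k^-1 * (k * x + w) ^+ 2 by rewrite mulr_ge0 ?sqr_ge0// ltW.
have e1 : k^-1 * (k * x - w) ^+ 2 = k * x ^+ 2 - 2 * (x * w) + k^-1 * w ^+ 2 by field; rewrite gt_eqF.
have e2 : k^-1 * (k * x + w) ^+ 2 = k * x ^+ 2 + 2 * (x * w) + k^-1 * w ^+ 2 by field; rewrite gt_eqF.
rewrite e1 in k1; rewrite e2 in k2.
have k3 := sqr_ge0 (x + y - w); have k4 := sqr_ge0 (x + y + w); have k5 := sqr_ge0 w.
apply: le_trans (ler_norm _) _; rewrite normrM.
apply: le_trans (ler_wpM2r (normr_ge0 _) ps1) _; rewrite !mul1r ler_norml.
by move: k1 k2 k3 k4 k5; move: (k^-1 * _) => v; rewrite !expr2 => *; apply/andP; split; lra.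
Qed.

Let indS_int : integ leb2 (rect 0 l 0 H) (fun z => q z ^+ 2 * \1_S z) /\
  \int[leb2]_(z in rect 0 l 0 H) (q z ^+ 2 * \1_S z) = \int[leb2]_(z in S) (q z ^+ 2).
Proof.
have [[_ _ mq] _] := cell_meas C.
have mS : measurable S by exact: measurable_rect.
split.
  apply: integ_le sq.2; first exact: measurable_rect.
    by apply: measurable_funTS; apply: measurable_funM; [exact: measurable_funX|exact: measurable_indic].
  move=> z _; rewrite indicE; case: (_ \in _); rewrite ?mulr1 ?mulr0 ?normr0 ?sqr_ge0//.
  by rewrite ger0_norm ?sqr_ge0.
have /andP[al1 al2] := al0; have r0' := r0; have rH' := rH.
have ES : S = rect 0 l 0 H `&` S.
  by apply/esym/setIidPr; apply: rectS; lra.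
rewrite (_ : \int[leb2]_(z in S) (q z ^+ 2) = \int[leb2]_(z in rect 0 l 0 H `&` S) (q z ^+ 2)); last by rewrite -ES.
rewrite [RHS]Rintegral_mkcondr; apply: eq_Rintegral => z _.
by rewrite patchE indicE; case: ifP => _; rewrite ?mulr1 ?mulr0.
Qed.

Let pw_sum (lb le bP tP ps r1 r2 r3 r4 : R) : lb - le <= bP -> tP <= r1 + r2 + r3 -> ps <= r4 ->
  lb - le <= r1 + r2 + r3 + r4 - (tP - bP + ps).
Proof. by lra. Qed.

Let ct := C0 * (2 * r)^-1.
Let cb := C0 * (4 / H).
Let b := tau (4 / H).
Let t := tau (2 * r)^-1.
Let ri : 0 <= (2 * r)^-1. Proof. by rewrite invr_ge0 mulr_ge0// ltW. Qed.
Let Hi : 0 <= 4 / H. Proof. by rewrite divr_ge0// ltW. Qed.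
Let kH1 : 2 <= 4 / H * H. Proof. by rewrite divfK ?gt_eqF// ler_nat. Qed.
Let kH2 : 2 <= (2 * r)^-1 * H.
Proof. by rewrite ler_pdivlMl ?mulr_gt0//; have := rH; have := r0; lra. Qed.
(** [L] bounds the flux in the high layer from below, [Rz] the flux in the low layer plus the term
    with [W] from above. *)
Let L s m z := (2 / 3 * s ^+ 3 - 2 * m) * b z.2 - 2 * cb / m * ((q z - s) ^+ 2 + W z ^+ 2).
Let Rz z := 2 / 3 * (chi z.1 * t z.2) + 2 * ct * (W z ^+ 2) + 2 * ct * (q z ^+ 2 * \1_S z) +
  (1 / 2 * (px z + qy z) ^+ 2 + W z ^+ 2 + (r * (eta z * px z) ^+ 2 + r^-1 * W z ^+ 2)).

Let ar1 (y : R) : y <= 2 * r -> 4 * y <= H.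
Proof.
move=> h; apply: le_trans rH; rewrite (_ : 8 * r = 4 * (2 * r)); first by rewrite ler_pM2l.
by rewrite mulrA -natrM.
Qed.

Let ar2 (y : R) : H / 2 <= y -> 2 * H <= 4 * y.
Proof.
rewrite ler_pdivrMr// => h; rewrite (_ : 4 * y = 2 * (y * 2)); first by rewrite ler_pM2l.
by rewrite [y * 2]mulrC mulrA -natrM.
Qed.

Let ar3 (y : R) : H / 2 <= y -> 2 * (2 * r) <= y.
Proof.
apply: le_trans; rewrite ler_pdivlMr//; apply: le_trans rH.
by rewrite mulrC mulrA mulrA -!natrM.
Qed.

Let psi_norm (k y : R) : 0 <= k -> 0 <= y -> `|k * (y - 0)| = k * y.
Proof. by move=> k0 y0; rewrite subr0 ger0_norm ?mulr_ge0. Qed.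

(** [psi] lives between the heights [2 r] and [H / 2], where the cutoff is 1 for every [x], so the
    weighted bound on [p_x] suffices. *)
Let psi_eta z : 0 <= z.2 -> `|psi z.2| <= 1 /\ (psi z.2 = 0 \/ eta z = 1).
Proof.
move=> z0; have r20 : 0 < 2 * r by rewrite mulr_gt0.
split.
  have /andP[a1 a2] := B01 (4 / H * (z.2 - 0)); have /andP[a3 a4] := B01 ((2 * r)^-1 * (z.2 - 0)).
  rewrite ler_norml /psi lerBlDr lerBrDr; apply/andP; split.
    by apply: le_trans a1; rewrite addrC subr_le0.
  by apply: le_trans a2 _; rewrite lerDl.
have [z2|/ltW z2] := leP z.2 (2 * r).
  left; have p1 : `|4 / H * (z.2 - 0)| <= 1.
    by rewrite (psi_norm Hi z0) mulrAC ler_pdivrMr// mul1r ar1.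
  have p2 : `|(2 * r)^-1 * (z.2 - 0)| <= 1.
    by rewrite (psi_norm ri z0) ler_pdivrMl// mulr1.
  by rewrite /psi (B1 p1) (B1 p2) subrr.
have [z3|/ltW z3] := leP z.2 (H / 2).
  by right; apply: (cutoff1_above B1 B0) => //; rewrite z2.
left; have p1 : 2 <= `|4 / H * (z.2 - 0)|.
  by rewrite (psi_norm Hi z0) mulrAC ler_pdivlMr// ar2.
have p2 : 2 <= `|(2 * r)^-1 * (z.2 - 0)|.
  by rewrite (psi_norm ri z0) ler_pdivlMl// mulrC ar3.
by rewrite /psi (B0 p1) (B0 p2) subrr.
Qed.

Let LR s m z : 0 <= s <= 1 -> 0 < m <= 1 -> rect 0 l 0 H z ->
  L s m z <= Rz z - (dpsi z.2 * P z + psi z.2 * ((qy z - px z) * W z)).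
Proof.
move=> s01 m01; have /andP[m0 m1] := m01; have r20 : 0 < 2 * r by rewrite mulr_gt0.
move=> /rectE[zx /andP[z0 zH]].
  have P1 := jk_le (p z) (q z); have P2 := jk_le_sqr (p z) (q z); have P3 := jk_ge (p z) (q z) s01 m01.
  have e0 : 0 <= (q z - s) ^+ 2 + W z ^+ 2 by rewrite addr_ge0 ?sqr_ge0.
  have hb := pw_beta (tau_bound Hi z0) m0 e0 P3.
  have i0 : (0 : R) <= \1_S z by rewrite indicE.
  have hc : [\/ 1 <= chi z.1, t z.2 = 0 | \1_S z = 1 :> R].
    have [zf|zf] := boolP (far z.1); last by apply: Or31; exact: chi_near.
    have [z4|/ltW z4] := leP z.2 (4 * r).
      by apply: Or33; rewrite indicE mem_set//; apply/rectE; rewrite z0 z4.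
    apply: Or32; apply: tau_far => //; rewrite ler_pdivlMl//.
    by apply: le_trans z4; rewrite mulrAC -natrM.
  have ht := pw_tau (tau_bound ri z0) (sqr_ge0 (W z)) (sqr_ge0 (q z)) i0 (chi_ge0 z.1) P1 P2 hc.
  have [ps1 pe] := psi_eta z0.
  have hp := pw_psi (px z) (qy z) (W z) ps1 r0 pe.
  have -> : dpsi z.2 * P z = t z.2 * jk (p z) (q z) - b z.2 * jk (p z) (q z).
    by rewrite -mulrBl; congr (_ * _); rewrite /dpsi /t /b /tau opprK addrC.
exact: pw_sum hb ht hp.
Qed.

(** By [jk_identity] the averaged flux of the high layer equals that of the low layer plus the term
    with [W]. The decay constant [A] enters with a factor [1 / H] only. *)
Lemma jk_main s m A : 0 <= s <= 1 -> 0 < m <= 1 ->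
  \int[leb2]_(z in rect 0 l 0 H) ((q z - s) ^+ 2) <= A ->
  (2 / 3 * s ^+ 3 - 2 * m) * l - 2 * (C0 * (4 / H)) / m * (A + F) <=
  2 / 3 * (al + 4 * r) + 2 * (C0 * (2 * r)^-1) * F +
  2 * (C0 * (2 * r)^-1) * (32 * r ^+ 2 * (gradient_const + F)) +
  (1 / 2 * F + F + (r * gradient_const + r^-1 * F)).
Proof.
move=> s01 m01 hA; have /andP[m0 m1] := m01.
have C00 : 0 < C0 by exact: lt_le_trans C01.
rewrite -/ct -/cb.
have ct0 : 0 <= ct by rewrite mulr_ge0// ltW.
have cb0 : 0 <= 2 * cb / m by exact: divr_ge0 (mulr_ge0 (ler0n R 2) (mulr_ge0 (ltW C00) Hi)) (ltW m0).
have [iI I0] := jk_identity.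
have ib : integ leb2 (rect 0 l 0 H) (fun z => b z.2) by apply: continuous_integ2; exact: (c_snd (@tau_cont _)).
have [iS eS] := indS_int; have [ichi Ichi] := chi_int.
have it : integ mu `[0, H]%classic t by apply: continuous_integ; exact: tau_cont.
have ict : integ leb2 (rect 0 l 0 H) (fun z => chi z.1 * t z.2) by exact: integ_prod.
have sqs : sq_integ leb2 (rect 0 l 0 H) (fun z => q z - s) by apply: s2B => //; exact: s2c.
have [ipx Ipx] := px_cutoff.
have iL1 := i2Z (2 / 3 * s ^+ 3 - 2 * m) ib.
have iL2 := i2Z (2 * cb / m) (i2D sqs.2 sW.2).
have iR1 := i2Z (2 / 3) ict. have iR2 := i2Z (2 * ct) sW.2. have iR3 := i2Z (2 * ct) iS.
have iR4 := i2Z (1 / 2) sf.2. have iR5 := i2Z r ipx. have iR6 := i2Z r^-1 sW.2.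
have iRA := i2D (i2D iR1 iR2) iR3. have iRB := i2D (i2D iR4 sW.2) (i2D iR5 iR6).
have key : {ae leb2, forall z, rect 0 l 0 H z -> L s m z <= Rz z - (dpsi z.2 * P z + psi z.2 * ((qy z - px z) * W z))}.
  by apply: aeW => z; exact: LR.
have iL : integ leb2 (rect 0 l 0 H) (L s m) by exact: i2B iL1 iL2.
have iR : integ leb2 (rect 0 l 0 H) Rz by exact: i2D iRA iRB.
have := R2le iL (i2B iR iI) key; rewrite (R2B iR iI) I0 subr0 /L /Rz.
rewrite (R2B iL1 iL2) (R2Z _ ib) (R2Z _ (i2D sqs.2 sW.2)) (R2D sqs.2 sW.2).
rewrite (R2D iRA iRB) (R2D (i2D iR1 iR2) iR3) (R2D iR1 iR2).
rewrite (R2D (i2D iR4 sW.2) (i2D iR5 iR6)) (R2D iR4 sW.2) (R2D iR5 iR6).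
rewrite (R2Z _ ict) !(R2Z _ sW.2) (R2Z _ iS) (R2Z _ sf.2) (R2Z _ ipx) eS.
have -> : \int[leb2]_(z in rect 0 l 0 H) b z.2 = l.
  rewrite (R2x ib) (@R1eq _ 0 l _ (fun=> 1)) ?R1c ?(ltW l0)//; first by rewrite mul1r subr0.
  by move=> x _ /=; exact: tau_int.
have -> : \int[leb2]_(z in rect 0 l 0 H) (chi z.1 * t z.2) = \int[mu]_(x in `[0, l]) chi x.
  rewrite (R2x ict); apply: R1eq => x _ /=.
  by rewrite (R1Z _ it) tau_int// mulr1.
have E1 := cell_energy_le C l0 H (isT : (0 < 3)%N); rewrite !mul1r in E1.
have W0 : 0 <= \int[leb2]_(z in rect 0 l 0 H) (W z ^+ 2) by apply: Rintegral_ge0 => z _; exact: sqr_ge0.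
have f0 : 0 <= \int[leb2]_(z in rect 0 l 0 H) ((px z + qy z) ^+ 2) by apply: Rintegral_ge0 => z _; exact: sqr_ge0.
have Q := q_far; rewrite -/S in Q.
move: E1 W0 f0 Q Ipx Ichi hA.
move: (\int[leb2]_(z in rect 0 l 0 H) (W z ^+ 2)) (\int[leb2]_(z in rect 0 l 0 H) ((px z + qy z) ^+ 2)) => w2 f2.
move: (\int[leb2]_(z in S) _) (\int[leb2]_(z in rect 0 l 0 H) ((eta z * px z) ^+ 2)) => qS p2.
move: (\int[mu]_(x in `[0, l]) chi x) (\int[leb2]_(z in rect 0 l 0 H) ((q z - s) ^+ 2)) => ch qs.
move=> E1 W0 f0 Q Ipx Ichi hA.
have w2F : w2 <= F by rewrite (le_trans _ E1)// lerDr.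
have f2F : f2 <= F by rewrite (le_trans _ E1)// lerDl.
move=> h; apply: le_trans (le_trans h _).
  by rewrite lerD2l lerN2 ler_wpM2l// lerD.
apply: lerD; [apply: lerD; [apply: lerD|]|apply: lerD; [apply: lerD|apply: lerD]] => //.
- by rewrite ler_wpM2l// divr_ge0.
- by rewrite ler_wpM2l// mulr_ge0.
- by rewrite ler_wpM2l// mulr_ge0.
- by rewrite ler_wpM2l// divr_ge0.
- by rewrite ler_wpM2l// ltW.
- by rewrite ler_wpM2l// invr_ge0 ltW.
Qed.

End Jin_Kohn.

(** * Upper bound for the length of the Neumann part *)

Section Upper_bound_on_Neumann_length.
Context {R : realType}.
Local Notation mu := (@lebesgue_measure R).
Local Notation leb2 := (mu \x mu)%E.

(** Here [v] is [F / r], [K] is [r] times [gradient_const] and [d] is [l - al]. As [C0 >= 1], every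
    term is at most a multiple of [C0^3 (r + v + eps)]. *)
Lemma gap_arith (C0 r v eps d K s2 : R) : 1 <= C0 -> 0 < r <= 1 -> 0 <= v -> 0 < eps ->
  K <= 2560 * C0 ^+ 2 * r + 460 * C0 ^+ 2 * v + 8 * v ->
  2 / 3 * d <= s2 * eps + 3 * r + 8 / 3 * r + C0 * v + 32 * C0 * (K + v) + 3 / 2 * v + K + v ->
  s2 <= 6 -> d <= 150 * 1000 * C0 ^+ 3 * (r + v + eps).
Proof.
move=> C1 /andP[r0 r1] v0 e0 hK h hs.
have C00 : 0 <= C0 by exact: le_trans C1.
have D1 : 1 <= C0 ^+ 2 by rewrite expr_ge1.
have se : s2 * eps <= 6 * eps by rewrite ler_pM2r.
set X := r + v + eps; have X0 : 0 <= X by rewrite !addr_ge0// ltW.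
have rX : r <= X by rewrite /X -addrA lerDl addr_ge0// ltW.
have vX : v <= X by rewrite /X addrAC lerDr addr_ge0// ltW.
have eX : eps <= X by rewrite /X lerDr addr_ge0// ltW.
have DX : X <= C0 ^+ 2 * X by rewrite ler_peMl.
have CX : X <= C0 * X by rewrite ler_peMl.
have KX : K <= 3028 * (C0 ^+ 2 * X).
  have h1 : C0 ^+ 2 * r <= C0 ^+ 2 * X by rewrite ler_wpM2l// sqr_ge0.
  have h2 : C0 ^+ 2 * v <= C0 ^+ 2 * X by rewrite ler_wpM2l// sqr_ge0.
  by move: hK; rewrite -!mulrA; lra.
have E1 : C0 ^+ 2 * X <= C0 * (C0 ^+ 2 * X) by rewrite ler_peMl// mulr_ge0// sqr_ge0.
have E2 : C0 * v <= C0 * (C0 ^+ 2 * X) by rewrite ler_wpM2l// (le_trans vX).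
have E3 : C0 * (K + v) <= C0 * (3029 * (C0 ^+ 2 * X)) by rewrite ler_wpM2l//; lra.
rewrite exprS -!mulrA; move: h E1 E2 E3; rewrite -!mulrA; lra.
Qed.

Lemma gap_final (C0 rK v u F r l al eps p t s3l : R) :
  2 / 3 * s3l - 2 * r - t <= 2 / 3 * (al + 4 * r) + C0 * v + 32 * C0 * (rK + u) + (1 / 2 * F + F + (rK + v)) ->
  t <= r -> l - 2 * (p * eps) <= s3l -> C0 * u <= C0 * v -> F <= v ->
  2 / 3 * (l - al) <= 4 / 3 * p * eps + 3 * r + 8 / 3 * r + C0 * v + 32 * C0 * (rK + v) + 3 / 2 * v + rK + v.
Proof. by lra. Qed.

Lemma cell_gap_upper : exists2 K0 : R, 0 < K0 &
  forall (eps al F r : R) (th p q px qx qy : R * R -> R),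
  cell eps (period eps) al F th p q px qx qy -> 0 < eps <= 1 -> 0 <= al <= period eps ->
  0 < r <= 1 -> period eps - al <= K0 * (r + F / r + eps).
Proof.
have [B [C0 [sB B1 B0 B01 [dBle C01 dB]]]] := @plateau_exists R.
exists (150 * 1000 * C0 ^+ 3); first by apply: mulr_gt0; [rewrite -natrM ltr0n|apply: exprn_gt0; exact: lt_le_trans C01].
move=> eps al F r th p q px qx qy C /andP[e0 e1] al01 r01; have /andP[r0 r1] := r01.
set l := period eps in C al01 *.
have C00 : 0 < C0 by exact: lt_le_trans C01.
have el : eps * l = pi by rewrite mulrCA divff ?mulr1// gt_eqF.
have l2 : 2 <= l.
  by rewrite /l /period ler_pdivlMr//; apply: le_trans (@pi_ge2 R); rewrite ler_piMr.
have l0 : 0 < l by exact: lt_le_trans l2.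
have rl : r <= l by rewrite (le_trans r1)// (le_trans _ l2)// ler1n.
set s := Num.sqrt (1 - eps ^+ 2).
have e21 : 0 <= 1 - eps ^+ 2 by rewrite subr_ge0 expr_le1// ltW.
have s0 : 0 <= s by exact: sqrtr_ge0.
have s2 : s ^+ 2 = 1 - eps ^+ 2 by rewrite sqr_sqrtr.
have s1 : s <= 1 by rewrite -(@expr_le1 _ 2)// s2 gerBl sqr_ge0.
have s01 : 0 <= s <= 1 by rewrite s0.
(* With [m = r / l] the error [2 m] per unit length amounts to [2 r] over a period. *)
have m0 : 0 < r / l by rewrite divr_gt0.
have m01 : 0 < r / l <= 1 by rewrite m0 ler_pdivrMr// mul1r.
have F0 := cell_F_ge0 C.
have [A hA] := cell_decay C.
have A0 : 0 <= A.
  by apply: le_trans (hA 0); apply: Rintegral_ge0 => z _; rewrite addr_ge0 ?sqr_ge0.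
(* [A] is specific to the function, so no uniform height will do; [H] is taken after [A], large
   enough to push the decay term below [r]. *)
pose X := 8 * C0 * (A + F) * l / r ^+ 2.
have X0 : 0 <= X by exact: divr_ge0 (mulr_ge0 (mulr_ge0 (mulr_ge0 (ler0n R 8) (ltW C00)) (addr_ge0 A0 F0)) (ltW l0)) (sqr_ge0 _).
pose H := 8 * l + X.
have lH : l <= H by rewrite /H; move: l0 X0; lra.
have H0 : 0 < H by exact: lt_le_trans lH.
have rH : 8 * r <= H by rewrite /H; move: rl X0; lra.
have hq : \int[leb2]_(z in rect 0 l 0 H) ((q z - s) ^+ 2) <= A.
  apply: le_trans (hA H); have [[_ sp sq] _] := cell_sq C H.
  have l3 : l <= 3 * l by rewrite ler_peMl ?(ltW l0)// ler1n.
  have sp' : sq_integ leb2 (rect 0 l 0 H) (fun z => p z - eps).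
    by apply: s2B; [apply: s2S sp|exact: s2c].
  have sq' : sq_integ leb2 (rect 0 l 0 H) (fun z => q z - s).
    by apply: s2B; [apply: s2S sq|exact: s2c].
  apply: (R2le sq'.2 (i2D sp'.2 sq'.2)); apply: aeW => z _.
  by rewrite lerDr sqr_ge0.
have := jk_main sB B1 B0 B01 dBle C01 dB C l0 al01 r0 rl lH rH s01 m01 hq.
set K := gradient_const _ _ _ _.
have hm : 2 * (C0 * (4 / H)) / (r / l) * (A + F) <= r.
  have -> : 2 * (C0 * (4 / H)) / (r / l) * (A + F) = r * (X / H).
    by rewrite /X; field; rewrite !gt_eqF.
  by rewrite ler_piMr ?(ltW r0)// ler_pdivrMr// mul1r /H lerDr mulr_ge0// ltW.
(* [s^3 >= s^4 = (1 - eps^2)^2 >= 1 - 2 eps^2], and the loss over a period is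
   [2 eps^2 l = 2 pi eps]. *)
have ls : l - 2 * (eps ^+ 2 * l) <= s ^+ 3 * l.
  have -> : l - 2 * (eps ^+ 2 * l) = (1 - 2 * eps ^+ 2) * l by ring.
  rewrite ler_pM2r//; have h1 : s ^+ 4 <= s ^+ 3 by rewrite exprS ler_piMl// exprn_ge0.
  apply: le_trans h1; have -> : s ^+ 4 = (s ^+ 2) ^+ 2 by rewrite -exprM.
  by rewrite s2; have := sqr_ge0 (eps ^+ 2); move: (eps ^+ 2) => u; rewrite !expr2; lra.
have el2 : eps ^+ 2 * l = pi * eps by rewrite expr2 -mulrA el mulrC.
have K1 : r * K <= 2560 * C0 ^+ 2 * r + 460 * C0 ^+ 2 * (F / r) + 8 * (F / r).
  have hH : (C0 / H) ^+ 2 <= (C0 / r) ^+ 2.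
    rewrite lerXn2r ?nnegrE ?divr_ge0 ?(ltW r0) ?(ltW H0) ?(ltW C00)//.
    by rewrite ler_pM2l// lef_pV2 ?posrE// (le_trans rl).
  (* [23 = 15 + 8], after [H] is replaced by the smaller [r]. *)
  have hK : K <= 20 * (128 * C0 ^+ 2) + (20 * (23 * (C0 / r) ^+ 2) + 8) * F.
    by rewrite /K /gradient_const lerD2l ler_wpM2r// lerD2r ler_pM2l// /cutoff_const; lra.
  have := ler_wpM2l (ltW r0) hK; move=> /le_trans; apply.
  have -> : r * (20 * (128 * C0 ^+ 2) + (20 * (23 * (C0 / r) ^+ 2) + 8) * F) =
     2560 * C0 ^+ 2 * r + 460 * C0 ^+ 2 * (F / r) + 8 * (r * F) by field; rewrite gt_eqF.
  rewrite lerD2l ler_pM2l// mulrC ler_wpM2l// (le_trans r1)// invf_ge1//.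
have E1 : 2 * (C0 / (2 * r)) * F = C0 * (F / r) by field; rewrite gt_eqF.
have E2 : 2 * (C0 / (2 * r)) * (32 * r ^+ 2 * (K + F)) = 32 * C0 * (r * K + r * F).
  by field; rewrite gt_eqF.
have E3 : (2 / 3 * s ^+ 3 - 2 * (r / l)) * l = 2 / 3 * (s ^+ 3 * l) - 2 * r.
  by field; rewrite gt_eqF.
have rF : r * F <= F / r by rewrite mulrC ler_wpM2l// (le_trans r1)// invf_ge1.
have FF : F <= F / r by rewrite ler_peMr// invf_ge1.
have v0 : 0 <= F / r by rewrite divr_ge0// ltW.
rewrite E1 E2 E3 el2 in ls *; rewrite [r^-1 * F]mulrC => h.
have CK : C0 * (r * F) <= C0 * (F / r) by rewrite ler_pM2l.
apply: (@gap_arith C0 r (F / r) eps (l - al) (r * K) (4 / 3 * pi)) => //.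
  exact: gap_final h hm ls CK FF.
have := @pihalf_lt2 R; move: (pi : R) => x; lra.
Qed.

End Upper_bound_on_Neumann_length.

(** * Smooth admissible functions and their energy *)

Section Smooth_competitors.
Context {R : realType}.
Local Notation mu := (@lebesgue_measure R).
Local Notation leb2 := (mu \x mu)%E.
Implicit Types (u phi psi theta : R * R -> R) (l : R).

(** The constant sequence [phi] is the approximation; on half-boxes the errors vanish almost
    everywhere. *)
Lemma has_trace_smooth u phi : smooth phi -> measurable_fun setT u ->
  measurable_fun setT (wD (dirx R) u) -> measurable_fun setT (wD (diry R) u) ->
  {ae leb2, forall z, half_plane z -> u z = phi z} ->
  {ae leb2, forall z, half_plane z -> wD (dirx R) u z = 'D_(dirx R) phi z} ->
  {ae leb2, forall z, half_plane z -> wD (diry R) u z = 'D_(diry R) phi z} ->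
  has_trace u (fun x => phi (x, 0)).
Proof.
move=> sphi mu0 mux muy E Ex Ey.
have cphi := smooth_cont sphi.
have mphi := continuous_measurable2 cphi.
have mx : measurable_fun setT ('D_(dirx R) phi).
  by apply: continuous_measurable2; apply: smooth_cont; apply: smooth_derive => //; left.
have my : measurable_fun setT ('D_(diry R) phi).
  by apply: continuous_measurable2; apply: smooth_cont; apply: smooth_derive => //; right.
split.
  by apply: continuous_measurable_fun; exact: (@continuous_slice_x _ phi 0 cphi).
exists (fun=> phi); split => // r r0.
set I1 := (\int[leb2]_(z in _) _)%E; set I2 := (\int[mu]_(x in _) _)%E.
have -> : I1 = 0%E.
  have mhb : measurable (half_box r) by exact: (@measurable_rect R (- r) r 0 r).
  rewrite /I1 (ae_eq_integral (cst 0%E))//; first by rewrite integral0.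
    apply/measurable_EFinP.
    have h1 := measurable_sqrB (measurable_funTS (D := half_box r) mphi) (measurable_funTS mu0).
    have h2 := measurable_sqrB (measurable_funTS (D := half_box r) mx) (measurable_funTS mux).
    have h3 := measurable_sqrB (measurable_funTS (D := half_box r) my) (measurable_funTS muy).
    exact: measurable_funD (measurable_funD h1 h2) h3.
  apply: (aeS2 (aeS3 E Ex Ey (fun z a b c => conj a (conj b c))) (ae_neq2 0)).
  move=> z [h1 [h2 h3]] z2 [_ /=]; rewrite in_itv/= => /andP[z20 _].
  have hz : half_plane z by rewrite /half_plane /= lt_neqAle eq_sym z2.
  by rewrite h1// h2// h3// !subrr expr2 mul0r !addr0.
have -> : I2 = 0%E.
  by apply: integral0_eq => x _; rewrite subrr expr2 mul0r.
by split; exact: cvg_cst.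
Qed.

Lemma L2_smooth l Y w psi : 0 < l -> continuous psi -> measurable_fun setT w ->
  {ae leb2, forall z, half_plane z -> w z = psi z} -> (forall z, Y < z.2 -> psi z = 0) ->
  L2_strip l w.
Proof.
move=> l0 cpsi mw E psi0; split; first exact: measurable_funTS.
have mpsi := continuous_measurable2 cpsi.
have -> : (\int[leb2]_(z in strip l) (w z ^+ 2)%:E = \int[leb2]_(z in strip l) (psi z ^+ 2)%:E)%E.
  apply: ae_eq_integral; first exact: measurable_strip.
  - by apply/measurable_EFinP; apply: measurable_funTS; exact: measurable_funX.
  - by apply/measurable_EFinP; apply: measurable_funTS; exact: measurable_funX.
  - apply: (aeS2 E (ae_neq2 0)) => z h z2 [_ z20]; rewrite h//.
    by rewrite /half_plane /= lt_neqAle eq_sym z2.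
have c2 : continuous (fun z => psi z ^+ 2) by move=> z; apply: cvgM; exact: cpsi.
have /integrableP[_] := @continuous_integ2 _ _ 0 l 0 Y c2.
apply: le_lt_trans; rewrite [leLHS]integral_mkcond [leRHS]integral_mkcond.
apply: ge0_le_int_nonmeasurable => z.
  by rewrite patchE; case: ifP => // _; rewrite lee_fin sqr_ge0.
have [zs|zs] := boolP (z \in strip l); rewrite !patchE ?zs ?(negbTE zs); last first.
  by case: ifP => // _; exact: abse_ge0.
move: zs; rewrite inE => -[/andP[h1 /ltW h2] h3]; have [zY|zY] := leP z.2 Y.
  rewrite mem_set; last by apply/rectE; rewrite h1 h2 h3 zY.
  by rewrite /= ger0_norm ?sqr_ge0.
by rewrite psi0// expr2 mul0r; case: ifP => _; [exact: abse_ge0|].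
Qed.

Lemma derive_zero_above Y phi e : (forall z, Y < z.2 -> phi z = 0) ->
  forall z, Y < z.2 -> 'D_e phi z = 0.
Proof.
move=> h0 z zY.
have nz : \forall t \near nbhs z, (cst 0 : R * R -> R) t = phi t.
  have oY : open [set t : R * R | Y < t.2].
    rewrite (_ : [set t | _] = snd @^-1` [set t | Y < t]); last by [].
    by apply: open_comp; [move=> t _; exact: cvg_snd|exact: open_gt].
  have : nbhs z [set t : R * R | Y < t.2] by exact: open_nbhs_nbhs.
  by apply: filterS => t tY /=; rewrite h0.
by rewrite -(@near_eq_derive _ _ _ (cst 0) phi z e nz) derive_cst.
Qed.

Lemma smooth_wD (phi : R * R -> R) e : dir e -> smooth phi -> weakly_derivable e phi /\
  {ae leb2, forall z, half_plane z -> wD e phi z = 'D_e phi z}.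
Proof.
move=> he sphi; have h := smooth_weak he sphi.
by split; [exists ('D_e phi)|exact: wD_ae].
Qed.

Lemma smooth_wD2 (phi : R * R -> R) e e2 : dir e -> dir e2 -> smooth phi ->
  weakly_derivable e2 (wD e phi) /\
  {ae leb2, forall z, half_plane z -> wD e2 (wD e phi) z = 'D_e2 ('D_e phi) z}.
Proof.
move=> he he2 sphi; have [h1 h2] := smooth_wD he sphi.
have sD := smooth_derive he sphi; have h := smooth_weak he2 sD.
have mD : measurable_fun setT (wD e phi) by case: (wD_is_weak h1).
have h3 : is_weak_derivative e2 (wD e phi) ('D_e2 ('D_e phi)).
  apply: (weak_ae he2 (measurable_funTS mD) _ _ _ h).
  - by case: h.
  - by apply: (aeS h2) => z hz /hz ->.
  - exact: aeW.
by split; [exists ('D_e2 ('D_e phi))|exact: wD_ae].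
Qed.

(** Above height [Y] the function coincides with its affine profile, so membership in [H^2] reduces
    to continuity on a bounded rectangle. *)
Lemma admissible_smooth eps a delta Y theta : 0 < eps -> smooth theta ->
  (forall z, theta (xshift (period eps) z) = theta z + pi) ->
  (forall z, Y < z.2 -> theta z = eps * z.1 + Num.sqrt (1 - eps ^+ 2) * z.2 + delta) ->
  (forall x, 0 <= x < a * period eps -> theta (x, 0) = 0) ->
  (forall x, a * period eps <= x < period eps -> 'D_(diry R) theta (x, 0) = 0) ->
  admissible eps a delta theta.
Proof.
move=> e0 sth per top bD bN; set l := period eps in per bD bN *.
have l0 : 0 < l by rewrite divr_gt0// pi_gt0.
have el : eps * l = pi by rewrite mulrCA divff ?mulr1// gt_eqF.
have dX : dir (dirx R) by left. have dY : dir (diry R) by right.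
have mwd (u : R * R -> R) e : weakly_derivable e u -> measurable_fun setT (wD e u).
  by move=> /wD_is_weak[].
have mth := continuous_measurable2 (smooth_cont sth).
have [wx Ex] := smooth_wD dX sth; have [wy Ey] := smooth_wD dY sth.
have [wyx Eyx] := smooth_wD2 dY dX sth; have [wyy Eyy] := smooth_wD2 dY dY sth.
split.
- exists (fun x => theta (x, 0)); last by apply: aeW => x; exact: bD.
  by apply: has_trace_smooth => //; [exact: mwd|exact: mwd|exact: aeW].
- exists (fun x => 'D_(diry R) theta (x, 0)); last by apply: aeW => x; exact: bN.
  exact: (@has_trace_smooth _ ('D_(diry R) theta) (smooth_derive dY sth) (mwd _ _ wy) (mwd _ _ wyx) (mwd _ _ wyy) Ey Eyx Eyy).
- by move=> x y _; have := per (x, y); rewrite /xshift /= => ->; rewrite mulrDr el; ring.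
set s := Num.sqrt _ in top *.
pose L (z : R * R) := -1 * (eps * z.1 + s * z.2 + delta).
have sL : smooth L.
  apply: smoothM; first exact: smooth_cst.
  apply: smoothD; last exact: smooth_cst.
  apply: smoothD; apply: smoothM; by [exact: smooth_cst|exact: smooth_fst|exact: smooth_snd].
set v := (fun z => theta z - _).
have vE : v = (fun z => theta z + L z) by apply/funext => z; rewrite /v /L mulN1r.
have sv : smooth v by rewrite vE; exact: smoothD.
have v0 z : Y < z.2 -> v z = 0 by move=> zY; rewrite /v top// subrr.
have L2v (psi w : R * R -> R) := @L2_smooth l Y w psi l0.
have H1 (psi w : R * R -> R) : smooth psi -> (forall z, Y < z.2 -> psi z = 0) ->
    measurable_fun setT w -> {ae leb2, forall z, half_plane z -> w z = psi z} ->
    (forall e, dir e -> weakly_derivable e w /\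
      {ae leb2, forall z, half_plane z -> wD e w z = 'D_e psi z}) -> H1_strip l w.
  move=> spsi psi0 mw E H; split; first exact: L2v (smooth_cont spsi) mw E psi0.
  move=> e he; have [h1 h2] := H e he; split => //.
  apply: L2v (smooth_cont (smooth_derive he spsi)) (mwd _ _ h1) h2 _.
  exact: derive_zero_above.
split.
- move=> x y _; have := per (x, y); rewrite /v /xshift /= => ->.
  by rewrite mulrDr el; ring.
- apply: (H1 v v sv v0) => [|//|e he]; first exact: continuous_measurable2 (smooth_cont sv).
    exact: aeW.
  exact: smooth_wD.
- move=> e he; have [h1 h2] := smooth_wD he sv.
  have D1 := smooth_derive he sv.
  have D2 : forall z, Y < z.2 -> 'D_e v z = 0 by exact: derive_zero_above v0.
  have D3 := mwd _ _ h1.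
  have D4 : forall e2, dir e2 -> weakly_derivable e2 (wD e v) /\
      {ae leb2, forall z, half_plane z -> wD e2 (wD e v) z = 'D_e2 ('D_e v) z}.
    by move=> e2 he2; exact: (smooth_wD2 he he2 sv).
  exact: (H1 ('D_e v) (wD e v) D1 D2 D3 h2 D4).
Qed.

(** Classical derivatives stand for the weak ones of [energy]; for smooth functions they agree
    almost everywhere on the half-plane. *)
Definition density theta z : R :=
  ('D_(dirx R) ('D_(dirx R) theta) z + 'D_(diry R) ('D_(diry R) theta) z) ^+ 2
  + (1 - ('D_(dirx R) theta z ^+ 2 + 'D_(diry R) theta z ^+ 2)) ^+ 2.

Lemma density_continuous theta : smooth theta -> continuous (density theta).
Proof.
move=> sth; have dX : dir (dirx R) by left. have dY : dir (diry R) by right.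
have cx := smooth_cont (smooth_derive dX sth); have cy := smooth_cont (smooth_derive dY sth).
have cxx := smooth_cont (smooth_derive dX (smooth_derive dX sth)).
have cyy := smooth_cont (smooth_derive dY (smooth_derive dY sth)).
have c2 (f : R * R -> R) : continuous f -> continuous (fun z => f z ^+ 2).
  by move=> cf z; apply: cvgM; exact: cf.
have cA (f g : R * R -> R) : continuous f -> continuous g -> continuous (fun z => f z + g z).
  by move=> cf cg z; apply: cvgD; [exact: cf|exact: cg].
have h1 := c2 _ (cA _ _ cxx cyy).
have c3 : continuous (fun z => 1 - ('D_(dirx R) theta z ^+ 2 + 'D_(diry R) theta z ^+ 2)).
  by move=> z; apply: cvgB; [exact: cvg_cst|exact: (cA _ _ (c2 _ cx) (c2 _ cy) z)].
exact: (cA _ _ h1 (c2 _ c3)).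
Qed.

(** The strip is cut at [c]. Both pieces, the left one moved by a period, lie in the rectangle,
    whose integral is spent once for each; hence the factor 2. *)
Lemma energy_smooth_le eps theta c Y K : 0 < eps -> smooth theta ->
  (forall z, theta (xshift (period eps) z) = theta z + pi) -> 0 <= c <= period eps ->
  (forall z, Y < z.2 -> density theta z = 0) ->
  \int[leb2]_(z in rect c (c + period eps) 0 Y) density theta z <= K ->
  (energy eps theta <= (2 * K)%:E)%E.
Proof.
move=> e0 sth per; set l := period eps in per * => /andP[c0 cl] top hK.
have l0 : 0 < l by rewrite divr_gt0// pi_gt0.
have dX : dir (dirx R) by left. have dY : dir (diry R) by right.
have [_ Ex] := smooth_wD dX sth; have [_ Ey] := smooth_wD dY sth.
have [w1 Exx] := smooth_wD2 dX dX sth; have [w2 Eyy] := smooth_wD2 dY dY sth.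
have cd := density_continuous sth; have md := continuous_measurable2 cd.
have d0 z : 0 <= density theta z by rewrite addr_ge0 ?sqr_ge0.
have iS x1 x2 : (\int[leb2]_(z in rect x1 x2 0 Y) (density theta z)%:E =
    (\int[leb2]_(z in rect x1 x2 0 Y) density theta z)%:E)%E.
  rewrite /Rintegral fineK//; apply: integrable_fin_num; first exact: measurable_rect.
  exact: (@continuous_integ2 _ _ x1 x2 0 Y cd).
have perd : {ae leb2, forall z, half_plane z -> density theta (xshift l z) = density theta z}.
  have Dper (f : R * R -> R) k e : dir e -> smooth f -> (forall z, f (xshift l z) = f z + k) ->
      forall z, 'D_e f (xshift l z) = 'D_e f z.
    move=> he sf pf z; have [_ <-] := is_derive_xshift l z he sf.
    have -> : (fun z => f (xshift l z)) = (fun z => f z + k) by apply/funext.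
    have [_ ->] := is_deriveD (smooth_is_derive z he sf) (is_derive_cst k z e).
    by rewrite addr0.
  have D0 (f : R * R -> R) e : dir e -> smooth f -> (forall z, f (xshift l z) = f z) ->
      forall z, 'D_e f (xshift l z) = 'D_e f z.
    by move=> he sf pf; apply: (Dper f 0) => // z; rewrite pf addr0.
  have h1 := Dper _ _ _ dX sth per; have h2 := Dper _ _ _ dY sth per.
  have h3 := D0 _ _ dX (smooth_derive dX sth) h1.
  have h4 := D0 _ _ dY (smooth_derive dY sth) h2.
  by apply: aeW => z _; rewrite /density h1 h2 h3 h4.
have -> : energy eps theta = (\int[leb2]_(z in strip l) (density theta z)%:E)%E.
  apply: ae_eq_integral; first exact: measurable_strip.
  - apply/measurable_EFinP; apply: measurable_funTS.
    have [wx _] := smooth_wD dX sth; have [wy _] := smooth_wD dY sth.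
    by apply: measurable_energy; [case: (wD_is_weak wx)|case: (wD_is_weak wy)|case: (wD_is_weak w1)|case: (wD_is_weak w2)].
  - by apply/measurable_EFinP; exact: measurable_funTS.
  - apply: (aeS3 (aeS2 Ex Ey (fun z a b => conj a b)) (aeS2 Exx Eyy (fun z a b => conj a b)) (ae_neq2 0)).
    move=> z [h1 h2] [h3 h4] z2 [_ z20].
    have hz : half_plane z by rewrite /half_plane /= lt_neqAle eq_sym z2.
    by rewrite /density h1// h2// h3// h4.
have mR x1 x2 : measurable (rect x1 x2 0 Y) by exact: measurable_rect.
have sub x1 x2 : c <= x1 -> x2 <= c + l ->
    (\int[leb2]_(z in rect x1 x2 0 Y) (density theta z)%:E <= K%:E)%E.
  move=> h1 h2; apply: le_trans (_ : (\int[leb2]_(z in rect c (c + l) 0 Y) (density theta z)%:E <= K%:E)%E).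
    apply: ge0_subset_integral; [exact: mR|exact: mR| | |exact: rectS].
      by apply/measurable_EFinP; exact: measurable_funTS.
    by move=> z _; rewrite lee_fin.
  by rewrite iS lee_fin.
have h1 : (\int[leb2]_(z in rect 0 c 0 Y) (density theta z)%:E <= K%:E)%E.
  have := @int_rect_shift R 0 c 0 Y l (density theta) md d0 perd (lexx _).
  by rewrite add0r => <-; apply: sub.
have h2 : (\int[leb2]_(z in rect c l 0 Y) (density theta z)%:E <= K%:E)%E.
  by apply: sub => //; rewrite lerDr.
have -> : (2 * K)%:E = (K%:E + K%:E)%E by rewrite mulr_natl mulr2n EFinD.
apply: le_trans (leeD h1 h2).
apply: le_trans (int_patch_le (mR _ _) (mR _ _) (mR 0 l) md d0 _).
  rewrite [leLHS]integral_mkcond [leRHS]integral_mkcond.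
  apply: ge0_le_int_nonmeasurable => z.
    by rewrite patchE; case: ifP => // _; rewrite lee_fin.
  have [zs|zs] := boolP (z \in strip l); rewrite !patchE ?zs ?(negbTE zs); last first.
    by case: ifP => // _; rewrite lee_fin.
  move: zs; rewrite inE => -[/andP[g1 /ltW g2] g3]; have [zY|zY] := leP z.2 Y.
    by rewrite mem_set//; apply/rectE; rewrite g1 g2 g3 zY.
  by rewrite top//; case: ifP.
apply: aeW => z /rectE[/andP[g1 g2] g3].
by have [zc|/ltW zc] := leP z.1 c; [left|right]; apply/rectE; rewrite ?g1 ?g2 ?zc.
Qed.

End Smooth_competitors.

(** * Quasi-periodic gluing *)

Section Gluing.
Context {R : realType}.
Implicit Types (f g phi : R * R -> R) (z : R * R).

(** The hypothesis passes to ['D_e phi], which keeps the induction on the order going. *)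
Lemma near_smooth phi : (forall z, exists2 g, smooth g & \forall t \near z, phi t = g t) -> smooth phi.
Proof.
have cH psi : (forall z, exists2 g, smooth g & \forall t \near z, psi t = g t) -> continuous psi.
  move=> Hp z P; have [g sg nz] := Hp z.
  have pz : nbhs (psi z) P -> nbhs (g z) P by rewrite (nbhs_singleton nz).
  move=> /pz hP; have h : nbhs z (g @^-1` P) := smooth_cont sg hP.
  have : nbhs z (psi @^-1` P) by apply: filterS2 nz h => t /= ->.
  exact.
move=> H k; elim: k phi H => [|k IH] phi H; first by split => //; exact: cH.
have cphi := cH _ H.
apply: CkS => // e he; exists ('D_e phi).
  move=> z; have [g sg nz] := H z; split => //.
  apply: (@near_eq_derivable _ _ _ g phi z e); first by apply: filterS nz => t /= ->.
  by case: (smooth_is_derive z he sg).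
apply: IH => z; have [g sg nz] := H z; exists ('D_e g); first exact: smooth_derive.
apply: filterS (near_join nz) => t nt; exact: (@near_eq_derive _ _ _ phi g t e nt).
Qed.

Lemma density_near phi g z : (\forall t \near z, phi t = g t) -> density phi z = density g z.
Proof.
move=> nz; have D1 (e : R * R) : 'D_e phi z = 'D_e g z by exact: (@near_eq_derive _ _ _ phi g z e nz).
have D2 (e : R * R) : 'D_e ('D_e phi) z = 'D_e ('D_e g) z.
  apply: (@near_eq_derive _ _ _ ('D_e phi) ('D_e g) z e).
  by apply: filterS (near_join nz) => t nt; exact: (@near_eq_derive _ _ _ phi g t e nt).
by rewrite /density !D1 !D2.
Qed.

Lemma derive_xshift_eq c phi e : dir e -> smooth phi ->
  'D_e (fun z => phi (xshift c z)) = (fun z => 'D_e phi (xshift c z)).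
Proof. by move=> he sphi; apply/funext => z; have [_ ->] := is_derive_xshift c z he sphi. Qed.

Lemma density_ext f g (t u : R * R) : (forall e, dir e -> 'D_e f t = 'D_e g u) ->
  (forall e, dir e -> 'D_e ('D_e f) t = 'D_e ('D_e g) u) -> density f t = density g u.
Proof.
have dX : dir (dirx R) by left. have dY : dir (diry R) by right.
by move=> h1 h2; rewrite /density (h1 _ dX) (h1 _ dY) (h2 _ dX) (h2 _ dY).
Qed.

Lemma density_xshift c phi z : smooth phi -> density (fun z => phi (xshift c z)) z = density phi (xshift c z).
Proof.
move=> sphi; have dX : dir (dirx R) by left. have dY : dir (diry R) by right.
have D1 e : dir e -> 'D_e (fun z => phi (xshift c z)) z = 'D_e phi (xshift c z).
  by move=> he; have [_ ->] := is_derive_xshift c z he sphi.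
have D2 e : dir e -> 'D_e ('D_e (fun z => phi (xshift c z))) z = 'D_e ('D_e phi) (xshift c z).
  move=> he; rewrite (derive_xshift_eq c he sphi).
  by have [_ ->] := is_derive_xshift c z he (smooth_derive he sphi).
exact: density_ext D1 D2.
Qed.

Variables (l : R) (f : R * R -> R).
Hypothesis l0 : 0 < l.
Hypothesis sf : smooth f.
Hypothesis seam : forall x y, `|x + l / 2| < l / 4 -> f (x + l, y) = f (x, y) + pi.

(** The index of the period that contains [x], with periods centred at the multiples of [l]. *)
Let fl (x : R) : int := Num.floor (x / l + 2^-1).
Definition glue z := f (z.1 - (fl z.1)%:~R * l, z.2) + (fl z.1)%:~R * pi.

Let fl_eq x (n : int) : n%:~R * l - l / 2 <= x < n%:~R * l + l / 2 -> fl x = n.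
Proof.
move=> /andP[h1 h2]; apply: floor_def; rewrite intrD; apply/andP; split.
  by rewrite -lerBlDr ler_pdivlMr// mulrBl [2^-1 * l]mulrC.
by rewrite -ltrBrDr ltr_pdivrMr// -addrA mulrDl (_ : 1%:~R - 2^-1 = 2^-1 :> R) ?[2^-1 * l]mulrC//; field.
Qed.

Let fl_bounds x : (fl x)%:~R * l - l / 2 <= x < (fl x)%:~R * l + l / 2.
Proof.
have /andP[h1 h2] := floor_itv (x / l + 2^-1); rewrite -/(fl x) intrD in h1 h2 *.
have e : x = x / l * l by rewrite divfK ?gt_eqF.
apply/andP; split.
  rewrite {2}e lerBlDr -[l / 2]mulrC -mulrDl ler_pM2r//.
rewrite {1}e -[l / 2]mulrC -mulrDl ltr_pM2r//; move: h2; move: (x / l) => u; lra.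
Qed.

(** The seam condition extends the formula of the [n]-th period into the preceding one, so that near
    every point, seams included, the glued function is a single translate of [f] plus a constant. *)
Let glue_eq n z : n%:~R * l - 3 * l / 4 < z.1 < n%:~R * l + l / 2 ->
  glue z = f (xshift (- (n%:~R * l)) z) + n%:~R * pi.
Proof.
move=> /andP[h1 h2]; rewrite /glue /xshift.
have [h3|h3] := leP (n%:~R * l - l / 2) z.1; first by rewrite (@fl_eq _ n) ?h3.
have -> : fl z.1 = n - 1.
  apply: fl_eq; rewrite intrB; move: h1 h2 h3; set u := n%:~R; move=> h1 h2 h3.
  by apply/andP; split; [move: h1 l0|move: h3 l0]; rewrite mulrBl mul1r; lra.
rewrite (_ : z.1 - (n - 1)%:~R * l = z.1 - n%:~R * l + l); last by rewrite intrB; ring.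
rewrite seam; first by rewrite intrB; ring.
by move: h1 h3 l0; set u := n%:~R * l; rewrite ltr_norml => *; apply/andP; split; lra.
Qed.

Let glue_near z : exists n : int, n = fl z.1 /\ \forall t \near z, glue t = f (xshift (- (n%:~R * l)) t) + n%:~R * pi.
Proof.
exists (fl z.1); split => //; set n := fl z.1.
pose U := [set t : R * R | n%:~R * l - 3 * l / 4 < t.1 < n%:~R * l + l / 2].
have oU : open U.
  rewrite (_ : U = fst @^-1` `](n%:~R * l - 3 * l / 4), (n%:~R * l + l / 2)[%classic); last first.
    by apply/seteqP; split => t; rewrite /U /= in_itv.
  by apply: open_comp; [move=> t _; exact: cvg_fst|exact: interval_open].
have Uz : U z.
  have := fl_bounds z.1; rewrite -/n /U /=; move: l0; move: (n%:~R * l) => v lp /andP[g1 g2].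
  by rewrite g2 andbT; lra.
by have : nbhs z U by [exact: open_nbhs_nbhs]; apply: filterS => t; exact: glue_eq.
Qed.

Lemma glue_smooth : smooth glue.
Proof.
apply: near_smooth => z; have [n [_ nz]] := glue_near z.
exists (fun t => f (xshift (- (n%:~R * l)) t) + n%:~R * pi) => //.
by apply: smoothD; [exact: smooth_xshift|exact: smooth_cst].
Qed.

Lemma glue_shift z : glue (xshift l z) = glue z + pi.
Proof.
have -> : glue (xshift l z) = f (z.1 + l - (fl (z.1 + l))%:~R * l, z.2) + (fl (z.1 + l))%:~R * pi by [].
have -> : fl (z.1 + l) = fl z.1 + 1.
  apply: fl_eq; have := fl_bounds z.1; rewrite intrD mulrDl mul1r.
  by move: (_%:~R * l) => v /andP[g1 g2]; apply/andP; split; lra.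
rewrite (_ : z.1 + l - (fl z.1 + 1)%:~R * l = z.1 - (fl z.1)%:~R * l); last by rewrite intrD; ring.
by rewrite /glue intrD; ring.
Qed.

Lemma glue0 x y : - (l / 2) <= x < l / 2 -> glue (x, y) = f (x, y).
Proof. by move=> h; rewrite /glue /= (@fl_eq x 0) ?mul0r ?subr0 ?addr0// sub0r add0r. Qed.

Lemma glue_near0 z : `|z.1| < l / 2 -> \forall t \near z, glue t = f t.
Proof.
move=> /[!ltr_norml] /andP[h1 h2]; have [n [nE nz]] := glue_near z.
have n0 : n = 0 by rewrite nE; apply: fl_eq; rewrite mul0r sub0r add0r ltW.
by apply: filterS nz => t ->; rewrite n0 mul0r oppr0 mul0r addr0 /xshift addr0; case: t.
Qed.

Lemma glue_affine (s e d Y : R) : e * l = pi ->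
  (forall z, Y < z.2 -> f z = e * z.1 + s * z.2 + d) ->
  forall z, Y < z.2 -> glue z = e * z.1 + s * z.2 + d.
Proof. by move=> el top z zY; rewrite /glue top//= -el; ring. Qed.

End Gluing.

(** * Profiles of the competitor *)

Section Competitor_estimates.
Context {R : realType}.

Lemma derive1_locally_constant (f : R -> R) c a b t : (forall u, a < u < b -> f u = c) ->
  a < t < b -> derive1 f t = 0.
Proof.
move=> fc tab; have nz : \forall u \near nbhs t, f u = (cst c : R -> R) u.
  have : nbhs t `]a, b[%classic by apply: open_nbhs_nbhs; split; [exact: interval_open|rewrite /= in_itv].
  by apply: filterS => u /=; rewrite in_itv => /fc.
by rewrite derive1E (@near_eq_derive _ _ _ f (cst c) t 1 nz) derive_cst.
Qed.

Lemma sigmoid_exists : exists (sg : R -> R) (S : R), [/\ smooth1 sg, forall t, t <= - 2^-1 -> sg t = 0,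
  forall t, 2^-1 <= t -> sg t = 1, forall t, 0 <= sg t <= 1 & [/\ 0 <= S,
  forall t, `|derive1 sg t| <= S, forall t, `|derive1 (derive1 sg) t| <= S,
  forall t, 2^-1 < `|t| -> derive1 sg t = 0 & forall t, 2^-1 < `|t| -> derive1 (derive1 sg) t = 0]].
Proof.
have [Z [sZ Z1 Z0 Z01 _]] := @step_exists R.
pose sg (t : R) := 1 + -1 * Z (1 * (t - - (3 / 2))).
have ssg : smooth1 sg.
  apply: smooth1D; first exact: smooth1_cst.
  by apply: smooth1M; [exact: smooth1_cst|exact: smooth1_comp sZ (smooth1_affine _ _)].
have g0 t : t <= - 2^-1 -> sg t = 0 by move=> h; rewrite /sg Z1; lra.
have g1 t : 2^-1 <= t -> sg t = 1 by move=> h; rewrite /sg Z0; lra.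
have h1 t : 2^-1 < `|t| -> derive1 sg t = 0.
  rewrite lter_normr => /orP[h|h].
  - apply: (@derive1_locally_constant sg 1 2^-1 (t + 1)); last by rewrite h/= ltrDl ltr01.
    by move=> u /andP[/ltW h2 _]; exact: g1.
  - apply: (@derive1_locally_constant sg 0 (t - 1) (- 2^-1)); last by lra.
    by move=> u /andP[_ /ltW h2]; exact: g0.
have h2 t : 2^-1 < `|t| -> derive1 (derive1 sg) t = 0.
  move=> h; have := h; rewrite lter_normr => /orP[h'|h'].
  - apply: (@derive1_locally_constant (derive1 sg) 0 2^-1 (t + 1)); last by rewrite h'/= ltrDl ltr01.
    by move=> u /andP[h3 _]; apply: h1; rewrite lter_normr h3.
  - apply: (@derive1_locally_constant (derive1 sg) 0 (t - 1) (- 2^-1)); last by lra.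
    by move=> u /andP[_ h3]; apply: h1; rewrite lter_normr; apply/orP; right; lra.
have supp (f : R -> R) : (forall t, 2^-1 < `|t| -> f t = 0) -> supp_in f (- 1) 1.
  move=> hf t; rewrite -ltr_norml -leNgt => h; apply: hf; apply: lt_le_trans h; lra.
have [K1 hK1] := smooth1_bounded (smooth1_cont (smooth1_derive ssg)) (supp _ h1).
have [K2 hK2] := smooth1_bounded (smooth1_cont (smooth1_derive (smooth1_derive ssg))) (supp _ h2).
have K10 : 0 <= K1 by apply: le_trans (hK1 0).
have K20 : 0 <= K2 by apply: le_trans (hK2 0).
exists sg, (K1 + K2); split => //.
  by move=> t; have /andP[a b] := Z01 (1 * (t - - (3 / 2))); rewrite /sg; lra.
split => //; first exact: addr_ge0.
- by move=> t; apply: le_trans (hK1 t) _; rewrite lerDl.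
- by move=> t; apply: le_trans (hK2 t) _; rewrite lerDr.
Qed.

(* [(1 + y^2)^(-1/4)]: at height [y] the competitor climbs from 0 to [pi] over a
   width [1 / wid y], so that its energy per unit height is of order [wid y ^+ 3],
   which is integrable. *)
Definition wid (y : R) : R := expR (- 4^-1 * ln (1 + y * y)).
Definition dwid (y : R) : R := - 2^-1 * (y * wid y ^+ 5).

Let q0 (y : R) : 0 < 1 + y * y.
Proof. by rewrite ltr_pwDl// -expr2 sqr_ge0. Qed.

Lemma wid_gt0 y : 0 < wid y. Proof. exact: expR_gt0. Qed.

Lemma wid4 y : wid y ^+ 4 * (1 + y * y) = 1.
Proof.
rewrite /wid !exprS expr0 mulr1 -!expRD.
rewrite [X in expR X](_ : _ = - ln (1 + y * y)); last by field.
by rewrite expRN lnK ?posrE// mulVf// gt_eqF.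
Qed.

Lemma wid_le1 y : wid y <= 1.
Proof.
have w0 := wid_gt0 y; have h : wid y ^+ 4 <= 1.
  rewrite -[X in _ <= X](wid4 y); apply: ler_peMr; first by rewrite exprn_ge0// ltW.
  by rewrite lerDl -expr2 sqr_ge0.
by rewrite -(@expr_le1 _ 4)// ltW.
Qed.

Lemma wid0 : wid 0 = 1.
Proof. by rewrite /wid mulr0 addr0 ln1 mulr0 expR0. Qed.

Lemma sqr_wid4 y : y ^+ 2 * wid y ^+ 4 <= 1.
Proof. by rewrite -[leRHS](wid4 y) mulrC ler_pM2l ?exprn_gt0 ?wid_gt0// expr2 lerDr. Qed.

Lemma wid_is_derive y : is_derive y (1 : R) wid (dwid y).
Proof.
have h1 : is_derive y (1 : R) (fun y : R => 1 + y * y) (y + y).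
  have h := smooth1_is_derive y (smooth1D (smooth1_cst 1) (smooth1M (@smooth1_affine R 1 0) (@smooth1_affine R 1 0))).
  have e : (fun y : R => 1 + y * y) = (fun x : R => 1 + 1 * (x - 0) * (1 * (x - 0))).
    by apply/funext => x; rewrite subr0 !mul1r.
  rewrite e; have hh := is_deriveD (is_derive_cst (1 : R) y 1) (is_deriveM (is_derive_id y (1 : R)) (is_derive_id y (1 : R))).
  rewrite -e; apply: is_derive_eq; rewrite add0r /GRing.scale/= !mulr1//.
have h2 : is_derive y (1 : R) (@ln R \o (fun y : R => 1 + y * y)) ((1 + y * y)^-1 * (y + y)).
  have hl := is_derive1_ln (q0 y).
  exact: (is_derive1_comp (f := @ln R) (g := fun y : R => 1 + y * y)).
have h3 : is_derive y (1 : R) (fun y : R => - 4^-1 * ln (1 + y * y)) (- 4^-1 * ((1 + y * y)^-1 * (y + y))).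
  exact: (is_deriveZ (- 4^-1) h2).
have h4 : is_derive y (1 : R) (@expR R \o (fun y : R => - 4^-1 * ln (1 + y * y)))
   (expR (- 4^-1 * ln (1 + y * y)) * (- 4^-1 * ((1 + y * y)^-1 * (y + y)))).
  have hl := is_derive_expR (- 4^-1 * ln (1 + y * y)).
  exact: (is_derive1_comp (f := @expR R) (g := fun y : R => - 4^-1 * ln (1 + y * y))).
have E : expR (- 4^-1 * ln (1 + y * y)) * (- 4^-1 * ((1 + y * y)^-1 * (y + y))) = dwid y.
  have -> : (1 + y * y)^-1 = wid y ^+ 4.
    by apply: (mulIf (lt0r_neq0 (q0 y))); rewrite wid4 mulVf// lt0r_neq0.
  by rewrite -/(wid y) /dwid; field.
rewrite -E; exact: h4.
Qed.

(** The derivative [dwid] is a polynomial in [y] and [wid y], so each order of smoothness yields the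
    next. *)
Lemma wid_smooth : smooth1 wid.
Proof.
have cw : continuous wid.
  by move=> y; apply/differentiable_continuous/derivable1_diffP; case: (wid_is_derive y).
move=> k; elim: k => [|k IH]; first by split.
apply: (Ck1S cw wid_is_derive).
have E : dwid = (fun y => - 2^-1 * (y * (wid y * (wid y * (wid y * (wid y * wid y)))))).
  by apply/funext => y; rewrite /dwid !exprS expr0 mulr1.
rewrite E; apply: Ck1M; first exact: Ck1_cst.
apply: Ck1M; first exact: Ck1_id.
by do 4 (apply: Ck1M => //).
Qed.

Lemma dwidE y : derive1 wid y = dwid y.
Proof. by rewrite derive1E; case: (wid_is_derive y). Qed.

Lemma ddwidE y : derive1 (derive1 wid) y = - 2^-1 * (wid y ^+ 4 * wid y - 5 / 2 * (y ^+ 2 * wid y ^+ 4) * (wid y ^+ 4 * wid y)).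
Proof.
have -> : derive1 wid = (fun y => - 2^-1 * y * (wid y * (wid y * (wid y * (wid y * wid y))))).
  by apply/funext => t; rewrite dwidE /dwid; ring.
have sw := wid_smooth; have s2 := smooth1M sw sw; have s3 := smooth1M sw s2.
have s4 := smooth1M sw s3; have s5 := smooth1M sw s4.
have sy : smooth1 (fun y : R => - 2^-1 * y).
  by apply: smooth1M; [exact: smooth1_cst|move=> k; exact: Ck1_id].
have dy : derive1 (fun y : R => - 2^-1 * y) y = - 2^-1.
  by rewrite derive1E; have [_ ->] := is_deriveZ (- 2^-1) (is_derive_id y (1 : R)); rewrite /GRing.scale/= mulr1.
rewrite derive1M_smooth// dy !derive1M_smooth// dwidE /dwid; by field.
Qed.

(** [p1] and [g] are the deviations of the gradient from [(k e, s)]. [W] is quadratic in [p1] but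
    linear in [g], which is why [g] must be of order [w^2] where [p1] may be of order [w]. *)
Lemma W_bound (s e p1 k g A j S w i c : R) : 0 <= s <= 1 -> s ^+ 2 = 1 - e ^+ 2 -> 0 <= k <= 1 ->
  `|p1| <= A * j + S * (w * i) -> `|g| <= A * j + c * e ^+ 2 + S * (w ^+ 2 * i) ->
  0 <= j <= 1 -> 0 <= i <= 1 -> 0 <= w <= 1 -> 0 <= e <= 1 -> 0 <= A -> 0 <= S -> 0 <= c ->
  `|1 - ((p1 + k * e) ^+ 2 + (s + g) ^+ 2)| <=
  (3 + 4 * (A ^+ 2 + S ^+ 2) + 2 * (A + c + S) + 3 * (A + c + S) ^+ 2) * (e ^+ 2 + j + w ^+ 2 * i).
Proof.
move=> /andP[s0 s1] s2 /andP[k0 k1] hp hg /andP[j0 j1] /andP[i0 i1] /andP[w0 w1] /andP[e0 e1] A0 S0 c0.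
set X := e ^+ 2 + j + w ^+ 2 * i; set N := A + c + S.
have e20 : 0 <= e ^+ 2 by exact: sqr_ge0.
have w20 : 0 <= w ^+ 2 * i by rewrite mulr_ge0 ?sqr_ge0.
have X0 : 0 <= X by rewrite !addr_ge0.
have N0 : 0 <= N by rewrite !addr_ge0.
have eX : e ^+ 2 <= X by rewrite /X -addrA lerDl addr_ge0.
have jX : j <= X by rewrite /X addrAC lerDr addr_ge0.
have wX : w ^+ 2 * i <= X by rewrite /X lerDr addr_ge0.
have e21 : e ^+ 2 <= 1 by rewrite expr_le1.
have w21 : w ^+ 2 * i <= 1 by rewrite mulr_ile1 ?sqr_ge0// expr_le1.
have X3 : X <= 3 by rewrite /X; lra.
have gX : `|g| <= N * X.
  apply: le_trans hg _; rewrite /N !mulrDl; apply: lerD; [apply: lerD|]; exact: ler_wpM2l.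
have p2 : p1 ^+ 2 <= 2 * (A ^+ 2 + S ^+ 2) * X.
  have h1 : p1 ^+ 2 <= (A * j + S * (w * i)) ^+ 2.
    by rewrite -[p1 ^+ 2]real_normK ?num_real// lerXn2r ?nnegrE// (le_trans _ hp).
  have h2 : (A * j + S * (w * i)) ^+ 2 <= 2 * (A * j) ^+ 2 + 2 * (S * (w * i)) ^+ 2.
    by have := sqr_ge0 (A * j - S * (w * i)); move: (A * j) (S * _) => a b; rewrite !expr2; lra.
  have j2 : A ^+ 2 * j ^+ 2 <= A ^+ 2 * X.
    by rewrite ler_wpM2l ?sqr_ge0// (le_trans _ jX)// expr2 ler_piMr.
  have i2 : S ^+ 2 * (w ^+ 2 * i ^+ 2) <= S ^+ 2 * X.
    by rewrite ler_wpM2l ?sqr_ge0// (le_trans _ wX)// ler_wpM2l ?sqr_ge0// expr2 ler_piMr.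
  rewrite !exprMn in h2; move: h1 h2 j2 i2; rewrite -!mulrA; lra.
have pk : (p1 + k * e) ^+ 2 <= 2 * p1 ^+ 2 + 2 * e ^+ 2.
  have h1 : (p1 + k * e) ^+ 2 <= 2 * p1 ^+ 2 + 2 * (k * e) ^+ 2.
    by have := sqr_ge0 (p1 - k * e); move: (k * e) => a; rewrite !expr2; lra.
  have h2 : (k * e) ^+ 2 <= e ^+ 2 by rewrite exprMn ler_piMl// expr_le1.
  lra.
have g2 : g ^+ 2 <= 3 * N ^+ 2 * X.
  have h1 : g ^+ 2 <= (N * X) ^+ 2.
    by rewrite -[g ^+ 2]real_normK ?num_real// lerXn2r ?nnegrE// mulr_ge0.
  apply: le_trans h1 _; rewrite exprMn [3 * _]mulrC -[leRHS]mulrA ler_wpM2l ?sqr_ge0//.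
  by rewrite expr2 ler_wpM2r.
have sg : `|s * g| <= N * X.
  by rewrite normrM ger0_norm// (le_trans _ gX)// ler_piMl.
have -> : 1 - ((p1 + k * e) ^+ 2 + (s + g) ^+ 2) = e ^+ 2 - (p1 + k * e) ^+ 2 - 2 * (s * g) - g ^+ 2.
  have -> : e ^+ 2 = 1 - s ^+ 2 by rewrite s2 opprB addrCA subrr addr0.
  ring.
have P0 := sqr_ge0 (p1 + k * e); have G0 := sqr_ge0 g; have p0 := sqr_ge0 p1.
move: sg; rewrite !ler_norml => /andP[a1 a2].
have -> : (3 + 4 * (A ^+ 2 + S ^+ 2) + 2 * N + 3 * N ^+ 2) * X =
   3 * X + 2 * (2 * (A ^+ 2 + S ^+ 2) * X) + 2 * (N * X) + 3 * N ^+ 2 * X by ring.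
move: p2 pk g2 a1 a2 eX P0 G0 p0 e20.
move: (2 * (A ^+ 2 + S ^+ 2) * X) (N * X) (3 * N ^+ 2 * X) ((p1 + k * e) ^+ 2) (g ^+ 2) (p1 ^+ 2) (s * g) (e ^+ 2) X0.
by move=> b1 b2 b3 b4 b5 b6 b7 b8 *; apply/andP; split; lra.
Qed.

Lemma density_arith (f W M N X e j w i : R) : `|f| <= N * X -> `|W| <= M * X -> X = e ^+ 2 + j + w ^+ 2 * i ->
  0 <= j <= 1 -> 0 <= i <= 1 -> 0 <= N -> 0 <= M ->
  f ^+ 2 + W ^+ 2 <= 3 * (N ^+ 2 + M ^+ 2) * (e ^+ 4 + j + w ^+ 4 * i).
Proof.
move=> hf hW XE /andP[j0 j1] /andP[i0 i1] N0 M0.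
have w20 : 0 <= w ^+ 2 * i by rewrite mulr_ge0 ?sqr_ge0.
have X0 : 0 <= X by rewrite XE !addr_ge0// sqr_ge0.
have f2 : f ^+ 2 <= (N * X) ^+ 2 by rewrite -[f ^+ 2]real_normK ?num_real// lerXn2r ?nnegrE// mulr_ge0.
have W2 : W ^+ 2 <= (M * X) ^+ 2 by rewrite -[W ^+ 2]real_normK ?num_real// lerXn2r ?nnegrE// mulr_ge0.
have X2 : X ^+ 2 <= 3 * (e ^+ 4 + j + w ^+ 4 * i).
  have h : X ^+ 2 <= 3 * ((e ^+ 2) ^+ 2 + j ^+ 2 + (w ^+ 2 * i) ^+ 2).
    rewrite XE; move: (e ^+ 2) (w ^+ 2 * i) => a b.
    by have := sqr_ge0 (a - j); have := sqr_ge0 (a - b); have := sqr_ge0 (j - b); rewrite !expr2; lra.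
  have e4 : (e ^+ 2) ^+ 2 = e ^+ 4 by rewrite -exprM.
  have w4 : (w ^+ 2 * i) ^+ 2 = w ^+ 4 * i ^+ 2 by rewrite exprMn -exprM.
  rewrite e4 w4 in h; apply: le_trans h _; rewrite ler_pM2l//; apply: lerD; [apply: lerD => //|].
    by rewrite expr2 ler_piMr.
  by rewrite ler_wpM2l ?exprn_even_ge0// expr2 ler_piMr.
apply: le_trans (lerD f2 W2) _; rewrite !exprMn -mulrDl [3 * _]mulrC -[leRHS]mulrA ler_wpM2l//.
by rewrite addr_ge0 ?sqr_ge0.
Qed.

End Competitor_estimates.

Section Derivation_rules.
Context {R : realType}.
Implicit Types (f g : R * R -> R) (z e : R * R) (h : R -> R).

Lemma is_derive_eqr f z e a b : is_derive z e f a -> a = b -> is_derive z e f b.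
Proof. by move=> h <-. Qed.

Lemma is_derive_cstr c z e : is_derive z e (fun=> c : R) 0.
Proof. exact: is_derive_cst. Qed.

Lemma is_derive_fst z e : is_derive z e (fun z : R * R => z.1) e.1.
Proof. by apply/is_derive_line => /=; exact: is_derive_affine. Qed.

Lemma is_derive_snd z e : is_derive z e (fun z : R * R => z.2) e.2.
Proof. by apply/is_derive_line => /=; exact: is_derive_affine. Qed.

Lemma is_derive_fun1 h z e : smooth1 h -> is_derive z e (fun z : R * R => h z.1) (derive1 h z.1 * e.1).
Proof. by move=> sh; exact: is_derive_comp (smooth1_is_derive _ sh) (is_derive_fst z e). Qed.

Lemma is_derive_fun2 h z e : smooth1 h -> is_derive z e (fun z : R * R => h z.2) (derive1 h z.2 * e.2).
Proof. by move=> sh; exact: is_derive_comp (smooth1_is_derive _ sh) (is_derive_snd z e). Qed.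

Lemma is_derive_add f g z e a b : is_derive z e f a -> is_derive z e g b ->
  is_derive z e (fun z => f z + g z) (a + b).
Proof. by move=> hf hg; exact: is_deriveD. Qed.

Lemma is_derive_mul f g z e a b : is_derive z e f a -> is_derive z e g b ->
  is_derive z e (fun z => f z * g z) (a * g z + f z * b).
Proof.
move=> hf hg; apply: is_derive_eqr (is_deriveM hf hg) _.
by rewrite addrC /GRing.scale/= mulrC [f z * b]mulrC [b * f z]mulrC.
Qed.

End Derivation_rules.

(** * The competitor and its energy *)

Section Competitor.
Context {R : realType}.
Local Notation mu := (@lebesgue_measure R).
Local Notation leb2 := (mu \x mu)%E.
Variables (B : R -> R) (A C0 C1 : R).
Hypothesis sB : smooth1 B.
Hypothesis B1 : forall t, `|t| <= 1 -> B t = 1.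
Hypothesis B0 : forall t, 2 <= `|t| -> B t = 0.
Hypothesis B01 : forall t, 0 <= B t <= 1.
Hypothesis dB : forall t, `|derive1 B t| <= C0.
Hypothesis ddB : forall t, `|derive1 (derive1 B) t| <= C1.
Variables (sg : R -> R) (S : R).
Hypothesis ssg : smooth1 sg.
Hypothesis sg0 : forall t, t <= - 2^-1 -> sg t = 0.
Hypothesis sg1 : forall t, 2^-1 <= t -> sg t = 1.
Hypothesis sg01 : forall t, 0 <= sg t <= 1.
Hypothesis S0 : 0 <= S.
Hypothesis dsg : forall t, `|derive1 sg t| <= S.
Hypothesis ddsg : forall t, `|derive1 (derive1 sg) t| <= S.
Hypothesis dsg0 : forall t, 2^-1 < `|t| -> derive1 sg t = 0.
Hypothesis ddsg0 : forall t, 2^-1 < `|t| -> derive1 (derive1 sg) t = 0.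
Variable eps : R.
Hypothesis eps01 : 0 < eps <= 4^-1.

Let l := period eps.
(** Up to height [2 Y] the transition stays in [|x| <= l / 4] (see [wide]), while [1 / Y] is of
    order [eps^2], which keeps the cost of switching profiles small. *)
Let Y := l ^+ 2 / 64.
Let s := Num.sqrt (1 - eps ^+ 2).
(** At [y = 0], [|x| <= 1 / 2], the product [core_x core_y] has y-derivative 1 and cancels that of
    [y]: this produces the Neumann condition without changing the values at [y = 0]. *)
Definition core_x (x : R) := B (2 * (x - 0)).
Definition core_y (y : R) := y * B y.
(** Between the heights [Y] and [2 Y] it switches from the dislocation to the affine profile. *)
Let U (y : R) := B (Y^-1 * (y - 0)).
Let V (z : R * R) := z.1 * wid z.2.

(** Up to height [Y] this is [s y], corrected in the core, plus the step [pi sg]; above [2 Y] it is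
    the affine profile [eps x + s y + pi / 2]. *)
Definition comp (z : R * R) : R :=
  s * (z.2 + -1 * (core_x z.1 * core_y z.2)) +
  U z.2 * (pi * sg (V z) + (-1 * (eps * z.1) + -1 * (pi / 2))) + (eps * z.1 + pi / 2).

Hypothesis A0 : 0 <= A.
Hypothesis hA1 : forall x, [/\ `|core_x x| <= A, `|derive1 core_x x| <= A & `|derive1 (derive1 core_x) x| <= A].
Hypothesis hA2 : forall y, [/\ `|core_y y| <= A, `|derive1 core_y y| <= A & `|derive1 (derive1 core_y) y| <= A].

Let scx : smooth1 core_x. Proof. exact: smooth1_comp sB (smooth1_affine _ _). Qed.
Let sid : smooth1 (fun y : R => y). Proof. by move=> k; exact: Ck1_id. Qed.
Let scy : smooth1 core_y. Proof. exact: smooth1M. Qed.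
Let sU : smooth1 U. Proof. exact: smooth1_comp sB (smooth1_affine _ _). Qed.
Let sw : smooth1 (@wid R). Proof. exact: wid_smooth. Qed.
Let sV : smooth V.
Proof. by apply: smoothM; [exact: smooth_fst|apply: smooth_comp => //; exact: smooth_snd]. Qed.

Lemma comp_smooth : smooth comp.
Proof.
have c (k : R) : smooth (fun _ : R * R => k) by exact: smooth_cst.
have f1 (h : R -> R) : smooth1 h -> smooth (fun z : R * R => h z.1) by move=> sh; apply: smooth_comp => //; exact: smooth_fst.
have f2 (h : R -> R) : smooth1 h -> smooth (fun z : R * R => h z.2) by move=> sh; apply: smooth_comp => //; exact: smooth_snd.
have ex : smooth (fun z : R * R => eps * z.1) by apply: smoothM; [exact: c|exact: smooth_fst].
apply: smoothD; last by apply: smoothD.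
apply: smoothD; apply: smoothM => //; try exact: f2.
  apply: smoothD; first exact: smooth_snd.
  by apply: smoothM; [exact: c|apply: smoothM; [exact: f1|exact: f2]].
apply: smoothD; first by apply: smoothM; [exact: c|exact: smooth_comp].
by apply: smoothD; apply: smoothM => //; exact: c.
Qed.

Let w1 := derive1 (@wid R).
Let w2 := derive1 w1.
Let sw1 : smooth1 w1. Proof. exact: smooth1_derive. Qed.
Let cx' := derive1 core_x.
Let cx'' := derive1 cx'.
Let cy' := derive1 core_y.
Let cy'' := derive1 cy'.
Let U' := derive1 U.
Let U'' := derive1 U'.
Let g' := derive1 sg.
Let g'' := derive1 g'.
(** The step minus the affine profile, bounded over a period; it meets the derivatives of [U], which
    are of order [eps^2]. *)
Let E z := pi * sg (V z) + (-1 * (eps * z.1) + -1 * (pi / 2)).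

Let fx z := -1 * s * (cx' z.1 * core_y z.2) + U z.2 * (pi * (g' (V z) * wid z.2) + -1 * eps) + eps.
Let fy z := s * (1 + -1 * (core_x z.1 * cy' z.2)) + (U' z.2 * E z + U z.2 * (pi * (g' (V z) * (z.1 * w1 z.2)))).
Let fxx z := -1 * s * (cx'' z.1 * core_y z.2) + U z.2 * (pi * (g'' (V z) * wid z.2 * wid z.2)).
Let fyy z := -1 * s * (core_x z.1 * cy'' z.2) + (U'' z.2 * E z + 2 * (U' z.2 * (pi * (g' (V z) * (z.1 * w1 z.2)))) +
  U z.2 * (pi * (g'' (V z) * (z.1 * w1 z.2) ^+ 2 + g' (V z) * (z.1 * w2 z.2)))).

Let dV z e : is_derive z e V (e.1 * wid z.2 + z.1 * (w1 z.2 * e.2)).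
Proof. exact: is_derive_mul (is_derive_fst z e) (is_derive_fun2 z e sw). Qed.
Let dsgV h z e : smooth1 h -> is_derive z e (fun z => h (V z)) (derive1 h (V z) * (e.1 * wid z.2 + z.1 * (w1 z.2 * e.2))).
Proof. by move=> sh; exact: is_derive_comp (smooth1_is_derive _ sh) (dV z e). Qed.

Local Ltac derive_leaf := first
  [exact: is_derive_cstr|exact: is_derive_fst|exact: is_derive_snd
  |apply: dsgV; first [exact: ssg|exact: (smooth1_derive ssg)]
  |apply: is_derive_fun1; first [exact: scx|exact: (smooth1_derive scx)]
  |apply: is_derive_fun2; first [exact: scy|exact: (smooth1_derive scy)|exact: sU|exact: (smooth1_derive sU)|exact: sw|exact: sw1]].
Local Ltac derive_auto := repeat first [derive_leaf|apply: is_derive_add|apply: is_derive_mul].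

Let comp_dx z : is_derive z (dirx R) comp (fx z).
Proof. by apply: is_derive_eqr; [rewrite /comp; derive_auto|rewrite /fx /= /cx' /g'; ring]. Qed.

Let comp_dy z : is_derive z (diry R) comp (fy z).
Proof. by apply: is_derive_eqr; [rewrite /comp; derive_auto|rewrite /fy /E /= /cy' /g' /U'; ring]. Qed.

Let comp_dxx z : is_derive z (dirx R) fx (fxx z).
Proof. by apply: is_derive_eqr; [rewrite /fx; derive_auto|rewrite /fxx /= /cx'' /g'' /cx' /g'; ring]. Qed.

Let dyy_arith (a e u u1 u2 g q : R) : a + (u2 * 1 * e + u1 * (pi * g) + (u1 * 1 * (pi * g) + u * (0 * g + pi * q))) =
  a + (u2 * e + 2 * (u1 * (pi * g)) + u * (pi * q)).
Proof. by ring. Qed.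

Let comp_dyy z : is_derive z (diry R) fy (fyy z).
Proof.
have sU1 : smooth1 U' by exact: smooth1_derive.
have sg1' : smooth1 g' by exact: smooth1_derive.
have d1 : is_derive z (diry R) (fun z => s * (1 + -1 * (core_x z.1 * cy' z.2))) (-1 * s * (core_x z.1 * cy'' z.2)).
  by apply: is_derive_eqr; [derive_auto|rewrite /= /cy'' /cy'; ring].
have dE : is_derive z (diry R) E (pi * (g' (V z) * (z.1 * w1 z.2))).
  by apply: is_derive_eqr; [rewrite /E; derive_auto|rewrite /= /g'; ring].
have dg : is_derive z (diry R) (fun z => g' (V z) * (z.1 * w1 z.2))
    (g'' (V z) * (z.1 * w1 z.2) ^+ 2 + g' (V z) * (z.1 * w2 z.2)).
  have h := is_derive_mul (dsgV z (diry R) sg1') (is_derive_mul (is_derive_fst z (diry R)) (is_derive_fun2 z (diry R) sw1)).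
  apply: is_derive_eqr h _; rewrite /= -/g'' -/w2; move: (g'' _) (g' _) (w1 _) (w2 _) (wid _) => *; ring.
have h := is_derive_add d1 (is_derive_add (is_derive_mul (is_derive_fun2 z (diry R) sU1) dE)
  (is_derive_mul (is_derive_fun2 z (diry R) sU) (is_derive_mul (is_derive_cstr pi z (diry R)) dg))).
exact: is_derive_eqr h (dyy_arith _ _ _ _ _ _ _).
Qed.

Let densE z : density comp z = (fxx z + fyy z) ^+ 2 + (1 - (fx z ^+ 2 + fy z ^+ 2)) ^+ 2.
Proof.
have ex : 'D_(dirx R) comp = fx by apply/funext => t; have [_ ->] := comp_dx t.
have ey : 'D_(diry R) comp = fy by apply/funext => t; have [_ ->] := comp_dy t.
rewrite /density ex ey; have [_ ->] := comp_dxx z; have [_ ->] := comp_dyy z.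
by have [_ ->] := comp_dx z; have [_ ->] := comp_dy z.
Qed.

Lemma comp_diry0 x : `|x| <= 2^-1 -> 'D_(diry R) comp (x, 0) = 0.
Proof.
move=> hx; have [_ ->] := comp_dy (x, 0).
have w10 : w1 0 = 0 by rewrite /w1 dwidE /dwid mul0r mulr0.
have U'0 : U' 0 = 0.
  rewrite /U' /U derive1_rescale// subrr mulr0.
  rewrite (@derive1_locally_constant R B 1 (-1) 1 0) ?mulr0//; last by rewrite ltrN10 ltr01.
  by move=> u /andP[h1 h2]; apply: B1; rewrite ler_norml !ltW.
have c1 : core_x x = 1.
  by apply: B1; rewrite subr0 normrM ger0_norm// mulrC -ler_pdivlMr// mul1r.
have cy1 : cy' 0 = 1.
  rewrite /cy' /core_y derive1M_smooth// mul0r addr0 B1 ?normr0// mulr1.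
  by rewrite derive1E; have [_ ->] := is_derive_id (0 : R) (1 : R).
by rewrite /fy /= w10 U'0 c1 cy1; ring.
Qed.

Lemma comp_line0 x : `|x| >= 2^-1 -> comp (x, 0) = if x < 0 then 0 else pi.
Proof.
move=> hx; have U0 : U 0 = 1 by rewrite /U subrr mulr0 B1// normr0.
have cy0 : core_y 0 = 0 by rewrite /core_y mul0r.
rewrite /comp /= U0 /V /= wid0 mulr1 cy0.
have [x0|x0] := ltP x 0.
  by rewrite sg0; [ring|move: hx; rewrite ltr0_norm// lerNr].
by rewrite sg1; [ring|move: hx; rewrite ger0_norm].
Qed.

Lemma comp_top z : 2 * Y < z.2 -> 1 <= Y -> comp z = eps * z.1 + s * z.2 + pi / 2.
Proof.
move=> zY Y1; have Y0 : 0 < Y by exact: lt_le_trans Y1.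
have z0 : 0 < z.2 by apply: lt_trans zY; rewrite mulr_gt0.
have -> : comp z = s * (z.2 + -1 * (core_x z.1 * core_y z.2)) + U z.2 * E z + (eps * z.1 + pi / 2) by [].
rewrite /core_y B0; last by rewrite gtr0_norm// (le_trans _ (ltW zY))// ler_peMr.
rewrite /U B0; first by ring.
by rewrite subr0 gtr0_norm ?mulr_gt0 ?invr_gt0// ler_pdivlMl// mulrC ltW.
Qed.

Let e0 : 0 < eps. Proof. by case/andP: eps01. Qed.
Let e1 : eps <= 1. Proof. by case/andP: eps01 => _ /le_trans; apply; rewrite invf_le1// ler1n. Qed.
Let pi2 : 2 <= pi :> R. Proof. exact: pi_ge2. Qed.
Let pi4 : pi <= 4 :> R. Proof. by have := @pihalf_lt2 R; rewrite ltr_pdivrMr// => /ltW; rewrite -natrM. Qed.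
Let pi0 : 0 <= pi :> R. Proof. exact: pi_ge0. Qed.
Let el : eps * l = pi. Proof. by rewrite /l /period mulrCA divff ?mulr1// gt_eqF. Qed.

Lemma period_ge8 : 8 <= l.
Proof.
rewrite /l /period ler_pdivlMr//; apply: le_trans pi2.
have /andP[_ h] := eps01; have h' : 8 * eps <= 8 * 4^-1 by rewrite ler_pM2l.
by apply: le_trans h' _; rewrite ler_pdivrMr// -natrM ler_nat.
Qed.
Let l0 : 0 < l. Proof. by apply: lt_le_trans period_ge8. Qed.

Lemma height_ge1 : 1 <= Y.
Proof.
rewrite /Y ler_pdivlMr// mul1r (_ : 64 = 8 ^+ 2); last by rewrite -natrX.
by rewrite lerXn2r ?nnegrE ?(ltW l0)// period_ge8.
Qed.
Let Y0 : 0 < Y. Proof. exact: lt_le_trans height_ge1. Qed.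

Let Yinv : 0 <= Y^-1 <= 16 * eps ^+ 2.
Proof.
rewrite invr_ge0 (ltW Y0)/= -[leLHS]mul1r ler_pdivrMr// /Y.
have -> : 16 * eps ^+ 2 * (l ^+ 2 / 64) = (eps * l) ^+ 2 / 4 by field.
rewrite el ler_pdivlMr// mul1r (_ : 4 = 2 ^+ 2); last by rewrite -natrX.
by rewrite lerXn2r ?nnegrE.
Qed.

(** [jb] and [ib] are smooth majorants of the indicators of the core and of the transition, so that
    error bounds are continuous functions. *)
Definition jb (z : R * R) := B (1 * (z.1 - 0)) * B (2^-1 * (z.2 - 0)).
Definition ib (z : R * R) := B (2 * (V z - 0)).

Lemma jb01 z : 0 <= jb z <= 1.
Proof.
have /andP[a0 a1] := B01 (1 * (z.1 - 0)); have /andP[b0 b1] := B01 (2^-1 * (z.2 - 0)).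
by rewrite /jb mulr_ge0//= mulr_ile1.
Qed.
Lemma ib01 z : 0 <= ib z <= 1. Proof. exact: B01. Qed.

Let suppB : supp_in B (- 2) 2. Proof. by move=> t ht; apply: B0; rewrite leNgt ltr_norml. Qed.
Let supp_d (h : R -> R) a b : smooth1 h -> supp_in h a b -> supp_in (derive1 h) a b.
Proof. by move=> sh hs t ht; apply: (derive1_supp sh hs). Qed.
Let supp_x : supp_in core_x (- 1) 1.
Proof.
move=> t; rewrite -ltr_norml -leNgt => ht; apply: B0; rewrite subr0 normrM ger0_norm//.
by rewrite ler_peMr.
Qed.
Let supp_y : supp_in core_y (- 2) 2.
Proof. by move=> t ht; rewrite /core_y suppB ?mulr0. Qed.

Let jbound (h1 h2 : R -> R) z : supp_in h1 (- 1) 1 -> supp_in h2 (- 2) 2 ->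
  (forall t, `|h1 t| <= A) -> (forall t, `|h2 t| <= A) -> `|h1 z.1 * h2 z.2| <= A ^+ 2 * jb z.
Proof.
move=> s1 s2 a1 a2; have /andP[j0 j1] := jb01 z; have Aj : 0 <= A ^+ 2 * jb z by rewrite mulr_ge0 ?sqr_ge0.
have [hx|hx] := boolP (- 1 < z.1 < 1); last by rewrite s1// mul0r normr0.
have [hy|hy] := boolP (- 2 < z.2 < 2); last by rewrite s2// mulr0 normr0.
have -> : jb z = 1.
  rewrite -!ltr_norml in hx hy; rewrite /jb !B1 ?mulr1//.
  - by rewrite subr0 normrM ger0_norm ?invr_ge0// ler_pdivrMl// mulr1 ltW.
  - by rewrite subr0 mul1r ltW.
by rewrite mulr1 normrM expr2 ler_pM.
Qed.

Let vbound (h : R -> R) z r c : (forall t, 2^-1 < `|t| -> h t = 0) -> (forall t, `|h t| <= S) ->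
  (`|V z| <= 2^-1 -> `|r| <= c) -> 0 <= c -> `|h (V z) * r| <= S * (c * ib z).
Proof.
move=> h0 hS hr c0; have /andP[i0 i1] := ib01 z.
have [hv|hv] := ltP 2^-1 `|V z|; first by rewrite h0// mul0r normr0 mulr_ge0// mulr_ge0.
have -> : ib z = 1.
  by rewrite /ib B1// subr0 normrM ger0_norm// mulrC -ler_pdivlMr// mul1r.
by rewrite mulr1 normrM ler_pM// hr.
Qed.

Let wid01 y : 0 <= @wid R y <= 1. Proof. by rewrite wid_le1 ltW// wid_gt0. Qed.
Let wid2_ge0 y : 0 <= @wid R y ^+ 2. Proof. exact: sqr_ge0. Qed.
Let wid42 y : @wid R y ^+ 4 <= wid y ^+ 2.
Proof.
have /andP[a b] := wid01 y; rewrite (_ : 4%N = (2 + 2)%N)// exprD ler_piMr// expr_le1//.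
Qed.

Let v_arith1 (a b c : R) : `|a| <= 2^-1 -> `|b| <= 1 -> 0 <= c -> `|- 2^-1 * (a * b * c)| <= c.
Proof.
move=> ha hb c0; rewrite mulrA normrM [`|c|]ger0_norm// ler_piMl// normrM mulr_ile1//.
  by rewrite normrN ger0_norm// invf_le1// ler1n.
by rewrite normrM mulr_ile1// (le_trans ha)// invf_le1// ler1n.
Qed.

Let v_arith2 (t a c : R) : 0 <= t -> t <= 1 -> `|a| <= 2^-1 -> 0 <= c -> `|- 2^-1 * (1 - 5 / 2 * t) * (a * c)| <= c.
Proof.
move=> t0 t1 ha c0; rewrite mulrA normrM [`|c|]ger0_norm// ler_piMl// normrM mulr_ile1//.
  by rewrite ler_norml; apply/andP; split; lra.
by apply: le_trans ha _; rewrite invf_le1// ler1n.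
Qed.

Let E_arith (a b p : R) : `|b| <= p / 2 -> 0 <= a -> a <= p -> p <= 4 -> `|a + (-1 * b + -1 * (p / 2))| <= 8.
Proof. by rewrite !ler_norml => /andP[h1 h2] *; apply/andP; split; lra. Qed.

(** In the transition [x = V / wid y], so [x wid'] is of order [y wid^4], and [y wid^2 <= 1]. This
    gives the order [wid^2] that [W_bound] demands of the y-component. *)
Let xw1 z : `|V z| <= 2^-1 -> `|z.1 * w1 z.2| <= wid z.2 ^+ 2 /\ `|z.1 * w2 z.2| <= wid z.2 ^+ 2.
Proof.
move=> hV; have y1 : `|z.2 * wid z.2 ^+ 2| <= 1.
  rewrite -(@expr_le1 _ 2)// real_normK ?num_real// exprMn -exprM; exact: sqr_wid4.
have w20 := wid2_ge0 z.2; have w42 := wid42 z.2.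
have w40 : 0 <= wid z.2 ^+ 4 by rewrite exprn_ge0//; case/andP: (wid01 z.2).
split.
  have -> : z.1 * w1 z.2 = - 2^-1 * (V z * (z.2 * wid z.2 ^+ 2) * wid z.2 ^+ 2).
    by rewrite /w1 dwidE /dwid /V; ring.
  exact: v_arith1.
have t0 : 0 <= z.2 ^+ 2 * wid z.2 ^+ 4 by rewrite mulr_ge0// sqr_ge0.
have -> : z.1 * w2 z.2 = - 2^-1 * (1 - 5 / 2 * (z.2 ^+ 2 * wid z.2 ^+ 4)) * (V z * wid z.2 ^+ 4).
  by rewrite /w2 /w1 ddwidE /V; ring.
by apply: le_trans w42; apply: v_arith2 => //; exact: sqr_wid4.
Qed.

Let U01 y : 0 <= U y <= 1. Proof. exact: B01. Qed.
Let C00 : 0 <= C0. Proof. exact: le_trans (normr_ge0 _) (dB 0). Qed.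
Let C10 : 0 <= C1. Proof. exact: le_trans (normr_ge0 _) (ddB 0). Qed.
Let eps2 : 0 <= eps ^+ 2 <= 1. Proof. by rewrite sqr_ge0 expr_le1 ?(ltW e0). Qed.

Let U'_bound y : `|U' y| <= 16 * C0 * eps ^+ 2.
Proof.
have /andP[y0 y1] := Yinv; rewrite /U' /U derive1_rescale// normrM ger0_norm//.
apply: le_trans (ler_pM y0 (normr_ge0 _) y1 (dB _)) _.
by rewrite mulrAC.
Qed.

Let U''_bound y : `|U'' y| <= 256 * C1 * eps ^+ 2.
Proof.
have /andP[y0 y1] := Yinv; have /andP[a0 a1] := eps2.
have E1 : U' = (fun y => Y^-1 * derive1 B (Y^-1 * (y - 0))).
  by apply/funext => t; rewrite /U' /U derive1_rescale.
rewrite /U'' E1 derive1M_smooth; [|exact: smooth1_cst|exact: smooth1_comp (smooth1_derive sB) (smooth1_affine _ _)].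
rewrite derive1_cst mul0r add0r derive1_rescale; last exact: smooth1_derive.
rewrite !normrM ger0_norm//.
have h2 : Y^-1 <= 16 by apply: le_trans y1 _; rewrite ler_piMr.
have h3 := ler_pM y0 (normr_ge0 _) h2 (ddB (Y^-1 * (y - 0))).
apply: le_trans (ler_pM y0 _ y1 h3) _; first by rewrite mulr_ge0.
rewrite (_ : 16 * eps ^+ 2 * (16 * C1) = 256 * C1 * eps ^+ 2)//; ring.
Qed.

Let E_bound z : `|z.1| <= l / 2 -> `|E z| <= 8.
Proof.
move=> hx; have hex : `|eps * z.1| <= pi / 2.
  rewrite normrM gtr0_norm// -el -mulrA ler_pM2l//.
have /andP[g0 g1] := sg01 (V z).
have p0 : 0 <= pi * sg (V z) by rewrite mulr_ge0.
have p1 : pi * sg (V z) <= pi by rewrite ler_piMr.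
exact: E_arith hex p0 p1 pi4.
Qed.

Let normU (z : R * R) (r c : R) : `|r| <= c -> `|U z.2 * (pi * r)| <= 4 * c.
Proof.
move=> hr; have /andP[u0 u1] := U01 z.2; rewrite !normrM ger0_norm// [`|pi|]ger0_norm//.
apply: le_trans (_ : _ <= 1 * (4 * c)) _; last by rewrite mul1r.
by apply: ler_pM => //; [exact: mulr_ge0|exact: ler_pM].
Qed.

Let s01 : 0 <= s <= 1 /\ s ^+ 2 = 1 - eps ^+ 2.
Proof.
have /andP[a0 a1] := eps2.
have s2 : s ^+ 2 = 1 - eps ^+ 2 by rewrite sqr_sqrtr// subr_ge0.
by split => //; rewrite sqrtr_ge0/= -(@expr_le1 _ 2) ?sqrtr_ge0// s2 gerBl.
Qed.

Let norms (r c : R) : `|r| <= c -> `|-1 * s * r| <= c.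
Proof.
have [/andP[a0 a1] _] := s01; move=> h; rewrite mulN1r normrM normrN [`|s|]ger0_norm//.
by apply: le_trans h; rewrite ler_piMl.
Qed.

Definition slope_const := 3 + 4 * ((A ^+ 2) ^+ 2 + (4 * S) ^+ 2) + 2 * (A ^+ 2 + 128 * C0 + 4 * S) +
  3 * (A ^+ 2 + 128 * C0 + 4 * S) ^+ 2.
Definition laplacian_const := 2 * A ^+ 2 + 2048 * C1 + 128 * C0 * S + 12 * S.
Definition density_const := 3 * (laplacian_const ^+ 2 + slope_const ^+ 2).

Let laplacian_const_ge0 : 0 <= laplacian_const.
Proof.
exact: addr_ge0 (addr_ge0 (addr_ge0 (mulr_ge0 (ler0n R 2) (sqr_ge0 A)) (mulr_ge0 (ler0n R 2048) C10))
  (mulr_ge0 (mulr_ge0 (ler0n R 128) C00) S0)) (mulr_ge0 (ler0n R 12) S0).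
Qed.

Let slope_const_ge0 : 0 <= slope_const.
Proof.
have N0 : 0 <= A ^+ 2 + 128 * C0 + 4 * S.
  exact: addr_ge0 (addr_ge0 (sqr_ge0 A) (mulr_ge0 (ler0n R 128) C00)) (mulr_ge0 (ler0n R 4) S0).
exact: addr_ge0 (addr_ge0 (addr_ge0 (ler0n R 3) (mulr_ge0 (ler0n R 4) (addr_ge0 (sqr_ge0 _) (sqr_ge0 _))))
  (mulr_ge0 (ler0n R 2) N0)) (mulr_ge0 (ler0n R 3) (sqr_ge0 _)).
Qed.

Let sum5 (a b c d f A2 S' C C' j i e N : R) : `|a| <= A2 * j -> `|b| <= 4 * (S' * i) -> `|c| <= A2 * j ->
  `|d| <= 2048 * C * e -> `|f| <= 64 * C' * (S' * i) -> 0 <= A2 -> 0 <= S' -> 0 <= C -> 0 <= C' ->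
  0 <= j -> 0 <= i -> 0 <= e -> `|N| <= 4 * (2 * (S' * i)) ->
  `|a + b + (c + (d + 2 * f + N))| <= (2 * A2 + 2048 * C + 128 * C' * S' + 12 * S') * (e + j + i).
Proof.
move=> ha hb hc hd hf A20 S0' C0' C0'' j0 i0 ee hN.
have nn (x y : R) : 0 <= x -> 0 <= y -> 0 <= x * y by exact: mulr_ge0.
have k1 := nn _ _ A20 i0; have k2 := nn _ _ A20 ee.
have k3 := nn _ _ C0' j0; have k4 := nn _ _ C0' i0.
have k5 := nn _ _ (nn _ _ C0'' S0') j0; have k6 := nn _ _ (nn _ _ C0'' S0') ee.
have k7 := nn _ _ S0' j0; have k8 := nn _ _ S0' ee.
have k9 : 64 * C' * (S' * i) = 64 * (C' * S' * i) by ring.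
rewrite k9 in hf.
have -> : (2 * A2 + 2048 * C + 128 * C' * S' + 12 * S') * (e + j + i) =
  2 * (A2 * e) + 2 * (A2 * j) + 2 * (A2 * i) + 2048 * C * e + 2048 * (C * j) + 2048 * (C * i) +
  128 * (C' * S' * e) + 128 * (C' * S' * j) + 128 * (C' * S' * i) + 12 * (S' * e) + 12 * (S' * j) + 12 * (S' * i) by ring.
move: ha hb hc hd hf hN k1 k2 k3 k4 k5 k6 k7 k8.
move: (A2 * j) (A2 * e) (A2 * i) (2048 * C * e) (C * j) (C * i) (C' * S' * e) (C' * S' * j) (C' * S' * i) (S' * e) (S' * j) (S' * i).
move=> v1 v2 v3 v4 v5 v6 v7 v8 v9 v10 v11 v12; rewrite !ler_norml.
move=> /andP[a1 a2] /andP[b1 b2] /andP[c1 c2] /andP[d1 d2] /andP[f1 f2] /andP[N1 N2] *.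
by apply/andP; split; lra.
Qed.

(** The Laplacian and [W] are both of order [eps^2] in general, of order 1 in the core and of order
    [wid^2] in the transition; the density squares these orders. *)
Lemma comp_density z : `|z.1| <= l / 2 ->
  density comp z <= density_const * (eps ^+ 4 + jb z + wid z.2 ^+ 4 * ib z).
Proof.
move=> hz; have [s1 s2] := s01; have Ez := E_bound hz; have /andP[w0 w11] := wid01 z.2.
have /andP[j0 j1] := jb01 z; have /andP[i0 i1] := ib01 z; have /andP[u0 u1] := U01 z.2.
have w20 := wid2_ge0 z.2; have /andP[ee0 ee1] := eps2.
have jx (h : R -> R) k := @jbound h k z.
have A1x t : `|core_x t| <= A by case: (hA1 t). have A1x' t : `|cx' t| <= A by case: (hA1 t).
have A1x'' t : `|cx'' t| <= A by case: (hA1 t). have A1y t : `|core_y t| <= A by case: (hA2 t).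
have A1y' t : `|cy' t| <= A by case: (hA2 t). have A1y'' t : `|cy'' t| <= A by case: (hA2 t).
have sx' := supp_d scx supp_x; have sx'' := supp_d (smooth1_derive scx) sx'.
have sy' := supp_d scy supp_y; have sy'' := supp_d (smooth1_derive scy) sy'.
have gw : `|g' (V z) * wid z.2| <= S * (wid z.2 * ib z) by apply: vbound => // _; rewrite ger0_norm.
have gx : `|g' (V z) * (z.1 * w1 z.2)| <= S * (wid z.2 ^+ 2 * ib z) by apply: vbound => // /xw1[].
have gxx : `|g' (V z) * (z.1 * w2 z.2)| <= S * (wid z.2 ^+ 2 * ib z) by apply: vbound => // /xw1[].
have gww : `|g'' (V z) * (wid z.2 * wid z.2)| <= S * (wid z.2 ^+ 2 * ib z).
  by apply: vbound => // _; rewrite -expr2 ger0_norm.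
have ggx : `|g'' (V z) * (z.1 * w1 z.2) ^+ 2| <= S * (wid z.2 ^+ 2 * ib z).
  apply: vbound => // /xw1[h _]; rewrite ger0_norm ?sqr_ge0// -real_normK ?num_real//.
  rewrite expr2; apply: le_trans (ler_wpM2l (normr_ge0 _) h) _; rewrite ler_piMl//.
  by apply: le_trans h _; rewrite expr_le1.
have UE : `|U' z.2 * E z| <= 128 * C0 * eps ^+ 2.
  rewrite normrM; apply: le_trans (ler_pM (normr_ge0 _) (normr_ge0 _) (U'_bound _) Ez) _.
  rewrite (_ : 16 * C0 * eps ^+ 2 * 8 = 128 * C0 * eps ^+ 2)//; ring.
have U1 : `|U' z.2| <= 16 * C0.
  by apply: le_trans (U'_bound _) _; rewrite ler_piMr// mulr_ge0.
have UE2 : `|U'' z.2 * E z| <= 2048 * C1 * eps ^+ 2.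
  rewrite normrM; apply: le_trans (ler_pM (normr_ge0 _) (normr_ge0 _) (U''_bound _) Ez) _.
  rewrite (_ : 256 * C1 * eps ^+ 2 * 8 = 2048 * C1 * eps ^+ 2)//; ring.
have Uf : `|U' z.2 * (pi * (g' (V z) * (z.1 * w1 z.2)))| <= 64 * C0 * (S * (wid z.2 ^+ 2 * ib z)).
  rewrite normrM; have hp : `|pi * (g' (V z) * (z.1 * w1 z.2))| <= 4 * (S * (wid z.2 ^+ 2 * ib z)).
    by rewrite normrM; apply: ler_pM => //; rewrite ger0_norm.
  apply: le_trans (ler_pM (normr_ge0 _) (normr_ge0 _) U1 hp) _.
  rewrite (_ : 16 * C0 * (4 * _) = 64 * C0 * (S * (wid z.2 ^+ 2 * ib z)))//; ring.
have wi0 : 0 <= wid z.2 ^+ 2 * ib z by exact: mulr_ge0.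
rewrite densE; apply: (@density_arith R _ _ slope_const laplacian_const (eps ^+ 2 + jb z + wid z.2 ^+ 2 * ib z)).
- rewrite /laplacian_const.
  have hN : `|U z.2 * (pi * (g'' (V z) * (z.1 * w1 z.2) ^+ 2 + g' (V z) * (z.1 * w2 z.2)))| <= 4 * (2 * (S * (wid z.2 ^+ 2 * ib z))).
    by apply: normU; apply: le_trans (ler_normD _ _) _; rewrite mulr_natl mulr2n lerD.
  have hb : `|U z.2 * (pi * (g'' (V z) * wid z.2 * wid z.2))| <= 4 * (S * (wid z.2 ^+ 2 * ib z)).
    by apply: normU; rewrite -mulrA.
  apply: (sum5 (norms (jx _ _ sx'' supp_y A1x'' A1y)) hb (norms (jx _ _ supp_x sy'' A1x A1y'')) UE2 Uf) => //.
  exact: sqr_ge0.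
- have -> : fx z = (-1 * s * (cx' z.1 * core_y z.2) + U z.2 * (pi * (g' (V z) * wid z.2))) + (1 - U z.2) * eps.
    by rewrite /fx; ring.
  have -> : fy z = s + (-1 * s * (core_x z.1 * cy' z.2) + (U' z.2 * E z + U z.2 * (pi * (g' (V z) * (z.1 * w1 z.2))))).
    by rewrite /fy; ring.
  have hp : `|-1 * s * (cx' z.1 * core_y z.2) + U z.2 * (pi * (g' (V z) * wid z.2))| <=
      A ^+ 2 * jb z + 4 * S * (wid z.2 * ib z).
    apply: le_trans (ler_normD _ _) _; apply: lerD; first exact: norms (jx _ _ sx' supp_y A1x' A1y).
    by rewrite -mulrA; exact: normU.
  have hg : `|-1 * s * (core_x z.1 * cy' z.2) + (U' z.2 * E z + U z.2 * (pi * (g' (V z) * (z.1 * w1 z.2))))| <=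
      A ^+ 2 * jb z + 128 * C0 * eps ^+ 2 + 4 * S * (wid z.2 ^+ 2 * ib z).
    rewrite -addrA; apply: le_trans (ler_normD _ _) _; apply: lerD; first exact: norms (jx _ _ supp_x sy' A1x A1y').
    by apply: le_trans (ler_normD _ _) _; apply: lerD => //; rewrite -mulrA; exact: normU.
  have hk : 0 <= 1 - U z.2 <= 1 by rewrite subr_ge0 u1 gerBl.
  have he : 0 <= eps <= 1 by rewrite e1 (ltW e0).
  exact: (W_bound s1 s2 hk hp hg (jb01 z) (ib01 z) (wid01 z.2) he (sqr_ge0 A)
    (mulr_ge0 (ler0n R 4) S0) (mulr_ge0 (ler0n R 128) C00)).
- by [].
- exact: jb01.
- exact: ib01.
- exact: laplacian_const_ge0.
- exact: slope_const_ge0.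
Qed.

(** The dislocation is centred over the Neumann part, the last unit interval of the period. *)
Let xc := l - 2^-1.
Definition competitor (z : R * R) := glue l comp (xshift (- xc) z).

Let l8 : 8 <= l. Proof. exact: period_ge8. Qed.

Let core_x0 x : 1 <= `|x| -> core_x x = 0.
Proof. by move=> h; apply: supp_x; rewrite -ltr_norml -leNgt. Qed.

Let wide_arith (L : R) : L <= 16 * (1 + L / 1024) -> 8 * 8 <= L -> False.
Proof. by lra. Qed.

(** Otherwise [l wid y <= 2], and [l^4 = (l wid y)^4 (1 + y^2)] is at most [16 (1 + l^4 / 1024)],
    which is impossible for [l >= 8]. *)
Let wide y : `|y| < 2 * Y -> 2^-1 <= l / 4 * wid y.
Proof.
move=> hy; rewrite leNgt; apply/negP => h.
have a0 : 0 <= l * wid y by rewrite mulr_ge0 ?(ltW l0) ?ltW ?wid_gt0.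
have a2 : l * wid y <= 2 by move: h; rewrite mulrAC; move: (l * wid y) => v; lra.
have a4 : (l * wid y) ^+ 4 <= 2 ^+ 4 by rewrite lerXn2r ?nnegrE.
have y2 : y ^+ 2 <= (2 * Y) ^+ 2 by rewrite -[y ^+ 2]real_normK ?num_real// lerXn2r ?nnegrE ?(ltW hy)// mulr_ge0// ltW.
have e4 : (2 * Y) ^+ 2 = l ^+ 4 / 1024 by rewrite /Y; field.
have l2 : 8 * 8 <= l * l by apply: ler_pM => //; exact: l8.
have l4 : l * l <= l ^+ 4.
  have -> : l ^+ 4 = (l * l) * (l * l) by rewrite -!expr2 -exprM.
  apply: ler_peMr; first exact: mulr_ge0 (ltW l0) (ltW l0).
  by apply: le_trans l2; rewrite -natrM ler1n.
have E1 : l ^+ 4 = (l * wid y) ^+ 4 * (1 + y ^+ 2).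
  have -> : (l * wid y) ^+ 4 * (1 + y ^+ 2) = l ^+ 4 * (wid y ^+ 4 * (1 + y * y)) by ring.
  by rewrite wid4 mulr1.
have b1 : (l * wid y) ^+ 4 * (1 + y ^+ 2) <= 2 ^+ 4 * (1 + l ^+ 4 / 1024).
  apply: ler_pM => //; first by rewrite exprn_ge0.
    by rewrite addr_ge0// sqr_ge0.
  by rewrite lerD2l -e4.
rewrite -E1 (_ : (2 : R) ^+ 4 = 16) in b1; last by rewrite -natrX.
by move: b1 l4 l2; move: (l ^+ 4) (l * l) => L L2 g1 g2 g3; exact: wide_arith g1 (le_trans g3 g2).
Qed.

(** Near the seam the core has ended. Wherever [U] is nonzero, [wide] shows that the step has
    reached 0 on the left and [pi] on the right; the remaining terms are affine in x. *)
Let comp_seam x y : `|x + l / 2| < l / 4 -> comp (x + l, y) = comp (x, y) + pi.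
Proof.
move=> hx; have lp := l0; have lb := l8.
have [x1 x2] : x < - (l / 4) /\ l / 4 < x + l by move: hx; rewrite ltr_norml => /andP[]; split; lra.
have q2 : 2 <= l / 4 by lra.
have n1 : core_x x = 0 by apply: core_x0; rewrite ltr0_norm; lra.
have n2 : core_x (x + l) = 0 by apply: core_x0; rewrite gtr0_norm; lra.
have exl : eps * (x + l) = eps * x + pi by rewrite mulrDr el.
rewrite /comp /= n1 n2 exl.
have [hy|hy] := leP 2 `|Y^-1 * (y - 0)|; first by rewrite /U B0//; ring.
have hy2 : `|y| < 2 * Y.
  by move: hy; rewrite subr0 normrM gtr0_norm ?invr_gt0// ltr_pdivrMl// mulrC.
have hw := wide hy2; have w0 := @wid_gt0 R y.
have v1 : V (x, y) <= - 2^-1.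
  rewrite /V /= lerNr -mulNr; apply: le_trans hw _; rewrite ler_pM2r//; lra.
have v2 : 2^-1 <= V (x + l, y).
  by rewrite /V /=; apply: le_trans hw _; rewrite ler_pM2r// ltW.
by rewrite (sg0 v1) (sg1 v2); ring.
Qed.

Let sglue : smooth (glue l comp).
Proof. exact: glue_smooth l0 comp_smooth comp_seam. Qed.
Let sth : smooth competitor. Proof. exact: smooth_xshift. Qed.

Let th_per z : competitor (xshift l z) = competitor z + pi.
Proof.
rewrite /competitor -(@glue_shift R l comp l0).
by congr (glue l comp _); rewrite /xshift /= addrAC.
Qed.

Let th_top z : 2 * Y < z.2 -> competitor z = eps * z.1 + s * z.2 + (pi / 2 - eps * xc).
Proof.
move=> zY; have top t : 2 * Y < t.2 -> comp t = eps * t.1 + s * t.2 + pi / 2.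
  by move=> h; exact: comp_top h height_ge1.
by rewrite /competitor (glue_affine el top)//=; ring.
Qed.

Let al1 : (1 - eps / pi) * l = l - 1.
Proof. by rewrite mulrBl mul1r mulrAC el divff// gt_eqF// pi_gt0. Qed.

(** Before the Neumann part the step is 0. Points more than half a period to the left of [xc] are
    read off one period later, where the value [pi] of the step cancels the gain. *)
Lemma competitor_admissible : admissible eps (1 - eps / pi) (pi / 2 - eps * xc) competitor.
Proof.
have lp := l0; have lb := l8; have e0' := e0.
apply: (@admissible_smooth R eps _ _ (2 * Y)) => //.
- move=> x; rewrite -/l al1 => /andP[x0 x1]; rewrite /competitor /xshift /=.
  have [h|h] := leP (- (l / 2)) (x + - xc).
    have xm : x + - xc < - 2^-1 by rewrite /xc; lra.
    rewrite (@glue0 R l comp l0); last by rewrite h/=; lra.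
    rewrite comp_line0; last by rewrite ltr0_norm; lra.
    by rewrite (_ : x + - xc < 0) //; lra.
  have := @glue_shift R l comp l0 (x + - xc, 0); rewrite /xshift /=.
  have xp : 2^-1 <= x + - xc + l by rewrite /xc; lra.
  rewrite (@glue0 R l comp l0); last by apply/andP; split; lra.
  rewrite comp_line0; last by rewrite ger0_norm; lra.
  rewrite (_ : (x + - xc + l < 0) = false); last by apply/negbTE; rewrite -leNgt; lra.
  by move=> E1; apply: (addIr pi); rewrite -E1 add0r.
- move=> x; rewrite -/l al1 => /andP[x0 x1].
  have dY : dir (diry R) by right.
  have xs : `|x + - xc| <= 2^-1 by rewrite /xc ler_norml; apply/andP; split; lra.
  have xl : `|x + - xc| < l / 2 by apply: le_lt_trans xs _; lra.
  have [_ ->] := is_derive_xshift (- xc) (x, 0) dY sglue.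
  have nz := @glue_near0 R l comp l0 comp_seam (x + - xc, 0) xl.
  rewrite (@near_eq_derive _ _ _ (glue l comp) comp (x + - xc, 0) (diry R) nz).
  exact: comp_diry0.
Qed.

Let density_zero (a b c d : R) : a = 0 -> b = 0 -> c = eps -> d = s ->
  (a + b) ^+ 2 + (1 - (c ^+ 2 + d ^+ 2)) ^+ 2 = 0.
Proof. by have [_ s2] := s01; move=> -> -> -> ->; rewrite s2; ring. Qed.

Let density_top z : 2 * Y < z.2 -> density competitor z = 0.
Proof.
move=> zY; set d := pi / 2 - eps * xc.
have dL z' e : is_derive z' e (fun z : R * R => eps * z.1 + s * z.2 + d) (eps * e.1 + s * e.2).
  apply: is_derive_eqr; first by derive_auto.
  by rewrite !mul0r !add0r addr0.
have nz : \forall t \near z, competitor t = eps * t.1 + s * t.2 + d.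
  have oY : open [set t : R * R | 2 * Y < t.2].
    rewrite (_ : [set t | _] = snd @^-1` [set t | 2 * Y < t]); last by [].
    by apply: open_comp; [move=> t _; exact: cvg_snd|exact: open_gt].
  have : nbhs z [set t : R * R | 2 * Y < t.2] by exact: open_nbhs_nbhs.
  by apply: filterS => t tY /=; exact: th_top.
rewrite (density_near nz) /density.
have E1 e : 'D_e (fun z : R * R => eps * z.1 + s * z.2 + d) = (fun=> eps * e.1 + s * e.2).
  by apply/funext => t; have [_ ->] := dL t e.
apply: density_zero.
- by rewrite E1; have [_ ->] := is_derive_cstr (eps * (dirx R).1 + s * (dirx R).2) z (dirx R).
- by rewrite E1; have [_ ->] := is_derive_cstr (eps * (diry R).1 + s * (diry R).2) z (diry R).
- by have [_ ->] := dL z (dirx R); rewrite /= mulr1 mulr0 addr0.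
- by have [_ ->] := dL z (diry R); rewrite /= mulr1 mulr0 add0r.
Qed.

Let Bint (k t0 a b : R) : 0 < k -> integ mu `[a, b]%classic (fun x => B (k * (x - t0))) /\
  \int[mu]_(x in `[a, b]) B (k * (x - t0)) <= 4 / k.
Proof.
move=> k0; have iB : integ mu `[a, b]%classic (fun x => B (k * (x - t0))).
  by apply: continuous_integ; exact: smooth1_cont (smooth1_comp sB (smooth1_affine _ _)).
split => //; have h : t0 - 2 / k <= t0 + 2 / k.
  by rewrite lerD2l -subr_ge0 opprK addr_ge0// divr_ge0// ltW.
have iI : integ mu `[a, b]%classic (\1_(`[t0 - 2 / k, t0 + 2 / k]%classic) : R -> R).
  apply: (@integ_le _ _ _ mu _ _ (fun=> 1)) (i1c a b 1) => //.
  by move=> x _; rewrite indicE; case: (_ \in _); rewrite ?normr1 ?normr0.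
have E1 : 4 / k = t0 + 2 / k - (t0 - 2 / k) by field; rewrite gt_eqF.
rewrite E1; apply: le_trans (Rint_indic_le a b h); apply: R1le => //; apply: aeW => x _.
have /andP[b0 b1] := B01 (k * (x - t0)).
have [hx|hx] := leP 2 `|k * (x - t0)|; first by rewrite B0// indicE.
rewrite indicE mem_set//= in_itv/=; move: hx; rewrite normrM gtr0_norm// mulrC -ltr_pdivlMr// ltr_distl.
by move=> /andP[h1 h2]; rewrite !ltW.
Qed.

(** For [y >= 1], [- 4 wid' = 2 y wid^5] exceeds [wid^3], because [y^2 wid^4 = 1 - wid^4 >= 1 / 2];
    below 1 the plateau suffices. The majorant has a bounded integral, since [wid'] integrates to a
    difference of values of [wid]. *)
Let wid_cube y : 0 <= y -> wid y ^+ 3 <= B (1 * (y - 0)) + -4 * dwid y.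
Proof.
move=> y0; have /andP[w0 w11] := wid01 y; have wp := @wid_gt0 R y.
have E1 : -4 * dwid y = 2 * (y * wid y ^+ 2) * wid y ^+ 3 by rewrite /dwid; field.
have w30 : 0 <= wid y ^+ 3 by rewrite exprn_ge0.
have yw : 0 <= y * wid y ^+ 2 by rewrite mulr_ge0// sqr_ge0.
have /andP[b0 b1] := B01 (1 * (y - 0)).
have [h|/ltW h] := leP y 1.
  rewrite B1; last by rewrite subr0 mul1r ger0_norm.
  by rewrite E1 -[leLHS]addr0 lerD ?exprn_ile1// mulr_ge0// mulr_ge0.
rewrite E1 -[leLHS]add0r; apply: lerD => //; apply: ler_peMl => //.
have t4 : (y * wid y ^+ 2) ^+ 2 = 1 - wid y ^+ 4.
  by rewrite -[1](wid4 y) exprMn -exprM expr2; ring.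
have w4 : 2 * wid y ^+ 4 <= 1.
  rewrite -[leRHS](wid4 y) mulrC; apply: ler_wpM2l; first by rewrite exprn_ge0.
  by rewrite (_ : 2 = 1 + 1)// lerD2l -expr2 expr_ge1.
rewrite -(@expr_ge1 _ 2)// ?mulr_ge0// exprMn t4; move: w4; rewrite expr2; lra.
Qed.

Let wid_cube_int H : 0 <= H -> integ mu `[0, H]%classic (fun y => wid y ^+ 3) /\
  \int[mu]_(y in `[0, H]) (wid y ^+ 3) <= 8.
Proof.
move=> H0; have cw := smooth1_cont sw.
have iw : integ mu `[0, H]%classic (fun y => wid y ^+ 3).
  apply: continuous_integ => y; have h := cw y.
  by apply: cvgM => //; apply: cvgM.
have cdw : continuous (@dwid R).
  rewrite (_ : @dwid R = derive1 (@wid R)); first exact: smooth1_cont (smooth1_derive sw).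
  by apply/funext => y; rewrite dwidE.
have idw : integ mu `[0, H]%classic (@dwid R) by exact: continuous_integ.
have [iB IB] := @Bint 1 0 0 H ltr01.
split => //; have h : \int[mu]_(y in `[0, H]) (wid y ^+ 3) <=
    \int[mu]_(y in `[0, H]) (B (1 * (y - 0)) + -4 * dwid y).
  apply: R1le => //; first by apply: i1D => //; exact: i1Z.
  by apply: aeW => y /andP[y0 _]; exact: wid_cube.
apply: le_trans h _; rewrite R1D//; last exact: i1Z.
rewrite R1Z// (prim_int (@prim_C1 R H _ _ H0 (@wid_is_derive R) cdw)) wid0.
have wH := @wid_gt0 R H; move: IB; rewrite divr1; move: (\int[mu]_(y in _) _) (wid H) wH => u v; lra.
Qed.

(** [49 = 1 + 32 + 16], from the three terms of [comp_density]. In the first, [eps^4] meets an area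
    of order [l^3], that is [eps^-3]. *)
Lemma competitor_energy : (energy eps competitor <= (2 * (density_const * 49))%:E)%E.
Proof.
have lp := l0; have lb := l8; have Q0 : 0 <= density_const by rewrite /density_const mulr_ge0// addr_ge0 ?sqr_ge0.
(* [[c, c + l]] is the period centred at [xc], inside which the competitor is a plain translate of
   [comp]. *)
pose c := l / 2 - 2^-1; pose H := 2 * Y.
have H0 : 0 <= H by rewrite mulr_ge0// ltW.
have cl : 0 <= c <= l by rewrite /c; apply/andP; split; lra.
apply: (@energy_smooth_le R eps competitor c H _ e0 sth th_per cl density_top).
rewrite -/l; pose J z := jb (xshift (- xc) z); pose I (z : R * R) := wid z.2 ^+ 4 * ib (xshift (- xc) z).
have f1 (h : R -> R) : smooth1 h -> smooth (fun z : R * R => h z.1) by move=> sh; apply: smooth_comp => //; exact: smooth_fst.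
have f2 (h : R -> R) : smooth1 h -> smooth (fun z : R * R => h z.2) by move=> sh; apply: smooth_comp => //; exact: smooth_snd.
have sBk (k t0 : R) : smooth1 (fun x => B (k * (x - t0))) by exact: smooth1_comp sB (smooth1_affine _ _).
have sJ : smooth J.
  have sj : smooth jb by apply: smoothM; [exact: (f1 _ (sBk 1 0))|exact: (f2 _ (sBk 2^-1 0))].
  exact: smooth_xshift.
have s4 : smooth1 (fun y : R => wid y ^+ 4).
  rewrite (_ : (fun y => _) = (fun y : R => wid y * (wid y * (wid y * wid y)))); first by do 3 (apply: smooth1M => //).
  by apply/funext => y; rewrite !exprS expr0 mulr1.
have sI : smooth I.
  apply: smoothM; first exact: f2 s4.
  have si : smooth ib by exact: smooth_comp (sBk 2 0) sV.
  exact: smooth_xshift.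
have iJ : integ leb2 (rect c (c + l) 0 H) J by apply: continuous_integ2; exact: smooth_cont.
have iI : integ leb2 (rect c (c + l) 0 H) I by apply: continuous_integ2; exact: smooth_cont.
have iE : integ leb2 (rect c (c + l) 0 H) (fun=> eps ^+ 4) by exact: i2c.
have iG := i2Z density_const (i2D (i2D iE iJ) iI).
apply: le_trans (R2le (@continuous_integ2 _ _ c (c + l) 0 H (density_continuous sth)) iG _) _.
  apply: (aeS2 (ae_neq1 c) (ae_neq1 (c + l))) => z z1 z2 /rectE[/andP[h1 h2] _].
  have hz : `|z.1 + - xc| < l / 2.
    rewrite ltr_norml; apply/andP; split.
      have h : c < z.1 by rewrite lt_neqAle eq_sym z1.
      by move: h; rewrite /c /xc; lra.
    have h : z.1 < c + l by rewrite lt_neqAle z2.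
    by move: h; rewrite /c /xc; lra.
  rewrite /competitor (density_xshift (- xc) z sglue) (density_near (@glue_near0 R l comp l0 comp_seam (xshift (- xc) z) hz)).
  exact: (comp_density (z := xshift (- xc) z) (ltW hz)).
rewrite (R2Z _ (i2D (i2D iE iJ) iI)) ler_wpM2l// (R2D (i2D iE iJ) iI) (R2D iE iJ).
have ccl : c <= c + l by rewrite lerDl ltW.
have B1' : \int[leb2]_(z in rect c (c + l) 0 H) (eps ^+ 4) <= 1.
  rewrite (R2x iE); under eq_Rintegral do rewrite R1c//.
  rewrite R1c// subr0 addrAC subrr add0r.
  have -> : eps ^+ 4 * H * l = (eps * l) ^+ 3 * eps / 32 by rewrite /H /Y; field.
  rewrite el; have p3 : pi ^+ 3 <= 4 ^+ 3 :> R by rewrite lerXn2r ?nnegrE.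
  have h := ler_pM (exprn_ge0 3 pi0) (ltW e0) p3 e1.
  rewrite ler_pdivrMr// mul1r; have /andP[_ e4] := eps01.
  have h' := ler_pM (exprn_ge0 3 pi0) (ltW e0) p3 e4; apply: le_trans h' _.
  by rewrite ler_pdivrMr// -natrX -natrM ler_nat.
have B2 : \int[leb2]_(z in rect c (c + l) 0 H) J z <= 32.
  have [i1 I1] := @Bint 1 xc c (c + l) ltr01.
  have k2 : 0 < 2^-1 :> R by rewrite invr_gt0.
  have [i2 I2] := @Bint 2^-1 0 0 H k2.
  rewrite (R2x iJ) (@R1eq _ c (c + l) _ (fun x => (\int[mu]_(y in `[0, H]) B (2^-1 * (y - 0))) * B (1 * (x - xc)))); last first.
    move=> x _; rewrite mulrC -R1Z//; apply: R1eq => y _.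
    by rewrite /J /jb /xshift /= subr0.
  rewrite R1Z//; have g1 : 0 <= \int[mu]_(x in `[c, c + l]) B (1 * (x - xc)).
    by apply: Rintegral_ge0 => x _; case/andP: (B01 (1 * (x - xc))).
  have g2 : 0 <= \int[mu]_(y in `[0, H]) B (2^-1 * (y - 0)).
    by apply: Rintegral_ge0 => x _; case/andP: (B01 (2^-1 * (x - 0))).
  apply: le_trans (ler_pM g2 g1 I2 I1) _.
  by rewrite divr1 invrK -!natrM ler_nat.
(* At height [y] the support of [ib] has length at most [2 / wid y], which lowers [wid^4] to the
   integrable [wid^3]. *)
have B3 : \int[leb2]_(z in rect c (c + l) 0 H) I z <= 16.
  have [iw Iw] := wid_cube_int H0.
  rewrite (R2y iI); apply: le_trans (R1le (i2int2 iI) (i1Z 2 iw) _) _.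
    apply: aeW => y _; have wp := @wid_gt0 R y.
    have k2 : 0 < 2 * wid y by rewrite mulr_gt0.
    have [i1 I1] := @Bint (2 * wid y) xc c (c + l) k2.
    rewrite (@R1eq _ c (c + l) _ (fun x => wid y ^+ 4 * B (2 * wid y * (x - xc)))); last first.
      by move=> x _; rewrite /I /ib /V /xshift /= subr0; congr (_ * B _); ring.
    rewrite R1Z//; have w40 : 0 <= wid y ^+ 4 by rewrite exprn_ge0// ltW.
    apply: le_trans (ler_wpM2l w40 I1) _.
    by rewrite [leLHS](_ : _ = 2 * wid y ^+ 3)//; field; rewrite gt_eqF.
  by rewrite R1Z//; move: Iw; move: (\int[mu]_(y in _) _) => u; lra.
move: B1' B2 B3; move: (\int[leb2]_(z in _) _) (\int[leb2]_(z in _) _) (\int[leb2]_(z in _) _) => u v w.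
lra.
Qed.

End Competitor.

(** * Energy bound for minimizers and conclusion *)

Section Bounded_energy_competitors.
Context {R : realType}.

Lemma competitor_exists : exists2 E0 : R, 0 < E0 & forall eps : R, 0 < eps <= 4^-1 ->
  exists (a delta : R) (theta : R * R -> R), [/\ 0 <= a <= 1, admissible eps a delta theta &
    (energy eps theta <= E0%:E)%E].
Proof.
have [B [C0 [sB B1 B0 B01 [_ C01 dB]]]] := @plateau_exists R.
have [sg [S [ssg g0 g1 g01 [S0 d1 d2 z1 z2]]]] := @sigmoid_exists R.
have supp_d (h : R -> R) a b : smooth1 h -> supp_in h a b -> supp_in (derive1 h) a b.
  by move=> sh hs t ht; apply: (derive1_supp sh hs).
have suppB : supp_in B (- 2) 2 by move=> t ht; apply: B0; rewrite leNgt ltr_norml.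
have bd (h : R -> R) a b : smooth1 h -> supp_in h a b -> exists2 K : R, 0 <= K & forall t, `|h t| <= K.
  move=> sh hs; have [K hK] := smooth1_bounded (smooth1_cont sh) hs.
  by exists K => //; exact: le_trans (normr_ge0 _) (hK 0).
have bd3 (h : R -> R) a b : smooth1 h -> supp_in h a b -> exists2 K : R, 0 <= K & forall t,
    [/\ `|h t| <= K, `|derive1 h t| <= K & `|derive1 (derive1 h) t| <= K].
  move=> sh hs; have sh1 := smooth1_derive sh; have hs1 := supp_d _ _ _ sh hs.
  have [K1 k1 b1] := bd _ _ _ sh hs; have [K2 k2 b2] := bd _ _ _ sh1 hs1.
  have [K3 k3 b3] := bd _ _ _ (smooth1_derive sh1) (supp_d _ _ _ sh1 hs1).
  exists (K1 + K2 + K3); first by rewrite !addr_ge0.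
  move=> t; split.
  - by apply: le_trans (b1 t) _; rewrite -addrA lerDl addr_ge0.
  - by apply: le_trans (b2 t) _; rewrite addrAC lerDr addr_ge0.
  - by apply: le_trans (b3 t) _; rewrite lerDr addr_ge0.
have [C1 _ ddB] : exists2 C1 : R, 0 <= C1 & forall t, `|derive1 (derive1 B) t| <= C1.
  by have [K k0 hK] := bd3 _ _ _ sB suppB; exists K => // t; case: (hK t).
have scx : smooth1 (core_x B) by exact: smooth1_comp sB (smooth1_affine _ _).
have scy : smooth1 (core_y B) by apply: smooth1M => //; move=> k; exact: Ck1_id.
have sx : supp_in (core_x B) (- 1) 1.
  move=> t; rewrite -ltr_norml -leNgt => ht; apply: B0; rewrite subr0 normrM ger0_norm//.
  by rewrite ler_peMr.
have sy : supp_in (core_y B) (- 2) 2 by move=> t ht; rewrite /core_y suppB ?mulr0.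
have [A1 a10 hx] := bd3 _ _ _ scx sx; have [A2 a20 hy] := bd3 _ _ _ scy sy.
pose A := A1 + A2; have A0 : 0 <= A by rewrite addr_ge0.
have hA1 x : [/\ `|core_x B x| <= A, `|derive1 (core_x B) x| <= A & `|derive1 (derive1 (core_x B)) x| <= A].
  by have [p1 p2 p3] := hx x; split; [apply: le_trans p1 _|apply: le_trans p2 _|apply: le_trans p3 _]; rewrite lerDl.
have hA2 x : [/\ `|core_y B x| <= A, `|derive1 (core_y B) x| <= A & `|derive1 (derive1 (core_y B)) x| <= A].
  by have [p1 p2 p3] := hy x; split; [apply: le_trans p1 _|apply: le_trans p2 _|apply: le_trans p3 _]; rewrite lerDr.
pose E0 := 2 * (density_const A C0 C1 S * 49).
have Q0 : 0 <= E0 by rewrite mulr_ge0// mulr_ge0// mulr_ge0// addr_ge0 ?sqr_ge0.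
exists (E0 + 1); first by rewrite ltr_wpDl.
move=> eps he; have /andP[e0 e4] := he.
exists (1 - eps / pi), (pi / 2 - eps * (period eps - 2^-1)), (competitor B sg eps); split.
- have e1 : eps / pi <= 1.
    rewrite ler_pdivrMr ?pi_gt0// mul1r (le_trans e4)//; apply: le_trans (@pi_ge2 R).
    by apply: (@le_trans _ _ 1); [rewrite invf_le1// ler1n|rewrite ler1n].
  by rewrite subr_ge0 e1/= gerBl divr_ge0 ?pi_ge0 ?ltW.
- exact: competitor_admissible.
- apply: (@le_trans _ _ E0%:E); last by rewrite lee_fin lerDl.
  exact: competitor_energy.
Qed.

(** [v] stands for [(1 - a) pi]; of [pi] only [1 < pi < 4] is used. *)
Lemma window_arith (eps a v X c : R) : v <= eps * X -> eps * c <= v -> (1 - a) * 1 < v ->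
  v < (1 - a) * 4 -> 0 < eps * c -> 1 - (X + c / 8) * eps < a < 1 - c / 8 * eps.
Proof. by move=> *; apply/andP; split; lra. Qed.

Lemma minimizer_cell (eps F : R) theta (a delta : R) : 0 < eps <= 1 -> minimizer eps theta a delta ->
  (energy eps theta <= F%:E)%E -> 0 <= a * period eps <= period eps /\ 2 <= period eps /\
  exists th p q px qx qy, cell eps (period eps) (a * period eps) F th p q px qx qy.
Proof.
move=> e01 [a01 hadm _] hF; have /andP[e0 e1] := e01; have /andP[a0 a1] := a01.
have l2 : 2 <= period eps.
  by rewrite /period ler_pdivlMr//; apply: le_trans (@pi_ge2 R); rewrite ler_piMr.
have l0 : 0 < period eps by exact: lt_le_trans l2.
by split; [rewrite mulr_ge0 ?(ltW l0)//= ler_piMl// ltW|split => //; exact: cell_of_admissible e01 a01 hadm hF].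
Qed.

End Bounded_energy_competitors.

Theorem theorem2p2 (R : realType) :
  (exists E1 eps0 : R, [/\ 0 < E1, 0 < eps0 <= 1 &
    forall (eps : R) (theta : R * R -> R) (a delta : R),
      0 < eps <= eps0 -> minimizer eps theta a delta ->
      (E1%:E <= energy eps theta)%E]) /\
  (exists alpha1 alpha2 : R, 0 < alpha1 < alpha2 /\
    exists2 eps1 : R, 0 < eps1 <= 1 &
    forall (eps : R) (theta : R * R -> R) (a delta : R),
      0 < eps <= eps1 -> minimizer eps theta a delta ->
      1 - alpha2 * eps < a < 1 - alpha1 * eps).
Proof.
have [K0 K00 upper] := @cell_gap_upper R.
split.
  (* The bound of [cell_gap_lower] for energies at most 1. *)
  pose c1 : R := (41 * (1 + 27 * 1 / 2))^-1.
  have c10 : 0 < c1 by rewrite invr_gt0 mulr_gt0// addr_gt0// divr_gt0// mulr_gt0.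
  (* With [r = t], energy at most [t^2] and [eps <= t], the upper bound becomes [3 K0 t], at most
     three quarters of the lower bound [c1]. *)
  pose t := Num.min 1 (c1 / (4 * K0)).
  have t0 : 0 < t by rewrite lt_min ltr01 divr_gt0// mulr_gt0.
  have t1 : t <= 1 by rewrite ge_min lexx.
  have tc : 4 * (K0 * t) <= c1.
    by rewrite mulrA mulrC -ler_pdivlMr ?mulr_gt0// ge_min lexx orbT.
  exists (t * t), t; split; [exact: mulr_gt0|by rewrite t0|].
  move=> eps theta a delta /andP[e0 et] hmin.
  have e01 : 0 < eps <= 1 by rewrite e0 (le_trans et).
  rewrite leNgt; apply/negP => /ltW hE.
  have [al01 [l2 [th [p [q [px [qx [qy C]]]]]]]] := minimizer_cell e01 hmin hE.
  have tt1 : t * t <= 1 by rewrite mulr_ile1// ltW.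
  have l0 : 0 < period eps by exact: lt_le_trans l2.
  have low : c1 <= period eps - a * period eps by exact: (cell_gap_lower C l0 al01 ltr01 tt1 l2).
  have t01 : 0 < t <= 1 by rewrite t0.
  have := upper _ _ _ _ _ _ _ _ _ _ C e01 al01 t01; rewrite mulfK ?gt_eqF// => up.
  have h3 : K0 * (t + t + eps) <= K0 * (t + t + t) by rewrite ler_pM2l// lerD2l.
  have := le_trans low (le_trans up h3); rewrite !mulrDr => h4.
  by move: h4 tc c10; move: (K0 * t) => u; lra.
have [E0 E00 comp_] := @competitor_exists R.
pose c2 := (41 * (1 + 27 * E0 / 2))^-1.
have c20 : 0 < c2 by rewrite invr_gt0 mulr_gt0// addr_gt0// divr_gt0// mulr_gt0.
have KE : 0 < K0 * (2 + E0) by rewrite mulr_gt0// addr_gt0.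
(* [(1 - a) pi] lies between [eps c2] and [eps K0 (2 + E0)]. Division by [pi < 4] leaves a margin
   above [c2 / 8]; adding [c2 / 8] to the upper constant makes it exceed the lower one. *)
exists (c2 / 8), (K0 * (2 + E0) + c2 / 8); split.
  by rewrite divr_gt0//= ltrDr.
exists 4^-1.
  by rewrite invr_gt0 ltr0n invf_le1// ler1n.
move=> eps theta a delta e04 hmin; have /andP[e0 e4] := e04.
have e1 : eps <= 1 by rewrite (le_trans e4)// invf_le1// ler1n.
have e01 : 0 < eps <= 1 by rewrite e0.
have hE : (energy eps theta <= E0%:E)%E.
  have [a' [d' [th' [a01 hadm hle]]]] := comp_ eps e04; have [_ _ hm] := hmin.
  exact: le_trans (hm _ _ _ a01 hadm) hle.
have [al01 [l2 [th [p [q [px [qx [qy C]]]]]]]] := minimizer_cell e01 hmin hE.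
have l0 : 0 < period eps by exact: lt_le_trans l2.
have low : c2 <= period eps - a * period eps by exact: (cell_gap_lower C l0 al01 E00 (lexx _) l2).
have unit_le (x : R) : x = 1 -> 0 < x <= 1.
  by move=> x1; apply/andP; split; rewrite x1; [exact: ltr01|exact: lexx].
have up := upper _ _ _ _ _ _ _ _ _ _ C e01 al01 (unit_le 1 erefl).
have up2 : period eps - a * period eps <= K0 * (2 + E0).
  apply: le_trans up _; rewrite ler_pM2l// divr1; move: e1; lra.
have el : eps * period eps = pi by rewrite /period mulrCA divff ?mulr1// gt_eqF.
have E1 : eps * (period eps - a * period eps) = (1 - a) * pi by rewrite -el; ring.
have h2 := ler_wpM2l (ltW e0) low; have h1 := ler_wpM2l (ltW e0) up2; rewrite E1 in h1 h2.
have p2 := @pi_ge2 R; have p4 : pi < 4 :> R by have := @pihalf_lt2 R; rewrite ltr_pdivrMr// -natrM.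
have a1 : 0 < 1 - a.
  have h : 0 < (1 - a) * pi by apply: lt_le_trans h2; rewrite mulr_gt0.
  by rewrite -(pmulr_lgt0 _ (pi_gt0 R)).
have h3 : (1 - a) * 1 < (1 - a) * pi by rewrite ltr_pM2l// (lt_le_trans _ p2)// ltr1n.
have h4 : (1 - a) * pi < (1 - a) * 4 by rewrite ltr_pM2l.
have ec : 0 < eps * c2 by rewrite mulr_gt0.
exact: window_arith h1 h2 h3 h4 ec.
Qed.
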